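(* Among arithmetic hyperbolic punctured spheres with $5$ cusps, the maximal systole length is $2\,\mathrm{arccosh}(5)$; that is, every arithmetic hyperbolic punctured sphere $M$ with $5$ cusps satisfies $\mathrm{sys}(M)\le 2\,\mathrm{arccosh}(5)$, and equality is attained by the arithmetic surface corresponding to the planar triangulation with three vertices of degree $4$ and two non-adjacent vertices of degree $3$.
   Context: A hyperbolic punctured sphere with $n$ cusps is a quotient $M=\mathbb{H}^2/\Gamma$, where $\Gamma$ is a discrete, cofinite (finite covolume), torsion-free subgroup of $\mathrm{PSL}_2(\mathbb{R})$ such that $M$ has genus zero and exactly $n$ cusps. The systole of $M$ is the shortest essential, non-peripheral closed curve on $M$ (not homotopic to a point or into a cusp), and $\mathrm{sys}(M)$ denotes its length; equivalently $\mathrm{sys}(M)$ is the minimum of $2\,\mathrm{arccosh}(|\mathrm{tr}(\gamma)|/2)$ over hyperbolic $\gamma\in\Gamma$. $M$ is called arithmetic if $\Gamma$ is an arithmetic Fuchsian group; since $\Gamma$ is non-cocompact, this means that some $\mathrm{PSL}_2(\mathbb{R})$-conjugate of $\Gamma$ is commensurable with $\mathrm{PSL}_2(\mathbb{Z})$. The Farey (modular) tessellation is the tessellation of $\mathbb{H}^2$ by ideal triangles with vertex set $\mathbb{Q}\cup\{\infty\}$ and an edge between $p/q$ and $r/s$ (in lowest terms, $\infty=1/0$) if and only if $ps-rq=\pm1$. A torsion-free finite-index subgroup $\Gamma\le\mathrm{PSL}_2(\mathbb{Z})$ with $\mathbb{H}^2/\Gamma$ of genus zero corresponds to the triangulation of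 the sphere (equivalently, of the plane including the exterior face) obtained as the quotient of the Farey tessellation by $\Gamma$, with vertices the cusps of $\mathbb{H}^2/\Gamma$. The triangulation in the claim is the triangular bipyramid. *)

(* Defs.v *)
From mathcomp Require Import all_boot all_order all_algebra.
From mathcomp Require Import complex.
From mathcomp Require Import all_classical all_reals all_analysis.

Set Implicit Arguments.
Unset Strict Implicit.
Unset Printing Implicit Defensive.

Import Order.TTheory GRing.Theory Num.Theory.
Import numFieldNormedType.Exports.

Local Open Scope ring_scope.
Local Open Scope classical_set_scope.

Section Fuchsian.
Variable R : realType.

Implicit Types (Gamma A B : set 'M[R]_2) (g h : 'M[R]_2) (u v : 'cV[R]_2).

(* Subgroups of PSL_2(R) are represented throughout by their full preimages in
   SL_2(R), i.e. by the subgroups of SL_2(R) that contain -1. *)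
Definition PSL2_subgroup Gamma : Prop :=
  [/\ forall g, Gamma g -> \det g = 1,
      Gamma 1%:M /\ Gamma (- 1%:M),
      forall g h, Gamma g -> Gamma h -> Gamma (g *m h) &
      forall g, Gamma g -> Gamma (invmx g)].

(* As -1 is in Gamma, this is equivalent to discreteness of the image in
   PSL_2(R). *)
Definition discrete Gamma : Prop := Gamma `<=` isolated Gamma.

Definition torsion_free Gamma : Prop :=
  forall g (k : nat), Gamma g -> (0 < k)%N ->
    g ^+ k = 1%:M \/ g ^+ k = - 1%:M -> g = 1%:M \/ g = - 1%:M.

Definition hyperbolic g : Prop := 2 < `|\tr g|.

Definition parabolic g : Prop :=
  [/\ `|\tr g| = 2, g <> 1%:M & g <> - 1%:M].

(* The hyperbolic plane: points x + iy, y > 0, as pairs (x, y). *)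
Definition upper_half : set (R * R) := [set z | 0 < z.2].

Definition mobius g (z : R * R) : R * R :=
  let z' := (z.1 +i* z.2)%C in
  let w := ((g 0 0)%:C%C * z' + (g 0 1)%:C%C)
           / ((g 1 0)%:C%C * z' + (g 1 1)%:C%C) in
  (complex.Re w, complex.Im w).

Definition same_orbit Gamma (z w : R * R) : Prop :=
  exists2 g, Gamma g & mobius g z = w.

(* The measure dx dy / y^2. *)
Definition hyperbolic_area
    (D : set (measurableTypeR R * measurableTypeR R)%type) : \bar R :=
  (\int[lebesgue_measure \x lebesgue_measure]_(z in D) (z.2 ^- 2)%:E)%E.

(* Some measurable strict fundamental domain has finite area. *)
Definition cofinite Gamma : Prop :=
  exists D : set (measurableTypeR R * measurableTypeR R)%type,
    [/\ measurable D, D `<=` upper_half,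
        forall z, upper_half z -> exists! w, D w /\ same_orbit Gamma z w &
        (hyperbolic_area D < +oo)%E].

Definition sphere2 : set (R * R * R) :=
  [set p | p.1.1 ^+ 2 + p.1.2 ^+ 2 + p.2 ^+ 2 = 1].

(* f induces a homeomorphism from the quotient H^2 / Gamma onto X. *)
Definition quotient_homeo Gamma (T : topologicalType) (X : set T)
    (f : R * R -> T) : Prop :=
  [/\ f @` upper_half = X,
      forall z w, upper_half z -> upper_half w ->
        (f z = f w <-> same_orbit Gamma z w),
      {within upper_half, continuous f} &
      forall U : set (R * R), open U ->
        exists2 V : set T, open V & f @` (upper_half `&` U) = X `&` V].

(* H^2 / Gamma is homeomorphic to a sphere minus finitely many points. *)
Definition genus_zero Gamma : Prop :=
  exists P : set (R * R * R),
    [/\ finite_set P, P `<=` sphere2 &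
        exists f, quotient_homeo Gamma (sphere2 `\` P) f].

(* Points of the boundary P^1(R) are given by homogeneous coordinates: the
   nonzero vector (p, q) stands for p/q, and the Moebius action becomes the
   linear one. *)
Definition same_point v (w : 'cV[R]_2) : Prop :=
  exists2 c : R, c != 0 & v = c *: w.

Definition boundary_orbit Gamma v (w : 'cV[R]_2) : Prop :=
  exists2 g, Gamma g & same_point (g *m v) w.

Definition parabolic_fixed_point Gamma v : Prop :=
  v != 0 /\ exists g, [/\ Gamma g, parabolic g & same_point (g *m v) v].

(* The cusps are the orbits of parabolic fixed points; s lists
   representatives. *)
Definition has_cusps Gamma (n : nat) : Prop :=
  exists s : 'I_n -> 'cV[R]_2,
    [/\ forall i, parabolic_fixed_point Gamma (s i),
        forall i j, boundary_orbit Gamma (s i) (s j) -> i = j &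
        forall v, parabolic_fixed_point Gamma v ->
          exists i, boundary_orbit Gamma v (s i)].

Definition punctured_sphere (n : nat) Gamma : Prop :=
  [/\ PSL2_subgroup Gamma, discrete Gamma, cofinite Gamma &
      [/\ torsion_free Gamma, genus_zero Gamma & has_cusps Gamma n]].

Definition arccosh (x : R) : R := ln (x + Num.sqrt (x ^+ 2 - 1)).

Definition systole Gamma : R :=
  inf [set 2 * arccosh (`|\tr g| / 2) | g in [set g | Gamma g /\ hyperbolic g]].

Definition finite_index A B : Prop :=
  A `<=` B /\ finite_set [set mulmx h @` A | h in B].

Definition commensurable A B : Prop :=
  finite_index (A `&` B) A /\ finite_index (A `&` B) B.

Definition PSL2Z : set 'M[R]_2 :=
  [set g | \det g = 1 /\ forall i j, g i j \is a Num.int].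

Definition arithmetic_group Gamma : Prop :=
  exists2 h, \det h = 1 &
    commensurable [set h *m g *m invmx h | g in Gamma] PSL2Z.

(* The point p/q of Q u {oo} in lowest terms, as (p, q); the sign is only
   determined up to same_point. *)
Definition farey_vertex v : Prop :=
  exists p q : int, [/\ coprimez p q, v 0 0 = p%:~R & v 1 0 = q%:~R].

Definition farey_edge v (w : 'cV[R]_2) : Prop :=
  [/\ farey_vertex v, farey_vertex w &
      `|v 0 0 * w 1 0 - w 0 0 * v 1 0| = 1].

Definition farey_triangle u v (w : 'cV[R]_2) : Prop :=
  [/\ farey_edge u v, farey_edge v w & farey_edge u w].

End Fuchsian.

(* A triangulation with vertex set V is given by its set of faces. *)
Definition adj (V : finType) (F : {set {set V}}) (x y : V) : bool :=
  (x != y) && [exists t in F, (x \in t) && (y \in t)].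

Definition degree (V : finType) (F : {set {set V}}) (x : V) : nat :=
  #|[pred y | adj F x y]|.

(* phi labels the vertices of the Farey tessellation and induces an
   isomorphism from its quotient by Gamma onto F: bijections on vertices, edges
   and triangles that respect incidence. *)
Definition farey_quotient_iso (R : realType) (Gamma : set 'M[R]_2)
    (V : finType) (F : {set {set V}}) (phi : 'cV[R]_2 -> V) : Prop :=
  [/\ (forall v w, farey_vertex v -> farey_vertex w ->
         (phi v = phi w <-> boundary_orbit Gamma v w)) /\
      (forall x, exists2 v, farey_vertex v & phi v = x),
      forall x y, adj F x y <->
        exists v w, [/\ farey_edge v w, phi v = x & phi w = y],
      forall v w v' w', farey_edge v w -> farey_edge v' w' ->
        phi v = phi v' -> phi w = phi w' ->
        exists g, [/\ Gamma g, same_point (g *m v) v' & same_point (g *m w) w'],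
      forall t, t \in F <->
        exists u v w, farey_triangle u v w /\
          t = finset (fun x => x \in [:: phi u; phi v; phi w]) &
      forall u v w u' v' w', farey_triangle u v w -> farey_triangle u' v' w' ->
        phi u = phi u' -> phi v = phi v' -> phi w = phi w' ->
        exists g, [/\ Gamma g, same_point (g *m u) u',
                      same_point (g *m v) v' & same_point (g *m w) w']].

Definition corresponds_to (R : realType) (Gamma : set 'M[R]_2)
    (V : finType) (F : {set {set V}}) : Prop :=
  [/\ PSL2_subgroup Gamma, finite_index Gamma (@PSL2Z R), torsion_free Gamma,
      genus_zero Gamma & exists phi, farey_quotient_iso Gamma F phi].

(* The triangular bipyramid, with apexes 0, 1 and equator 2, 3, 4. *)
Definition bipyramid : {set {set 'I_5}} :=
  finset (fun t : {set 'I_5} =>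
    (#|t| == 3%N) && (#|[pred i in t | (i < 2)%N]| == 1%N)).

Lemma adj_bipyramid (i j : 'I_5) :
  adj bipyramid i j = (i != j) && ~~ ((i < 2)%N && (j < 2)%N).
Proof.
rewrite /adj; case: eqVneq => //= neq_ij.
apply/existsP/idP => [[t]|ij].
  rewrite inE => /andP[/andP[_ /eqP t2] /andP[it jt]]; apply/negP => /andP[i2 j2].
  have : (#|pred2 i j| <= #|[pred k in t | (k < 2)%N]|)%N.
    by apply/subset_leq_card/fintype.subsetP => k; rewrite !inE => /orP[] /eqP->;
      apply/andP.
  by rewrite card2 neq_ij t2.
have [k /and3P[ki kj /eqP k2]] : exists k : 'I_5,
    [&& k != i, k != j & ((i < 2) + ((j < 2) + (k < 2)) == 1)%N].
  pose K (m : nat) : 'I_5 := inord m.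
  have KE m : (m < 5)%N -> K m = m :> nat by exact: inordK.
  suff [m m5 Pm] : exists2 m, (m < 5)%N &
      [&& m != i, m != j & ((i < 2) + ((j < 2) + (m < 2)) == 1)%N].
    by exists (K m); rewrite -!val_eqE /= KE.
  case: i j neq_ij ij => -[|[|[|[|[|//]]]]] ? -[[|[|[|[|[|//]]]]] ?] //= _ _;
  solve [by exists 0%N | by exists 2%N | by exists 3%N | by exists 4%N].
have uniq_ijk : uniq [:: i; j; k] by rewrite /= !inE negb_or neq_ij eq_sym ki eq_sym kj.
exists (finset (fun x => x \in [:: i; j; k])); rewrite !inE !eqxx !orbT /= andbT.
apply/andP; split; first by rewrite cardsE (card_uniqP uniq_ijk).
rewrite -sum1_card big_mkcondr /=.
under eq_bigl => x do rewrite inE.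
rewrite -big_uniq //= !big_cons big_nil addn0.
by move: k2; do 3![case: (_ < 2)%N].
Qed.

Lemma degree_bipyramid (i : 'I_5) :
  degree bipyramid i = (if (i < 2)%N then 3 else 4)%N.
Proof.
rewrite /degree -sum1_card big_mkcond /=.
under eq_bigr => j _ do rewrite inE adj_bipyramid -val_eqE.
by rewrite !big_ord_recl big_ord0; case: i => -[|[|[|[|[|//]]]]].
Qed.

(* Main.v *)
(** Upper bound.  Let [G] be arithmetic with quotient a sphere minus five points.  A normal subgroup [N] of [G] that
    contains [-1] and all parabolic elements is [G] itself: functions [c] from the upper half plane to [G] with
    [c (g z)] congruent to [g c z] and locally constant modulo [N] exist near every point of the sphere, punctures
    included, and can be glued because a plane rectangle minus finitely many points is connected.  Taking for [N]
    the elements with rational entries, up to conjugation, [G] becomes rational, preserves a lattice, and is conjugate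
    to a subgroup of finite index of [SL_2(Z)].  Let [X] be its coset space, of size [m].  The cocycles on [X] with
    values in [Z/2] that have even total over every cusp are coboundaries, by the same principle applied to kernels of
    characters.  There are at least [2 ^ (m / 2 - 4)] of the former and at most [2 ^ (m / 3 - 1)] of the latter, so
    [m <= 18].  Parabolic generators at cusps of widths [w], [w'] and determinant [D] have products of trace
    [2 - w w' D ^ 2] and [2 + w w' D ^ 2].  If all hyperbolic traces exceeded 10, then [w w' D ^ 2 >= 13] whenever
    [D <> 0]; narrow cusps would be surrounded by wide ones, which is impossible for five widths with sum at most 18.

    The bipyramid.  [SL_2(Z)] acts on the 18 oriented edges through its generators of order 2 and 3 modulo [-1], and
    the stabilizer of an edge realizes the bipyramid as a quotient of the Farey tessellation.  Any group [G] with such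
    a quotient consists of the matrices that preserve the labels of one, equivalently every, face.  A hyperbolic
    matrix is conjugate up to sign to a positive word in two elementary matrices; the words of trace less than 10 are
    finitely many and none of them preserves the labels of a face, whereas some word of trace 10 does.

    Genus zero.  The quadratic form attached to [z] is a nonnegative combination of the squares of the linear forms
    that vanish at the vertices of the Farey triangle containing [z].  Adding up the coefficients by labels gives a
    point of the cone over the boundary of the bipyramid, and normalization maps the quotient homeomorphically onto
    the sphere without the directions of the five vertices. *)
Require Import Defs.
From mathcomp Require Import all_boot all_order all_algebra.
From mathcomp Require Import all_classical all_reals all_analysis.
From mathcomp Require Import complex ring lra zify.

Set Implicit Arguments.
Unset Strict Implicit.
Unset Printing Implicit Defensive.

Import Order.TTheory GRing.Theory Num.Theory.
Import numFieldNormedType.Exports.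

Local Open Scope ring_scope.
Local Open Scope classical_set_scope.

(** * Two-by-two matrices and Moebius transformations *)

(** The normal subgroup principle stands in for the fact that the quotient of [G] by the normal
    closure of its parabolic elements is the fundamental group of the closed sphere. Rationality has
    to come first because the commensurator of the modular group also contains rational matrices
    divided by square roots. The count of cocycles is the inequality half of Euler's formula: [m]
    cosets give [m / 2] edges and [m / 3] triangles, and [m / 2 - 4 <= m / 3 - 1] amounts to
    [m <= 18]. The constant 10 is [3 * 4 - 2]: the bipyramid has adjacent cusps of widths 3 and 4,
    and its widths 4, 4, 4, 3, 3 add up to 18. Five widths of at least 4 would add up to 20, so a
    competitor has a cusp of width at most 3, whose neighbours all have width at least 5. Genus
    zero, as hypothesis and as conclusion, is just the existence of a homeomorphism. Hence the upper
    bound works with colourings along broken lines, and the example needs an explicit continuous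
    map; quadratic forms provide it because the group acts on them linearly, so that pieces on
    adjacent triangles fit together. *)

Definition mx2 (K : pzRingType) (a b c d : K) : 'M[K]_2 :=
  \matrix_(i, j) (if i == 0 then if j == 0 then a else b
                  else if j == 0 then c else d).

Definition cv (K : pzRingType) (p q : K) : 'cV[K]_2 :=
  \matrix_(i, j) (if i == 0 then p else q).

Definition det2 (K : pzRingType) (u v : 'cV[K]_2) : K :=
  u 0 0 * v 1 0 - v 0 0 * u 1 0.

Section Matrices2.
Variable K : comNzRingType.
Implicit Types (g h : 'M[K]_2) (u v : 'cV[K]_2).

Lemma mx2E (a b c d : K) :
  (mx2 a b c d 0 0 = a) * (mx2 a b c d 0 1 = b) *
  (mx2 a b c d 1 0 = c) * (mx2 a b c d 1 1 = d).
Proof. by do !split; rewrite mxE. Qed.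

Lemma cvE (p q : K) : (cv p q 0 0 = p) * (cv p q 1 0 = q).
Proof. by split; rewrite mxE. Qed.

Lemma ord2P (i : 'I_2) : i = 0 \/ i = 1.
Proof. by case: i => -[|[|//]] ?; [left|right]; apply: val_inj. Qed.

Lemma mx2P g h : g 0 0 = h 0 0 -> g 0 1 = h 0 1 -> g 1 0 = h 1 0 ->
  g 1 1 = h 1 1 -> g = h.
Proof.
by move=> *; apply/matrixP => i j; case: (ord2P i) => ->; case: (ord2P j) => ->.
Qed.

Lemma cvP u v : u 0 0 = v 0 0 -> u 1 0 = v 1 0 -> u = v.
Proof.
by move=> *; apply/matrixP => i j; rewrite (ord1 j); case: (ord2P i) => ->.
Qed.

Lemma mx2_eta g : g = mx2 (g 0 0) (g 0 1) (g 1 0) (g 1 1).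
Proof. by apply: mx2P; rewrite mxE. Qed.

Lemma cv_eta v : v = cv (v 0 0) (v 1 0).
Proof. by apply: cvP; rewrite mxE. Qed.

Lemma mulmx2E (n : nat) g (h : 'M[K]_(2, n)) i j :
  (g *m h) i j = g i 0 * h 0 j + g i 1 * h 1 j.
Proof. by rewrite mxE !big_ord_recl big_ord0 addr0; congr (_ * h _ _ + g _ _ * h _ _); apply: val_inj. Qed.

Lemma det_mx2E g : \det g = g 0 0 * g 1 1 - g 0 1 * g 1 0.
Proof.
rewrite (expand_det_row _ 0) !big_ord_recl big_ord0 addr0 /cofactor !det_mx11 !mxE /= expr0 mul1r expr1 mulN1r mulrN.
by congr (g _ _ * g _ _ - g _ _ * g _ _); apply: val_inj.
Qed.

Lemma tr_mx2E g : \tr g = g 0 0 + g 1 1.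
Proof. by rewrite /mxtrace !big_ord_recl big_ord0 addr0; congr (_ + g _ _); apply: val_inj. Qed.

Lemma mul_mx2 (a b c d a' b' c' d' : K) :
  mx2 a b c d *m mx2 a' b' c' d' =
  mx2 (a * a' + b * c') (a * b' + b * d') (c * a' + d * c') (c * b' + d * d').
Proof. by apply: mx2P; rewrite mulmx2E !mxE. Qed.

Lemma mx2_1 : 1%:M = mx2 1 0 0 1 :> 'M[K]_2.
Proof. by apply: mx2P; rewrite !mxE. Qed.

Lemma opp_mx2 (a b c d : K) : - mx2 a b c d = mx2 (- a) (- b) (- c) (- d).
Proof. by apply: mx2P; rewrite !mxE. Qed.

Lemma det_mx2 (a b c d : K) : \det (mx2 a b c d) = a * d - b * c.
Proof. by rewrite det_mx2E !mxE. Qed.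

Lemma tr_mx2 (a b c d : K) : \tr (mx2 a b c d) = a + d.
Proof. by rewrite tr_mx2E !mxE. Qed.

Lemma det2_mul g u v : det2 (g *m u) (g *m v) = \det g * det2 u v.
Proof. by rewrite /det2 !mulmx2E det_mx2E; ring. Qed.

Lemma mx2_colE g : [/\ g *m cv 1 0 = cv (g 0 0) (g 1 0) &
  g *m cv 0 1 = cv (g 0 1) (g 1 1)].
Proof. by split; apply: cvP; rewrite mulmx2E !mxE /=; ring. Qed.

Lemma det_opp2 g : \det (- g) = \det g.
Proof. by rewrite !det_mx2E !mxE; ring. Qed.

End Matrices2.

Section Inverse2.
Variable K : comUnitRingType.
Implicit Types (g h : 'M[K]_2) (u v : 'cV[K]_2).

Lemma det1_unit g : \det g = 1 -> g \in unitmx.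
Proof. by move=> d; rewrite unitmxE d unitr1. Qed.

Lemma invmx2 g : \det g = 1 -> invmx g = mx2 (g 1 1) (- g 0 1) (- g 1 0) (g 0 0).
Proof.
move=> d; apply: (can_inj (mulKmx (det1_unit d))).
rewrite mulmxV ?det1_unit // [in RHS](mx2_eta g) [in RHS]mul_mx2 !mxE /= mx2_1.
by move: d; rewrite det_mx2E => d; congr mx2; rewrite -?d; ring.
Qed.

Lemma det_inv1 g : \det g = 1 -> \det (invmx g) = 1.
Proof. by move=> d; rewrite det_inv d invr1. Qed.

Lemma det_mul1 g h : \det g = 1 -> \det h = 1 -> \det (g *m h) = 1.
Proof. by move=> dg dh; rewrite det_mulmx dg dh mulr1. Qed.

Lemma invmx_mul g h : \det g = 1 -> \det h = 1 -> invmx (g *m h) = invmx h *m invmx g.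
Proof.
move=> dg dh; apply: (can_inj (mulKmx (det1_unit (det_mul1 dg dh)))).
by rewrite mulmxV ?det1_unit ?det_mul1 // mulmxA mulmxK ?det1_unit // mulmxV ?det1_unit.
Qed.

Lemma tr_conj2 g h : \det h = 1 -> \tr (h *m g *m invmx h) = \tr g.
Proof. by move=> dh; rewrite mxtrace_mulC mulmxA mulVmx ?mul1mx ?det1_unit. Qed.

End Inverse2.

Section Mobius.
Variable R : realType.
Implicit Types (g h : 'M[R]_2) (u v : 'cV[R]_2) (z w : R * R).

Lemma mobiusE g z : 0 < z.2 -> \det g = 1 ->
  let D := (g 1 0 * z.1 + g 1 1) ^+ 2 + (g 1 0 * z.2) ^+ 2 in
  mobius g z = (((g 0 0 * z.1 + g 0 1) * (g 1 0 * z.1 + g 1 1)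
                  + g 0 0 * g 1 0 * z.2 ^+ 2) / D, z.2 / D).
Proof.
case: z => x y /= y0; rewrite det_mx2E /mobius => d.
move: d; move: (g 0 0) (g 0 1) (g 1 0) (g 1 1) => a b c d e.
have D0 : (c * x + d) ^+ 2 + (c * y) ^+ 2 != 0.
  apply/eqP => /eqP; rewrite paddr_eq0 ?sqr_ge0 // !sqrf_eq0 => /andP[/eqP h1].
  rewrite mulf_eq0 (gt_eqF y0) orbF => /eqP c0; move: e h1; rewrite c0.
  by rewrite mulr0 mul0r add0r subr0 => + d0; rewrite d0 mulr0 => /esym/eqP; rewrite oner_eq0.
rewrite /=; congr pair; rewrite !(mulr0, mul0r, subr0, addr0, add0r, oppr0).
  by field.
transitivity (y * (a * d - b * c) / ((c * x + d) ^+ 2 + (c * y) ^+ 2)); last by rewrite e mulr1.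
by field.
Qed.

Lemma mobius_den g z : 0 < z.2 -> \det g = 1 ->
  0 < (g 1 0 * z.1 + g 1 1) ^+ 2 + (g 1 0 * z.2) ^+ 2.
Proof.
case: z => x y /= y0; rewrite det_mx2E => e.
rewrite lt_def addr_ge0 ?sqr_ge0 // andbT.
apply/eqP => /eqP; rewrite paddr_eq0 ?sqr_ge0 // !sqrf_eq0 => /andP[/eqP h1].
rewrite mulf_eq0 (gt_eqF y0) orbF => /eqP c0; move: e h1; rewrite c0.
by rewrite mul0r add0r mulr0 subr0 => + d0; rewrite d0 mulr0 => /esym/eqP; rewrite oner_eq0.
Qed.

(* [nht z v] is the value at [v] of the inverse of the unimodular form
   [y^-1 [[x^2 + y^2, x], [x, 1]]] attached to [z]; its inverse is the height
   of [z] seen from the boundary point [v]. *)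
Definition nht z v : R := ((v 0 0 - v 1 0 * z.1) ^+ 2 + (v 1 0 * z.2) ^+ 2) / z.2.

Lemma mobius_gt0 g z : 0 < z.2 -> \det g = 1 -> 0 < (mobius g z).2.
Proof. by move=> z0 d; rewrite mobiusE //= divr_gt0 ?mobius_den. Qed.

Lemma nht_mobius g z v : 0 < z.2 -> \det g = 1 -> nht (mobius g z) (g *m v) = nht z v.
Proof.
move=> z0 d; have := mobius_den z0 d; rewrite mobiusE //= /nht /= !mulmx2E.
move: d z0; rewrite det_mx2E; case: z => x y /=.
move: (g 0 0) (g 0 1) (g 1 0) (g 1 1) (v 0 0) (v 1 0) => a b c d p q e y0 D0.
have yn := lt0r_neq0 y0; have Dn := lt0r_neq0 D0.
have {1}-> : y / ((c * x + d) ^+ 2 + (c * y) ^+ 2) =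
    (a * d - b * c) * y / ((c * x + d) ^+ 2 + (c * y) ^+ 2) by rewrite e mul1r.
rewrite -[RHS]mul1r -(expr1n _ 2) -e.
by field; rewrite yn Dn.
Qed.

(** The value at (1, 0) gives the height; those at (0, 1) and (1, 1) then give the real part. With
    the equivariance [nht_mobius] this yields the unit and composition laws of the action without
    computing with quotients. *)
Lemma nht_inj z w : 0 < z.2 -> 0 < w.2 -> (forall v, nht z v = nht w v) -> z = w.
Proof.
case: z w => [x y] [x' y'] /= y0 y0' h.
have := h (cv 1 0); rewrite /nht /= !cvE !(mul0r, subr0, expr0n, addr0, expr1n, div1r) => /invr_inj ey.
have := h (cv 1 1); have := h (cv 0 1); rewrite /nht /= !cvE -ey => h1 h2.
have yn := lt0r_neq0 y0.
have /(divIf yn) := h1; have /(divIf yn) := h2; rewrite !mul1r => h3 h4.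
by congr pair => //; nra.
Qed.

Lemma mobius1 z : 0 < z.2 -> mobius 1%:M z = z.
Proof.
move=> z0; apply: nht_inj; rewrite ?mobius_gt0 ?det1 // => v.
by rewrite -{1}(mul1mx v) nht_mobius ?det1.
Qed.

Lemma mobiusM g h z : 0 < z.2 -> \det g = 1 -> \det h = 1 ->
  mobius (g *m h) z = mobius g (mobius h z).
Proof.
move=> z0 dg dh; have dgh := det_mul1 dg dh.
apply: nht_inj; rewrite ?mobius_gt0 // => v.
rewrite -[v](mulKVmx (det1_unit dgh)) nht_mobius // -[in RHS]mulmxA !nht_mobius ?mobius_gt0 //.
Qed.

Lemma mobiusN g z : 0 < z.2 -> \det g = 1 -> mobius (- g) z = mobius g z.
Proof.
move=> z0 dg; rewrite !mobiusE ?det_opp2 // !mxE /=.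
by congr pair; congr (_ / _); ring.
Qed.

Lemma mobiusK g z : 0 < z.2 -> \det g = 1 -> mobius (invmx g) (mobius g z) = z.
Proof. by move=> z0 dg; rewrite -mobiusM ?det_inv1 // mulVmx ?det1_unit // mobius1. Qed.

Lemma mobiusKV g z : 0 < z.2 -> \det g = 1 -> mobius g (mobius (invmx g) z) = z.
Proof. by move=> z0 dg; rewrite -mobiusM ?det_inv1 // mulmxV ?det1_unit // mobius1. Qed.

Lemma nht_ge0 z v : 0 < z.2 -> 0 <= nht z v.
Proof. by move=> z0; rewrite divr_ge0 ?addr_ge0 ?sqr_ge0 // ltW. Qed.

(** Cauchy-Schwarz for the form of [z]: after clearing the heights, the difference is the square of
    the mixed term. Small horoballs at vectors with large [det2] are therefore disjoint. *)
Lemma nht_det z v (w : 'cV[R]_2) : 0 < z.2 -> det2 v w ^+ 2 <= nht z v * nht z w.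
Proof.
case: z => x y /= y0; rewrite /nht /det2 /= mulf_div ler_pdivlMr ?mulr_gt0 //.
rewrite -subr_ge0; set X := (X in 0 <= X).
suff -> : X = ((v 0 0 - v 1 0 * x) * (w 0 0 - w 1 0 * x) + v 1 0 * y * (w 1 0 * y)) ^+ 2.
  exact: sqr_ge0.
by rewrite /X; ring.
Qed.

Lemma nht_cont v z : 0 < z.2 -> {for z, continuous (nht ^~ v)}.
Proof.
move=> z0; rewrite /nht; apply: cvgM; last by apply: cvgV; [exact: lt0r_neq0|exact: cvg_snd].
have sq (f : R * R -> R) : {for z, continuous f} -> {for z, continuous (fun w => f w ^+ 2)}.
  by move=> fc; apply: (@continuous_comp _ _ _ f (fun x => x ^+ 2)) => //; exact: exprn_continuous.
apply: cvgD; apply: sq.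
  by apply: cvgB; [exact: cvg_cst|apply: cvgM; [exact: cvg_cst|exact: cvg_fst]].
by apply: cvgM; [exact: cvg_cst|exact: cvg_snd].
Qed.

Lemma pair_cont (S T U : topologicalType) (f : S -> T) (g : S -> U) (z : S) :
  {for z, continuous f} -> {for z, continuous g} ->
  {for z, continuous (fun x => (f x, g x))}.
Proof. by move=> cf cg; exact: (cvg_pair cf cg). Qed.

Lemma mobius_cont g z : 0 < z.2 -> \det g = 1 -> {for z, continuous (mobius g)}.
Proof.
move=> z0 dg.
have H : \forall w \near z, 0 < w.2.
  have c2 : {for z, continuous (fun w : R * R => w.2)} by exact: cvg_snd.
  exact: (cvgr_gt _ c2).
pose D (w : R * R) := (g 1 0 * w.1 + g 1 1) ^+ 2 + (g 1 0 * w.2) ^+ 2.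
pose F (w : R * R) := (((g 0 0 * w.1 + g 0 1) * (g 1 0 * w.1 + g 1 1)
                  + g 0 0 * g 1 0 * w.2 ^+ 2) / D w, w.2 / D w).
have FE : \forall w \near z, F w = mobius g w.
  by near=> w; rewrite mobiusE //; near: w.
rewrite /prop_for /continuous_at (mobiusE z0 dg).
apply: cvg_trans; first by apply: near_eq_cvg; exact: FE.
have c1 : {for z, continuous (fun w : R * R => w.1)} by exact: cvg_fst.
have c2 : {for z, continuous (fun w : R * R => w.2)} by exact: cvg_snd.
have lin (a b : R) : {for z, continuous (fun w : R * R => a * w.1 + b)}.
  by apply: cvgD; [apply: cvgM; [exact: cvg_cst|exact: c1]|exact: cvg_cst].
have sq (f : R * R -> R) : {for z, continuous f} -> {for z, continuous (fun w => f w ^+ 2)}.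
  by move=> fc; apply: (@continuous_comp _ _ _ f (fun x => x ^+ 2)) => //; exact: exprn_continuous.
have cD : {for z, continuous D}.
  by apply: cvgD; apply: sq => //; apply: cvgM; [exact: cvg_cst|exact: c2].
have Dn : D z != 0 by apply: lt0r_neq0; exact: mobius_den.
have cF : {for z, continuous F}; last exact: cF.
apply: (@pair_cont _ _ _ (fun w => ((g 0 0 * w.1 + g 0 1) * (g 1 0 * w.1 + g 1 1)
  + g 0 0 * g 1 0 * w.2 ^+ 2) / D w) (fun w => w.2 / D w)); apply: cvgM; try (by apply: cvgV); last exact: c2.
by apply: cvgD; [apply: cvgM; exact: lin|apply: cvgM; [exact: cvg_cst|exact: sq]].
Unshelve. all: by end_near.
Qed.

End Mobius.

(** * Paths in the plane that avoid a countable set *)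

Section PlaneSegments.
Variable R : realType.
Implicit Types (a b m : R * R) (t s : R).

Definition seg a b t : R * R := (a.1 + t * (b.1 - a.1), a.2 + t * (b.2 - a.2)).

Definition convex2 (O : set (R * R)) : Prop :=
  forall a b t, O a -> O b -> 0 <= t <= 1 -> O (seg a b t).

Lemma seg_cont a b : continuous (seg a b).
Proof.
move=> t; apply: (@pair_cont _ _ _ (fun t => a.1 + t * (b.1 - a.1)) (fun t => a.2 + t * (b.2 - a.2)));
by apply: cvgD; [exact: cvg_cst|apply: cvgM; [exact: cvg_id|exact: cvg_cst]].
Qed.

Lemma seg0 a b : seg a b 0 = a.
Proof. by rewrite /seg !mul0r !addr0; case: a. Qed.

Lemma seg1 a b : seg a b 1 = b.
Proof. by rewrite /seg !mul1r !subrKC; case: b. Qed.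

(** The interval has measure [e], a countable set has measure zero. *)
Lemma avoid_countable (C : set R) (e : R) : 0 < e -> countable C ->
  exists2 s, 0 < s < e & ~ C s.
Proof.
move=> e0 cC; apply: contrapT => h.
have sub : `]0, e[%classic `<=` C.
  move=> s /=; rewrite in_itv /= => se; apply: contrapT => nC; apply: h; by exists s.
have := countable_lebesgue_measure0 (sub_countable (subset_card_le sub) cC).
rewrite lebesgue_measure_itv /= lte_fin e0 => /eqP.
by rewrite -EFinB eqe subr0 gt_eqF.
Qed.

(* Two points outside a countable set are joined by a broken line through a
   point of their perpendicular bisector: each point of the countable set
   obstructs at most two choices. *)
Lemma broken_line (O C : set (R * R)) a b : open O -> convex2 O -> countable C ->
  O a -> O b -> ~ C a -> ~ C b ->
  exists m, forall t, 0 <= t <= 1 ->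
    [/\ O (seg a m t), O (seg m b t), ~ C (seg a m t) & ~ C (seg m b t)].
Proof.
move=> oO cO cC Oa Ob Ca Cb.
have [->|nab] := eqVneq a b.
  have sb t : seg b b t = b by rewrite /seg !subrr !mulr0 !addr0; case: (b).
  by exists b => t _; rewrite !sb; split.
pose u := b.1 - a.1; pose v := b.2 - a.2; pose n2 := u ^+ 2 + v ^+ 2.
have n20 : n2 != 0.
  apply/eqP => /eqP; rewrite paddr_eq0 ?sqr_ge0 // !sqrf_eq0 !subr_eq0 => /andP[/eqP e1 /eqP e2].
  by move: nab; rewrite (surjective_pairing a) (surjective_pairing b) e1 e2 eqxx.
pose m s := (a.1 + u / 2 - s * v, a.2 + v / 2 + s * u).
have mc : continuous m.
  move=> s; apply: (@pair_cont _ _ _ (fun s => a.1 + u / 2 - s * v) (fun s => a.2 + v / 2 + s * u)).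
    by apply: cvgB; [exact: cvg_cst|apply: cvgM; [exact: cvg_id|exact: cvg_cst]].
  by apply: cvgD; [exact: cvg_cst|apply: cvgM; [exact: cvg_id|exact: cvg_cst]].
have Om0 : O (m 0).
  have -> : m 0 = seg a b (1 / 2) by rewrite /m /seg /u /v; congr pair; field.
  by apply: cO => //; apply/andP; split; lra.
have /nbhs_ballP[e /= e0 eO] : \forall s \near 0, O (m s) by apply: mc; exact: open_nbhs_nbhs.
(* Only for [s = phi c] can the segment from [a] to [m s] pass through [c]; [psi] plays this role
   for [b]. Up to sign the inner quotient equals [2 * s], as the bisector meets the segment at half
   of [(u, v)]. *)
pose phi (c : R * R) := ((c.2 - a.2) * u - (c.1 - a.1) * v) / ((c.1 - a.1) * u + (c.2 - a.2) * v) / 2.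
pose psi (c : R * R) := - (((c.2 - b.2) * u - (c.1 - b.1) * v) / ((c.1 - b.1) * u + (c.2 - b.2) * v)) / 2.
have cD : countable (phi @` C `|` psi @` C).
  rewrite -bigcup2E; apply: bigcup_countable => // i _.
  by case: i => [|[|i]] //=; apply: sub_countable cC; exact: card_image_le.
have [s /andP[s0 se] nD] := avoid_countable e0 cD.
have Om : O (m s) by apply: eO; rewrite /ball /= sub0r normrN gtr0_norm.
exists (m s) => t t01; split; [exact: cO|exact: cO| |].
  move=> Cs; apply: nD; left; exists (seg a (m s) t) => //.
  have t0 : t != 0 by apply/eqP => t0; move: Cs; rewrite t0 seg0.
  have -> : phi (seg a (m s) t) = (t * s * n2) / (t / 2 * n2) / 2.
    by rewrite /phi /seg /m /n2 /=; congr (_ / _ / _); field.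
  by field; rewrite t0 n20.
move=> Cs; apply: nD; right; exists (seg (m s) b t) => //.
have t0 : 1 - t != 0.
  by apply/eqP => t0; move: Cs; rewrite (_ : t = 1) ?seg1 //; move: t0; lra.
have -> : psi (seg (m s) b t) = - ((1 - t) * s * n2 / (- (1 - t) / 2 * n2)) / 2.
  by rewrite /psi /seg /m /n2 /=; congr (- (_ / _) / _); rewrite /u /v; field.
by field; rewrite t0 n20.
Qed.

(** Connectedness of the interval: a locally constant property cuts out a relatively open and closed
    part. Continuation along segments is done with it. *)
Lemma interval_induction (X : set R) :
  (forall t, 0 <= t <= 1 -> \forall s \near t, 0 <= s <= 1 -> (X s <-> X t)) ->
  X 0 -> X 1.
Proof.
move=> lc X0.
have conn : connected `[0 : R, 1]%classic by exact/connected_intervalP/interval_is_interval.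
have memE t : `[0 : R, 1]%classic t = (0 <= t <= 1) :> Prop by rewrite /= in_itv.
have XE : `[0 : R, 1]%classic `&` X = `[0 : R, 1]%classic.
  apply: conn.
  - by exists 0; split => //; rewrite memE lexx ler01.
  - exists (interior [set s | 0 <= s <= 1 -> X s]); first exact: open_interior.
    rewrite eqEsubset; split => t [].
      move=> It Xt; split => //; rewrite memE in It.
      by apply: filterS (lc t It) => s h /h [_]; exact.
    by move=> It h; split => //; have := nbhs_singleton h; rewrite memE in It; exact.
  exists (~` interior [set s | 0 <= s <= 1 -> ~ X s]).
    exact/open_closedC/open_interior.
  rewrite eqEsubset; split => t [].
    move=> It Xt; split => // h; have := nbhs_singleton h; rewrite memE in It; exact.
  move=> It h; split => //; apply: contrapT => nX; apply: h; rewrite memE in It.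
  by apply: filterS (lc t It) => s h /h [Xs _] /Xs.
have : (`[0 : R, 1]%classic `&` X) 1 by rewrite XE memE lexx ler01.
by case.
Qed.

End PlaneSegments.

(** * Stereographic coordinates on the sphere *)

Section Stereographic.
Variable R : realType.
Implicit Types (a b : R * R) (p : R * R * R).

(** Inverse stereographic projection from the north pole (0, 0, 1), the only point of the sphere
    that it misses. It lends the sphere the convex regions of the plane. *)
Definition stereo a : R * R * R :=
  let D := a.1 ^+ 2 + a.2 ^+ 2 + 1 in
  (a.1 * 2 / D, a.2 * 2 / D, 1 - 2 / D).

Definition unstereo p : R * R := (p.1.1 / (1 - p.2), p.1.2 / (1 - p.2)).

Lemma stereo_den a : 0 < a.1 ^+ 2 + a.2 ^+ 2 + 1.
Proof. by rewrite ltr_wpDl // addr_ge0 ?sqr_ge0. Qed.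

Lemma stereo_sphere a : sphere2 (stereo a).
Proof. by rewrite /sphere2 /stereo /=; have := lt0r_neq0 (stereo_den a) => h; field. Qed.

Lemma stereo_lt1 a : (stereo a).2 < 1.
Proof. by rewrite /= ltrBlDr ltrDl divr_gt0 ?stereo_den. Qed.

Lemma stereoK a : unstereo (stereo a) = a.
Proof.
have h := lt0r_neq0 (stereo_den a); case: a h => x y /= h.
have h2 : 2 / (x ^+ 2 + y ^+ 2 + 1) != 0 by rewrite mulf_neq0 ?invr_eq0 ?pnatr_eq0.
by rewrite /unstereo /stereo /= opprB addrCA subrr addr0; congr pair; field; rewrite h.
Qed.

Lemma unstereoK p : sphere2 p -> p.2 < 1 -> stereo (unstereo p) = p.
Proof.
case: p => -[x y] z; rewrite /sphere2 /= => s z1.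
have z0 : 1 - z != 0 by rewrite subr_eq0 gt_eqF.
have D : (x / (1 - z)) ^+ 2 + (y / (1 - z)) ^+ 2 + 1 = 2 / (1 - z).
  transitivity ((x ^+ 2 + y ^+ 2 + (1 - z) ^+ 2) / (1 - z) ^+ 2); first by field.
  have -> : x ^+ 2 + y ^+ 2 + (1 - z) ^+ 2 = 2 * (1 - z) by lra.
  by field.
by rewrite /stereo /unstereo /= D; congr (_, _, _); field; rewrite z0.
Qed.

Lemma sphere_le1 p : sphere2 p -> p.2 <= 1.
Proof.
rewrite /sphere2 /= => s; rewrite leNgt; apply/negP => h.
have := sqr_ge0 p.1.1; have := sqr_ge0 p.1.2; nra.
Qed.

Lemma stereo_cont : continuous stereo.
Proof.
move=> a.
have c1 : {for a, continuous (fun w : R * R => w.1)} by exact: cvg_fst.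
have c2 : {for a, continuous (fun w : R * R => w.2)} by exact: cvg_snd.
have sq (f : R * R -> R) : {for a, continuous f} -> {for a, continuous (fun w => f w ^+ 2)}.
  by move=> fc; apply: (@continuous_comp _ _ _ f (fun x => x ^+ 2)) => //; exact: exprn_continuous.
pose D (a : R * R) := a.1 ^+ 2 + a.2 ^+ 2 + 1.
have cD : {for a, continuous D}.
  by apply: cvgD; [apply: cvgD; exact: sq|exact: cvg_cst].
have cDV : {for a, continuous (fun a => (D a)^-1)}.
  by apply: cvgV => //; exact/lt0r_neq0/stereo_den.
apply: (@pair_cont _ _ _ (fun a => (a.1 * 2 / D a, a.2 * 2 / D a)) (fun a => 1 - 2 / D a)).
  apply: (@pair_cont _ _ _ (fun a => a.1 * 2 / D a) (fun a => a.2 * 2 / D a));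
  by apply: cvgM => //; apply: cvgM => //; exact: cvg_cst.
by apply: cvgB; [exact: cvg_cst|apply: cvgM => //; exact: cvg_cst].
Qed.

Lemma unstereo_cont p : p.2 < 1 -> {for p, continuous unstereo}.
Proof.
move=> p1.
have c1 : {for p, continuous (fun w : R * R * R => w.1.1)}.
  by apply: (@continuous_comp _ _ _ (fun w : R * R * R => w.1) (fun w => w.1)); exact: cvg_fst.
have c2 : {for p, continuous (fun w : R * R * R => w.1.2)}.
  by apply: (@continuous_comp _ _ _ (fun w : R * R * R => w.1) (fun w => w.2)); [exact: cvg_fst|exact: cvg_snd].
have cV : {for p, continuous (fun w : R * R * R => (1 - w.2)^-1)}.
  apply: cvgV; first by rewrite subr_eq0 gt_eqF.
  by apply: cvgB; [exact: cvg_cst|exact: cvg_snd].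
apply: (@pair_cont _ _ _ (fun p => p.1.1 / (1 - p.2)) (fun p => p.1.2 / (1 - p.2)));
exact: cvgM.
Qed.

End Stereographic.

(** * Monodromy over a punctured sphere *)

Section Monodromy.
Variable R : realType.
Implicit Types (g h a b : 'M[R]_2) (z w : R * R) (A V : set (R * R * R)).

Definition normal_in (N G : set 'M[R]_2) : Prop :=
  [/\ N `<=` G, N 1%:M, forall a b, N a -> N b -> N (a *m b),
      forall a, N a -> N (invmx a) &
      forall g a, G g -> N a -> N (invmx g *m a *m g)].

(** [U] plays the role of a sheet over [V]: its translates cover the preimage of [V], and only
    elements of [N] bring points of [U] back into [U]. The point [p] may be a puncture, outside the
    image of [f]. *)
Definition locally_colored (G N : set 'M[R]_2) (f : R * R -> R * R * R)
    (p : R * R * R) : Prop :=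
  exists V, [/\ open V, V p & exists U : set (R * R), [/\ open U,
    forall g z, G g -> 0 < z.2 -> U z -> U (mobius g z) -> N g &
    forall z, 0 < z.2 -> V (f z) -> exists2 g, G g & U (mobius g z)]].

Variables (G N : set 'M[R]_2) (f : R * R -> R * R * R) (P : set (R * R * R)).
Hypotheses (GG : PSL2_subgroup G) (NG : normal_in N G).
Hypotheses (finP : finite_set P) (cG : countable G).
Hypothesis (fq : quotient_homeo G (@sphere2 R `\` P) f).

Let G1 : G 1%:M. Proof. by case: GG => _ []. Qed.
Let GM a b : G a -> G b -> G (a *m b). Proof. by case: GG => _ _ h _; apply: h. Qed.
Let GV a : G a -> G (invmx a). Proof. by case: GG => _ _ _; apply. Qed.
Let Gd a : G a -> \det a = 1. Proof. by case: GG => + _ _ _; apply. Qed.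
Let Gu a : G a -> a \in unitmx. Proof. by move=> /Gd /det1_unit. Qed.

(** Equality in [G / N], for representatives in [G]. *)
Definition eqN a b := [/\ G a, G b & N (invmx a *m b)].

Let eqN_refl a : G a -> eqN a a.
Proof. by move=> Ga; split => //; rewrite mulVmx ?Gu //; case: NG. Qed.

Let eqN_sym a b : eqN a b -> eqN b a.
Proof.
case=> Ga Gb Nab; split => //; case: NG => _ _ _ /(_ _ Nab) + _.
by rewrite invmx_mul ?det_inv1 ?Gd // invmxK.
Qed.

Let eqN_trans b a c : eqN a b -> eqN b c -> eqN a c.
Proof.
case=> Ga Gb Nab [_ Gc Nbc]; split => //; case: NG => _ _ /(_ _ _ Nab Nbc) + _ _.
by rewrite mulmxA mulmxK ?Gu.
Qed.

Let eqN_mul a a' b b' : eqN a a' -> eqN b b' -> eqN (a *m b) (a' *m b').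
Proof.
case=> Ga Ga' Na [Gb Gb' Nb]; split; try exact: GM.
case: NG => _ _ NM _ /(_ b _ Gb Na) h; have := NM _ _ h Nb.
by rewrite invmx_mul ?Gd // !mulmxA mulmxK ?Gu.
Qed.

(** A trivialization over [A] of the covering with fibre [G / N]: an equivariant and locally
    constant map to cosets. *)
Definition coloring A (c : R * R -> 'M[R]_2) : Prop :=
  forall z, 0 < z.2 -> A (f z) ->
    (forall g, G g -> eqN (c (mobius g z)) (g *m c z)) /\
    (\forall w \near z, 0 < w.2 -> eqN (c w) (c z)).

Definition colorable A := exists c, coloring A c.

Lemma sub_colorable A V : (forall z, 0 < z.2 -> A (f z) -> V (f z)) ->
  colorable V -> colorable A.
Proof. by move=> sub [c cc]; exists c => z z0 Az; apply: cc => //; apply: sub. Qed.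

Lemma coloringG A c z : coloring A c -> 0 < z.2 -> A (f z) -> G (c z).
Proof.
by move=> cc z0 Az; have [/(_ _ G1) + _] := cc z z0 Az; rewrite mobius1 // mul1mx => -[].
Qed.

(** The colour of [z] is an element that carries a point of [U] to [z]. Two candidates differ by an
    element that returns a point of [U] to [U], hence by an element of [N]. *)
Lemma local_colorable V (U : set (R * R)) : open U ->
  (forall g z, G g -> 0 < z.2 -> U z -> U (mobius g z) -> N g) ->
  (forall z, 0 < z.2 -> V (f z) -> exists2 g, G g & U (mobius g z)) ->
  colorable V.
Proof.
move=> oU UN VU.
pose c z := xget 1%:M [set g | G g /\ U (mobius (invmx g) z)].
have cP z g : G g -> U (mobius g z) -> G (c z) /\ U (mobius (invmx (c z)) z).
  move=> Gg Ug; rewrite /c; case: xgetP => [h -> //|/(_ (invmx g))] [].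
  by split; [exact: GV|rewrite invmxK].
have key a b z : 0 < z.2 -> G a -> G b -> U (mobius (invmx a) z) -> U (mobius (invmx b) z) -> eqN a b.
  move=> z0 Ga Gb Ua Ub; split => //; have Gab : G (invmx a *m b) by apply: GM => //; exact: GV.
  apply: (UN _ (mobius (invmx b) z)) => //; first by rewrite mobius_gt0 ?det_inv1 ?Gd.
  by rewrite mobiusM ?mobius_gt0 ?det_inv1 ?Gd // mobiusKV ?Gd.
exists c => z z0 /(VU z z0) [g Gg Ug]; have [Gc Uc] := cP _ _ Gg Ug.
split => [h Gh|].
  have Ugh : U (mobius (g *m invmx h) (mobius h z)).
    by rewrite mobiusM ?mobius_gt0 ?det_inv1 ?Gd // mobiusK ?Gd.
  have [Gc' Uc'] := cP _ _ (GM Gg (GV Gh)) Ugh.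
  apply: (key _ _ (mobius h z)) => //; [by rewrite mobius_gt0 ?Gd|exact: GM|].
  by rewrite invmx_mul ?Gd // mobiusM ?mobius_gt0 ?det_inv1 ?Gd // mobiusK ?Gd.
have : \forall w \near z, U (mobius (invmx (c z)) w).
  by apply: mobius_cont; rewrite ?det_inv1 ?Gd //; exact: open_nbhs_nbhs.
apply: filterS => w Uw w0; have [Gcw Ucw] := cP _ _ (GV Gc) Uw.
exact: (key _ _ w).
Qed.

Lemma orbit_fE z g : 0 < z.2 -> G g -> f (mobius g z) = f z.
Proof.
move=> z0 Gg; case: fq => _ /(_ (mobius g z) z) h _ _; apply/h => //; first by rewrite /upper_half /= mobius_gt0 ?Gd.
by exists (invmx g); [exact: GV|rewrite mobiusK ?Gd].
Qed.

Lemma f_sphere z : 0 < z.2 -> sphere2 (f z) /\ ~ P (f z).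
Proof.
move=> z0; case: fq => fX _ _ _.
have : (f @` @upper_half R) (f z) by exists z.
by rewrite fX.
Qed.

Lemma f_cont z : 0 < z.2 -> {for z, continuous f}.
Proof.
move=> z0; case: fq => _ _ fc _.
have oU : open (@upper_half R).
  have -> : @upper_half R = snd @^-1` [set x | 0 < x] by [].
  by apply: open_comp; [move=> w _; exact: cvg_snd|exact: open_gt].
by move: fc; rewrite continuous_open_subspace // => /(_ z); apply; rewrite inE.
Qed.

Definition cap (Q : set (R * R)) : set (R * R * R) :=
  [set p | p.2 < 1 /\ Q (unstereo p)].

Lemma cap_lift (Q : set (R * R)) (a : R * R) : Q a -> ~ P (stereo a) ->
  exists z, [/\ 0 < z.2, f z = stereo a & cap Q (f z)].
Proof.
move=> Qa Pa; case: fq => fX _ _ _.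
have [z z0 fz] : (f @` @upper_half R) (stereo a) by rewrite fX; split => //; exact: stereo_sphere.
by exists z; split => //; rewrite fz; split; [exact: stereo_lt1|rewrite stereoK].
Qed.

(* An invariant locally constant predicate on the preimage of a convex region
   descends to the region minus finitely many points, which is connected. *)
Lemma propagate (Q : set (R * R)) (E : R * R -> Prop) : open Q -> convex2 Q ->
  (forall z g, 0 < z.2 -> cap Q (f z) -> G g -> E z -> E (mobius g z)) ->
  (forall z, 0 < z.2 -> cap Q (f z) -> \forall w \near z, 0 < w.2 -> (E w <-> E z)) ->
  forall z w, 0 < z.2 -> 0 < w.2 -> cap Q (f z) -> cap Q (f w) -> E z -> E w.
Proof.
move=> oQ cQ Einv Eloc z w z0 w0 Qz Qw Ez.
have Efib z' w' : 0 < z'.2 -> 0 < w'.2 -> cap Q (f z') -> f z' = f w' -> E z' -> E w'.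
  move=> z'0 w'0 Qz' e Ez'; case: fq => _ /(_ z' w' z'0 w'0) [/(_ e) [g Gg <-] _] _ _.
  exact: Einv.
pose C := [set a | P (stereo a)].
have cC : countable C.
  apply: (@sub_countable _ _ _ (@unstereo R @` P)); last first.
    exact/finite_set_countable/finite_image.
  by apply: subset_card_le => a Ca; exists (stereo a); rewrite // stereoK.
have step (a b : R * R) : (forall t, 0 <= t <= 1 -> Q (seg a b t) /\ ~ C (seg a b t)) ->
    (exists z, [/\ 0 < z.2, f z = stereo a & E z]) ->
    (exists z, [/\ 0 < z.2, f z = stereo b & E z]).
  move=> ab; pose X t := exists z, [/\ 0 < z.2, f z = stereo (seg a b t) & E z].
  suff : X 0 -> X 1 by rewrite /X seg0 seg1.
  apply: interval_induction => t t01; have [Qt Ct] := ab t t01.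
  have [y [y0 fy Qy]] := cap_lift Qt Ct.
  (* [f] is open onto the punctured sphere, so the neighbourhood of [y] on which [E] is constant
     covers the nearby points of the segment. *)
  have /nbhs_interior := Eloc y y0 Qy; set U := interior _ => nU.
  case: fq => _ _ _ /(_ U (open_interior _)) [V oV fV].
  have Vt : V (f y).
    have : (f @` (@upper_half R `&` U)) (f y).
      by exists y => //; split; [exact: y0|exact: (nbhs_singleton nU)].
    by rewrite fV => -[].
  have : \forall s \near t, V (stereo (seg a b s)).
    apply: (@continuous_comp _ _ _ (seg a b) (@stereo R)); [exact: seg_cont|exact: stereo_cont|].
    by rewrite /= -fy; exact: open_nbhs_nbhs.
  apply: filterS => s Vs s01; have [Qs Cs] := ab s s01.
  have : (f @` (@upper_half R `&` U)) (stereo (seg a b s)).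
    by rewrite fV; split => //; split => //; exact: stereo_sphere.
  move=> [x [x0 Ux] fx]; have Exy := interior_subset Ux x0.
  have Qx : cap Q (f x) by rewrite fx; split; [exact: stereo_lt1|rewrite stereoK].
  split => -[z' [z'0 fz' Ez']].
    exists y; split => //; apply/Exy; apply: Efib Ez' => //; rewrite ?fz' ?fx //.
    by rewrite -fx.
  exists x; split => //; apply/Exy; apply: Efib Ez' => //; rewrite ?fz' ?fy //.
  by rewrite -fy.
have [sz Pz] := f_sphere z0; have [sw Pw] := f_sphere w0.
have [[z1 Qz'] [w1 Qw']] := (Qz, Qw).
have [m mP] : exists m, forall t, 0 <= t <= 1 ->
    [/\ Q (seg (unstereo (f z)) m t), Q (seg m (unstereo (f w)) t),
        ~ C (seg (unstereo (f z)) m t) & ~ C (seg m (unstereo (f w)) t)].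
  by apply: broken_line => //; rewrite /C /= unstereoK.
have [z' [z'0 fz' Ez']] : exists z, [/\ 0 < z.2, f z = stereo (unstereo (f w)) & E z].
  apply: (step m) => [t t01|]; first by have [] := mP t t01.
  apply: (step (unstereo (f z))) => [t t01|]; first by have [] := mP t t01.
  by exists z; rewrite unstereoK.
by apply: Efib Ez'; rewrite ?fz' ?unstereoK.
Qed.

(** Over the overlap the two colourings differ by a right factor that is locally constant modulo
    [N]. The overlap is convex, hence connected off the punctures, so a single factor [q] corrects
    [k1]; right translation respects cosets because [N] is normal. *)
Lemma glue (Q1 Q2 : set (R * R)) : open Q1 -> open Q2 -> convex2 Q1 -> convex2 Q2 ->
  colorable (cap Q1) -> colorable (cap Q2) -> colorable (cap (Q1 `|` Q2)).
Proof.
move=> o1 o2 c1 c2 [k1 kk1] [k2 kk2].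
have [q Gq qE] : exists2 q, G q & forall z, 0 < z.2 -> cap Q1 (f z) -> cap Q2 (f z) ->
    eqN (k1 z *m q) (k2 z).
  have [[w [w0 Q1w Q2w]]|no] := pselect (exists z, [/\ 0 < z.2, cap Q1 (f z) & cap Q2 (f z)]); last first.
    by exists 1%:M => // z z0 Q1z Q2z; case: no; exists z.
  have G1w := coloringG kk1 w0 Q1w; have G2w := coloringG kk2 w0 Q2w.
  exists (invmx (k1 w) *m k2 w); first by apply: GM => //; exact: GV.
  move=> z z0 Q1z Q2z; set q := _ *m k2 w.
  have Gq : G q by apply: GM => //; exact: GV.
  apply: (@propagate (Q1 `&` Q2) (fun z => eqN (k1 z *m q) (k2 z)) _ _ _ _ w z) => //.
  - exact: openI.
  - by move=> a b t [? ?] [? ?] ?; split; [exact: c1|exact: c2].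
  - move=> y g y0 [y1 [Q1y Q2y]] Gg e.
    have [/(_ g Gg) e1 _] := kk1 y y0 (conj y1 Q1y).
    have [/(_ g Gg) e2 _] := kk2 y y0 (conj y1 Q2y).
    apply: (eqN_trans (eqN_mul e1 (eqN_refl Gq))).
    by rewrite -mulmxA; apply: eqN_trans (eqN_sym e2); apply: eqN_mul => //; exact: eqN_refl.
  - move=> y y0 [y1 [Q1y Q2y]].
    have [_ e1] := kk1 y y0 (conj y1 Q1y); have [_ e2] := kk2 y y0 (conj y1 Q2y).
    near=> x => x0.
    have e1x : eqN (k1 x) (k1 y) by move: x0; near: x.
    have e2x : eqN (k2 x) (k2 y) by move: x0; near: x.
    split => e.
      by apply: eqN_trans e2x; apply: eqN_trans e; apply: eqN_mul (eqN_sym e1x) (eqN_refl Gq).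
    by apply: eqN_trans (eqN_sym e2x); apply: eqN_trans e; apply: eqN_mul e1x (eqN_refl Gq).
  - by split; case: Q1w => // ? ?; case: Q2w.
  - by split; case: Q1z => // ? ?; case: Q2z.
  by rewrite /q mulmxA mulmxV ?Gu // mul1mx; exact: eqN_refl.
pose k z := if pselect (cap Q1 (f z)) then k1 z *m q else k2 z.
have k1E z : 0 < z.2 -> cap Q1 (f z) -> k z = k1 z *m q by move=> *; rewrite /k; case: pselect.
have k2E z : 0 < z.2 -> cap Q2 (f z) -> eqN (k z) (k2 z).
  move=> z0 Q2z; rewrite /k; case: (pselect (cap Q1 (f z))) => [Q1z|nQ1z] /=; first exact: qE.
  exact/eqN_refl/coloringG/Q2z.
have nbQ (Q : set (R * R)) z : open Q -> 0 < z.2 -> cap Q (f z) -> \forall w \near z, cap Q (f w).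
  move=> oQ z0 [z1 Qz].
  have h1 : \forall w \near z, (f w).2 < 1.
    have cf2 : {for z, continuous (fun w => (f w).2)}.
      by apply: (@continuous_comp _ _ _ f (fun p : R * R * R => p.2)); [exact: f_cont|exact: cvg_snd].
    exact: (cvgr_lt _ cf2).
  have h2 : \forall w \near z, Q (unstereo (f w)).
    apply: (@continuous_comp _ _ _ f (@unstereo R)); [exact: f_cont|exact: unstereo_cont|].
    exact: open_nbhs_nbhs.
  by near=> w; split; near: w.
exists k => z z0 [z1 [Qz|Qz]].
- have Qc : cap Q1 (f z) by []; have [e1 n1] := kk1 z z0 Qc; split => [g Gg|].
    rewrite !k1E ?orbit_fE ?mobius_gt0 ?Gd // mulmxA.
    exact: eqN_mul (e1 g Gg) (eqN_refl Gq).
  near=> w => w0; have Qw : cap Q1 (f w) by near: w; exact: nbQ.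
  rewrite !k1E //; apply: eqN_mul (eqN_refl Gq); move: w0; by near: w.
- have Qc : cap Q2 (f z) by []; have [e1 n1] := kk2 z z0 Qc; split => [g Gg|].
    apply: eqN_trans (k2E _ _ _) _; rewrite ?orbit_fE ?mobius_gt0 ?Gd //.
    apply: eqN_trans (e1 g Gg) _; apply: eqN_mul (eqN_refl Gg) (eqN_sym (k2E _ _ _)) => //.
  near=> w => w0; have Qw : cap Q2 (f w) by near: w; exact: nbQ.
  apply: eqN_trans (k2E _ w0 Qw) _; apply: eqN_trans (eqN_sym (k2E _ z0 Qc)).
  by move: w0; near: w.
Unshelve. all: by end_near.
Qed.

Definition rect (l r b t : R) : set (R * R) := [set x | l < x.1 < r /\ b < x.2 < t].

Lemma rect_open (l r b t : R) : open (rect l r b t).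
Proof.
have -> : rect l r b t = (fst @^-1` `]l, r[%classic) `&` (snd @^-1` `]b, t[%classic).
  by apply/seteqP; split => x /=; rewrite /rect /= !in_itv.
by apply: openI; apply: open_comp; rewrite ?interval_open // => x _; [exact: cvg_fst|exact: cvg_snd].
Qed.

Lemma rect_convex (l r b t : R) : convex2 (rect l r b t).
Proof.
move=> x y s [/andP[x1 x2] /andP[x3 x4]] [/andP[y1 y2] /andP[y3 y4]] /andP[s0 s1].
have lo (k u v : R) : k < u -> k < v -> k < u + s * (v - u).
  move=> ku kv; have [uv|vu] := leP u v.
    by apply: (lt_le_trans ku); rewrite lerDl mulr_ge0 ?subr_ge0.
  by apply: (lt_le_trans kv); have : 0 <= (1 - s) * (u - v); [by apply: mulr_ge0; rewrite subr_ge0 // ltW|lra].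
have hi (k u v : R) : u < k -> v < k -> u + s * (v - u) < k.
  by move=> uk vk; have := lo (- k) (- u) (- v); rewrite !ltrN2 => /(_ uk vk); lra.
by rewrite /rect /seg /=; split; apply/andP; split; [exact: lo|exact: hi|exact: lo|exact: hi].
Qed.

Let colorable_rect (l r b t : R) := colorable (cap (rect l r b t)).

Lemma rect_hsplit (l m1 m2 r b t : R) : m1 < m2 -> colorable_rect l m2 b t ->
  colorable_rect m1 r b t -> colorable_rect l r b t.
Proof.
move=> m12 c1 c2; apply: sub_colorable (glue _ _ _ _ c1 c2); try exact: rect_open; try exact: rect_convex.
move=> z _ [z1 [/andP[h1 h2] h3]]; split => //.
by have [h|h] := ltP (unstereo (f z)).1 m2; [left|right]; split => //; apply/andP; split => //; exact: lt_le_trans h.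
Qed.

Lemma rect_vsplit (l r b m1 m2 t : R) : m1 < m2 -> colorable_rect l r b m2 ->
  colorable_rect l r m1 t -> colorable_rect l r b t.
Proof.
move=> m12 c1 c2; apply: sub_colorable (glue _ _ _ _ c1 c2); try exact: rect_open; try exact: rect_convex.
move=> z _ [z1 [h3 /andP[h1 h2]]]; split => //.
by have [h|h] := ltP (unstereo (f z)).2 m2; [left|right]; split => //; apply/andP; split => //; exact: lt_le_trans h.
Qed.

Hypothesis locN : forall p, sphere2 p -> locally_colored G N f p.

Lemma small_rect_colorable (a : R * R) : exists2 e : R, 0 < e &
  colorable_rect (a.1 - e) (a.1 + e) (a.2 - e) (a.2 + e).
Proof.
have [V [oV Va [U [oU UN VU]]]] := locN (stereo_sphere a).
have /nbhs_ballP[e /= e0 eV] : \forall x \near a, V (stereo x).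
  by apply: stereo_cont; exact: open_nbhs_nbhs.
exists e => //; apply: sub_colorable (local_colorable oU UN VU) => z z0 [z1 [h1 h2]].
have [sz _] := f_sphere z0.
rewrite -(unstereoK sz z1); apply: eV; split; rewrite /ball /= distrC ltr_distl //.
Qed.

(* Bisection with overlapping pieces, two thirds of the size of the square. *)
Lemma square_colorable (l b s : R) : 0 < s -> colorable_rect l (l + s) b (b + s).
Proof.
move=> s0; apply: contrapT => bad0.
pose bad (q : R * R * R) := 0 < q.2 /\
  ~ colorable_rect q.1.1 (q.1.1 + q.2) q.1.2 (q.1.2 + q.2).
pose nest (q q' : R * R * R) := [/\ q'.2 = 2 / 3 * q.2, q.1.1 <= q'.1.1,
  q'.1.1 + q'.2 <= q.1.1 + q.2, q.1.2 <= q'.1.2 & q'.1.2 + q'.2 <= q.1.2 + q.2].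
have step q : exists q', bad q -> bad q' /\ nest q q'.
  have [bq|] := pselect (bad q); last by exists q.
  apply: contrapT => no; case: (bq) => t0 /=; apply.
  have sub i j : 0 <= i <= 1 -> 0 <= j <= 1 ->
      colorable_rect (q.1.1 + i * (q.2 / 3)) (q.1.1 + i * (q.2 / 3) + 2 / 3 * q.2)
        (q.1.2 + j * (q.2 / 3)) (q.1.2 + j * (q.2 / 3) + 2 / 3 * q.2).
    move=> /andP[i0 i1] /andP[j0 j1]; apply: contrapT => nc; apply: no.
    exists (q.1.1 + i * (q.2 / 3), q.1.2 + j * (q.2 / 3), 2 / 3 * q.2) => _.
    by split; split => //=; nra.
  have b0 : is_true (((0 : R) <= 0) && ((0 : R) <= 1)) by rewrite ?lexx ?ler01.
  have b1 : is_true (((0 : R) <= 1) && ((1 : R) <= 1)) by rewrite ?lexx ?ler01.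
  have [c00 c01 c10 c11] := And4 (sub 0 0 b0 b0) (sub 0 1 b0 b1) (sub 1 0 b1 b0) (sub 1 1 b1 b1).
  move: c00 c01 c10 c11; rewrite !mul0r !addr0 !mul1r => c00 c01 c10 c11.
  have e1 : q.1.1 + q.2 / 3 + 2 / 3 * q.2 = q.1.1 + q.2 by field.
  have e2 : q.1.2 + q.2 / 3 + 2 / 3 * q.2 = q.1.2 + q.2 by field.
  have l1 : q.1.1 + q.2 / 3 < q.1.1 + 2 / 3 * q.2 by lra.
  have l2 : q.1.2 + q.2 / 3 < q.1.2 + 2 / 3 * q.2 by lra.
  rewrite e1 e2 in c00 c01 c10 c11.
  by apply: (rect_hsplit l1); apply: (rect_vsplit l2).
have {step}[F FP] := choice step.
pose q n := iter n F (l, b, s).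
have badq n : bad (q n).
  by elim: n => [|n IH] //=; case: (FP _ IH).
have nestq n : nest (q n) (q n.+1) by case: (FP _ (badq n)).
have sq n : (q n).2 = (2 / 3) ^+ n * s.
  elim: n => [|n IH]; first by rewrite expr0 mul1r.
  by case: (nestq n) => -> _ _ _ _; rewrite IH exprS mulrA.
have sq0 n : 0 < (q n).2 by case: (badq n).
have mono (h : R * R * R -> R) : (forall n, h (q n) <= h (q n.+1)) ->
    (forall n, h (q n.+1) + (q n.+1).2 <= h (q n) + (q n).2) ->
    exists x, forall n, h (q n) <= x <= h (q n) + (q n).2.
  move=> h1 h2; pose S := [set h (q n) | n in [set: nat]].
  have le1 n m : h (q n) <= h (q (n + m)%N).
    by elim: m => [|m IH]; rewrite ?addn0 // addnS; exact: le_trans (h1 _).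
  have le2 n m : h (q (n + m)%N) + (q (n + m)%N).2 <= h (q n) + (q n).2.
    by elim: m => [|m IH]; rewrite ?addn0 // addnS; exact: le_trans (h2 _) _.
  have le3 n m : h (q n) <= h (q m) + (q m).2.
    apply: le_trans (le1 n m) _; rewrite addnC; apply: le_trans (le2 m n).
    by rewrite lerDl ltW.
  have hS : has_sup S.
    by split; [exists (h (q 0)), 0%N|exists (h (q 0) + (q 0).2) => _ [n _ <-]].
  exists (sup S) => n; apply/andP; split; first by apply: ub_le_sup; [case: hS|exists n].
  by apply: ge_sup; [case: hS|move=> _ [m _ <-]].
have [x xP] := mono (fun q => q.1.1) (fun n => let: And5 _ h _ _ _ := nestq n in h)
  (fun n => let: And5 _ _ h _ _ := nestq n in h).
have [y yP] := mono (fun q => q.1.2) (fun n => let: And5 _ _ _ h _ := nestq n in h)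
  (fun n => let: And5 _ _ _ _ h := nestq n in h).
have [e e0 ce] := small_rect_colorable (x, y).
have [n ne] : exists n, (q n).2 < e.
  have : (fun n => (2 / 3 : R) ^+ n * s) @ \oo --> (0 * s : R).
    apply: cvgM; last exact: cvg_cst.
    by apply: cvg_expr; rewrite ger0_norm ?divr_ge0 // ltr_pdivrMr // mul1r ltr_nat.
  rewrite mul0r => /(cvgr_lt _) /(_ _ e0) [n _ /(_ n (leqnn n)) h].
  by exists n; rewrite sq.
case: (badq n) => _; apply; apply: sub_colorable ce => z _ [z1 [/andP[h1 h2] /andP[h3 h4]]].
have /andP[x1 x2] := xP n; have /andP[y1 y2] := yP n.
split => //; move: h1 h2 h3 h4; case: (unstereo (f z)) => u v /= h1 h2 h3 h4.
by split; apply/andP; split => /=; lra.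
Qed.

(** Join a point [z] to [mobius g z] in the upper half plane, avoiding the fibre of the north pole,
    which is at most one orbit and hence countable. The image of the path stays in a square of the
    stereographic plane. Along it a colouring of that square is constant modulo [N], while
    equivariance multiplies it by [g]; so [g] lies in [N]. *)
Lemma monodromy_trivial : G `<=` N.
Proof.
move=> g Gg.
pose C : set (R * R) := [set z | 0 < z.2 /\ ~ (f z).2 < 1].
have cC : countable C.
  have [[y [y0 y1]]|no] := pselect (exists y, C y); last first.
    by apply: (@sub_countable _ _ _ set0) => //; apply: subset_card_le => z Cz; case: no; exists z.
  apply: (@sub_countable _ _ _ [set mobius h y | h in G]); last exact: sub_countable (card_image_le _ _) cG.
  apply: subset_card_le => z [z0 z1].
  have north w : 0 < w.2 -> ~ (f w).2 < 1 -> f w = (0, 0, 1).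
    move=> w0 /negP; rewrite -leNgt => h; have [sw _] := f_sphere w0.
    have e : (f w).2 = 1 by apply/le_anti; rewrite h sphere_le1.
    move: sw; rewrite /sphere2 /= e expr1n => /(canRL (addrK _)); rewrite subrr => /eqP.
    rewrite paddr_eq0 ?sqr_ge0 // !sqrf_eq0 => /andP[/eqP e1 /eqP e2].
    by rewrite (surjective_pairing (f w)) (surjective_pairing (f w).1) e e1 e2.
  case: fq => _ /(_ y z y0 z0) [h _] _ _.
  by have [k Gk <-] := h (etrans (north _ y0 y1) (esym (north _ z0 z1))); exists k.
have [s _ sC] : exists2 s, 0 < s < 1 & ~ (fst @` C) s.
  by apply: avoid_countable => //; exact: sub_countable (card_image_le _ _) cC.
pose z : R * R := (s, 1); have z0 : 0 < z.2 by [].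
have nCz : ~ C z by move=> Cz; apply: sC; exists z.
have gz0 : 0 < (mobius g z).2 by rewrite mobius_gt0 ?Gd.
have nCgz : ~ C (mobius g z) by move=> [_ h]; apply: nCz; split => //; rewrite -(orbit_fE z0 Gg).
have oU : open (@upper_half R).
  have -> : @upper_half R = snd @^-1` [set x | 0 < x] by [].
  by apply: open_comp; [move=> w _; exact: cvg_snd|exact: open_gt].
have cU : convex2 (@upper_half R).
  by move=> a b t; rewrite /upper_half /seg /= => a0 b0 /andP[t0 t1]; nra.
have [m mP] := broken_line oU cU cC z0 gz0 nCz nCgz.
have notC w : 0 < w.2 -> ~ C w -> (f w).2 < 1.
  by move=> w0 h; apply: contrapT => ?; apply: h.
have bound (a b : R * R) : (forall t, 0 <= t <= 1 -> 0 < (seg a b t).2 /\ ~ C (seg a b t)) ->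
    exists r, forall t, 0 <= t <= 1 ->
    `|(unstereo (f (seg a b t))).1| <= r /\ `|(unstereo (f (seg a b t))).2| <= r.
  move=> ab; pose F t := `|(unstereo (f (seg a b t))).1| + `|(unstereo (f (seg a b t))).2|.
  have Fc : {within `[0, 1], continuous F}.
    apply: continuous_in_subspaceT => t; rewrite inE /= in_itv /= => t01.
    have [st Ct] := ab t t01.
    have uc : {for t, continuous (fun t => unstereo (f (seg a b t)))}.
      apply: (@continuous_comp _ _ _ (fun t => f (seg a b t)) (@unstereo R)).
        by apply: (@continuous_comp _ _ _ (seg a b) f); [exact: seg_cont|exact: f_cont].
      by apply: unstereo_cont; exact: notC.
    apply: cvgD; apply: cvg_norm.
      by apply: (@continuous_comp _ _ _ (fun t => unstereo (f (seg a b t))) fst); [exact: uc|exact: cvg_fst].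
    by apply: (@continuous_comp _ _ _ (fun t => unstereo (f (seg a b t))) snd); [exact: uc|exact: cvg_snd].
  have [c _ cP] := EVT_max ler01 Fc; exists (F c) => t t01.
  have /cP h : t \in `[0, 1]%R by rewrite in_itv.
  by split; apply: le_trans h; rewrite /F ?lerDl ?lerDr.
have [r1 r1P] := bound z m (fun t t01 => let: And4 a _ c _ := mP t t01 in conj a c).
have [r2 r2P] := bound m (mobius g z) (fun t t01 => let: And4 _ b _ d := mP t t01 in conj b d).
(* One more than the bounds, because [rect] is open. *)
pose r := Num.max r1 r2 + 1.
have r0 : 0 < 2 * r.
  have /r1P[+ _] : is_true (((0 : R) <= 0) && ((0 : R) <= 1)) by rewrite ?lexx ?ler01.
  have : r1 <= Num.max r1 r2 by rewrite le_max lexx.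
  have := normr_ge0 (unstereo (f (seg z m 0))).1; rewrite /r; lra.
have [k kP] := square_colorable (- r) (- r) r0.
have inr (w : R * R) : `|w.1| <= Num.max r1 r2 -> `|w.2| <= Num.max r1 r2 ->
    rect (- r) (- r + 2 * r) (- r) (- r + 2 * r) w.
  have -> : - r + 2 * r = r by ring.
  by move=> h1 h2; split; rewrite -ltr_norml /r ltr_pwDr.
have follow (a b : R * R) : (forall t, 0 <= t <= 1 -> 0 < (seg a b t).2 /\
    cap (rect (- r) (- r + 2 * r) (- r) (- r + 2 * r)) (f (seg a b t))) -> eqN (k b) (k a).
  move=> ab; have : eqN (k (seg a b 1)) (k a); last by rewrite seg1.
  apply: (@interval_induction R (fun t => eqN (k (seg a b t)) (k a))); last first.
    have [|s0 h] := ab 0; first by apply/andP; split; lra.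
    by rewrite seg0 in s0 h *; apply/eqN_refl/(coloringG kP).
  move=> t t01; have [st ht] := ab t t01; have [_ nk] := kP _ st ht.
  have : \forall u \near t, 0 < (seg a b u).2 -> eqN (k (seg a b u)) (k (seg a b t)).
    exact: (@seg_cont R a b t _ nk).
  apply: filterS => u hu u01; have [su _] := ab u u01; split => h.
    exact: eqN_trans (eqN_sym (hu su)) h.
  exact: eqN_trans (hu su) h.
have e1 : eqN (k m) (k z).
  apply: follow => t t01; have [a _ c _] := mP t t01; have [h1 h2] := r1P t t01; split => //.
  by split; [exact: notC|apply: inr; rewrite le_max ?h1 ?h2].
have e2 : eqN (k (mobius g z)) (k m).
  apply: follow => t t01; have [_ b _ d] := mP t t01; have [h1 h2] := r2P t t01; split => //.
  by split; [exact: notC|apply: inr; rewrite le_max ?h1 ?h2 orbT].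
have [|/(_ g Gg) e3 _] := kP z z0.
  have t01 : is_true (((0 : R) <= 0) && ((0 : R) <= 1)) by rewrite ?lexx ?ler01.
  split; first exact: notC.
  by have [h1 h2] := r1P 0 t01; rewrite seg0 in h1 h2; apply: inr; rewrite le_max ?h1 ?h2.
have Gk : G (k z) by case: e1.
have := eqN_mul (eqN_trans (eqN_sym (eqN_trans e2 e1)) e3) (eqN_refl (GV Gk)).
rewrite -mulmxA mulmxV ?Gu // mulmx1 => -[_ _]; by rewrite invmx1 mul1mx.
Qed.

End Monodromy.

Section Seq.
Lemma seq_pos (R : realType) (T : eqType) (s : seq T) (Q : T -> R -> Prop) :
  (forall x e e', Q x e -> 0 < e' <= e -> Q x e') ->
  (forall x, x \in s -> exists2 e, 0 < e & Q x e) ->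
  exists2 e, 0 < e & forall x, x \in s -> Q x e.
Proof.
move=> mono; elim: s => [_|x s IH sQ]; first by exists 1.
have [|e1 e10 h1] := IH; first by move=> y ys; apply: sQ; rewrite inE ys orbT.
have [e2 e20 h2] := sQ x (mem_head _ _).
have m0 : 0 < Num.min e1 e2 by rewrite lt_min e10.
exists (Num.min e1 e2) => // y; rewrite inE => /predU1P[->|ys].
  by apply: mono h2 _; rewrite m0 ge_min lexx orbT.
by apply: mono (h1 y ys) _; rewrite m0 ge_min lexx.
Qed.

Lemma finite_set_min (R : realType) (S : set R) : finite_set S -> S !=set0 ->
  exists2 m, S m & forall x, S x -> m <= x.
Proof.
move=> /finite_seqP[s ->] [x0 /= x0s]; case: s x0s => // x s _.
elim: s x => [|y s IH] x; first by exists x => [|z] /=; rewrite inE // => /eqP ->.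
have [m ms mP] := IH y; have [xm|mx] := leP x m.
  exists x => [|z] /=; first exact: mem_head.
  by rewrite inE => /predU1P[->|/mP] //; exact: le_trans.
exists m => [|z] /=; first by rewrite inE ms orbT.
by rewrite inE => /predU1P[->|/mP] //; exact: ltW.
Qed.
End Seq.

(** * Integral matrices, Farey vertices and reduction theory *)

Section Modular.
Variable R : realType.
Implicit Types (g h : 'M[R]_2) (A B : 'M[int]_2) (u v : 'cV[R]_2) (z : R * R).

Definition e1 : 'cV[R]_2 := cv 1 0.
Definition e2 : 'cV[R]_2 := cv 0 1.

Definition real_mx A : 'M[R]_2 := map_mx intr A.

Lemma real_mxE A i j : real_mx A i j = (A i j)%:~R.
Proof. by rewrite mxE. Qed.

Lemma real_mxM A B : real_mx (A *m B) = real_mx A *m real_mx B.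
Proof. exact: map_mxM. Qed.

Lemma real_mx1 : real_mx 1%:M = 1%:M.
Proof. exact: map_mx1. Qed.

Lemma real_mxN A : real_mx (- A) = - real_mx A.
Proof. exact: map_mxN. Qed.

Lemma det_real_mx A : \det (real_mx A) = (\det A)%:~R.
Proof. by rewrite !det_mx2E !real_mxE -!intrM -intrB. Qed.

Lemma tr_real_mx A : \tr (real_mx A) = (\tr A)%:~R.
Proof. by rewrite !tr_mx2E !real_mxE -intrD. Qed.

Lemma real_mx_inj : injective real_mx.
Proof. by move=> A B /matrixP e; apply/matrixP => i j; have := e i j; rewrite !real_mxE => /intr_inj. Qed.

Lemma PSL2ZP g : PSL2Z g <-> exists2 A, \det A = 1 & g = real_mx A.
Proof.
split=> [[dg /= ig]|[A dA ->]]; last first.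
  split; first by rewrite det_real_mx dA.
  by move=> i j; rewrite real_mxE intr_int.
exists (\matrix_(i, j) Num.floor (g i j)); last first.
  by apply/matrixP => i j; rewrite !mxE; have /intrP[m ->] := ig i j; rewrite intrKfloor.
apply: (@intr_inj R); rewrite -det_real_mx -dg; congr (\det _).
by apply/matrixP => i j; rewrite !mxE; have /intrP[m ->] := ig i j; rewrite intrKfloor.
Qed.

Lemma PSL2Z_real A : \det A = 1 -> PSL2Z (real_mx A).
Proof. by move=> dA; apply/PSL2ZP; exists A. Qed.

Lemma inv_real_mx A : \det A = 1 -> invmx (real_mx A) = real_mx (invmx A).
Proof.
move=> dA; have dr : \det (real_mx A) = 1 by rewrite det_real_mx dA.
by rewrite !invmx2 //; apply: mx2P; rewrite !mxE ?rmorphN.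
Qed.

Lemma PSL2Z_group : PSL2_subgroup (@PSL2Z R).
Proof.
split.
- by move=> g [].
- by split; apply/PSL2ZP; [exists 1%:M|exists (- 1%:M)]; rewrite ?det_opp2 ?det1 ?real_mxN ?real_mx1.
- move=> g h /PSL2ZP[A dA ->] /PSL2ZP[B dB ->]; rewrite -real_mxM.
  by apply/PSL2Z_real/det_mul1.
- by move=> g /PSL2ZP[A dA ->]; rewrite inv_real_mx //; apply/PSL2Z_real/det_inv1.
Qed.

Lemma bezout_mx (p q : int) : coprimez p q ->
  exists A, [/\ \det A = 1, A 0 0 = p & A 1 0 = q].
Proof.
case/coprimezP => -[a b] /= e; exists (mx2 p (- b) q a).
by split; rewrite ?mxE // det_mx2 -e; ring.
Qed.

Lemma farey_vertexP v : farey_vertex v <-> exists2 g, PSL2Z g & v = g *m e1.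
Proof.
split=> [[p [q [co vp vq]]]|[g /PSL2ZP[A dA ->] ->]].
  have [A [dA Ap Aq]] := bezout_mx co; exists (real_mx A); first exact: PSL2Z_real.
  by apply: cvP; rewrite mulmx2E !mxE /= mulr1 mulr0 addr0 ?Ap ?Aq.
exists (A 0 0), (A 1 0); rewrite !mulmx2E !mxE /= !(mulr1, mulr0, addr0); split=> //.
apply/coprimezP; exists (A 1 1, - A 0 1) => /=; rewrite -dA det_mx2E; ring.
Qed.

Lemma PSL2Z_farey g v : PSL2Z g -> farey_vertex v -> farey_vertex (g *m v).
Proof.
have [_ _ ZM _] := PSL2Z_group.
move=> Zg /farey_vertexP[h Zh ->]; apply/farey_vertexP; exists (g *m h); first exact: ZM.
by rewrite mulmxA.
Qed.

Lemma farey_vertexN v : farey_vertex v -> farey_vertex (- v).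
Proof.
have [_ [_ Z1] _ _] := PSL2Z_group.
by move=> fv; have := PSL2Z_farey Z1 fv; rewrite mulNmx mul1mx.
Qed.

Lemma farey_e1 : farey_vertex e1.
Proof. by exists 1, 0; rewrite !mxE; split. Qed.

Lemma farey_e2 : farey_vertex e2.
Proof. by exists 0, 1; rewrite !mxE; split. Qed.

Lemma int_unit (m n : int) : m * n = 1 -> m = 1 \/ m = -1.
Proof.
by move=> e; have /eqP := congr1 absz e; rewrite abszM muln_eq1 => /andP[/eqP h _]; lia.
Qed.

Lemma farey_parallel u v : farey_vertex u -> farey_vertex v -> det2 u v = 0 ->
  v = u \/ v = - u.
Proof.
move=> /farey_vertexP[g Zg ->] /farey_vertexP[h Zh ->].
have [Zd _ ZM ZV] := PSL2Z_group; have dg := Zd _ Zg.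
have /PSL2ZP[C dC hC] : PSL2Z (invmx g *m h) by apply: ZM => //; exact: ZV.
have -> : h = g *m real_mx C by rewrite -hC mulKVmx ?det1_unit.
rewrite -mulmxA det2_mul dg mul1r /det2 !mulmx2E !mxE /= !(mulr0, mulr1, mul1r, addr0, subr0).
move=> /eqP; rewrite intr_eq0 => /eqP c0.
have [|c1|c1] := @int_unit (C 0 0) (C 1 1); first by rewrite -dC det_mx2E c0 mulr0 subr0.
  by left; congr (g *m _); apply: cvP; rewrite mulmx2E !mxE /= ?c0 ?c1; ring.
by right; rewrite -mulmxN; congr (g *m _); apply: cvP; rewrite mulmx2E !mxE /= ?c0 ?c1; ring.
Qed.

Definition int_cv v := forall i, v i 0 \is a Num.int.

Lemma farey_int v : farey_vertex v -> int_cv v.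
Proof. by case=> p [q [_ vp vq]] i; case: (ord2P i) => ->; rewrite ?vp ?vq intr_int. Qed.

Lemma int_det2 u v : int_cv u -> int_cv v -> det2 u v \is a Num.int.
Proof. by move=> iu iv; rewrite rpredB ?rpredM. Qed.

(** The form of [z] is positive definite, uniformly for [z] in a box away from the real axis. Here
    [Q] bounds the square of the second coordinate and [L] the squares of both. *)
Lemma nht_bound (a b c K : R) : 0 < a -> exists M : nat, forall z v,
  a <= z.2 -> z.2 <= b -> `|z.1| <= c -> nht z v <= K ->
  forall i, `|v i 0| <= M%:R.
Proof.
move=> a0; pose Q := `|K| / a; pose L := Q + 2 * (`|K| * `|b| + Q * c ^+ 2).
have Q0 : 0 <= Q by rewrite divr_ge0 // ltW.
have L0 : 0 <= L by rewrite addr_ge0 // mulr_ge0 // addr_ge0 // mulr_ge0 // sqr_ge0.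
exists (Num.bound (L + 1)) => z v az zb zc nK.
have y0 : 0 < z.2 by exact: lt_le_trans az.
have M2 : L + 1 <= (Num.bound (L + 1))%:R by apply/ltW/archi_boundP; rewrite addr_ge0.
have sqle (t : R) : t ^+ 2 <= L -> `|t| <= (Num.bound (L + 1))%:R.
  rewrite -(real_normK (num_real t)); move: (`|t|) (normr_ge0 t) => n n0 nL; apply: le_trans M2.
  by rewrite leNgt; apply/negP => h; have := mulr_ge0 L0 n0; nra.
move: nK; rewrite /nht ler_pdivrMr // => nK.
have nK' : (v 0 0 - v 1 0 * z.1) ^+ 2 + (v 1 0 * z.2) ^+ 2 <= `|K| * z.2.
  by apply: (le_trans nK); rewrite ler_wpM2r ?ler_norm // ltW.
have q2 : v 1 0 ^+ 2 <= Q.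
  rewrite /Q ler_pdivlMr //; apply: (@le_trans _ _ (v 1 0 ^+ 2 * z.2)); first by rewrite ler_wpM2l ?sqr_ge0.
  rewrite -(ler_pM2r y0); apply: le_trans nK'; rewrite exprMn -mulrA -expr2 lerDr.
  exact: sqr_ge0.
have x2 : z.1 ^+ 2 <= c ^+ 2.
  by rewrite -(real_normK (num_real z.1)) ler_pXn2r ?nnegrE ?normr_ge0 // (le_trans _ zc).
have p2 : v 0 0 ^+ 2 <= 2 * (`|K| * `|b| + Q * c ^+ 2).
  have h1 : (v 0 0 - v 1 0 * z.1) ^+ 2 <= `|K| * `|b|.
    apply: (@le_trans _ _ (`|K| * z.2)); first by apply: le_trans nK'; rewrite lerDl sqr_ge0.
    by rewrite ler_wpM2l // (le_trans zb) ?ler_norm.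
  have h2 : (v 1 0 * z.1) ^+ 2 <= Q * c ^+ 2 by rewrite exprMn ler_pM ?sqr_ge0.
  have h3 := sqr_ge0 (v 0 0 - 2 * (v 1 0 * z.1)); nra.
move=> i; apply: sqle; case: (ord2P i) => ->; rewrite /L; first by apply: (le_trans p2); rewrite lerDr.
by apply: (le_trans q2); rewrite lerDl mulr_ge0 // addr_ge0 // mulr_ge0 // sqr_ge0.
Qed.

Lemma finite_int_cv (M : nat) : finite_set [set v | int_cv v /\ forall i, `|v i 0| <= M%:R].
Proof.
pose F (t : 'I_(2 * M).+1 * 'I_(2 * M).+1) : 'cV[R]_2 := cv (t.1%:R - M%:R) (t.2%:R - M%:R).
apply: (@sub_finite_set _ _ (F @` setT)); last exact/finite_image/finite_finset.
move=> v [iv bv].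
have key i : exists j : 'I_(2 * M).+1, v i 0 = j%:R - M%:R.
  have /intrP[m e] := iv i; have := bv i; rewrite e -intr_norm (pmulrn 1 M) ler_int ler_norml => /andP[h1 h2].
  have e2 : `|(m + M%:Z)%R|%N%:Z = m + M%:Z by rewrite gez0_abs // -lerBlDr sub0r.
  have lt : (`|(m + M%:Z)%R| < (2 * M).+1)%N by rewrite ltnS -lez_nat e2; lia.
  by exists (Ordinal lt) => /=; rewrite (pmulrn 1 `|_|%N) e2 intrD addrK.
have [j0 h0] := key 0; have [j1 h1] := key 1.
by exists (j0, j1) => //; apply: cvP; rewrite mxE /= ?h0 ?h1.
Qed.

Lemma mobius_shift z (l : R) : 0 < z.2 -> mobius (mx2 1 l 0 1) z = (z.1 + l, z.2).
Proof.
move=> z0; rewrite mobiusE ?det_mx2 ?mulr0 ?subr0 ?mulr1 //= !mxE /=.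
by congr pair; field; rewrite ?oner_neq0.
Qed.

(** Among the Farey vertices pick [u] with [nht z u] minimal; only finitely many compete with [e1].
    Move [u] to infinity and translate the real part into the interval of length 1 around 0;
    minimality against [e2] then says that the point lies on or outside the unit circle. *)
Lemma PSL2Z_reduce z : 0 < z.2 -> exists2 g, PSL2Z g &
  `|(mobius g z).1| <= 1 / 2 /\ 1 <= (mobius g z).1 ^+ 2 + (mobius g z).2 ^+ 2.
Proof.
move=> z0; have [Zd [Z1 _] ZM ZV] := PSL2Z_group.
pose S := [set nht z v | v in [set v | farey_vertex v /\ nht z v <= nht z e1]].
have finS : finite_set S.
  apply: finite_image; have [M bM] := @nht_bound z.2 z.2 `|z.1| (nht z e1) z0.
  apply: sub_finite_set (finite_int_cv M) => v [fv nv]; split; first exact: farey_int.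
  exact: (bM z).
have [u fu umin] : exists2 u, farey_vertex u & forall v, farey_vertex v -> nht z u <= nht z v.
  have [|_ [u [fu nu] <-] umin] := finite_set_min finS.
    by exists (nht z e1), e1 => //; split => //; exact: farey_e1.
  exists u => // v fv; have [h|/ltW h] := leP (nht z v) (nht z e1); last exact: le_trans h.
  by apply: umin; exists v.
have /farey_vertexP[A ZA uA] := fu; have dA := Zd _ ZA.
set w0 := mobius (invmx A) z; pose k := Num.floor (w0.1 + 1 / 2).
have w00 : 0 < w0.2 by rewrite mobius_gt0 ?det_inv1.
have dT (l : int) : \det (mx2 1 l 0 1) = 1 by rewrite det_mx2; ring.
pose T := real_mx (mx2 1 (- k) 0 1).
have ZT : PSL2Z T by apply: PSL2Z_real.
have wE : mobius T w0 = (w0.1 - k%:~R, w0.2).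
  have -> : T = mx2 1 (- k%:~R) 0 1 by apply: mx2P; rewrite !mxE /= ?rmorphN.
  exact: mobius_shift.
have Zg : PSL2Z (T *m invmx A) by apply: ZM => //; exact: ZV.
exists (T *m invmx A) => //; rewrite mobiusM ?Zd //; last exact: ZV.
have key : nht (mobius T w0) e1 <= nht (mobius T w0) e2.
  have gz : mobius T w0 = mobius (T *m invmx A) z by rewrite mobiusM ?Zd //; exact: ZV.
  rewrite gz -{1}(mulKVmx (det1_unit (Zd _ Zg)) e1) -{1}(mulKVmx (det1_unit (Zd _ Zg)) e2).
  rewrite !nht_mobius ?Zd //.
  have -> : invmx (T *m invmx A) *m e1 = u.
    rewrite invmx_mul ?Zd //; last exact: ZV.
    rewrite invmxK uA -mulmxA; congr (_ *m _); rewrite inv_real_mx // invmx2 //.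
    by apply: cvP; rewrite mulmx2E !mxE /=; ring.
  by apply: umin; apply: PSL2Z_farey; [exact: ZV|exact: farey_e2].
rewrite -/w0 wE in key *; clearbody w0.
have kx : (k%:~R : R) <= w0.1 + 1 / 2 < k%:~R + 1.
  by rewrite -[in X in _ && X](intrD _ k 1) floor_itv ?num_real.
have {kx} /andP[k1 k2] := kx.
split=> /=; first by rewrite ler_norml; apply/andP; split; lra.
move: key; rewrite /nht !mxE /= ler_pM2r ?invr_gt0 //; lra.
Qed.

End Modular.

(** * Groups commensurable with the modular group *)

Section Groups.
Variable R : realType.
Implicit Types (g h : 'M[R]_2) (A B G : set 'M[R]_2) (u v : 'cV[R]_2) (z w : R * R).

Lemma seq_pigeonhole (T : eqType) (s : seq T) (f : nat -> T) :
  (forall n, f n \in s) -> exists i j, (i < j)%N /\ f i = f j.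
Proof.
move=> fs; have : ~~ uniq [seq f n | n <- iota 0 (size s).+1].
  apply/negP => /uniq_leq_size /(_ _) h.
  have : (size [seq f n | n <- iota 0 (size s).+1] <= size s)%N.
    by apply: h => _ /mapP[n _ ->].
  by rewrite size_map size_iota ltnn.
move=> /(uniqPn (f 0)) [i [j [ij]]]; rewrite size_map size_iota => js.
have ist := ltn_trans ij js.
by rewrite !(nth_map 0%N) ?size_iota // !nth_iota // !add0n; exists i, j.
Qed.

Lemma PSL2_subgroupI A B : PSL2_subgroup A -> PSL2_subgroup B -> PSL2_subgroup (A `&` B).
Proof.
move=> [dA [A1 AN] AM AV] [dB [B1 BN] BM BV]; split.
- by move=> g [/dA].
- by [].
- by move=> g h [? ?] [? ?]; split; [exact: AM|exact: BM].
- by move=> g [? ?]; split; [exact: AV|exact: BV].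
Qed.

Lemma PSL2_subgroupX A g k : PSL2_subgroup A -> A g -> A (g ^+ k).
Proof.
by move=> [dA [A1 AN] AM AV] Ag; elim: k => [|k IH]; rewrite ?expr0 // exprS; exact: AM.
Qed.

Lemma finite_index_reps A B : PSL2_subgroup A -> PSL2_subgroup B -> finite_index A B ->
  exists s : seq 'M[R]_2, (forall h, h \in s -> B h) /\
    forall b, B b -> exists2 h, h \in s & A (invmx h *m b).
Proof.
move=> [dA [A1 _] AM AV] [dB _ BM BV] [sAB /finite_seqP[cs csE]].
pose rep C := xget 1%:M [set b | B b /\ [set b *m a | a in A] = C].
exists [seq rep C | C <- cs & `[< exists2 b, B b & [set b *m a | a in A] = C >]]; split.
  move=> _ /mapP[C + ->]; rewrite mem_filter => /andP[/asboolP[b Bb bC] _].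
  by rewrite /rep; case: xgetP => [h -> []|/(_ b)] // [].
move=> b Bb; exists (rep [set b *m a | a in A]).
  apply/mapP; exists [set b *m a | a in A] => //; rewrite mem_filter.
  apply/andP; split; first by apply/asboolP; exists b.
  have : [set mulmx h @` A | h in B] [set b *m a | a in A] by exists b.
  by rewrite csE.
rewrite /rep; case: xgetP => [h _ [Bh hb]|/(_ b)]; last by case.
have : [set b *m a | a in A] b by exists 1%:M; rewrite ?mulmx1.
by rewrite -hb => -[a Aa <-]; rewrite mulKmx ?det1_unit ?dB.
Qed.

(** By the pigeonhole principle two powers of [g] lie in the same left coset of [A]. *)
Lemma finite_index_pow A B g : PSL2_subgroup A -> PSL2_subgroup B -> finite_index A B ->
  B g -> exists2 k, (0 < k)%N & A (g ^+ k).
Proof.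
move=> gA gB fi Bg; have [s [sB sP]] := finite_index_reps gA gB fi.
have [dA [A1 _] AM AV] := gA; have [dB _ _ _] := gB.
have /choice[f fP] : forall n, exists h, h \in s /\ A (invmx h *m g ^+ n).
  by move=> n; have [h hs Ah] := sP _ (PSL2_subgroupX n gB Bg); exists h.
have [i [j [ij fij]]] : exists i j, (i < j)%N /\ f i = f j.
  by apply: (@seq_pigeonhole _ s) => n; case: (fP n).
exists (j - i)%N; first by rewrite subn_gt0.
have [hs Ai] := fP i; have [_ Aj] := fP j.
have dh := dB _ (sB _ hs); have dgi : \det (g ^+ i) = 1 by apply: dB; exact: PSL2_subgroupX.
have := AM _ _ (AV _ Ai) Aj; rewrite -fij invmx_mul ?det_inv1 // invmxK -mulmxA mulKVmx ?det1_unit //.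
rewrite -{1}(subnKC (ltnW ij)) exprD mulmxA mulVmx ?det1_unit // mul1mx.
by [].
Qed.

(* [1 + t v (J v)^T] with [J] the rotation by a right angle: the parabolic elements fixing [v]. *)
Definition parab (t : R) v : 'M[R]_2 :=
  mx2 (1 - t * (v 0 0 * v 1 0)) (t * v 0 0 ^+ 2) (- (t * v 1 0 ^+ 2)) (1 + t * (v 0 0 * v 1 0)).

Lemma parabM s t v : parab s v *m parab t v = parab (s + t) v.
Proof. by rewrite mul_mx2; congr mx2; ring. Qed.

Lemma parab0 v : parab 0 v = 1%:M.
Proof. by rewrite mx2_1 /parab; congr mx2; ring. Qed.

Lemma parabX t v k : parab t v ^+ k = parab (t *+ k) v.
Proof. by elim: k => [|k IH]; rewrite ?mulr0n ?parab0 // exprS IH mulrS -parabM. Qed.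

Lemma det_parab t v : \det (parab t v) = 1.
Proof. by rewrite det_mx2; ring. Qed.

Lemma tr_parab t v : \tr (parab t v) = 2.
Proof. by rewrite tr_mx2; ring. Qed.

Lemma parab_fix t v : parab t v *m v = v.
Proof. by apply: cvP; rewrite mulmx2E !mxE /=; ring. Qed.

Lemma parab_conj g t v : \det g = 1 -> g *m parab t v = parab t (g *m v) *m g.
Proof.
have key (x L M : R) : M = x + \det g * (L - x) -> \det g = 1 -> L = M.
  by move=> -> ->; ring.
move=> dg; apply: mx2P; rewrite !mulmx2E !mx2E !mulmx2E; [apply: (key (g 0 0))|apply: (key (g 0 1))|
  apply: (key (g 1 0))|apply: (key (g 1 1))] => //; rewrite det_mx2E; ring.
Qed.

Lemma parab_int (k : int) v : int_cv v -> PSL2Z (parab k%:~R v).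
Proof.
move=> iv; split; first exact: det_parab.
by move=> i j; case: (ord2P i) => ->; case: (ord2P j) => ->; rewrite !mxE /=
  ?(rpredB, rpredD, rpredN, rpredM, rpredX, intr_int, rpred1).
Qed.

Lemma tr_parabM s t u v : \tr (parab s u *m parab t v) = 2 - s * t * det2 u v ^+ 2.
Proof. by rewrite mul_mx2 tr_mx2 /det2; ring. Qed.

Lemma parab_inj_oo t v : v != 0 -> parab t v = 1%:M -> t = 0.
Proof.
move=> v0; rewrite mx2_1 => /matrixP e; have := e 0 1; have := e 1 0; rewrite !mxE /=.
move=> /eqP; rewrite oppr_eq0 mulf_eq0 sqrf_eq0 => /orP[/eqP->//|/eqP v1] /eqP.
rewrite mulf_eq0 sqrf_eq0 => /orP[/eqP->//|/eqP v2].
by move: v0; rewrite (cv_eta v) v1 v2 => /eqP[]; apply: cvP; rewrite !mxE.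
Qed.

Definition isQ (x : R) := exists q : rat, x = ratr q.

Lemma isQ_int x : x \is a Num.int -> isQ x.
Proof. by move=> /intrP[m ->]; exists m%:~R; rewrite ratr_int. Qed.
Lemma isQD x y : isQ x -> isQ y -> isQ (x + y).
Proof. by move=> [p ->] [q ->]; exists (p + q); rewrite rmorphD. Qed.
Lemma isQB x y : isQ x -> isQ y -> isQ (x - y).
Proof. by move=> [p ->] [q ->]; exists (p - q); rewrite rmorphB. Qed.
Lemma isQM x y : isQ x -> isQ y -> isQ (x * y).
Proof. by move=> [p ->] [q ->]; exists (p * q); rewrite rmorphM. Qed.
Lemma isQV x : isQ x -> isQ x^-1.
Proof. by move=> [p ->]; exists p^-1; rewrite fmorphV. Qed.
Lemma isQN x : isQ x -> isQ (- x).
Proof. by move=> [p ->]; exists (- p); rewrite rmorphN. Qed.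

Lemma isQ_den x : isQ x -> exists2 d : nat, (0 < d)%N & x * d%:R \is a Num.int.
Proof.
move=> [q ->]; exists `|denq q|%N; first by rewrite absz_gt0 denq_neq0.
have -> : (`|denq q|%N%:R : R) = ratr (denq q)%:~R.
  by rewrite ratr_int (pmulrn 1) -{2}(gez0_abs (ltW (denq_gt0 q))).
by rewrite -rmorphM /= -numqE ratr_int intr_int.
Qed.

Lemma farey_neq0 v : farey_vertex v -> v != 0.
Proof.
move=> /farey_vertexP[h [/det1_unit hu _] ->]; apply/eqP => /(congr1 (mulmx (invmx h))).
by rewrite mulKmx // mulmx0 => /matrixP/(_ 0 0)/eqP; rewrite !mxE oner_eq0.
Qed.

Section Commensurable.
Variable G : set 'M[R]_2.
Hypotheses (GG : PSL2_subgroup G) (cG : commensurable G (@PSL2Z R)).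

Let D := G `&` @PSL2Z R.
Let DG : PSL2_subgroup D. Proof. exact: PSL2_subgroupI GG (PSL2Z_group R). Qed.
Let GM a b : G a -> G b -> G (a *m b). Proof. by case: GG => _ _ h _; apply: h. Qed.
Let GV a : G a -> G (invmx a). Proof. by case: GG => _ _ _; apply. Qed.
Let Gd a : G a -> \det a = 1. Proof. by case: GG => + _ _ _; apply. Qed.
Let Gu a : G a -> a \in unitmx. Proof. by move=> /Gd /det1_unit. Qed.

Lemma repsG : exists s : seq 'M[R]_2, (forall h, h \in s -> G h) /\
    forall b, G b -> exists2 h, h \in s & PSL2Z (invmx h *m b).
Proof.
have [s [sB sP]] := finite_index_reps DG GG cG.1; exists s; split => // b /sP[h hs []].
by exists h.
Qed.

Lemma repsZ : exists s : seq 'M[R]_2, (forall h, h \in s -> PSL2Z h) /\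
    forall b, PSL2Z b -> exists2 h, h \in s & D (invmx h *m b).
Proof. exact: finite_index_reps DG (PSL2Z_group R) cG.2. Qed.

(** Products of two entries are the right quantity, as [g] may be a rational matrix divided by a
    square root. For integral [v] a power of the parabolic element at [v] lies in [G]; conjugated by
    [g] and raised to a further power it is integral, and its entries involve an integer times
    products of coordinates of [g *m v]. Taking for [v] the vectors [e1], [e2] and their sum,
    polarization and [\det g = 1] give all products. *)
Lemma rational_products g i j k l : G g -> isQ (g i j * g k l).
Proof.
move=> Gg; have dg := Gd Gg.
have sq v : int_cv v -> let w := g *m v in
    [/\ isQ (w 0 0 ^+ 2), isQ (w 1 0 ^+ 2) & isQ (w 0 0 * w 1 0)].
  move=> iv /=; have Zp := parab_int 1 iv.
  have [m m0 [Gm _]] := finite_index_pow DG (PSL2Z_group R) cG.2 Zp.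
  have Gc : G (g *m parab 1%:~R v ^+ m *m invmx g) by apply: GM; [exact: GM|exact: GV].
  move: Gc; rewrite parabX parab_conj // mulmxK ?Gu // => Gc.
  have [n n0 [_ [_ Zc]]] := finite_index_pow DG GG cG.1 Gc.
  move: Zc; rewrite parabX; set t := _ *+ n => Zc.
  have t0 : t != 0 by rewrite /t !mulrn_eq0 !gtn_eqF // oner_eq0.
  have tQ : isQ t by apply: isQ_int; rewrite /t mulr1z -mulrnA natr_int.
  have div x : isQ (t * x) -> isQ x by move=> h; rewrite -(mulKf t0 x); apply: isQM => //; exact: isQV.
  have := Zc 0 1; have := Zc 1 0; have := Zc 1 1; rewrite !mxE /= => h1 h2 h3.
  split; apply: div.
  - exact: isQ_int.
  - by rewrite -[_ * _]opprK; apply/isQN/isQ_int.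
  by rewrite -[_ * _](addKr 1); apply: isQD; [apply/isQN/isQ_int; rewrite rpred1|exact: isQ_int].
have i1 : int_cv (e1 R) by apply/farey_int/farey_e1.
have i2 : int_cv (e2 R) by apply/farey_int/farey_e2.
have i3 : int_cv (e1 R + e2 R) by move=> n; rewrite mxE rpredD.
have := sq _ i1; have := sq _ i2; have := sq _ i3; rewrite /= mulmxDr !mulmx2E ![(_ + _ : 'cV_2) _ _]mxE !mulmx2E !mxE /=.
rewrite !(mulr0, mulr1, addr0, add0r) => -[q1 q2 q3] [b2 d2 bd] [a2 c2 ac].
set a := g 0 0 in q1 q2 q3 a2 c2 ac b2 d2 bd *; set b := g 0 1 in q1 q2 q3 a2 c2 ac b2 d2 bd *.
set c := g 1 0 in q1 q2 q3 a2 c2 ac b2 d2 bd *; set d := g 1 1 in q1 q2 q3 a2 c2 ac b2 d2 bd *.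
have half x y : isQ x -> y = x / 2%:R -> isQ y.
  by move=> qx ->; apply: isQM => //; apply/isQV/isQ_int; rewrite natr_int.
have ab : isQ (a * b).
  by apply: (@half ((a + b) ^+ 2 - a ^+ 2 - b ^+ 2)); [apply: isQB => //; exact: isQB|field].
have cd : isQ (c * d).
  by apply: (@half ((c + d) ^+ 2 - c ^+ 2 - d ^+ 2)); [apply: isQB => //; exact: isQB|field].
have e : a * d - b * c = 1 by rewrite -dg det_mx2E.
have q4 : isQ (a * d + b * c).
  have -> : a * d + b * c = (a + b) * (c + d) - a * c - b * d by ring.
  by apply: isQB => //; exact: isQB.
have one : isQ 1 by apply: isQ_int; rewrite rpred1.
have ad : isQ (a * d) by apply: (half (a * d + b * c + 1)); [exact: isQD|lra].
have bc : isQ (b * c) by apply: (half (a * d + b * c - 1)); [exact: isQB|lra].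
case: (ord2P i) => ->; case: (ord2P j) => ->; case: (ord2P k) => ->; case: (ord2P l) => ->;
  by rewrite -?expr2 // mulrC.
Qed.

(** [G] meets finitely many cosets [h *m PSL2Z], and some multiple [t *: h] of each representative
    is integral, since its entries are rational up to a common factor. Then [t * det2] is a nonzero
    integer. *)
Lemma det2_gap : exists2 e, 0 < e & forall g u v, G g -> int_cv u -> int_cv v ->
  det2 u (g *m v) != 0 -> e <= `|det2 u (g *m v)|.
Proof.
have [s [sG sP]] := repsG.
suff [e e0 eP] : exists2 e : R, 0 < e & forall h, h \in s -> forall u v, int_cv u -> int_cv v ->
    det2 u (h *m v) != 0 -> e <= `|det2 u (h *m v)|.
  exists e => // g u v Gg iu iv; have [h hs /PSL2ZP[A dA gA]] := sP g Gg.
  have -> : g *m v = h *m (real_mx R A *m v) by rewrite mulmxA -gA mulKVmx //; exact/Gu/sG.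
  apply: eP => // k; rewrite mulmx2E !real_mxE rpredD ?rpredM ?intr_int //.
apply: (@seq_pos R _ s (fun h e => forall u v, int_cv u -> int_cv v ->
  det2 u (h *m v) != 0 -> e <= `|det2 u (h *m v)|)).
- move=> h e e' he /andP[_ e'e] u v iu iv n0; exact: le_trans (he u v iu iv n0).
- move=> h hs; have Gh := sG _ hs.
  have [i [j x0]] : exists i j, h i j != 0.
    apply: contrapT => no; have := Gd Gh; rewrite det_mx2E.
    have h0 i j : h i j = 0 by apply: contrapT => /eqP ?; apply: no; exists i, j.
    by rewrite !h0 mul0r subrr => /esym/eqP; rewrite oner_eq0.
  have /choice[d dP] : forall kl : 'I_2 * 'I_2, exists d : nat, (0 < d)%N /\ h i j * h kl.1 kl.2 * d%:R \is a Num.int.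
    by move=> kl; have [d d0 dP] := isQ_den (rational_products i j kl.1 kl.2 Gh); exists d.
  pose t := h i j * (\prod_kl d kl)%:R.
  have t0 : t != 0.
    by rewrite mulf_neq0 // pnatr_eq0 -lt0n prodn_gt0 // => kl; case: (dP kl).
  have ti k l : t * h k l \is a Num.int.
    rewrite /t (bigD1 (k, l)) //= natrM; have [_ /= hd] := dP (k, l).
    have -> : forall N : nat, h i j * ((d (k, l))%:R * N%:R) * h k l = h i j * h k l * (d (k, l))%:R * N%:R.
      by move=> N; ring.
    by rewrite rpredM ?natr_int.
  exists (`|t|^-1); first by rewrite invr_gt0 normr_gt0.
  move=> u v iu iv n0; rewrite -div1r ler_pdivrMr ?normr_gt0 // -normrM.
  have : det2 u (h *m v) * t \is a Num.int.
    have -> : det2 u (h *m v) * t = det2 u ((t *: h) *m v).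
      by rewrite /det2 !mulmx2E !mxE; ring.
    apply: int_det2 => // k; have E l : (t *: h) k l = t * h k l by rewrite mxE.
    by rewrite mulmx2E !E rpredD // rpredM.
  move=> /intrP[m mE]; rewrite mE -intr_norm ler1z -gtz0_ge1 normr_gt0 -(intr_eq0 R) -mE mulf_neq0 //.
Qed.

(** Some power of [g] is integral, so it maps the primitive vector [v] to a proportional primitive
    vector, which can only be [v] or [- v]. *)
Lemma farey_eigenvalue g v c : G g -> farey_vertex v -> g *m v = c *: v -> c = 1 \/ c = -1.
Proof.
move=> Gg fv gv; have [k k0 [_ Zk]] := finite_index_pow DG GG cG.1 Gg.
have gk : g ^+ k *m v = c ^+ k *: v.
  elim: (k) => [|n IH]; first by rewrite !expr0 mul1mx scale1r.
  by rewrite !exprSr -mulmxA gv -scalemxAr IH scalerA mulrC.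
have vn := farey_neq0 fv.
have ck : `|c| ^+ k = 1.
  have [|e|e] := farey_parallel fv (PSL2Z_farey Zk fv); first by rewrite gk /det2 !mxE; ring.
    move: e; rewrite gk => /eqP; rewrite -subr_eq0 -{2}(scale1r v) -scalerBl scaler_eq0 (negPf vn) orbF subr_eq0 => /eqP e.
    by rewrite -normrX e normr1.
  move: e; rewrite gk => /eqP; rewrite -subr_eq0 opprK -{2}(scale1r v) -scalerDl scaler_eq0 (negPf vn) orbF addr_eq0 => /eqP e.
  by rewrite -normrX e normrN1.
have /eqP := ck; rewrite pexpr_eq1 // => /eqP; case: (ger0P c) => _ e; [left|right] => //.
by rewrite -e opprK.
Qed.

(** After moving [v] to [e1] the element is triangular with both diagonal entries 1 or both -1. *)
Lemma farey_stab g v c : G g -> farey_vertex v -> g *m v = c *: v ->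
  [\/ g = 1%:M, g = - 1%:M | parabolic g].
Proof.
move=> Gg fv gv; have c2 := farey_eigenvalue Gg fv gv.
have [g1|g1] := pselect (g = 1%:M); first by constructor 1.
have [g2|g2] := pselect (g = - 1%:M); first by constructor 2.
constructor 3; split => //.
have /farey_vertexP[h Zh vE] := fv; have dh := Zh.1; have uh := det1_unit dh.
pose k := invmx h *m g *m h.
have tk : \tr k = \tr g by rewrite /k mxtrace_mulC mulmxA mulmxV // mul1mx.
have dk : \det k = 1 by rewrite !det_mul1 ?det_inv1 // Gd.
have ke : k *m e1 R = c *: e1 R.
  by rewrite /k -!mulmxA -vE gv -scalemxAr vE mulKmx.
clearbody k.
have := congr1 (fun w : 'cV[R]_2 => w 0 0) ke; have := congr1 (fun w : 'cV[R]_2 => w 1 0) ke.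
rewrite !mulmx2E !mxE /= !(mulr0, mulr1, addr0) => k10 k00.
move: dk; rewrite det_mx2E k10 k00 mulr0 subr0 -tk tr_mx2E k00.
case: c2 => ->; rewrite ?mul1r ?mulN1r; first by move=> ->; rewrite -mulr2n normr_nat.
by move=> /(canRL (@opprK _)) ->; rewrite -opprD normrN -mulr2n normr_nat.
Qed.

Lemma finite_bounded (M : nat) : finite_set [set g | G g /\ forall i j, `|g i j| <= M%:R].
Proof.
have [s [sG sP]] := repsG.
pose I (N : nat) := [set v : 'cV[R]_2 | int_cv v /\ forall i, `|v i 0| <= N%:R].
pose J (N : nat) := [set mx2 (p.1 0 0) (p.2 0 0) (p.1 1 0) (p.2 1 0) | p in I N `*` I N].
have finJ N : finite_set (J N) by apply/finite_image/finite_setX; exact: finite_int_cv.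
have /choice[N NP] : forall h, exists N : nat, forall g : 'M[R]_2, (forall i j, `|g i j| <= M%:R) ->
    forall i j, `|(h *m g : 'M[R]_2) i j| <= N%:R.
  move=> h; pose B := \sum_i \sum_j `|h i j|.
  have hB i j : `|h i j| <= B.
    rewrite /B (bigD1 i) //= (bigD1 j) //= -addrA lerDl addr_ge0 ?sumr_ge0 // => k _.
    by rewrite sumr_ge0.
  exists (Num.bound (B * M%:R + B * M%:R)) => g gM i j.
  have B0 : 0 <= B by exact: le_trans (hB 0 0).
  apply: le_trans (ltW (archi_boundP _)); last by rewrite addr_ge0 ?mulr_ge0.
  by rewrite mulmx2E; apply: le_trans (ler_normD _ _) _; rewrite !normrM lerD ?ler_pM.
apply: (@sub_finite_set _ _ (\bigcup_(h in [set` s]) (mulmx h @` J (N (invmx h))))); last first.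
  by apply: bigcup_finite => [|h _]; [by apply/finite_seqP; exists s|exact: finite_image].
move=> g [Gg gM]; have [h hs [_ Zi]] := sP g Gg; exists h => //.
exists (invmx h *m g); last by rewrite mulKVmx //; exact/Gu/sG.
exists (col 0 (invmx h *m g), col 1 (invmx h *m g)).
  by split; split => i; rewrite mxE //; exact: NP.
by apply: mx2P; rewrite mx2E mxE.
Qed.

Definition hbox (a b c : R) : set (R * R) := [set z | [/\ a <= z.2, z.2 <= b & `|z.1| <= c]].

(** Proper discontinuity. At [invmx g *m v] the form of [z] has the value that the form of
    [mobius g z] has at [v]; this bounds the columns of [invmx g], and [G] has finitely many
    elements with bounded entries. *)
Lemma finite_return (a b c : R) : 0 < a ->
  finite_set [set g | G g /\ exists2 z, hbox a b c z & hbox a b c (mobius g z)].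
Proof.
move=> a0; have [M MP] := @nht_bound R a b c ((1 + c ^+ 2 + b ^+ 2) / a) a0.
apply: (@sub_finite_set _ _ (invmx @` [set g | G g /\ forall i j, `|g i j| <= M%:R])); last first.
  exact/finite_image/finite_bounded.
move=> g [Gg [z [z1 z2 z3] [w1 w2 w3]]]; exists (invmx g); last exact: invmxK.
split; first exact: GV.
have z0 : 0 < z.2 by exact: lt_le_trans z1.
have w0 : 0 < (mobius g z).2 by exact: lt_le_trans w1.
have K0 : 0 <= 1 + c ^+ 2 + b ^+ 2 by rewrite !addr_ge0 ?sqr_ge0.
have key v : (v 0 0 - v 1 0 * (mobius g z).1) ^+ 2 + (v 1 0 * (mobius g z).2) ^+ 2 <= 1 + c ^+ 2 + b ^+ 2 ->
    forall i, `|(invmx g *m v) i 0| <= M%:R.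
  move=> h; apply: (MP z) => //.
  rewrite -(nht_mobius _ z0 (Gd Gg)) mulKVmx ?Gu // /nht ler_pM ?addr_ge0 ?sqr_ge0 //.
    by rewrite invr_ge0 ltW.
  by rewrite lef_pV2 // posrE.
have sq x t : 0 <= x -> x <= t -> x ^+ 2 <= t ^+ 2.
  by move=> x0 xt; rewrite ler_pXn2r ?nnegrE // (le_trans x0).
have x2 : (mobius g z).1 ^+ 2 <= c ^+ 2 by rewrite -(real_normK (num_real _)); exact: sq.
have y2 : (mobius g z).2 ^+ 2 <= b ^+ 2 by apply: sq => //; exact: ltW.
have k1 : forall i, `|(invmx g *m e1 R) i 0| <= M%:R.
  by apply: key; rewrite !mxE /= !mul0r subr0 expr0n expr1n addr0 -addrA lerDl addr_ge0 ?sqr_ge0.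
have k2 : forall i, `|(invmx g *m e2 R) i 0| <= M%:R.
  by apply: key; rewrite /e2 !cvE !mul1r sub0r sqrrN; lra.
have [E1 E2] := mx2_colE (invmx g); rewrite /e1 E1 in k1; rewrite /e2 E2 in k2.
have := k1 0; have := k1 1; have := k2 0; have := k2 1; rewrite !cvE => ? ? ? ? i j.
by case: (ord2P i) => ->; case: (ord2P j) => ->.
Qed.

Hypothesis tfG : torsion_free G.

(** All powers of [g] fix [z], so two of them coincide; then [g] has finite order and
    torsion-freeness applies. *)
Lemma stabilizer_trivial g z : G g -> 0 < z.2 -> mobius g z = z -> g = 1%:M \/ g = - 1%:M.
Proof.
move=> Gg z0 gz.
have /finite_seqP[s sE] := @finite_return z.2 z.2 `|z.1| z0.
have gzn n : mobius (g ^+ n) z = z.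
  elim: n => [|n IH]; first by rewrite expr0 mobius1.
  by rewrite exprS mobiusM ?Gd ?IH //; exact: PSL2_subgroupX.
have inS n : g ^+ n \in s.
  have : [set h | G h /\ exists2 w, hbox z.2 z.2 `|z.1| w & hbox z.2 z.2 `|z.1| (mobius h w)] (g ^+ n).
    by split; [exact: PSL2_subgroupX|exists z; rewrite ?gzn; split].
  by rewrite sE.
have [i [j [ij e]]] := seq_pigeonhole inS.
apply: (tfG Gg (_ : 0 < j - i)%N); first by rewrite subn_gt0.
left; have ui : g ^+ i \in unitmx by apply: Gu; exact: PSL2_subgroupX.
apply: (can_inj (mulKmx ui)); rewrite mulmx1.
by rewrite [RHS]e -{2}(subnKC (ltnW ij)) exprD.
Qed.

(** Finitely many elements return a small box to itself. Those fixing [z0] are [1] and [-1]; each of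
    the others moves [z0], hence also a small ball, away. *)
Lemma free_nbhd z0 : 0 < z0.2 -> exists2 e : R, 0 < e & forall g z, G g ->
  ball z0 e z -> ball z0 e (mobius g z) -> 0 < z.2 /\ (g = 1%:M \/ g = - 1%:M).
Proof.
move=> y0; pose B := hbox (z0.2 / 2) (2 * z0.2) (`|z0.1| + 1).
have /finite_seqP[s sE] := @finite_return (z0.2 / 2) (2 * z0.2) (`|z0.1| + 1) (divr_gt0 y0 (ltr0n _ 2)).
have e00 : 0 < Num.min 1 (z0.2 / 2) by rewrite lt_min ltr01 divr_gt0.
have subB z : ball z0 (Num.min 1 (z0.2 / 2)) z -> B z.
  move=> [h1 h2]; move: h1 h2; rewrite /ball /= !lt_min => /andP[h1 _] /andP[_].
  rewrite ltr_norml => /andP[h3 h4]; split; [lra|lra|].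
  rewrite -(subrK z0.1 z.1); apply: le_trans (ler_normD _ _) _; rewrite addrC lerD2l distrC.
  exact: ltW.
have [e e0 eP] : exists2 e : R, 0 < e & forall g, g \in s -> G g ->
    forall z, ball z0 e z -> ball z0 e (mobius g z) -> g = 1%:M \/ g = - 1%:M.
  apply: (@seq_pos R _ s (fun g e => G g -> forall z, ball z0 e z -> ball z0 e (mobius g z) ->
    g = 1%:M \/ g = - 1%:M)).
    move=> g e e' h /andP[_ le] Gg z b1 b2; apply: (h Gg z); exact: le_ball b1 || exact: le_ball b2.
  move=> g _; have [Gg|nG] := pselect (G g); last by exists 1.
  have [gz|gz] := pselect (mobius g z0 = z0).
    by exists 1 => // _ z _ _; exact: (stabilizer_trivial Gg y0).
  have [r r0 nb] : exists2 r : R, 0 < r & ~ ball z0 r (mobius g z0).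
    apply: contrapT => no; apply: gz; apply: injective_projections; apply/eqP; rewrite -subr_eq0 -normr_eq0; apply/eqP/le_anti; rewrite normr_ge0 andbT.
      rewrite leNgt; apply/negP => h; apply: no; exists `|(mobius g z0).1 - z0.1| => // -[+ _].
      by rewrite /ball /= distrC ltxx.
    rewrite leNgt; apply/negP => h; apply: no; exists `|(mobius g z0).2 - z0.2| => // -[_].
    by rewrite /ball /= distrC ltxx.
  have r20 : 0 < r / 2 by rewrite divr_gt0.
  have /nbhs_ballP[e /= e0 eP] : \forall z \near z0, ball (mobius g z0) (r / 2) (mobius g z).
    by apply: (mobius_cont y0 (Gd Gg)); exact: nbhsx_ballx.
  have m0 : 0 < Num.min e (r / 2) by rewrite lt_min e0.
  exists (Num.min e (r / 2)) => // _ z b1 b2; exfalso; apply: nb.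
  have b3 : ball (mobius g z0) (r / 2) (mobius g z) by apply: eP; apply: le_ball b1; rewrite ge_min lexx.
  have b4 : ball z0 (r / 2) (mobius g z) by apply: le_ball b2; rewrite ge_min lexx orbT.
  by rewrite (splitr r); apply: ball_triangle b4 (ball_sym b3).
have m0 : 0 < Num.min e (Num.min 1 (z0.2 / 2)) by rewrite lt_min e0.
exists (Num.min e (Num.min 1 (z0.2 / 2))) => // g z Gg b1 b2.
have s1 : Num.min e (Num.min 1 (z0.2 / 2)) <= e by rewrite ge_min lexx.
have s2 : Num.min e (Num.min 1 (z0.2 / 2)) <= Num.min 1 (z0.2 / 2) by rewrite ge_min lexx orbT.
have Bz := subB _ (le_ball s2 b1); split.
  by case: Bz => h _ _; apply: lt_le_trans h; rewrite divr_gt0.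
apply: (eP g _ Gg z (le_ball s1 b1) (le_ball s1 b2)).
have : [set g | G g /\ exists2 z, B z & B (mobius g z)] g.
  by split => //; exists z => //; exact/subB/(le_ball s2).
by rewrite sE.
Qed.

End Commensurable.
End Groups.

(** * The normal subgroup principle for arithmetic groups *)

Section ArithmeticMonodromy.
Variable R : realType.
Implicit Types (g h : 'M[R]_2) (u v w : 'cV[R]_2) (z : R * R).

Lemma det2_parallel u v : u != 0 -> v != 0 -> det2 u v = 0 -> same_point v u.
Proof.
move=> u0 v0 d0.
have [c vE] : exists c, v = c *: u.
  have [p0|p0] := eqVneq (u 0 0) 0.
    have q0 : u 1 0 != 0.
      by apply: contra u0 => /eqP q0; apply/eqP/cvP; rewrite !mxE ?p0 ?q0.
    exists (v 1 0 / u 1 0); apply: cvP; rewrite mxE ?divfK // p0 mulr0.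
    move: d0; rewrite /det2 p0 mul0r sub0r => /eqP; rewrite oppr_eq0 mulf_eq0 (negPf q0) orbF => /eqP //.
  exists (v 0 0 / u 0 0); apply: cvP; rewrite mxE ?divfK //.
  by apply: (mulfI p0); rewrite mulrA mulrCA mulfV // mulr1; apply/eqP; rewrite -subr_eq0 -d0 /det2 eq_sym; apply/eqP; ring.
by exists c => //; apply: contra v0 => /eqP c0; rewrite vE c0 scale0r.
Qed.

Lemma nhtZ z c v : nht z (c *: v) = c ^+ 2 * nht z v.
Proof. by rewrite /nht !mxE mulrA; congr (_ / _); ring. Qed.

Section Orbits.
Variable G : set 'M[R]_2.
Hypothesis GG : PSL2_subgroup G.
Let Gd g : G g -> \det g = 1. Proof. by case: GG => + _ _ _; apply. Qed.

Lemma boundary_orbit_refl v : boundary_orbit G v v.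
Proof. by case: GG => _ [G1 _] _ _; exists 1%:M => //; exists 1; rewrite ?oner_neq0 // mul1mx scale1r. Qed.

Lemma boundary_orbit_sym v w : boundary_orbit G v w -> boundary_orbit G w v.
Proof.
move=> [g Gg [c c0 e]]; case: GG => _ _ _ /(_ g Gg) GV; exists (invmx g) => //.
exists c^-1; first by rewrite invr_eq0.
apply: (can_inj (mulKmx (det1_unit (Gd Gg)))); rewrite mulKVmx ?det1_unit ?Gd //.
by rewrite -scalemxAr e scalerA mulVf // scale1r.
Qed.

Lemma boundary_orbit_trans v u w : boundary_orbit G u v -> boundary_orbit G v w -> boundary_orbit G u w.
Proof.
move=> [g Gg [c c0 e]] [h Gh [d d0 e']]; case: GG => _ _ /(_ h g Gh Gg) GM _.
exists (h *m g) => //; exists (c * d); first by rewrite mulf_neq0.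
by rewrite -mulmxA e -scalemxAr e' scalerA.
Qed.

End Orbits.

Variables (G N : set 'M[R]_2) (f : R * R -> R * R * R) (P : set (R * R * R)).
Hypotheses (GG : PSL2_subgroup G) (cG : commensurable G (@PSL2Z R)) (tfG : torsion_free G).
Hypotheses (NG : normal_in N G) (Nopp : N (- 1%:M)).
Hypothesis (Npar : forall g, G g -> parabolic g -> N g).
Hypotheses (finP : finite_set P) (PS : P `<=` @sphere2 R).
Hypothesis (fq : quotient_homeo G (@sphere2 R `\` P) f).

Let GM a b : G a -> G b -> G (a *m b). Proof. by case: GG => _ _ h _; apply: h. Qed.
Let GV a : G a -> G (invmx a). Proof. by case: GG => _ _ _; apply. Qed.
Let Gd a : G a -> \det a = 1. Proof. by case: GG => + _ _ _; apply. Qed.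
Let Gu a : G a -> a \in unitmx. Proof. by move=> /Gd /det1_unit. Qed.

Lemma countable_commensurable : countable G.
Proof.
have [s [sG sP]] := repsG GG cG.
apply: (@sub_countable _ _ _ (\bigcup_(h in [set` s]) (mulmx h @` (@real_mx R @` setT)))); last first.
  apply: bigcup_countable => [|h _]; first by apply: finite_set_countable; apply/finite_seqP; exists s.
  apply: sub_countable (card_image_le _ _) _; apply: sub_countable (card_image_le _ _) _.
  exact: countableP.
apply: subset_card_le => g Gg; have [h hs /PSL2ZP[A dA gA]] := sP g Gg.
by exists h => //; exists (real_mx R A); [exists A|rewrite -gA mulKVmx //; exact/Gu/sG].
Qed.

(** Take for [U] a ball to which only [1] and [-1] return points; both lie in [N]. *)
Lemma locally_colored_regular p : sphere2 p -> ~ P p -> locally_colored G N f p.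
Proof.
move=> Sp Pp; have [fX _ _ fo] := fq.
have [z0 y0 fz0] : (f @` @upper_half R) p by rewrite fX.
have [e e0 eP] := free_nbhd GG cG tfG y0.
have [V oV fV] := fo _ (@ball_open _ _ z0 e).
exists V; split => //.
  have : (f @` (@upper_half R `&` ball z0 e)) p.
    by exists z0 => //; split => //; exact: ballxx.
  by rewrite fV => -[].
exists (ball z0 e); split; first exact: ball_open.
  by move=> g z Gg _ b1 b2; have [_ [->|->]] := eP g z Gg b1 b2 => //; case: NG.
move=> z z1 Vz; have : (f @` (@upper_half R `&` ball z0 e)) (f z).
  rewrite fV; split => //; rewrite -fX; by exists z.
move=> [w [w0 bw] fw]; case: fq => _ /(_ z w z1 w0) [/(_ (esym fw)) [g Gg gz] _] _ _.
by exists g; rewrite // gz.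
Qed.

(** [U] consists of horoballs at one Farey vertex per cusp, for all cusps at once, so it is never
    decided which cusp belongs to [p]. They are so small that an element bringing a point back to
    [U] must fix the vertex, hence is parabolic or a sign. The neighbourhood of [p] is the
    complement of [C], a finite union of images of a truncated fundamental domain: [C] is compact
    and misses [p], and every point over the complement can be moved into [U]. *)
Lemma locally_colored_cusp p : P p -> locally_colored G N f p.
Proof.
move=> Pp; have [s [sZ sP]] := repsZ GG cG.
pose r h := invmx h *m e1 R.
have rfar h : h \in s -> farey_vertex (r h).
  move=> hs; apply: PSL2Z_farey (farey_e1 R); have [_ _ _ ZV] := PSL2Z_group R; exact/ZV/sZ.
(* The first listed representative equivalent to [h]; choosing by position makes equivalent vertices
   share literally the same one. *)
pose rho h := nth 1%:M s (find (fun h' => `[< boundary_orbit G (r h) (r h') >]) s).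
have rhoP h : h \in s -> rho h \in s /\ boundary_orbit G (r h) (r (rho h)).
  move=> hs; have hh : has (fun h' => `[< boundary_orbit G (r h) (r h') >]) s.
    by apply/hasP; exists h => //; apply/asboolP; exact: boundary_orbit_refl.
  split; first by rewrite mem_nth // -has_find.
  by apply/asboolP; exact: (nth_find 1%:M hh).
have rho_eq h h' : boundary_orbit G (r h) (r h') -> rho h = rho h'.
  move=> hh'; congr (nth _ _ _); apply: eq_find => k; apply/asbool_equiv_eq; split => ?.
    by apply: boundary_orbit_trans (boundary_orbit_sym _ hh') _.
  exact: boundary_orbit_trans hh' _.
have [e e0 gap] := det2_gap GG cG.
pose U : set (R * R) := [set z | 0 < z.2 /\ exists2 h, h \in s & nht z (r (rho h)) < e].
have oU : open U.
  rewrite openE => z [z0 [h hs hz]]; rewrite /interior.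
  have h1 : \forall w \near z, 0 < w.2.
    have c2 : {for z, continuous (fun w : R * R => w.2)} by exact: cvg_snd.
    exact: (cvgr_gt _ c2).
  have h2 : \forall w \near z, nht w (r (rho h)) < e.
    exact: (cvgr_lt _ (nht_cont (v := r (rho h)) z0)).
  near=> w; split; first by near: w.
  by exists h => //; near: w.
have nhtG g z v : G g -> 0 < z.2 -> nht z (invmx g *m v) = nht (mobius g z) v.
  by move=> Gg z0; rewrite -(nht_mobius _ z0 (Gd Gg)) mulKVmx ?Gu.
have UN g z : G g -> 0 < z.2 -> U z -> U (mobius g z) -> N g.
  move=> Gg z0 [_ [h1 h1s hz1]] [_ [h2 h2s]]; rewrite -nhtG // => hz2.
  have [r1 b1] := rhoP _ h1s; have [r2 b2] := rhoP _ h2s.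
  (* By [nht_det] the square of the determinant is below the product of two values less than [e], so
     [gap] forces it to vanish. *)
  have d0 : det2 (r (rho h1)) (invmx g *m r (rho h2)) = 0.
    apply/eqP; apply: contraT => dn.
    have := gap _ _ _ (GV Gg) (farey_int (rfar _ r1)) (farey_int (rfar _ r2)) dn.
    rewrite leNgt -(ltr_pXn2r (_ : 0 < 2)%N) // ?nnegrE ?ltW // real_normK ?num_real // => /negP[].
    apply: (le_lt_trans (nht_det _ _ z0)); rewrite expr2.
    by apply: ltr_pM => //; exact: nht_ge0.
  have n1 := farey_neq0 (rfar _ r1).
  have n2 : invmx g *m r (rho h2) != 0.
    apply: contra (farey_neq0 (rfar _ r2)) => /eqP /(congr1 (mulmx g)).
    by rewrite mulKVmx ?Gu // mulmx0 => ->.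
  have [c c0 cE] := det2_parallel n1 n2 d0.
  have gE : g *m r (rho h1) = c^-1 *: r (rho h2).
    apply: (scalerI c0); rewrite scalemxAr -cE mulKVmx ?Gu // scalerA mulfV // scale1r //.
  have e12 : rho h1 = rho h2.
    apply: rho_eq; apply: boundary_orbit_trans b1 _ => //.
    apply: boundary_orbit_trans (boundary_orbit_sym _ b2) => //.
    by exists g => //; exists c^-1; rewrite ?invr_eq0.
  rewrite -e12 in gE; case: (farey_stab GG cG Gg (rfar _ r1) gE) => [->|->|pg] //.
    by case: NG.
  exact: Npar.
have [k k0 kP] : exists2 k : R, 0 < k & forall h, h \in s -> forall z, 0 < z.2 ->
    nht z (r h) < k -> exists2 g, G g & U (mobius g z).
  apply: (@seq_pos R _ s (fun h k => forall z, 0 < z.2 ->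
    nht z (r h) < k -> exists2 g, G g & U (mobius g z))).
    by move=> h k k' hk /andP[_ k'k] z z0 hz; apply: hk => //; exact: lt_le_trans k'k.
  move=> h hs; have [_ [g Gg [c c0 gE]]] := rhoP _ hs.
  have c20 : 0 < c ^+ 2 by rewrite exprn_even_gt0.
  (* The orbit relation gives the representative only up to the scalar [c], which multiplies [nht]
     by its square. *)
  exists (e * c ^+ 2); first by rewrite mulr_gt0.
  move=> z z0 hz; exists g => //; split; first by rewrite mobius_gt0 ?Gd.
  exists h => //; rewrite -(ltr_pM2r c20); apply: le_lt_trans hz.
  by rewrite mulrC -nhtZ -gE nht_mobius ?Gd.
(* At heights above [Y] the value of [nht] at infinity is below [k]. *)
pose Y := Num.max 1 k^-1.
have Y1 : 1 <= Y by rewrite le_max lexx.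
pose K : set (R * R) := `[- (1 / 2), 1 / 2]%classic `*` `[1 / 2, Y]%classic.
have cK : compact K by apply: compact_setX; exact: segment_compact.
have dh h : h \in s -> \det (invmx h) = 1 by move=> /sZ [dh _]; rewrite det_inv1.
have K0 z : K z -> 0 < z.2.
  by move=> [_] /=; rewrite in_itv /= => /andP[h _]; apply: lt_le_trans h; lra.
pose C := \bigcup_(h in [set` s]) ((f \o mobius (invmx h)) @` K).
have clC : closed C.
  apply: closed_bigcup => [|h hs]; first by apply/finite_seqP; exists s.
  apply: compact_closed; first exact: norm_hausdorff.
  apply: continuous_compact => //; apply: continuous_in_subspaceT => z; rewrite inE => Kz.
  apply: (@continuous_comp _ _ _ (mobius (invmx h)) f).
    by apply: mobius_cont; [exact: K0|exact: dh].
  by apply: (f_cont fq); rewrite mobius_gt0 ?dh ?K0.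
exists (~` C); split; first exact: closed_openC.
  move=> [h hs [z Kz fz]].
  have [_] := f_sphere fq (mobius_gt0 (K0 z Kz) (dh _ hs)).
  by apply; rewrite -[f _]/((f \o mobius (invmx h)) z) fz.
exists U; split => // z z0 nC.
have [B ZB [Bx B1]] := PSL2Z_reduce z0.
have [h hs [Gd0 Zd0]] := sP B ZB; set d := invmx h *m B in Gd0 Zd0.
have uh : h \in unitmx by have [/det1_unit] := sZ _ hs.
have BE : B = h *m d by rewrite mulKVmx.
have Bz : mobius B z = mobius h (mobius d z) by rewrite BE; apply: mobiusM => //; [case: (sZ _ hs)|exact: Gd].
set z' := mobius B z in Bx B1 Bz.
have z'0 : 0 < z'.2 by rewrite mobius_gt0 //; case: ZB.
have y12 : 1 / 2 <= z'.2.
  rewrite leNgt; apply/negP => y12; move: Bx; rewrite ler_norml => /andP[h1 h2]; nra.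
have dz0 : 0 < (mobius d z).2 by rewrite mobius_gt0 ?Gd.
have [yY|Yy] := leP z'.2 Y.
  case: nC; exists h => //; exists z'.
    by split => /=; rewrite in_itv /= ?y12 // -ler_norml.
  rewrite /= Bz mobiusK //; first exact: (orbit_fE GG fq).
  by case: (sZ _ hs).
have [g Gg Ug] : exists2 g, G g & U (mobius g (mobius d z)).
  apply: (kP h hs) => //; rewrite -(nht_mobius _ dz0 (sZ _ hs).1) mulKVmx // -Bz.
  rewrite /nht !cvE mul0r subr0 mul0r expr0n expr1n addr0 div1r.
  rewrite -[k]invrK ltf_pV2 ?posrE ?invr_gt0 //; apply: le_lt_trans Yy.
  by rewrite le_max lexx orbT.
by exists (g *m d); [exact: GM|rewrite mobiusM ?Gd].
Unshelve. all: by end_near.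
Qed.

Lemma arith_monodromy : G `<=` N.
Proof.
apply: (monodromy_trivial GG NG finP countable_commensurable fq) => p Sp.
by have [Pp|Pp] := pselect (P p); [exact: locally_colored_cusp|exact: locally_colored_regular].
Qed.

End ArithmeticMonodromy.

(** * Conjugation into the modular group *)

Section Conjugation.
Variable R : realType.
Implicit Types (g h : 'M[R]_2) (u v w : 'cV[R]_2) (z : R * R) (G : set 'M[R]_2).

Definition cj h G : set 'M[R]_2 := [set h *m g *m invmx h | g in G].

Section Conj.
Variables (h : 'M[R]_2) (G : set 'M[R]_2).
Hypotheses (dh : \det h = 1) (GG : PSL2_subgroup G).
Let uh : h \in unitmx. Proof. exact: det1_unit. Qed.
Let Gd g : G g -> \det g = 1. Proof. by case: GG => + _ _ _; apply. Qed.
Lemma cjP g : cj h G g <-> G (invmx h *m g *m h).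
Proof.
split=> [[k Gk <-]|Gk]; first by rewrite !mulmxA mulVmx // mul1mx -mulmxA mulVmx // mulmx1.
by exists (invmx h *m g *m h); rewrite // !mulmxA mulmxV // mul1mx -mulmxA mulmxV // mulmx1.
Qed.

Lemma cj_group : PSL2_subgroup (cj h G).
Proof.
case: GG => _ [G1 GN] GM GV; split.
- by move=> _ [g Gg <-]; rewrite !det_mul1 ?det_inv1 // Gd.
- by split; apply/cjP; rewrite ?mulmx1 ?mulmxN ?mulNmx ?mulmx1 mulVmx.
- move=> a b /cjP Ga /cjP Gb; apply/cjP; have := GM _ _ Ga Gb.
  by rewrite !mulmxA mulmxK.
- move=> _ [g Gg <-]; exists (invmx g); first exact: GV.
  have dg := Gd Gg; by rewrite invmx_mul ?det_mul1 ?det_inv1 // invmxK invmx_mul // mulmxA.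
Qed.

Lemma cj_exp g k : (h *m g *m invmx h) ^+ k = h *m g ^+ k *m invmx h.
Proof.
elim: k => [|k IH]; first by rewrite !expr0 mulmx1 mulmxV.
by rewrite !exprS IH -[LHS]/(_ *m _) !mulmxA mulmxKV.
Qed.

Lemma cj_torsion_free : torsion_free G -> torsion_free (cj h G).
Proof.
have cj1 g : h *m g *m invmx h = 1%:M \/ h *m g *m invmx h = - 1%:M <-> g = 1%:M \/ g = - 1%:M.
  split=> -[e|e].
  - left; apply: (can_inj (mulKmx uh)); apply: (can_inj (mulmxK (_ : invmx h \in unitmx))).
      by rewrite unitmx_inv.
    by rewrite e mulmx1 mulmxV.
  - right; apply: (can_inj (mulKmx uh)); apply: (can_inj (mulmxK (_ : invmx h \in unitmx))).
      by rewrite unitmx_inv.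
    by rewrite e mulmxN mulNmx mulmx1 mulmxV.
  - by left; rewrite e mulmx1 mulmxV.
  - by right; rewrite e mulmxN mulmx1 mulNmx mulmxV.
move=> tf _ k [g Gg <-] k0; rewrite cj_exp => /cj1 /(tf g k Gg k0) ?; exact/cj1.
Qed.

Lemma cj_genus_zero : genus_zero G -> genus_zero (cj h G).
Proof.
move=> [P [fP PS [f [fX ff fc fo]]]]; exists P; split => //.
have di : \det (invmx h) = 1 by rewrite det_inv1.
have E k z : G k -> 0 < z.2 -> mobius (h *m k *m invmx h) z = mobius h (mobius k (mobius (invmx h) z)).
  by move=> /Gd dk z0; rewrite mobiusM ?det_mul1 // mobiusM ?mobius_gt0.
exists (f \o mobius (invmx h)); split.
- rewrite -fX eqEsubset; split => [_ [z z0 <-]|_ [z z0 <-]].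
    by exists (mobius (invmx h) z); rewrite // /upper_half /= mobius_gt0.
  by exists (mobius h z) => /=; rewrite ?mobiusK // /upper_half /= mobius_gt0.
- move=> z w z0 w0 /=; have z1 := mobius_gt0 z0 di; have w1 := mobius_gt0 w0 di.
  split=> [/(ff _ _ z1 w1)[g Gg gz]|[k [g Gg <-]] kz].
    exists (h *m g *m invmx h); first by exists g.
    by rewrite E // gz mobiusKV.
  apply/(ff _ _ z1 w1); exists g => //.
  by rewrite -kz E // mobiusK //; apply: mobius_gt0 => //; exact: Gd.
- apply: continuous_in_subspaceT => z; rewrite inE => z0.
  apply: (@continuous_comp _ _ _ (mobius (invmx h)) f); first exact: mobius_cont.
  by apply: (f_cont (And4 fX ff fc fo)); rewrite mobius_gt0.
- move=> U oU; have oU' : open [set z | 0 < z.2 /\ U (mobius h z)].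
    rewrite openE => z [z0 Uz]; rewrite /interior.
    have h1 : \forall w \near z, 0 < w.2.
      have c2 : {for z, continuous (fun w : R * R => w.2)} by exact: cvg_snd.
      exact: (cvgr_gt _ c2).
    have h2 : \forall w \near z, U (mobius h w) by apply: mobius_cont => //; exact: open_nbhs_nbhs.
    by near=> w; split; near: w.
  have [V oV fV] := fo _ oU'.
  exists V => //; rewrite -fV eqEsubset; split => [_ [z [z0 Uz] <-]|_ [z [z0 [_ Uz]] <-]].
    exists (mobius (invmx h) z) => //; split; rewrite /upper_half /= ?mobius_gt0 // mobiusKV //.
  by exists (mobius h z); [split; rewrite // /upper_half /= mobius_gt0|rewrite /= mobiusK].
Unshelve. all: by end_near.
Qed.

Lemma cj_parabolic g : parabolic g -> parabolic (h *m g *m invmx h).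
Proof.
move=> [tg g1 g2]; split; first by rewrite tr_conj2.
  move=> e; apply: g1; apply: (can_inj (mulKmx uh)); apply: (can_inj (mulmxK (_ : invmx h \in unitmx))).
    by rewrite unitmx_inv.
  by rewrite e mulmx1 mulmxV.
move=> e; apply: g2; apply: (can_inj (mulKmx uh)); apply: (can_inj (mulmxK (_ : invmx h \in unitmx))).
  by rewrite unitmx_inv.
by rewrite e mulmxN mulNmx mulmx1 mulmxV.
Qed.

Lemma cj_boundary_orbit v w : boundary_orbit (cj h G) (h *m v) (h *m w) <-> boundary_orbit G v w.
Proof.
split=> [[_ [g Gg <-]] [c c0 e]|[g Gg [c c0 e]]].
  exists g => //; exists c => //; apply: (can_inj (mulKmx uh)).
  by rewrite -scalemxAr -e -!mulmxA mulKmx.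
exists (h *m g *m invmx h); first by exists g.
by exists c => //; rewrite -!mulmxA mulKmx // e scalemxAr.
Qed.

End Conj.

Lemma cj_parabolic_fixed h G v : \det h = 1 -> PSL2_subgroup G ->
  parabolic_fixed_point G v -> parabolic_fixed_point (cj h G) (h *m v).
Proof.
move=> dh GG [v0 [g [Gg pg [c c0 gv]]]]; have uh := det1_unit dh; split.
  by apply: contra v0 => /eqP /(congr1 (mulmx (invmx h))); rewrite mulKmx // mulmx0 => ->.
exists (h *m g *m invmx h); split; [by exists g|exact: cj_parabolic|].
by exists c => //; rewrite -!mulmxA mulKmx // gv scalemxAr.
Qed.

Lemma cjK h G : \det h = 1 -> PSL2_subgroup G -> cj (invmx h) (cj h G) = G.
Proof.
move=> dh GG; have uh := det1_unit dh; apply/seteqP; split => g.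
  move=> /(cjP _ (det_inv1 dh)); rewrite invmxK => /(cjP _ dh).
  by rewrite !mulmxA mulVmx // mul1mx -mulmxA mulVmx // mulmx1.
move=> Gg; apply/(cjP _ (det_inv1 dh)); rewrite invmxK; by exists g.
Qed.

Lemma cj_cusps h G n : \det h = 1 -> PSL2_subgroup G -> has_cusps G n -> has_cusps (cj h G) n.
Proof.
move=> dh GG [s [s1 s2 s3]]; have uh := det1_unit dh; exists (fun i => h *m s i); split.
- by move=> i; apply: cj_parabolic_fixed.
- by move=> i j /(cj_boundary_orbit _ dh); exact: s2.
move=> v pv; have pv' : parabolic_fixed_point G (invmx h *m v).
  by rewrite -(cjK dh GG); apply: cj_parabolic_fixed; rewrite ?det_inv1 //; exact: cj_group.
have [i hi] := s3 _ pv'; exists i.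
by rewrite -(mulKVmx uh v); apply/(cj_boundary_orbit _ dh).
Qed.

End Conjugation.

(** * Rationality and the invariant lattice *)

Section Rational.
Variable R : realType.
Implicit Types (g h : 'M[R]_2) (u v w : 'cV[R]_2) (z : R * R).
Variable G : set 'M[R]_2.
Hypotheses (GG : PSL2_subgroup G) (cG : commensurable G (@PSL2Z R)).
Let Gd g : G g -> \det g = 1. Proof. by case: GG => + _ _ _; apply. Qed.
Let Gu a : G a -> a \in unitmx. Proof. by move=> /Gd /det1_unit. Qed.

(* The rational elements form a normal subgroup, since products of pairs of
   entries of an element of G are rational; it contains the parabolic elements
   because their trace is rational and nonzero. *)
Lemma genus_zero_rational : torsion_free G -> genus_zero G ->
  forall g i j, G g -> isQ (g i j).
Proof.
move=> tf [P [fP PS [f fq]]]; case: (GG) => _ [G1 GN] GM GV.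
have Q1 : isQ (1 : R) by apply: isQ_int; rewrite rpred1.
have Q0 : isQ (0 : R) by apply: isQ_int; rewrite rpred0.
have Qinv g : G g -> (forall i j, isQ (g i j)) -> forall i j, isQ (invmx g i j).
  move=> /Gd dg Qg i j; rewrite invmx2 //.
  by case: (ord2P i) => ->; case: (ord2P j) => ->; rewrite mx2E //; exact: isQN.
pose N : set 'M[R]_2 := [set g | G g /\ forall i j, isQ (g i j)].
have NN : normal_in N G.
  split=> [g []//||a b [Ga Qa] [Gb Qb]|a [Ga Qa]|g a Gg [Ga Qa]].
  - by split => // i j; rewrite mxE; case: (i == j).
  - by split; [exact: GM|move=> i j; rewrite mulmx2E; apply: isQD; exact: isQM].
  - by split; [exact: GV|exact: Qinv].
  split; first by apply: (GM) => //; apply: (GM) => //; exact: GV.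
  have Qg i j k l : isQ (g i j * g k l) by exact: (rational_products GG cG).
  have key i j k l m n : isQ (invmx g i j * a k l * g m n).
    rewrite mulrAC; apply: isQM => //; rewrite invmx2 ?Gd //.
    by case: (ord2P i) => ->; case: (ord2P j) => ->; rewrite mx2E // mulNr; exact: isQN.
  move=> i j; rewrite !mulmx2E !mulrDl.
  by apply: isQD; apply: isQD.
suff GN' : G `<=` N by move=> g i j /GN' [_].
apply: (@arith_monodromy R G N f P) => //.
  by split => // i j; rewrite !mxE; apply: isQN; case: (i == j).
move=> g Gg [tg _ _]; split => // i j.
have t2 : isQ (\tr g) /\ \tr g != 0.
  move: tg; case: (ger0P (\tr g)) => _ => [->|/(canRL (@opprK _)) ->].
    by split; [apply: isQ_int; rewrite natr_int|rewrite pnatr_eq0].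
  by split; [apply/isQN/isQ_int; rewrite natr_int|rewrite oppr_eq0 pnatr_eq0].
rewrite -(mulfK t2.2 (g i j)); apply: isQM; last exact: isQV t2.1.
by rewrite tr_mx2E mulrDr; apply: isQD; exact: (rational_products GG cG).
Qed.

(** [S] is a nonzero subgroup of the multiples of [1 / d], so it has a least positive element, and
    division with remainder shows that it generates. *)
Lemma additive_generator (S : R -> Prop) (d : nat) : S 0 ->
  (forall x y, S x -> S y -> S (x - y)) -> (0 < d)%N ->
  (forall x, S x -> x * d%:R \is a Num.int) -> (exists2 x, S x & 0 < x) ->
  exists2 a, S a /\ 0 < a & forall x, S x -> exists m : int, x = m%:~R * a.
Proof.
move=> S0 SB d0 Sd [x0 Sx0 x00].
have d0' : 0 < d%:R :> R by rewrite ltr0n.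
have dn := lt0r_neq0 d0'.
pose p (n : nat) := `[< (0 < n)%N /\ S (n%:R / d%:R) >].
have ex : exists n, p n.
  have /intrP[m mE] := Sd _ Sx0.
  have m0 : 0 < m by rewrite -(ltr_int R) -mE mulr_gt0.
  exists `|m|%N; apply/asboolP; split; first by rewrite absz_gt0 gt_eqF.
  by rewrite (pmulrn 1) gtz0_abs // -mE mulfK.
have := ex_minnP ex; case=> n /asboolP[n0 Sn] nmin.
have a0 : 0 < n%:R / d%:R :> R by rewrite divr_gt0 // ltr0n.
exists (n%:R / d%:R) => // x Sx.
have SN y : S y -> S (- y) by move=> Sy; rewrite -sub0r; exact: SB.
have SD (y y' : R) : S y -> S y' -> S (y + y') by move=> Sy Sz; rewrite -(opprK y'); apply: (SB) => //; exact: SN.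
have Smn (k : nat) : S (k%:R * (n%:R / d%:R)).
  elim: k => [|k IH]; first by rewrite mul0r.
  by rewrite -natr1 mulrDl mul1r; exact: SD.
have Sm (m : int) : S (m%:~R * (n%:R / d%:R)).
  case: (intP m) => [|k|k]; first by rewrite mul0r.
    by rewrite -pmulrn; exact: Smn.
  by rewrite mulrNz mulNr -pmulrn; apply: (SN); exact: Smn.
exists (Num.floor (x / (n%:R / d%:R))); set m := Num.floor _.
have /andP[m1 m2] : (m%:~R : R) <= x / (n%:R / d%:R) < m%:~R + 1.
  by rewrite -[in X in _ && X](intrD _ m 1) floor_itv ?num_real.
set y := x - m%:~R * (n%:R / d%:R).
have Sy : S y by apply: (SB).
have y1 : 0 <= y by rewrite subr_ge0 -ler_pdivlMr.
have y2 : y < n%:R / d%:R by rewrite ltrBlDl -{2}(mul1r (n%:R / d%:R)) -mulrDl -ltr_pdivrMr.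
apply/eqP; rewrite -subr_eq0 -/y eq_le y1 andbT leNgt; apply/negP => y0.
have /intrP[k kE] := Sd _ Sy.
have k0 : 0 < k by rewrite -(ltr_int R) -kE mulr_gt0.
have pk : p `|k|%N.
  apply/asboolP; split; first by rewrite absz_gt0 gt_eqF.
  by rewrite (pmulrn 1) gtz0_abs // -kE mulfK.
have := nmin _ pk; rewrite -(ler_nat R) (pmulrn 1 `|k|%N) gtz0_abs // -kE.
by rewrite -ler_pdivrMr // leNgt y2.
Qed.

Lemma finite_den (s : seq 'M[R]_2) : (forall g, g \in s -> forall i j, isQ (g i j)) ->
  exists2 d : nat, (0 < d)%N & forall g, g \in s -> forall i j, g i j * d%:R \is a Num.int.
Proof.
elim: s => [|g s IH] sQ; first by exists 1%N.
have [d d0 dP] := IH (fun h hs => sQ h (@mem_behead _ (g :: s) h hs)).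
have /choice[e eP] : forall kl : 'I_2 * 'I_2, exists e : nat, (0 < e)%N /\ g kl.1 kl.2 * e%:R \is a Num.int.
  by move=> kl; have [e e0 eP] := isQ_den (sQ g (mem_head _ _) kl.1 kl.2); exists e.
pose E := (\prod_kl e kl)%N.
exists (d * E)%N; first by rewrite muln_gt0 d0 prodn_gt0 // => kl; case: (eP kl).
move=> h; rewrite inE => /predU1P[->|hs] i j; rewrite natrM.
  rewrite /E (bigD1 (i, j)) //= natrM; have [_ /= he] := eP (i, j).
  have -> : forall N : nat, g i j * (d%:R * ((e (i, j))%:R * N%:R)) = g i j * (e (i, j))%:R * (d%:R * N%:R).
    by move=> N; ring.
  by apply: rpredM => //; apply: rpredM; exact: natr_int.
by rewrite mulrA rpredM ?dP ?natr_int.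
Qed.

(* The lattice spanned by the translates of Z^2 is invariant; a triangular
   basis of it conjugates G into integral matrices. *)
Lemma invariant_lattice : (forall g i j, G g -> isQ (g i j)) ->
  exists a b c : R, [/\ 0 < a, 0 < c, isQ a, isQ b & isQ c /\
    forall g, G g -> exists A : 'M[int]_2, g *m mx2 a b 0 c = mx2 a b 0 c *m real_mx R A].
Proof.
move=> GQ; case: (GG) => _ [G1 GN] GM GV.
(* The lattice is obtained as the intersection of all subgroups that contain the translates; its
   invariance and its bounded denominators follow by choosing suitable [S]. *)
pose gen (S : 'cV[R]_2 -> Prop) := [/\ S 0, forall u v, S u -> S v -> S (u - v) &
  forall g w, G g -> int_cv w -> S (g *m w)].
pose L v := forall S, gen S -> S v.
have L0 : L 0 by move=> S [].
have LB u v : L u -> L v -> L (u - v).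
  by move=> Lu Lv S gS; case: (gS) => _ SB _; apply: SB; [exact: Lu|exact: Lv].
have LN v : L v -> L (- v) by move=> Lv; rewrite -sub0r; exact: LB.
have LD u v : L u -> L v -> L (u + v).
  by move=> Lu Lv; rewrite -(opprK v); apply: (LB) => //; exact: LN.
have Lint w : int_cv w -> L w by move=> iw S [_ _ /(_ _ _ G1 iw)]; rewrite mul1mx.
have LG g v : G g -> L v -> L (g *m v).
  move=> Gg Lv S [S0 SB SG]; apply: (Lv (fun v => S (g *m v))); split.
  - by rewrite mulmx0.
  - by move=> x y; rewrite mulmxBr; exact: SB.
  by move=> h w Gh iw; rewrite mulmxA; apply: SG => //; exact: (GM).
have LZ (m : int) v : L v -> L (m%:~R *: v).
  move=> Lv; have Ln (k : nat) : L (k%:R *: v).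
    elim: k => [|k IH]; first by rewrite scale0r.
    by rewrite -natr1 scalerDl scale1r; exact: (LD).
  case: (intP m) => [|k|k]; first by rewrite scale0r.
    by rewrite -pmulrn; exact: Ln.
  by rewrite mulrNz scaleNr -pmulrn; apply: (LN); exact: Ln.
have [s [sG sP]] := repsG GG cG.
have [d d0 dP] := finite_den (fun g gs i j => GQ g i j (sG g gs)).
have dn : d%:R != 0 :> R by rewrite pnatr_eq0 -lt0n.
have Ld v : L v -> forall i, v i 0 * d%:R \is a Num.int.
  move=> /(_ (fun v => forall i, v i 0 * d%:R \is a Num.int)); apply; split.
  - by move=> i; rewrite mxE mul0r rpred0.
  - by move=> u w hu hw i; rewrite !mxE mulrBl rpredB.
  move=> g w Gg iw i; have [h hs /PSL2ZP[A dA gA]] := sP g Gg.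
  have -> : g = h *m real_mx R A by rewrite -gA mulKVmx //; exact/Gu/sG.
  rewrite -mulmxA mulmx2E mulrDl !(mulrAC _ _ d%:R).
  have iA k : (real_mx R A *m w) k 0 \is a Num.int.
    by rewrite mulmx2E !real_mxE rpredD // rpredM // intr_int.
  by rewrite rpredD // rpredM // dP.
(* [a] generates the part of the lattice on the horizontal axis and [c], below, the projection to
   the second coordinate; with a lift [cv b c] this is a Hermite basis. *)
have [a [La a0] aP] : exists2 a, L (cv a 0) /\ 0 < a & forall x, L (cv x 0) -> exists m : int, x = m%:~R * a.
  apply: (@additive_generator (fun x => L (cv x 0)) d) => //.
  - by have -> : cv 0 0 = 0 :> 'cV[R]_2 by apply: cvP; rewrite !mxE.
  - move=> x y Lx Ly; have -> : cv (x - y) 0 = cv x 0 - cv y 0 :> 'cV[R]_2; last exact: LB.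
    by apply: cvP; rewrite !mxE //= subr0.
  - by move=> x /Ld /(_ 0); rewrite cvE.
  by exists 1; [exact: Lint (farey_int (farey_e1 R))|exact: ltr01].
have [c [[b Lbc] c0] cP] : exists2 c, (exists b, L (cv b c)) /\ 0 < c &
    forall y, (exists x, L (cv x y)) -> exists m : int, y = m%:~R * c.
  apply: (@additive_generator (fun y => exists x, L (cv x y)) d) => //.
  - by exists 0; have -> : cv 0 0 = 0 :> 'cV[R]_2 by apply: cvP; rewrite !mxE.
  - move=> x y [x' Lx] [y' Ly]; exists (x' - y').
    have -> : cv (x' - y') (x - y) = cv x' x - cv y' y :> 'cV[R]_2; last exact: LB.
    by apply: cvP; rewrite !mxE.
  - by move=> x [x' /Ld /(_ 1)]; rewrite cvE.
  by exists 1; [exists 0; exact: Lint (farey_int (farey_e2 R))|exact: ltr01].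
have Qd (x : R) : x * d%:R \is a Num.int -> isQ x.
  by move=> ix; rewrite -(mulfK dn x); apply: isQM; [exact: isQ_int|apply/isQV/isQ_int; rewrite natr_int].
have basis v : L v -> exists m n : int, v = cv (m%:~R * a + n%:~R * b) (n%:~R * c).
  move=> Lv; have [|n nE] := cP (v 1 0); first by exists (v 0 0); rewrite -cv_eta.
  have [|m mE] := aP (v 0 0 - n%:~R * b).
    have -> : cv (v 0 0 - n%:~R * b) 0 = v - n%:~R *: cv b c.
      by apply: cvP; rewrite !mxE //= nE subrr.
    by apply: (LB) => //; exact: LZ.
  by exists m, n; rewrite [LHS]cv_eta nE -mE subrK.
exists a, b, c; split => //.
- by apply: Qd; have := Ld _ La 0; rewrite cvE.
- by apply: Qd; have := Ld _ Lbc 0; rewrite cvE.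
split; first by apply: Qd; have := Ld _ Lbc 1; rewrite cvE.
move=> g Gg; have [m1 [n1 E1]] := basis _ (LG _ _ Gg La).
have [m2 [n2 E2]] := basis _ (LG _ _ Gg Lbc).
exists (mx2 m1 m2 n1 n2).
have e1 := congr1 (fun w : 'cV[R]_2 => w 0 0) E1; have e2 := congr1 (fun w : 'cV[R]_2 => w 1 0) E1.
have e3 := congr1 (fun w : 'cV[R]_2 => w 0 0) E2; have e4 := congr1 (fun w : 'cV[R]_2 => w 1 0) E2.
rewrite /= !mulmx2E !cvE in e1 e2 e3 e4.
apply: mx2P; rewrite !mulmx2E !real_mxE !mx2E ?e1 ?e2 ?e3 ?e4; ring.
Qed.

End Rational.

(** * Finite index under conjugation *)

Section FiniteIndex.
Variable R : realType.
Implicit Types (g h : 'M[R]_2) (A B C G : set 'M[R]_2).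

(** Finite index expressed by a map to a finite type that separates cosets; in this form it passes
    easily to conjugates and towers. *)
Definition fin_ind A B := exists (K : finType) (k : 'M[R]_2 -> K),
  forall g h, B g -> B h -> k g = k h -> A (invmx g *m h).

Lemma fin_ind_finite_index A B : PSL2_subgroup A -> PSL2_subgroup B -> A `<=` B ->
  fin_ind A B -> finite_index A B.
Proof.
move=> [dA _ AM AV] [dB _ _ _] AB [K [k kP]]; split => //.
pose F x := [set mulmx (xget 1%:M [set h | B h /\ k h = x]) a | a in A].
apply: (@sub_finite_set _ _ (F @` setT)); last exact/finite_image/finite_finset.
move=> _ [g Bg <-]; exists (k g) => //; rewrite /F; case: xgetP => [h _ [Bh hg]|/(_ g)]; last by case.
have uh := det1_unit (dB _ Bh); have ug := det1_unit (dB _ Bg).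
apply/seteqP; split => _ [a Aa <-].
  exists (invmx g *m h *m a); last by rewrite -mulmxA mulKVmx.
  by apply: AM => //; exact: kP.
exists (invmx h *m g *m a); last by rewrite -mulmxA mulKVmx.
by apply: AM => //; exact: kP.
Qed.

Lemma finite_index_fin_ind A B : PSL2_subgroup A -> PSL2_subgroup B ->
  finite_index A B -> fin_ind A B.
Proof.
move=> gA gB /(finite_index_reps gA gB) [s [sB sP]].
have [dA _ AM AV] := gA; have [dB _ _ _] := gB.
pose p g h := `[< A (invmx h *m g) >].
exists 'I_(size s).+1, (fun g => inord (find (p g) s)) => g h Bg Bh /(congr1 val).
have has_p x : B x -> has (p x) s.
  by move=> /sP [y ys Ay]; apply/hasP; exists y => //; apply/asboolP.
rewrite /= !inordK ?ltnS ?find_size // => e.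
have /asboolP hg := nth_find 1%:M (has_p _ Bg); have /asboolP hh := nth_find 1%:M (has_p _ Bh).
rewrite -e in hh; set y := nth _ _ _ in hg hh.
have By : B y by apply: sB; rewrite mem_nth // -has_find has_p.
have := AM _ _ (AV _ hg) hh.
have dy := dB _ By; rewrite invmx_mul ?det_inv1 ?(dB _ Bg) // invmxK -mulmxA mulKVmx //.
exact: det1_unit.
Qed.

Lemma fin_ind_trans A B C : PSL2_subgroup B -> PSL2_subgroup C -> B `<=` C ->
  fin_ind A B -> fin_ind B C -> fin_ind A C.
Proof.
move=> [dB _ BM BV] [dC _ CM CV] BC [K [k kP]] [L [l lP]].
pose r x := xget 1%:M [set h | C h /\ l h = x].
have rP g : C g -> C (r (l g)) /\ l (r (l g)) = l g.
  by move=> Cg; rewrite /r; case: xgetP => [h _ //|/(_ g)]; case.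
exists (K * L)%type, (fun g => (k (invmx (r (l g)) *m g), l g)) => g h Cg Ch [e1 e2].
rewrite -e2 in e1; have [Cr lr] := rP g Cg.
have := kP _ _ (lP _ _ Cr Cg lr) (lP _ _ Cr Ch (etrans lr e2)) e1.
have dr := dC _ Cr; rewrite invmx_mul ?det_inv1 ?(dC _ Cg) // invmxK -mulmxA mulKVmx //.
exact: det1_unit.
Qed.

(* Conjugation by W maps a principal congruence subgroup into PSL2Z. *)
Lemma fin_ind_conj (W : 'M[R]_2) : \det W = 1 ->
  (forall i j k l, isQ (W i j * invmx W k l)) ->
  fin_ind [set g | PSL2Z g /\ PSL2Z (W *m g *m invmx W)] (@PSL2Z R).
Proof.
move=> dW QW; have uW := det1_unit dW.
have /choice[d dP] : forall t : 'I_2 * 'I_2 * ('I_2 * 'I_2), exists d : nat, (0 < d)%N /\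
    W t.1.1 t.1.2 * invmx W t.2.1 t.2.2 * d%:R \is a Num.int.
  by move=> t; have [d d0 dP] := isQ_den (QW t.1.1 t.1.2 t.2.1 t.2.2); exists d.
pose M := (\prod_t d t)%N.
have M0 : (0 < M)%N by rewrite prodn_gt0 // => t; case: (dP t).
have MP i j k l : W i j * invmx W k l * M%:R \is a Num.int.
  rewrite /M (bigD1 ((i, j), (k, l))) //= natrM; have [_ /= h] := dP ((i, j), (k, l)).
  by rewrite mulrA; apply: rpredM => //; exact: natr_int.
(* Entries modulo [M]: if these agree, then [invmx g *m h] is [1] plus [M] times an integral matrix,
   and [M] clears the denominators of the conjugation by [W]. *)
pose res (x : R) : 'I_M.+1 := inord `|(Num.floor x %% M%:Z)%Z|%N.
exists 'M['I_M.+1]_2, (fun g => map_mx res g) => g h Zg Zh /matrixP e.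
have [Zd _ ZM ZV] := PSL2Z_group R.
have Zgh : PSL2Z (invmx g *m h) by apply: ZM => //; exact: ZV.
split => //; split; first by rewrite !det_mul1 ?det_inv1 // Zd.
have [/PSL2ZP[A dA gA] /PSL2ZP[B dB hB]] := (Zg, Zh).
have ME i j : exists m : int, h i j = g i j + m%:~R * M%:R.
  have := e i j; rewrite !mxE gA hB !real_mxE /res !intrKfloor => /(congr1 val).
  have M0' : 0 < M%:Z by rewrite ltz_nat.
  have lt x : (`|(x %% M%:Z)%Z| < M.+1)%N.
    by rewrite -ltz_nat gez0_abs ?modz_ge0 ?gt_eqF // (lt_trans (ltz_pmod x M0')) // ltz_nat.
  rewrite /= !inordK // => /(congr1 Posz); rewrite !gez0_abs ?modz_ge0 ?gt_eqF // => E.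
  exists ((B i j %/ M%:Z)%Z - (A i j %/ M%:Z)%Z).
  rewrite {1}(divz_eq (B i j) M%:Z) {1}(divz_eq (A i j) M%:Z) -E !rmorphD !rmorphM /= rmorphN /= -pmulrn; ring.
have /choice[m mE] : forall ij : 'I_2 * 'I_2, exists m : int, h ij.1 ij.2 = g ij.1 ij.2 + m%:~R * M%:R.
  by move=> ij; exact: ME.
pose E := \matrix_(i, j) m (i, j).
have hE : h = g + M%:R *: real_mx R E.
  by apply/matrixP => i j; rewrite !mxE (mE (i, j)) mulrC.
have -> : W *m (invmx g *m h) *m invmx W = 1%:M + M%:R *: (W *m (invmx g *m real_mx R E) *m invmx W).
  rewrite hE mulmxDr mulVmx ?(det1_unit (Zd _ Zg)) // mulmxDr mulmxDl mulmx1 mulmxV //.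
  by rewrite -!scalemxAr -scalemxAl.
have [F FE] : exists F : 'M[int]_2, invmx g *m real_mx R E = real_mx R F.
  by exists (invmx A *m E); rewrite gA inv_real_mx // real_mxM.
move=> i j; rewrite FE mxE rpredD //; first by rewrite mxE natr_int.
rewrite mxE !mulmx2E !real_mxE.
have key k l : M%:R * (W i k * (F k l)%:~R * invmx W l j) \is a Num.int.
  have -> : M%:R * (W i k * (F k l)%:~R * invmx W l j) = (F k l)%:~R * (W i k * invmx W l j * M%:R) by ring.
  by apply: rpredM => //; exact: intr_int.
by rewrite !mulrDl !mulrDr; apply: rpredD; apply: rpredD.
Qed.

Theorem integral_conjugate (n : nat) (Gamma : set 'M[R]_2) :
  punctured_sphere n Gamma -> arithmetic_group Gamma ->
  exists h k, [/\ \det h = 1, \det k = 1 & let G := cj k (cj h Gamma) in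
    [/\ PSL2_subgroup G, torsion_free G, genus_zero G & has_cusps G n] /\
    finite_index G (@PSL2Z R)].
Proof.
move=> [GG _ _ [tf gz hc]] [h dh cG]; rewrite -/(cj h Gamma) in cG.
set G := cj h Gamma in cG.
have gG : PSL2_subgroup G by exact: cj_group.
have tfG : torsion_free G by exact: cj_torsion_free.
have gzG : genus_zero G by exact: cj_genus_zero.
have hcG : has_cusps G n by exact: cj_cusps.
have [a [b [c [a0 c0 Qa Qb [Qc inv]]]]] := invariant_lattice gG cG (genus_zero_rational gG cG tfG gzG).
(* Scaling the lattice basis to determinant 1 may introduce a square root. Only [t * t] is known to
   be rational, which is why [fin_ind_conj] speaks of products of entries of [W] and of its
   inverse. *)
pose t := (Num.sqrt (a * c))^-1.
have ac0 : 0 < a * c by exact: mulr_gt0.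
have t2 : t * t * (a * c) = 1.
  by rewrite /t -expr2 exprVn sqr_sqrtr ?ltW // mulVf ?gt_eqF.
pose W := mx2 (t * a) (t * b) 0 (t * c).
have dW : \det W = 1 by rewrite det_mx2 -t2; ring.
have uW := det1_unit dW.
have Qt : isQ (t * t).
  have -> : t * t = (a * c)^-1 by apply: (mulIf (lt0r_neq0 ac0)); rewrite t2 mulVf ?gt_eqF.
  by apply: isQV; exact: isQM.
have Q0 : isQ (0 : R) by apply: isQ_int; rewrite rpred0.
have WQ i j : exists2 q, isQ q & W i j = t * q.
  case: (ord2P i) => ->; case: (ord2P j) => ->; rewrite mx2E; [by exists a|by exists b| |by exists c].
  by exists 0; rewrite // mulr0.
have VQ i j : exists2 q, isQ q & invmx W i j = t * q.
  rewrite invmx2 //; case: (ord2P i) => ->; case: (ord2P j) => ->; rewrite !mx2E; [by exists c| | |by exists a].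
    by exists (- b); [exact: isQN|rewrite mulrN].
  by exists 0; rewrite // mulr0 oppr0.
exists h, (invmx W); rewrite det_inv1 //; split => //=; rewrite -/G.
have dV := det_inv1 dW.
split; first by split; [exact: cj_group|exact: cj_torsion_free|exact: cj_genus_zero|exact: cj_cusps].
have sub : cj (invmx W) G `<=` @PSL2Z R.
  move=> _ [g Gg <-]; have [A gA] := inv g Gg; rewrite invmxK.
  have WE : W = t *: mx2 a b 0 c by apply: mx2P; rewrite [RHS]mxE !mx2E // mulr0.
  have -> : invmx W *m g *m W = real_mx R A.
    by rewrite -mulmxA {2}WE -scalemxAr gA scalemxAl -WE mulKmx.
  apply: PSL2Z_real; apply: (@intr_inj R); rewrite -det_real_mx.
  have := congr1 determinant gA; rewrite !det_mulmx (_ : \det g = 1) ?mul1r; last by case: gG => + _ _ _; apply.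
  rewrite -[X in X = _]mulr1 => /mulfI <- //; rewrite det_mx2 mulr0 subr0 gt_eqF //.
apply: fin_ind_finite_index (PSL2Z_group R) sub _; first exact: cj_group.
(* The part of the modular group that conjugation by [W] keeps integral; there the commensurability
   of [G] with the modular group can be used. *)
pose C := [set g | PSL2Z g /\ PSL2Z (W *m g *m invmx W)].
have gC : PSL2_subgroup C.
  have -> : C = @PSL2Z R `&` cj (invmx W) (@PSL2Z R).
    apply/seteqP; split => g [Zg h']; split => //; first by apply/(cjP _ dV); rewrite invmxK.
    by move: h' => /(cjP _ dV); rewrite invmxK.
  by apply: PSL2_subgroupI (PSL2Z_group R) _; apply: cj_group => //; exact: PSL2Z_group.
apply: (@fin_ind_trans _ C) => //; [exact: PSL2Z_group|by move=> g []| |]; last first.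
  apply: fin_ind_conj => // i j k l; have [q Qq ->] := WQ i j; have [q' Qq' ->] := VQ k l.
  by rewrite mulrACA; apply: isQM => //; exact: isQM.
have [K [k kP]] := finite_index_fin_ind (PSL2_subgroupI gG (PSL2Z_group R)) (PSL2Z_group R) cG.2.
exists K, (fun g => k (W *m g *m invmx W)) => g g' [Zg Wg] [Zg' Wg'] /(kP _ _ Wg Wg') [Gk _].
have dg := Zg.1; apply/(cjP _ dV); rewrite invmxK.
move: Gk; rewrite invmx_mul ?det_mul1 // invmxK invmx_mul // !mulmxA.
by rewrite mulmxKV // !mulmxA.
Qed.

End FiniteIndex.

From mathcomp Require Import all_fingroup.

(** * The modular group as a free product *)

Lemma mx2_inj (K : comNzRingType) (a b c d a' b' c' d' : K) :
  mx2 a b c d = mx2 a' b' c' d' -> [/\ a = a', b = b', c = c' & d = d'].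
Proof.
move=> /matrixP e; have := e 0 0; have := e 0 1; have := e 1 0; have := e 1 1.
by rewrite !mx2E => -> -> -> ->.
Qed.

Lemma mx2_ex (K : comNzRingType) (A : 'M[K]_2) : exists a b c d : K, A = mx2 a b c d.
Proof. by exists (A 0 0), (A 0 1), (A 1 0), (A 1 1); exact: mx2_eta. Qed.

Section ModularGroup.
Implicit Types (A B : 'M[int]_2).

Definition mS : 'M[int]_2 := mx2 0 (-1) 1 0.
Definition mU : 'M[int]_2 := mx2 0 (-1) 1 (-1).
Definition mT (k : int) : 'M[int]_2 := mx2 1 k 0 1.

Lemma det_mS : \det mS = 1. Proof. by rewrite det_mx2. Qed.
Lemma det_mU : \det mU = 1. Proof. by rewrite det_mx2. Qed.
Lemma det_mT k : \det (mT k) = 1. Proof. by rewrite det_mx2; ring. Qed.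

Lemma mTD k l : mT (k + l) = mT k *m mT l.
Proof. by rewrite mul_mx2; congr mx2; ring. Qed.

Lemma mT0 : mT 0 = 1%:M.
Proof. by rewrite mx2_1. Qed.

Lemma mT1 : mT 1 = mU *m mU *m mS.
Proof. by rewrite !mul_mx2; congr mx2; ring. Qed.

Lemma mTN1 : mT (-1) = - (mS *m mU).
Proof. by rewrite mul_mx2 opp_mx2; congr mx2; ring. Qed.

Lemma mSS : mS *m mS = - 1%:M.
Proof. by rewrite mul_mx2 mx2_1 opp_mx2; congr mx2; ring. Qed.

Lemma mUUU : mU *m (mU *m mU) = 1%:M.
Proof. by rewrite !mul_mx2 mx2_1; congr mx2; ring. Qed.

(** Euclid's algorithm on the first column: translations reduce the upper entry modulo the lower one
    and [mS] exchanges them, until the lower entry is 0. *)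
Lemma SL2Z_ind (P : 'M[int]_2 -> Prop) : P 1%:M ->
  (forall A, P A -> P (mS *m A)) -> (forall A, P A -> P (mU *m A)) ->
  (forall A, P A -> P (- A)) -> forall A, \det A = 1 -> P A.
Proof.
move=> P1 PS PU PN.
have PT k A : P A -> P (mT k *m A).
  have P1T B : P B -> P (mT 1 *m B).
    by move=> PB; rewrite mT1 -!mulmxA; apply: (PU); apply: (PU); exact: PS.
  have P2T B : P B -> P (mT (-1) *m B).
    by move=> PB; rewrite mTN1 mulNmx -!mulmxA; apply: PN; apply: PS; exact: PU.
  move=> PA; case: (intP k) => [|n|n]; first by rewrite mT0 mul1mx.
    elim: n => [|n IH]; first exact: P1T.
    have -> : mT n.+2 = mT 1 *m mT n.+1 by rewrite -mTD; congr mT; lia.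
    by rewrite -mulmxA; exact: P1T.
  elim: n => [|n IH]; first exact: P2T.
  have -> : mT (- n.+2%:Z) = mT (-1) *m mT (- n.+1%:Z) by rewrite -mTD; congr mT; lia.
  by rewrite -mulmxA; exact: P2T.
move=> A; have [n] := ubnP (absz (A 1%R 0%R)); elim: n A => // n IH A le dA.
have [a [b [c [d AE]]]] := mx2_ex A; move: le dA; rewrite {A}AE mx2E det_mx2 => le dA.
have [c0|c0] := eqVneq c 0.
  move: dA; rewrite c0 mulr0 subr0 => ad.
  case: (int_unit ad) => a1; move: ad; rewrite a1 ?mul1r ?mulN1r => d1.
    by have -> : mx2 1 b 0 d = mT b *m 1%:M; [rewrite mulmx1 d1|exact: PT].
  have -> : mx2 (-1) b 0 d = - (mT (- b) *m 1%:M).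
    by rewrite mulmx1 opp_mx2 opprK oppr0 -d1 opprK.
  exact/PN/PT.
pose q := (a %/ c)%Z.
pose B := mS *m (mT (- q) *m mx2 a b c d).
have dB : \det B = 1 by rewrite !det_mul1 ?det_mS ?det_mT ?det_mx2.
have B10 : B 1 0 = (a %% c)%Z.
  by rewrite /B !mul_mx2 mx2E; have := divz_eq a c; rewrite -/q; move: (_ %% _)%Z; lia.
have PB : P B.
  apply: IH => //; rewrite B10; have := ltz_mod a c0; have := modz_ge0 a c0.
  move: le; set m := (_ %% _)%Z; lia.
have -> : mx2 a b c d = mT q *m (- (mS *m B)).
  by rewrite /B mulmxA mSS mulNmx opprK mul1mx mulmxA -mTD subrr mT0 mul1mx.
exact/PT/PN/PS.
Qed.

End ModularGroup.

Section ModularAction.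
Variables (gT : finGroupType) (s u : gT).
Hypotheses (s2 : (s * s = 1)%g) (u3 : (u * (u * u) = 1)%g).
Implicit Types (A B : 'M[int]_2) (x y : gT).

(** The graph of the wanted homomorphism, with [mS] sent to [s] and [mU] to [u]. As a relation it is
    multiplicative by construction; that it is a function expresses that the modular group is the
    free product of groups of order 2 and 3. *)
Inductive modrel : 'M[int]_2 -> gT -> Prop :=
| modrel1 : modrel 1%:M 1%g
| modrelS A x : modrel A x -> modrel (mS *m A) (s * x)%g
| modrelU A x : modrel A x -> modrel (mU *m A) (u * x)%g
| modrelN A x : modrel A x -> modrel (- A) x.

Let prodM (l : seq bool) : 'M[int]_2 :=
  foldr (fun e A => (if e then mT 1 else mx2 1 0 1 1) *m A) 1%:M l.
Let prodg (l : seq bool) : gT :=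
  foldr (fun e x => ((if e then u * u else u) * s) * x)%g 1%g l.

(* Words in s and u are reduced to s^a (u^e1 s) ... (u^en s) u^b; each matrix
   mU^e mS is, up to sign, an elementary matrix with nonnegative entries. *)
Lemma modrel_normal A x : modrel A x -> exists (a : bool) (l : seq bool) (b : 'I_3) (n : bool),
  A = (-1) ^+ n *: ((if a then mS else 1%:M) *m prodM l *m mU ^+ b) /\
  x = ((if a then s else 1) * prodg l * u ^+ b)%g.
Proof.
elim=> {A x} [|A x _ [a [l [b [n [-> ->]]]]]|A x _ [a [l [b [n [-> ->]]]]]|A x _ [a [l [b [n [-> ->]]]]]].
- by exists false, [::], 0, false; rewrite /= !mulmx1 scale1r mul1g mulg1.
- exists (~~ a), l, b; case: a => /=.
    exists (~~ n); rewrite -scalemxAr !mulmxA mSS !mulNmx !mul1mx scalerN -scaleNr mulgA !mulgA s2 !mul1g.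
    by split => //; congr (_ *: _); case: n; rewrite /= ?expr0 ?expr1 ?opprK.
  by exists n; rewrite -scalemxAr !mulmxA mulmx1 !mulgA mulg1.
- case: a => /=.
    exists false, (false :: l), b, (~~ n) => /=; rewrite !mul1mx -scalemxAr !mulmxA !mul1g !mulgA; split => //.
    have -> : mU *m mS = - mx2 1 0 1 1 :> 'M[int]_2 by rewrite mul_mx2 opp_mx2; congr mx2; ring.
    by rewrite !mulNmx scalerN -scaleNr; congr (_ *: _); case: n; rewrite /= ?expr0 ?expr1 ?opprK.
  case: l => [|[] l] /=.
  - exists false, [::], (inZp b.+1), n => /=; rewrite !mul1mx -scalemxAr !mulg1 !mul1g.
    case: b => -[|[|[|//]]] /= _; rewrite ?expr0 ?expg0 ?mulmx1 ?mulg1 ?expr1 ?expg1 //.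
    by rewrite !expgS expg0 mulg1 u3 exprS expr1 -[mU * mU]/(mU *m mU) mUUU.
  - exists true, l, b, n => /=; rewrite !mul1mx -scalemxAr !mul1g !mulmxA mT1 !mulmxA -[mU *m mU *m mU]mulmxA mUUU mul1mx.
    by rewrite !mulgA -[(u * u * u)%g]mulgA u3 mul1g.
  exists false, (true :: l), b, (~~ n) => /=; rewrite !mul1mx -scalemxAr !mul1g !mulgA; split => //.
  have -> : mT 1 = - (mU *m mx2 1 0 1 1) :> 'M[int]_2 by rewrite mul_mx2 opp_mx2; congr mx2; ring.
  by rewrite !mulmxA !mulNmx scalerN -scaleNr; congr (_ *: _); case: n; rewrite /= ?expr0 ?expr1 ?opprK.
- exists a, l, b, (~~ n); split => //; rewrite -scaleNr; congr (_ *: _).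
  by case: n; rewrite /= ?expr0 ?expr1 ?opprK.
Qed.

(** [prodM l] has nonnegative entries and determinant 1; comparing it with the possible values of
    the remaining factors leaves only the identity, and a nonempty product has a positive entry off
    the diagonal. So the normal form of the identity matrix is empty. *)
Lemma modrel1_inv x : modrel 1%:M x -> x = 1%g.
Proof.
move=> /modrel_normal [a [l [b [n [e ->]]]]].
have pMS e' l' : prodM (e' :: l') = (if e' then mT 1 else mx2 1 0 1 1) *m prodM l' by [].
have pM l' : exists p q r t : int, [/\ prodM l' = mx2 p q r t, p * t - q * r = 1 &
    [/\ 0 <= p, 0 <= q, 0 <= r & 0 <= t]].
  elim: l' => [|e' l' [p [q [r [t [pE dE [p0 q0 r0 t0]]]]]]].
    by exists 1, 0, 0, 1; split => //; exact: mx2_1.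
  rewrite pMS pE; case: e'; rewrite /mT mul_mx2; do 4!eexists; split; try reflexivity; try (split; lia);
  by transitivity (p * t - q * r); [ring|exact: dE].
have [p [q [r [t [pE dE [p0 q0 r0 t0]]]]]] := pM l.
have sg : prodM l *m mU ^+ b = (-1) ^+ n *: (if a then - mS else 1%:M).
  have nn : (-1) ^+ n * (-1) ^+ n = 1 :> int by rewrite -expr2 sqrr_sign.
  have -> : prodM l *m mU ^+ b = (if a then - mS else 1%:M) *m ((if a then mS else 1%:M) *m (prodM l *m mU ^+ b)).
    by case: (a); rewrite ?mul1mx // mulNmx (mulmxA mS mS) mSS mulNmx opprK mul1mx.
  rewrite -[X in _ = _ *: X]mulmx1 scalemxAr; congr (_ *m _).
  by rewrite [X in _ = _ *: X]e scalerA nn scale1r mulmxA.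
have [a0 [b0 [p1 q1 r1 t1]]] : a = false /\ b = 0 /\ [/\ p = 1, q = 0, r = 0 & t = 1].
  move: sg; rewrite pE /mS mx2_1 opp_mx2.
  have -> : (-1) ^+ n *: (if a then mx2 (- 0) (- -1) (- 1) (- 0) else mx2 1 0 0 1) =
      (let c : int := if n then -1 else 1 in if a then mx2 0 c (- c) 0 else mx2 c 0 0 c).
    by case: (n); case: (a); rewrite /= ?(expr0, expr1) ?scale1r ?scaleN1r ?opp_mx2; congr mx2; ring.
  have -> : mU ^+ b = (if b == 0 then mx2 1 0 0 1 else if b == 1 then mx2 0 (-1) 1 (-1) else mx2 (-1) 1 (-1) 0) :> 'M[int]_2.
    case: b {e} => -[|[|[|//]]] i /=; rewrite ?expr0 ?expr1 //; first exact: mx2_1.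
    by rewrite exprS expr1 -[mU * mU]/(mU *m mU) mul_mx2; congr mx2; ring.
  by case: b {e} => -[|[|[|//]]] i /=; rewrite mul_mx2; case: a; case: n => /=
    /mx2_inj[*]; try (exfalso; lia); split => //; split; [exact: val_inj|split; lia].
rewrite a0 b0 expg0 mulg1 mul1g; case: l pE {e sg} => // e' l pE; exfalso.
have [p' [q' [r' [t' [pE' dE' [p0' q0' r0' t0']]]]]] := pM l.
by move: pE; rewrite pMS pE' p1 q1 r1 t1; case: e'; rewrite /mT mul_mx2 => /mx2_inj[]; lia.
Qed.

Lemma modrelM A B x y : modrel A x -> modrel B y -> modrel (A *m B) (x * y)%g.
Proof.
move=> + By; elim=> {A x} [|A x _ IH|A x _ IH|A x _ IH].
- by rewrite mul1mx mul1g.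
- by rewrite -mulmxA -mulgA; exact: modrelS.
- by rewrite -mulmxA -mulgA; exact: modrelU.
- by rewrite mulNmx; exact: modrelN.
Qed.

Lemma modrel_total A : \det A = 1 -> exists x, modrel A x.
Proof.
move: A; apply: (@SL2Z_ind (fun A => exists x, modrel A x)) => [|A [x Ax]|A [x Ax]|A [x Ax]].
- by exists 1%g; exact: modrel1.
- by exists (s * x)%g; exact: modrelS.
- by exists (u * x)%g; exact: modrelU.
- by exists x; exact: modrelN.
Qed.

Lemma modrel_fun A x y : \det A = 1 -> modrel A x -> modrel A y -> x = y.
Proof.
move=> dA Ax Ay; have [z Az] := modrel_total (det_inv1 dA).
have h w : modrel A w -> (z * w)%g = 1%g.
  by move=> Aw; apply: modrel1_inv; have := modrelM Az Aw; rewrite mulVmx ?det1_unit.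
by apply: (mulgI z); rewrite !h.
Qed.

(** For permutations the left factor of a product acts first, so [slact] acts from the right, in
    accordance with right multiplication on cosets and on oriented edges. *)
Definition slact A : gT := xget 1%g [set x | modrel A x].

Lemma slactP A : \det A = 1 -> modrel A (slact A).
Proof. by move=> dA; rewrite /slact; case: xgetP => [x _ //|h]; have [x /h] := modrel_total dA. Qed.

Lemma slactE A x : \det A = 1 -> modrel A x -> slact A = x.
Proof. by move=> dA Ax; exact: modrel_fun (slactP dA) Ax. Qed.

Lemma slactM A B : \det A = 1 -> \det B = 1 -> slact (A *m B) = (slact A * slact B)%g.
Proof. by move=> dA dB; apply: slactE; [exact: det_mul1|apply: modrelM; exact: slactP]. Qed.

Lemma slact1 : slact 1%:M = 1%g.
Proof. by apply: slactE; [rewrite det1|exact: modrel1]. Qed.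

Lemma slactS : slact mS = s.
Proof.
apply: slactE; first exact: det_mS.
by rewrite -[mS]mulmx1 -[s]mulg1; apply: modrelS; exact: modrel1.
Qed.

Lemma slactU : slact mU = u.
Proof.
apply: slactE; first exact: det_mU.
by rewrite -[mU]mulmx1 -[u]mulg1; apply: modrelU; exact: modrel1.
Qed.

Lemma slactN A : \det A = 1 -> slact (- A) = slact A.
Proof. by move=> dA; apply: slactE; [rewrite det_opp2|exact/modrelN/slactP]. Qed.

Lemma slactV A : \det A = 1 -> slact (invmx A) = ((slact A)^-1)%g.
Proof.
move=> dA; apply: (mulgI (slact A)); rewrite mulgV -slactM ?det_inv1 //.
by rewrite mulmxV ?det1_unit // slact1.
Qed.

Lemma slactT : slact (mT 1) = (u * u * s)%g.
Proof. by rewrite mT1 !slactM ?det_mul1 ?det_mU ?det_mS // slactU slactS. Qed.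

Lemma slactTn n : slact (mT n%:Z) = ((u * u * s) ^+ n)%g.
Proof.
elim: n => [|n IH]; first by rewrite mT0 slact1 expg0.
have -> : mT n.+1 = mT 1 *m mT n by rewrite -mTD; congr mT; lia.
by rewrite slactM ?det_mT // IH slactT expgS.
Qed.

End ModularAction.

(** * Counting cocycles and cusp widths *)

Local Close Scope classical_set_scope.
Local Open Scope nat_scope.

Section UniformOrbits.
Variables (X : finType) (p : {perm X}).

Lemma card_stable_orbits (m : nat) (A : {set X}) : (forall x, #|porbit p x| = m) ->
  (forall x, x \in A -> p x \in A) -> #|A| = #|[set porbit p x | x in A]| * m.
Proof.
move=> hm hA.
have sub x : x \in A -> porbit p x \subset A.
  move=> xA; apply/fintype.subsetP => _ /porbitP[n ->].
  by rewrite permX; elim: n => //= n IH; exact: hA.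
apply: card_uniform_partition => [_ /imsetP[x _ ->]|]; first exact: hm.
apply/and3P; split.
- rewrite finset.eqEsubset; apply/andP; split.
    by apply/bigcupsP => _ /imsetP[x xA ->]; exact: sub.
  apply/fintype.subsetP => x xA; apply/bigcupP; exists (porbit p x); last exact: porbit_id.
  exact: imset_f.
- apply/finset.trivIsetP => _ _ /imsetP[x _ ->] /imsetP[y _ ->] ne.
  rewrite -finset.setI_eq0; apply/eqP/finset.setP => z; rewrite !inE; apply/negP => /andP[zx zy].
  by move: ne; rewrite -!eq_porbit_mem in zx zy *; rewrite -(eqP zx) (eqP zy) eqxx.
apply/negP => /imsetP[x _ e].
by have := porbit_id p x; rewrite -e inE.
Qed.

Lemma card_porbits_uniform (m : nat) : (forall x, #|porbit p x| = m) -> #|X| = #|porbits p| * m.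
Proof.
move=> hm; rewrite -cardsT (card_stable_orbits hm) => [|x _]; last by rewrite inE.
by congr (#|pred_of_set _| * _); apply/finset.setP => C; apply/imsetP/imsetP => -[x _ ->]; exists x.
Qed.

Lemma porbit2 : (forall x, p (p x) = x) -> (forall x, p x <> x) -> forall x, #|porbit p x| = 2.
Proof.
move=> p2 pn x; have -> : porbit p x = [set x; p x].
  apply/finset.setP => y; rewrite !inE; apply/porbitP/orP => [[n ->]|[] /eqP->].
  - rewrite permX; elim: n => [|n [] /eqP e] /=; rewrite ?e ?p2 eqxx; [by left|by right|by left].
  - by exists 0; rewrite perm1.
  by exists 1; rewrite expg1.
by rewrite cards2; case: eqVneq => // e; case: (pn x).
Qed.

Lemma porbit3 : (forall x, p (p (p x)) = x) -> (forall x, p x <> x) -> forall x, #|porbit p x| = 3.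
Proof.
move=> p3 pn x; have -> : porbit p x = x |: [set p x; p (p x)].
  apply/finset.setP => y; rewrite !inE; apply/porbitP/or3P => [[n ->]|].
    rewrite permX; elim: n => [|n [] /eqP e] /=; rewrite ?e ?p3 eqxx; by [constructor 1|constructor 2|constructor 3].
  by case=> /eqP->; [exists 0; rewrite perm1|exists 1; rewrite expg1|exists 2; rewrite permX].
have ne : x != p x by apply/eqP => e; apply: (pn x).
have ne2 : p x != p (p x) by apply/eqP => /perm_inj e; apply: (pn x).
have ne3 : x != p (p x).
  by apply/eqP => e; apply: (pn x); rewrite -[RHS]p3 -e.
by rewrite cardsU1 cards2 !inE negb_or ne ne2 ne3.
Qed.

Lemma invariant_card_ge : 2 ^ #|porbits p| <= #|[set a : {ffun X -> bool} | [forall x, a (p x) == a x]]|.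
Proof.
rewrite -card_powerset.
pose F (Q : {set {set X}}) : {ffun X -> bool} := [ffun x => porbit p x \in Q].
have Finj : {in powerset (porbits p) &, injective F}.
  move=> Q Q'; rewrite !inE => sQ sQ' /ffunP e; apply/finset.setP => C.
  have [/imsetP[x _ ->]|nC] := boolP (C \in porbits p); first by have := e x; rewrite !ffunE.
  by apply/idP/idP => h; case/negP: nC; [exact: (fintype.subsetP sQ)|exact: (fintype.subsetP sQ')].
rewrite -(card_in_imset Finj); apply: subset_leq_card.
apply/fintype.subsetP => _ /imsetP[Q _ ->]; rewrite inE; apply/forallP => x; rewrite !ffunE.
by have -> : porbit p (p x) = porbit p x; [apply/eqP; rewrite eq_porbit_mem; apply/porbitP; exists 1; rewrite expg1|].
Qed.

Lemma invariant_card_le : #|[set a : {ffun X -> bool} | [forall x, a (p x) == a x]]| <= 2 ^ #|porbits p|.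
Proof.
rewrite -card_powerset.
pose F (a : {ffun X -> bool}) : {set {set X}} := [set porbit p x | x in X & a x].
set I := [set a | _].
have inv a : a \in I -> forall x n, a (iter n p x) = a x.
  rewrite inE => /forallP h x; elim=> //= n IH; by rewrite (eqP (h _)).
have Finj : {in I &, injective F}.
  move=> a b aI bI e; apply/ffunP => x.
  have key c d : c \in I -> d \in I -> F c = F d -> c x -> d x.
    move=> cI dI cd cx; have : porbit p x \in F c by apply: imset_f; rewrite inE.
    rewrite cd => /imsetP[y]; rewrite inE => dy /eqP; rewrite eq_porbit_mem => /porbitP[n ->].
    by rewrite permX inv.
  by apply/idP/idP; [exact: key|apply: key].
rewrite -(card_in_imset Finj); apply: subset_leq_card.
apply/fintype.subsetP => _ /imsetP[a _ ->]; rewrite inE.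
by apply/fintype.subsetP => _ /imsetP[x _ ->]; exact: imset_f.
Qed.

End UniformOrbits.

Section CocycleCount.
Variables (X : finType) (s u t : {perm X}) (x0 : X).
Hypotheses (s2 : forall x, s (s x) = x) (sn : forall x, s x <> x).
Hypotheses (u3 : forall x, u (u (u x)) = x) (un : forall x, u x <> x).
Hypothesis (t5 : #|porbits t| <= 5).
Implicit Types (a e : {ffun X -> bool}).

Let IS := [set a : {ffun X -> bool} | [forall x, a (s x) == a x]].
Let IU := [set a : {ffun X -> bool} | [forall x, a (u x) == a x]].
Definition cusp_parity a (C : {set X}) : bool := odd #|[set x in C | a x]|.

Hypothesis coboundary : forall a, (forall x, a (s x) = a x) ->
  (forall C, C \in porbits t -> cusp_parity a C = false) ->
  exists2 e : {ffun X -> bool}, (forall x, e (u x) = e x) & (forall x, a x = e x (+) e (s x)).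

Let K := [set a in IS | [forall C in porbits t, ~~ cusp_parity a C]].

Let addf a e : {ffun X -> bool} := [ffun x => a x (+) e x].

Lemma cusp_parityD a e C : cusp_parity (addf a e) C = cusp_parity a C (+) cusp_parity e C.
Proof.
rewrite /cusp_parity; set A := [set x in C | a x]; set B := [set x in C | e x].
have -> : [set x in C | addf a e x] = (A :\: B) :|: (B :\: A).
  by apply/finset.setP => x; rewrite !inE ffunE; case: (x \in C); case: (a x); case: (e x).
have d : [disjoint A :\: B & B :\: A].
  by rewrite -finset.setI_eq0; apply/eqP/finset.setP => x; rewrite !inE; case: (x \in C); case: (a x); case: (e x).
have /eqP -> : #|(A :\: B) :|: (B :\: A)| == #|A :\: B| + #|B :\: A| by rewrite (leq_card_setU _ _).2.
by rewrite -(cardsID B A) -(cardsID A B) (finset.setIC B A) !oddD; case: (odd #|A :&: B|); case: (odd #|A :\: B|); case: (odd #|B :\: A|).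
Qed.

(** A set stable under the involution [s], which has no fixed points, is a union of pairs. *)
Lemma total_parity a : a \in IS -> odd #|[set x | a x]| = false.
Proof.
rewrite inE => /forallP h; rewrite (card_stable_orbits (porbit2 s2 sn)).
  by rewrite muln2 odd_double.
by move=> x; rewrite !inE (eqP (h x)).
Qed.

Lemma sum_parity a : odd #|[set x | a x]| = odd (\sum_(C in porbits t) (cusp_parity a C : nat)).
Proof.
have -> : #|[set x | a x]| = \sum_(C in porbits t) #|[set x in C | a x]|.
  rewrite -sum1_card (partition_big (porbit t) (mem (porbits t))) /=; last by move=> x _; exact: imset_f.
  apply: eq_bigr => C /imsetP[y _ ->]; rewrite -sum1_card; apply: eq_bigl => x.
  by rewrite !inE eq_porbit_mem andbC porbit_sym.
elim/big_ind2: _ => // [m1 m2 n1 n2 h1 h2|C _]; first by rewrite !oddD h1 h2.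
by rewrite /cusp_parity; case: (odd _).
Qed.

(** The parities at all cusps but [C0], at most four in number, define a map on [IS]. Its nonempty
    fibres embed into [K] by translation: the parity at [C0] is determined by the others, because
    the total is even. *)
Lemma cocycle_card : #|IS| <= 2 ^ 4 * #|K|.
Proof.
pose C0 := porbit t x0.
pose l := enum (porbits t :\ C0).
have sl : size l <= 4.
  by rewrite -cardE; have := cardsD1 C0 (porbits t); rewrite imset_f //; move: t5; lia.
pose par a : {ffun 'I_4 -> bool} := [ffun i => cusp_parity a (nth finset.set0 l (nat_of_ord i))].
have parK a e : a \in IS -> e \in IS -> par a = par e -> addf a e \in K.
  move=> aS eS /ffunP ae; have DS : addf a e \in IS.
    move: aS eS; rewrite !inE => /forallP h1 /forallP h2; apply/forallP => x.
    by rewrite !ffunE (eqP (h1 x)) (eqP (h2 x)).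
  have par0 C : C \in porbits t -> C != C0 -> cusp_parity (addf a e) C = false.
    move=> Ct Cn; have Cl : C \in l by rewrite mem_enum !inE Cn.
    have il : index C l < 4 by apply: leq_trans sl; rewrite index_mem.
    have := ae (Ordinal il); rewrite !ffunE /= nth_index // cusp_parityD => ->.
    exact: addbb.
  rewrite inE DS; apply/forall_inP => C Ct.
  have [->|Cn] := eqVneq C C0; last by rewrite par0.
  have := sum_parity (addf a e); rewrite total_parity // (bigD1 C0) ?imset_f //= big1 => [|D /andP[Dt Dn]].
    by rewrite addn0 oddb => <-.
  by rewrite par0.
have -> : #|IS| = \sum_(v : {ffun 'I_4 -> bool}) #|[set a in IS | par a == v]|.
  rewrite -sum1_card (partition_big par predT) //=; apply: eq_bigr => v _.
  by rewrite -sum1_card; apply: eq_bigl => a; rewrite inE.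
have -> : 2 ^ 4 = #|{: {ffun 'I_4 -> bool}}| by rewrite card_ffun card_bool card_ord.
rewrite -sum_nat_const; apply: leq_sum => v _.
have [->|[a0]] := finset.set_0Vmem [set a in IS | par a == v]; first by rewrite cards0.
rewrite inE => /andP[a0S /eqP a0v].
have inj : injective (addf a0).
  by move=> a b /ffunP h; apply/ffunP => x; have := h x; rewrite !ffunE; exact: addbI.
rewrite -(card_imset _ inj); apply: subset_leq_card; apply/fintype.subsetP => _ /imsetP[a + ->].
by rewrite inE => /andP[aS /eqP av]; apply: parK => //; rewrite a0v av.
Qed.

(** A function [e] and its complement have the same coboundary, so normalizing [e x0] to be false
    still produces all of [K], from at most half of [IU]. *)
Lemma coboundary_card : 2 * #|K| <= #|IU|.
Proof.
pose D e : {ffun X -> bool} := [ffun x => e x (+) e (s x)].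
pose neg e : {ffun X -> bool} := [ffun x => ~~ e x].
have negI : injective neg.
  by move=> a b /ffunP h; apply/ffunP => x; have := h x; rewrite !ffunE; exact: negb_inj.
pose I0 := [set e in IU | ~~ e x0].
have negU e : e \in IU -> neg e \in IU.
  by rewrite !inE => /forallP h; apply/forallP => x; rewrite !ffunE (eqP (h x)).
have KD : K \subset [set D e | e in I0].
  apply/fintype.subsetP => a; rewrite !inE => /andP[/forallP aS /forall_inP aP].
  have [||e eu ae] := coboundary (a := a).
  - by move=> x; exact/eqP.
  - by move=> C /aP /negbTE.
  have eU : e \in IU by rewrite inE; apply/forallP => x; rewrite eu.
  have [e0|e0] := boolP (e x0).
    apply/imsetP; exists (neg e); first by rewrite inE negU // ffunE e0.
    by apply/ffunP => x; rewrite !ffunE ae; case: (e x); case: (e _).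
  apply/imsetP; exists e; first by rewrite inE eU.
  by apply/ffunP => x; rewrite ffunE ae.
have : #|I0| + #|[set neg e | e in I0]| <= #|IU|.
  rewrite -cardsUI (_ : I0 :&: _ = finset.set0); last first.
    apply/finset.setP => e; rewrite !inE; apply/negP => /andP[/andP[_ h] /imsetP[e' + E]].
    by rewrite inE => /andP[_ h']; move: h; rewrite E ffunE h'.
  rewrite cards0 addn0; apply: subset_leq_card; apply/fintype.subsetP => e; rewrite !finset.in_setU => /orP[].
    by rewrite inE => /andP[].
  by move=> /imsetP[e' + ->]; rewrite inE => /andP[h _]; exact: negU.
rewrite card_imset // addnn -mul2n; apply: leq_trans; rewrite leq_mul2l /=.
by apply: leq_trans (subset_leq_card KD) _; exact: leq_imset_card.
Qed.

(** With [m] points, [s] has [m / 2] orbits and [u] has [m / 3]; the two counts combine to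
    [m / 2 + 1 <= m / 3 + 4]. *)
Lemma card_cosets_le : #|X| <= 18.
Proof.
have h2 := card_porbits_uniform (porbit2 s2 sn); have h3 := card_porbits_uniform (porbit3 u3 un).
have e1 := leq_trans (invariant_card_ge s) cocycle_card.
have e2 := leq_trans coboundary_card (invariant_card_le u).
have : 2 ^ (#|porbits s|).+1 <= 2 ^ (#|porbits u| + 4).
  rewrite expnS expnD; apply: leq_trans (_ : 2 * (2 ^ 4 * #|K|) <= _); first by rewrite leq_mul2l.
  by rewrite mulnCA mulnC leq_mul2r e2 orbT.
rewrite leq_exp2l //; lia.
Qed.

End CocycleCount.

(** * Impossibility of five large-gap cusp widths with sum at most 18 *)

Section WidthCount.
Variables (X : finType) (s t : {perm X}).
Local Notation w x := #|porbit t x|.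
Hypotheses (s2 : forall x, s (s x) = x) (t5 : #|porbits t| = 5) (X18 : #|X| <= 18).
Hypothesis w_adj : forall x, 13 <= w x * w (s x).
Hypothesis w_fan : forall x d, 0 < d -> 13 <= w (s x) * w (s (iter d t x)) * d ^ 2.

(* Neighbours of a cusp that have width one are at mutual distance at least
   four in the cyclic order, those of width two or three at least two. *)
Definition spacing (n : nat) : nat := if n == 1 then 2 else 1.

(** A packing condition: every dart at a cusp of width [n <= k] reserves [2 * spacing n] places,
    pairwise disjoint, in the cusps whose width times [k] is at least 13; the room there is the sum
    of their widths. *)
Definition width_ok (l : seq nat) (k : nat) : bool :=
  \sum_(n <- l | n <= k) n * (2 * spacing n) <= \sum_(n <- l | 13 <= n * k) n.

Lemma sum_widths (P : pred nat) (F : nat -> nat) :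
  \sum_(x | P (w x)) F (w x) =
  \sum_(n <- [seq #|pred_of_set C| | C <- enum (porbits t)] | P n) n * F n.
Proof.
rewrite big_map big_enum_cond /= [RHS]big_mkcondr /=.
rewrite (partition_big (porbit t) (mem (porbits t))) /=; last by move=> x _; exact: imset_f.
apply: eq_bigr => C /imsetP[y _ ->].
rewrite (eq_bigr (fun=> F (w y))) => [|x /andP[_ /eqP ->] //].
rewrite sum_nat_const; case: ifP => Py.
  congr (_ * _); apply: eq_card => x; rewrite unfold_in eq_porbit_mem andbC.
  by case: (boolP (x \in porbit t y)) => //=; rewrite -eq_porbit_mem => /eqP ->.
rewrite eq_card0 // => x; rewrite unfold_in; apply/negP => /andP[+ /eqP e].
by rewrite e Py.
Qed.

(** By [w_adj] the reverse [s x] of a narrow dart lies at a wide cusp, and the places reserved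
    around it stay at that cusp. Blocks of different darts are disjoint by [w_fan]. *)
Lemma width_ok_holds k : k <= 3 -> width_ok [seq #|pred_of_set C| | C <- enum (porbits t)] k.
Proof.
move=> k3; rewrite /width_ok -(sum_widths (fun n => n <= k) (fun n => 2 * spacing n)).
have -> : \sum_(n <- [seq #|pred_of_set C| | C <- enum (porbits t)] | 13 <= n * k) n =
    \sum_(x | 13 <= w x * k) 1.
  by rewrite (sum_widths (fun n => 13 <= n * k) (fun=> 1)); apply: eq_bigr => n _; rewrite muln1.
have w0 x : 0 < w x by apply/card_gt0P; exists x; exact: porbit_id.
pose D := [set p : X * 'I_4 | (w p.1 <= k) && (p.2 < 2 * spacing (w p.1))].
(* The blocks are centred: offsets 0 to 3 for width 1, and 1, 2 for widths 2 and 3. Blocks of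
   different lengths could thus collide only at distance at most 2, while [13 <= 3 * d ^ 2] forces
   at least 3. *)
pose off (p : X * 'I_4) := p.2 + 2 - spacing (w p.1).
pose phi p := iter (off p) t (s p.1).
have -> : \sum_(x | w x <= k) 2 * spacing (w x) = #|D|.
  rewrite -sum1_card (eq_bigl (fun p : X * 'I_4 => (w p.1 <= k) && (p.2 < 2 * spacing (w p.1)))); last by move=> p; rewrite inE.
  rewrite -(pair_big_dep (fun x => w x <= k) (fun x (j : 'I_4) => j < 2 * spacing (w x)) (fun _ _ => 1)) /=.
  apply: eq_bigr => x _; rewrite sum1_card /spacing.
  by case: ifP => _; rewrite -sum1_card big_mkcond !big_ord_recl big_ord0.
have itert n y : w (iter n t y) = w y.
  by rewrite -permX; congr #|pred_of_set _|; apply/eqP; rewrite eq_porbit_mem mem_porbit.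
have phi_w p : p \in D -> 13 <= w (phi p) * k.
  rewrite inE => /andP[pk _]; rewrite /phi itert; apply: leq_trans (w_adj p.1) _.
  by rewrite mulnC leq_mul2l pk orbT.
have phi_inj : {in D &, injective phi}.
  have key p q : p \in D -> q \in D -> off p <= off q -> phi p = phi q -> p = q.
    rewrite !inE => /andP[pk p2] /andP[qk q2] le e.
    have spq : s p.1 = iter (off q - off p) t (s q.1).
      have : injective (iter (off p) t) by elim: (off p) => //= n IH y z /perm_inj /IH.
      by apply; rewrite -iterD subnKC.
    have [d0|d0] := posnP (off q - off p).
      move: spq; rewrite d0 /= => /perm_inj e1; move: le d0; rewrite /off -e1.
      move: p2 q2; rewrite -e1; case: p q e1 {e pk qk} => [x i] [y j] /= -> i2 j2 le d0.
      congr pair; apply: val_inj => /=; move: i2 j2 le d0; rewrite /spacing; case: ifP; lia.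
    have := w_fan (s q.1) d0; rewrite s2 -spq s2; move: d0 le; rewrite /off.
    move: p2 q2 pk qk (w0 p.1) (w0 q.1); rewrite /spacing; move: (w p.1) (w q.1) => m n.
    have mn3 : m <= k -> n <= k -> m <= 3 /\ n <= 3 by lia.
    move=> p2 q2 mk nk m0 n0; have [m3 n3] := mn3 mk nk.
    case: m m0 m3 {mk mn3} p2 => [|[|[|[|//]]]] // _ _ p2;
    case: n n0 n3 {nk} q2 => [|[|[|[|//]]]] // _ _ q2; rewrite /= in p2 q2 *;
    move: p2 q2; case: p.2 => -[|[|[|[|//]]]] /= _ p2 //; case: q.2 => -[|[|[|[|//]]]] /= _ q2 //.
  move=> p q pD qD e; have [le|/ltnW le] := leqP (off p) (off q); first exact: key.
  by apply/esym; exact: key.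
rewrite -(card_in_imset phi_inj) sum1_card; apply: subset_leq_card.
by apply/fintype.subsetP => _ /imsetP[p pD ->]; rewrite unfold_in; exact: phi_w.
Qed.

(** Exhaustive search over lists of positive widths of sum at most [b]. The leaf expresses the
    conditions for [k] equal to 1, 2, 3 by [sumn], so that it can be evaluated. For five widths and
    bound 18 some width is at most 3, so the conditions are never vacuous. *)
Fixpoint width_search (n b : nat) (acc : seq nat) : bool :=
  if n is n'.+1 then all (fun k => width_search n' (b - k) (k :: acc)) (iota 1 b)
  else [&& sumn [seq n * (2 * spacing n) | n <- acc & n <= 1] <= sumn [seq n <- acc | 13 <= n * 1],
           sumn [seq n * (2 * spacing n) | n <- acc & n <= 2] <= sumn [seq n <- acc | 13 <= n * 2] &
           sumn [seq n * (2 * spacing n) | n <- acc & n <= 3] <= sumn [seq n <- acc | 13 <= n * 3]] ==> false.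

Lemma width_searchP l b acc : all (leq 1) l -> sumn l <= b ->
  width_search (size l) b acc -> width_search 0 0 (catrev l acc).
Proof.
elim: l b acc => //= k l IH b acc /andP[k0 l0] lb /allP /(_ k) h.
apply: (IH (b - k)) => //; first lia.
by apply: h; rewrite mem_iota; lia.
Qed.

Lemma no_widths : False.
Proof.
set l := [seq #|pred_of_set C| | C <- enum (porbits t)].
have sl : size l = 5 by rewrite size_map -cardE.
have l0 : all (leq 1) l.
  by apply/allP => _ /mapP[C + ->]; rewrite mem_enum => /imsetP[x _ ->]; apply/card_gt0P; exists x; exact: porbit_id.
have suml : sumn l = #|X|.
  have E := sum_widths xpredT (fun=> 1).
  rewrite sumnE; transitivity (\sum_(n <- l) n * 1); first by apply: eq_bigr => n _; rewrite muln1.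
  by rewrite -E sum1_card.
have lb : sumn l <= 18 by rewrite suml.
have := width_searchP (acc := [::]) l0 lb; rewrite sl.
have -> : width_search 5 18 [::] by vm_compute.
move=> /(_ isT) /=.
have ok k : k <= 3 -> sumn [seq n * (2 * spacing n) | n <- catrev l [::] & n <= k] <=
    sumn [seq n <- catrev l [::] | 13 <= n * k].
  move=> k3; have := width_ok_holds k3; rewrite -/l /width_ok !sumnE big_map !big_filter -/(rev l).
  by rewrite !(perm_big _ (permEl (perm_rev l))).
by rewrite !ok.
Qed.

End WidthCount.

Local Open Scope ring_scope.
Local Open Scope classical_set_scope.

(** An eigenvector for the eigenvalue [e], which is 1 or -1, can be taken integral and primitive,
    hence as the first column of some [B] of determinant 1; in this basis [A] is [e] times a
    translation. *)
Lemma int_parabolic (R : realType) (A : 'M[int]_2) : \det A = 1 -> `|\tr (real_mx R A)| = 2 ->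
  exists B k (n : bool), \det B = 1 /\ A *m B = (-1) ^+ n *: (B *m mT k).
Proof.
move=> dA tA; have [a [b [c [d AE]]]] := mx2_ex A.
have [e [ee te]] : exists e : int, e * e = 1 /\ a + d = e * 2.
  have : a + d = 2 \/ a + d = - 2.
    move: tA; rewrite tr_real_mx AE tr_mx2 -intr_norm -[2]/(2%:~R) => /intr_inj; lia.
  by case=> ->; [exists 1|exists (-1)].
have e1 : e = 1 \/ e = -1 by exact: int_unit ee.
have dd : a * d - b * c = 1 by rewrite -dA AE det_mx2.
have [p [q [pq h1 h2]]] : exists p q : int, [/\ ~~ ((p == 0) && (q == 0)),
    (a - e) * p + b * q = 0 & c * p + (d - e) * q = 0].
  (* By Cayley-Hamilton the first column of [A - e] lies in its kernel; when that column vanishes,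
     the kernel contains [(1, 0)]. *)
  have [z|nz] := boolP ((a - e == 0) && (c == 0)).
    by have [/eqP z1 /eqP z2] := andP z; exists 1, 0; rewrite z1 z2; split => //; ring.
  exists (a - e), c; split => //.
    transitivity (a * (a + d - e * 2) + e * e - (a * d - b * c)); first by ring.
    by rewrite te subrr mulr0 add0r ee dd.
  transitivity (c * (a + d - e * 2)); first by ring.
  by rewrite te subrr mulr0.
have g0 : gcdz p q != 0 by rewrite gcdz_eq0.
pose p' := (p %/ gcdz p q)%Z; pose q' := (q %/ gcdz p q)%Z.
have pE : p = p' * gcdz p q by rewrite divzK ?dvdz_gcdl.
have qE : q = q' * gcdz p q by rewrite divzK ?dvdz_gcdr.
have cop : coprimez p' q'.
  have [x [y xy]] := Bezoutz p q; apply/coprimezP; exists (x, y) => /=.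
  by apply: (mulIf g0); rewrite mul1r -[RHS]xy mulrDl -!mulrA -pE -qE.
have k1 : (a - e) * p' + b * q' = 0.
  by apply: (mulIf g0); rewrite mul0r mulrDl -!mulrA -pE -qE.
have k2 : c * p' + (d - e) * q' = 0.
  by apply: (mulIf g0); rewrite mul0r mulrDl -!mulrA -pE -qE.
have [B [dB Bp Bq]] := bezout_mx cop.
have [p2 [r [q2 [s BE]]]] := mx2_ex B; move: dB Bp Bq; rewrite {B}BE !mx2E det_mx2 => dB Bp Bq.
rewrite -{}Bp -{}Bq in k1 k2.
pose X := a * r + b * s; pose Y := c * r + d * s.
have ep : a * p2 + b * q2 = e * p2 by move/eqP: k1; rewrite mulrBl addrAC subr_eq0 => /eqP.
have eq : c * p2 + d * q2 = e * q2 by move/eqP: k2; rewrite mulrBl addrA subr_eq0 => /eqP.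
have pY : p2 * Y = e + q2 * X.
  have : e * (p2 * Y - q2 * X) = 1.
    transitivity ((e * p2) * Y - (e * q2) * X); first by ring.
    rewrite -ep -eq /X /Y; transitivity ((a * d - b * c) * (p2 * s - r * q2)); first by ring.
    by rewrite dd dB.
  move/(congr1 (fun z => e * z)); rewrite mulrA ee mul1r mulr1 => <-.
  by rewrite subrK.
exists (mx2 p2 r q2 s), (e * (s * X - r * Y)), (e == -1); split; first by rewrite det_mx2.
have -> : (-1) ^+ (e == -1) = e by case: e1 => ->.
have -> : forall M : 'M[int]_2, e *: M = mx2 (e * M 0 0) (e * M 0 1) (e * M 1 0) (e * M 1 1).
  by move=> M; apply: mx2P; rewrite !mx2E mxE.
rewrite AE !mul_mx2 !mx2E -/X -/Y; congr mx2.
- by rewrite ep; ring.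
- transitivity ((e * e) * (p2 * s * X - r * (p2 * Y)) + e * r); last by ring.
  rewrite ee pY; transitivity ((p2 * s - r * q2) * X); last by ring.
  by rewrite dB mul1r.
- by rewrite eq; ring.
transitivity ((e * e) * (q2 * X * s - r * q2 * Y) + e * s); last by ring.
have -> : q2 * X = p2 * Y - e by rewrite pY addrAC subrr add0r.
rewrite ee; transitivity ((p2 * s - r * q2) * Y); last by ring.
by rewrite dB mul1r.
Qed.

Section IntegralGroup.
Variables (R : realType) (G : set 'M[R]_2).
Hypothesis gG : PSL2_subgroup G.

Lemma finite_index_commensurable : finite_index G (@PSL2Z R) -> commensurable G (@PSL2Z R).
Proof.
move=> fi; have [sG _] := fi; have [Gd _ GM GV] := gG.
have GZ : G `&` @PSL2Z R = G by apply/seteqP; split => [g []|g Gg] //; split => //; exact: sG.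
rewrite /commensurable GZ; split => //; split => //.
apply: (@sub_finite_set _ _ [set G]); last exact: finite_set1.
move=> _ [g Gg <-]; apply/seteqP; have ug := det1_unit (Gd _ Gg).
split => [_ [h Gh <-]|h Gh]; first exact: GM.
by exists (invmx g *m h); [apply: (GM) => //; exact: GV|rewrite mulKVmx].
Qed.

Lemma finite_index_arithmetic : finite_index G (@PSL2Z R) -> arithmetic_group G.
Proof.
move=> fi; exists 1%:M; first by rewrite det1.
have -> : [set 1%:M *m g *m invmx 1%:M | g in G] = G; last exact: finite_index_commensurable.
by apply/seteqP; split=> [_ [g Gg <-]|g Gg]; [|exists g => //]; rewrite mul1mx invmx1 mulmx1.
Qed.

Lemma integral_discrete : G `<=` @PSL2Z R -> discrete G.
Proof.
move=> sG g Gg; split; [exact/mem_set|exists (ball g 1); first exact: nbhsx_ballx].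
apply/seteqP; split=> [h [/= gh Gh]|_ ->]; last by split => //; exact: ballxx.
have [[_ /= ig] [_ /= ih]] := (sG _ Gg, sG _ Gh).
have key i j : h i j = g i j.
  have [_ /(_ i j)] := gh; rewrite /ball /=.
  have /intrP[m ->] := ig i j; have /intrP[n ->] := ih i j.
  rewrite -intrB -intr_norm (ltr_int _ _ 1) => mn; congr _%:~R; lia.
by apply: mx2P.
Qed.

End IntegralGroup.

(** * The action of the modular group on cosets, and a hyperbolic element of small trace *)

Section Cosets.
Variable R : realType.
Variable G : set 'M[R]_2.
Hypotheses (gG : PSL2_subgroup G) (sG : G `<=` @PSL2Z R) (fi : finite_index G (@PSL2Z R)).
Implicit Types (A B : 'M[int]_2).

Let rG A := G (real_mx R A).

Let rG1 : rG 1%:M. Proof. by rewrite /rG real_mx1; case: gG => _ []. Qed.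
Let rGN1 : rG (- 1%:M). Proof. by rewrite /rG real_mxN real_mx1; case: gG => _ []. Qed.
Let rGM A B : rG A -> rG B -> rG (A *m B).
Proof. by rewrite /rG real_mxM; case: gG => _ _ h _; apply: h. Qed.
Let rGV A : \det A = 1 -> rG A -> rG (invmx A).
Proof. by move=> dA; rewrite /rG -inv_real_mx //; case: gG => _ _ _; apply. Qed.

(** [c] classifies the cosets of the form [G A]. The finite invariant [k] separates cosets on the
    other side, whence the inverse in [k']; as [k'] may take several values on one coset, [code]
    selects one of them by a choice that depends on the coset only. *)
Lemma coset_type : exists (X : finType) (c : 'M[int]_2 -> X),
  (forall A B, \det A = 1 -> \det B = 1 -> (c A = c B <-> rG (A *m invmx B))) /\
  (forall x, exists2 A, \det A = 1 & c A = x).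
Proof.
have [K [k kP]] := finite_index_fin_ind gG (PSL2Z_group R) fi.
pose k' A := k (real_mx R (invmx A)).
have k'P A B : \det A = 1 -> \det B = 1 -> k' A = k' B -> rG (A *m invmx B).
  move=> dA dB /(kP _ _ (PSL2Z_real R (det_inv1 dA)) (PSL2Z_real R (det_inv1 dB))).
  by rewrite inv_real_mx ?det_inv1 // invmxK -real_mxM.
pose cls A := [set x | exists B, [/\ \det B = 1, k' B = x & rG (B *m invmx A)]].
pose code A := xget (k' 1%:M) (cls A).
have codeP A : \det A = 1 -> cls A (code A).
  move=> dA; rewrite /code; case: xgetP => [x _ //|/(_ (k' A))]; case.
  by exists A; split => //; rewrite mulmxV ?det1_unit.
have clsE A B : \det A = 1 -> \det B = 1 -> rG (A *m invmx B) -> cls A = cls B.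
  move=> dA dB AB; apply/seteqP; split => x [C [dC kC hC]]; exists C; split => //.
    by have := rGM hC AB; rewrite mulmxA mulmxKV ?det1_unit.
  have BA := rGV (det_mul1 dA (det_inv1 dB)) AB.
  rewrite invmx_mul ?det_inv1 // invmxK in BA.
  by have := rGM hC BA; rewrite mulmxA mulmxKV ?det1_unit.
pose P : pred K := fun x => `[< exists2 A, \det A = 1 & code A = x >].
have P0 : P (code 1%:M) by apply/asboolP; exists 1%:M; rewrite ?det1.
pose X : finType := {x : K | P x}.
pose c A : X := insubd (Sub (code 1%:M) P0 : X) (code A).
have cE A : \det A = 1 -> val (c A) = code A.
  by move=> dA; rewrite insubdK //; apply/asboolP; exists A.
exists X, c; split=> [A B dA dB|x].
  split=> [/(congr1 val)|AB]; last first.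
    by apply: val_inj; rewrite !cE // /code (clsE A B).
  rewrite !cE // => e; have [C [dC kC hC]] := codeP A dA; have [E [dE kE hE]] := codeP B dB.
  have CE := k'P _ _ dC dE (etrans kC (etrans e (esym kE))).
  have AC := rGV (det_mul1 dC (det_inv1 dA)) hC.
  rewrite invmx_mul ?det_inv1 // invmxK in AC.
  have := rGM (rGM AC CE) hE.
  by rewrite !mulmxA mulmxKV ?det1_unit // mulmxKV ?det1_unit.
have /asboolP [A dA Ax] := valP x; exists A => //; apply: val_inj; by rewrite cE.
Qed.

Section Action.
Variables (X : finType) (c : 'M[int]_2 -> X).
Hypothesis cP : forall A B, \det A = 1 -> \det B = 1 -> (c A = c B <-> rG (A *m invmx B)).
Hypothesis cS : forall x, exists2 A, \det A = 1 & c A = x.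

Lemma c_mul A B C : \det A = 1 -> \det B = 1 -> \det C = 1 -> c A = c B -> c (A *m C) = c (B *m C).
Proof.
move=> dA dB dC /(cP dA dB) h; apply/cP; rewrite ?det_mul1 //.
by rewrite invmx_mul // mulmxA mulmxK ?det1_unit.
Qed.

Lemma c_opp A : \det A = 1 -> c (- A) = c A.
Proof.
move=> dA; apply/cP; rewrite ?det_opp2 //.
by rewrite mulNmx mulmxV ?det1_unit.
Qed.

Definition cact (M : 'M[int]_2) (x : X) : X := c (xget 1%:M [set A | \det A = 1 /\ c A = x] *m M).

Lemma cactE M A : \det M = 1 -> \det A = 1 -> cact M (c A) = c (A *m M).
Proof.
move=> dM dA; rewrite /cact; case: xgetP => [B _ [dB e]|/(_ A)]; last by case.
exact: c_mul.
Qed.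

Lemma cactM M N x : \det M = 1 -> \det N = 1 -> cact N (cact M x) = cact (M *m N) x.
Proof.
move=> dM dN; have [A dA <-] := cS x.
by rewrite !cactE ?det_mul1 // mulmxA.
Qed.

Lemma cact1 x : cact 1%:M x = x.
Proof. by have [A dA <-] := cS x; rewrite cactE ?det1 // mulmx1. Qed.

Lemma cactN M x : \det M = 1 -> cact (- M) x = cact M x.
Proof. by move=> dM; have [A dA <-] := cS x; rewrite !cactE ?det_opp2 // mulmxN c_opp ?det_mul1. Qed.

Lemma cact_inj M : \det M = 1 -> injective (cact M).
Proof.
move=> dM; apply: (can_inj (g := cact (invmx M))) => x.
by rewrite cactM ?det_inv1 // mulmxV ?det1_unit // cact1.
Qed.

Definition sp : {perm X} := perm (cact_inj det_mS).
Definition up : {perm X} := perm (cact_inj det_mU).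
Definition tp : {perm X} := perm (cact_inj (det_mT 1)).

Lemma spE x : sp x = cact mS x. Proof. by rewrite permE. Qed.
Lemma upE x : up x = cact mU x. Proof. by rewrite permE. Qed.
Lemma tpE x : tp x = cact (mT 1) x. Proof. by rewrite permE. Qed.

Lemma sp2 x : sp (sp x) = x.
Proof. by rewrite !spE cactM ?det_mS // mSS cactN ?det1 // cact1. Qed.

Lemma up3 x : up (up (up x)) = x.
Proof. by rewrite !upE !cactM ?det_mul1 ?det_mU // mUUU cact1. Qed.

Lemma tp_su x : tp x = sp (up (up x)).
Proof. by rewrite tpE spE !upE !cactM ?det_mul1 ?det_mU ?det_mS // mT1 -mulmxA. Qed.

Lemma tp_iter n x : iter n tp x = cact (mT n%:Z) x.
Proof.
elim: n => [|n IH]; first by rewrite mT0 cact1.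
by rewrite iterS IH tpE cactM ?det_mT // -mTD; congr (cact (mT _) _); lia.
Qed.

Hypothesis tf : torsion_free G.

(** A coset fixed by [M] gives the element [A *m M *m invmx A] of [G], which has finite order modulo
    sign together with [M]. *)
Lemma cact_free M (k : nat) x : \det M = 1 -> (0 < k)%N -> M ^+ k = 1 \/ M ^+ k = -1 ->
  M <> 1%:M -> M <> - 1%:M -> cact M x <> x.
Proof.
move=> dM k0 Mk M1 M2; have [A dA <-] := cS x; rewrite cactE // => /cP h.
have {}h : rG (A *m M *m invmx A) by apply: h; rewrite ?det_mul1.
have pw n : (A *m M *m invmx A) ^+ n = A *m M ^+ n *m invmx A.
  elim: n => [|n IH]; first by rewrite !expr0 mulmx1 mulmxV ?det1_unit.
  by rewrite !exprS IH -[LHS]/(_ *m _) !mulmxA mulmxKV ?det1_unit.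
have rpw n B : real_mx R B ^+ n = real_mx R (B ^+ n).
  by elim: n => [|n IH]; rewrite ?expr0 ?real_mx1 // !exprS real_mxM -IH.
have uA := det1_unit dA.
have cancel (B C : 'M[int]_2) : A *m B *m invmx A = A *m C *m invmx A -> B = C.
  by move=> /(congr1 (mulmx^~ A)); rewrite !mulmxKV // => /(can_inj (mulKmx uA)).
have [] := tf h k0.
- rewrite rpw pw; case: Mk => ->; [left|right].
    by rewrite -[1]/(1%:M) mulmx1 mulmxV // real_mx1.
  by rewrite -[1]/(1%:M) mulmxN mulNmx mulmx1 mulmxV // real_mxN real_mx1.
- rewrite -real_mx1 => /real_mx_inj e; apply: M1; apply: cancel.
  by rewrite e mulmx1 mulmxV.
rewrite -real_mx1 -real_mxN => /real_mx_inj e; apply: M2; apply: cancel.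
by rewrite e mulmxN mulNmx mulmx1 mulmxV.
Qed.

Lemma sp_free x : sp x <> x.
Proof.
rewrite spE; apply: (@cact_free _ 2) => //; first exact: det_mS.
- by right; rewrite expr2; exact: mSS.
- by rewrite mx2_1 => /mx2_inj[].
by rewrite mx2_1 opp_mx2 => /mx2_inj[].
Qed.

Lemma up_free x : up x <> x.
Proof.
rewrite upE; apply: (@cact_free _ 3) => //; first exact: det_mU.
- by left; rewrite !exprS expr0 mulr1; exact: mUUU.
- by rewrite mx2_1 => /mx2_inj[].
by rewrite mx2_1 opp_mx2 => /mx2_inj[].
Qed.

Section Cocycle.
Variable a : {ffun X -> bool}.
Hypothesis as_ : forall x, a (sp x) = a x.
Hypothesis ac : forall C, C \in porbits tp -> cusp_parity a C = false.

(** The double cover of the coset space given by the cocycle [a]: crossing an edge by [sp] changes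
    the sheet where [a] is true, turning by [up] does not. Invariance of [a] under [sp] makes [fs]
    an involution. *)
Let fs (q : X * bool) := (sp q.1, q.2 (+) a q.1).
Let fu (q : X * bool) := (up q.1, q.2).

Let fs_inj : injective fs.
Proof. by apply: inv_inj => -[x e]; rewrite /fs /= sp2 as_ addbK. Qed.
Let fu_inj : injective fu.
Proof. by move=> [x e] [y f] [] /perm_inj -> ->. Qed.

Let ps : {perm X * bool} := perm fs_inj.
Let pu : {perm X * bool} := perm fu_inj.

Let ps2 : (ps * ps = 1)%g.
Proof. by apply/permP => -[x e]; rewrite permM perm1 !permE /fs /= sp2 as_ addbK. Qed.
Let pu3 : (pu * (pu * pu) = 1)%g.
Proof. by apply/permP => -[x e]; rewrite !permM perm1 !permE /fu /= up3. Qed.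

Let ma := slact ps pu.

Let ma_fst A q : \det A = 1 -> (ma A q).1 = cact A q.1.
Proof.
move=> dA; have := slactP ps pu dA; rewrite -/(ma A); move: (ma A) => p pr.
suff [] : \det A = 1 /\ forall q, (p q).1 = cact A q.1 by move=> _; apply.
elim: pr => {dA A p q} [|A x _ [dA IH]|A x _ [dA IH]|A x _ [dA IH]].
- by rewrite det1; split => // q; rewrite perm1 cact1.
- split; first by rewrite det_mul1 ?det_mS.
  by move=> q; rewrite permM IH permE /= spE cactM ?det_mS.
- split; first by rewrite det_mul1 ?det_mU.
  by move=> q; rewrite permM IH permE /= upE cactM ?det_mU.
by rewrite det_opp2; split => // q; rewrite IH cactN.
Qed.

Let ma_flip A x e : \det A = 1 -> (ma A (x, ~~ e)).2 = ~~ (ma A (x, e)).2.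
Proof.
move=> dA; have := slactP ps pu dA; rewrite -/(ma A); move: (ma A) => p pr.
suff h : forall x e, p (x, ~~ e) = ((p (x, e)).1, ~~ (p (x, e)).2) by rewrite h.
elim: pr => {dA A p x e} [|A p _ IH|A p _ IH|A p _ IH] x e //.
- by rewrite !perm1.
- by rewrite !permM !permE /fs /= -IH; case: e; case: (a x).
by rewrite !permM !permE /fu /= -IH.
Qed.

Let pt := (pu * pu * ps)%g.

Let pt_iter n x e : (pt ^+ n)%g (x, e) = (iter n tp x, e (+) odd (\sum_(k < n) (a (iter k.+1 tp x) : nat))%N).
Proof.
elim: n => [|n IH]; first by rewrite expg0 perm1 big_ord0 addbF.
rewrite expgSr permM IH !permM !permE /fu /fs /= -tp_su big_ord_recr /= oddD oddb -addbA.
by congr (_, _ (+) (_ (+) _)); rewrite tp_su as_.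
Qed.

(** One full turn around a cusp changes the sheet by the parity of [a] over that cusp, which is
    even. *)
Let pt_period x e : (pt ^+ #|porbit tp x|)%g (x, e) = (x, e).
Proof.
rewrite pt_iter iter_porbit; congr pair.
have -> : (\sum_(k < #|porbit tp x|) (a (iter k.+1 tp x) : nat))%N = #|[set y in porbit tp x | a y]%SET|.
  have px : porbit tp (tp x) = porbit tp x.
    by apply/eqP; rewrite eq_porbit_mem; apply/porbitP; exists 1%N; rewrite expg1.
  rewrite -[in RHS]px -[#|[set _ in _ | _]%SET|]sum1_card.
  rewrite (eq_bigl (fun y => (y \in traject tp (tp x) #|porbit tp (tp x)|) && a y)); last first.
    by move=> y; rewrite !finset.inE porbit_traject.
  rewrite big_mkcondr /= -(big_uniq _ (uniq_traject_porbit tp (tp x))) /=.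
  rewrite (big_nth (tp x)) size_traject px big_mkord; apply: eq_bigr => i _.
  by rewrite (nth_traject tp (ltn_ord i)) -iterSr /=; case: (a _).
by have := ac (imset_f (porbit tp) (isT : x \in X)); rewrite /cusp_parity => ->; rewrite addbF.
Qed.

Let pt_fix n x e : iter n tp x = x -> (pt ^+ n)%g (x, e) = (x, e).
Proof.
move=> nx; set w := #|porbit tp x|.
have w0 : (0 < w)%N by apply/card_gt0P; exists x; exact: porbit_id.
have wq q : iter (q * w)%N tp x = x.
  by elim: q => // q IH; rewrite mulSn iterD IH iter_porbit.
have r0 : (n %% w = 0)%N.
  have rx : iter (n %% w)%N tp x = x by move: nx; rewrite {1}(divn_eq n w) addnC iterD wq.
  have := @nth_uniq _ x (traject tp x w) (n %% w)%N 0%N.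
  rewrite size_traject ltn_mod w0 uniq_traject_porbit => /(_ isT isT isT).
  by rewrite !nth_traject ?ltn_mod // rx eqxx => /esym/eqP.
rewrite (divn_eq n w) r0 addn0 mulnC expgM; elim: (n %/ w)%N => [|q IH]; first by rewrite expg0 perm1.
by rewrite expgS permM pt_period IH.
Qed.

Hypothesis gz : genus_zero G.

(** The elements of [G] that fix the sheets over the base coset form a normal subgroup containing
    the parabolic ones, hence all of [G]: the double cover is trivial. The sheet reached at a coset
    from [(x0, false)] then depends on the coset alone, and is the wanted [e]. *)
Lemma cocycle_coboundary : exists2 e : {ffun X -> bool},
  (forall x, e (up x) = e x) & (forall x, a x = e x (+) e (sp x)).
Proof.
pose x0 := c 1%:M.
have cx0 A : \det A = 1 -> cact A x0 = c A by move=> dA; rewrite cactE ?det1 // mul1mx.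
have rGc A : \det A = 1 -> rG A -> c A = x0.
  by move=> dA hA; apply/cP; rewrite ?det1 // invmx1 mulmx1.
have cG := finite_index_commensurable gG fi.
pose fx A := ma A (x0, false) = (x0, false).
have fxe A e : \det A = 1 -> fx A -> ma A (x0, e) = (x0, e).
  move=> dA; rewrite /fx; case: e => // hA.
  rewrite (surjective_pairing (ma A (x0, true))); congr pair.
    by rewrite ma_fst //=; have := ma_fst (x0, false) dA; rewrite hA.
  by have := ma_flip x0 false dA; rewrite hA.
have fixv (p : {perm X * bool}) y : p y = y -> (p^-1)%g y = y.
  by move=> py; apply: (@perm_inj _ p); rewrite permKV.
pose N : set 'M[R]_2 := [set g | exists A, [/\ \det A = 1, g = real_mx R A, rG A & fx A]].
have [Gd _ GM GV] := gG.
have NG : normal_in N G.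
  split.
  - by move=> g [A [_ -> hA _]].
  - by exists 1%:M; rewrite det1 real_mx1 /fx /ma slact1 // perm1.
  - move=> _ _ [A [dA -> hA fA]] [B [dB -> hB fB]]; exists (A *m B).
    by rewrite det_mul1 // real_mxM; split => //; [exact: rGM|rewrite /fx /ma slactM // permM -/(ma A) fA].
  - move=> _ [A [dA -> hA fA]]; exists (invmx A); rewrite det_inv1 // inv_real_mx //.
    by split => //; [exact: rGV|rewrite /fx /ma slactV //; exact: fixv].
  move=> g _ Gg [A [dA -> hA fA]]; have /PSL2ZP[B dB gB] := sG Gg; rewrite gB in Gg *.
  have dV := det_inv1 dB.
  exists (invmx B *m A *m B); rewrite !det_mul1 // inv_real_mx // -!real_mxM; split => //.
    by apply: rGM => //; apply: rGM => //; exact: rGV.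
  rewrite /fx /ma !slactM ?det_mul1 // !permM -/(ma _) -/(ma _) -/(ma _).
  have e1 : (ma (invmx B) (x0, false)).1 = x0.
    by rewrite ma_fst //= cx0 // rGc //; exact: rGV.
  have -> : ma A (ma (invmx B) (x0, false)) = ma (invmx B) (x0, false).
    by move: e1; case: (ma (invmx B) _) => q e /= ->; exact: fxe.
  by rewrite /ma slactV // permKV.
have Nopp : N (- 1%:M).
  by exists (- 1%:M); rewrite det_opp2 det1 real_mxN real_mx1 /fx /ma slactN ?det1 // slact1 // perm1.
(* Up to sign and conjugation the element is a power of [mT 1] that fixes the coset [c B]; by
   [pt_fix] it fixes both sheets over it. *)
have Npar g : G g -> parabolic g -> N g.
  move=> Gg pg; have /PSL2ZP[A dA gA] := sG Gg; rewrite gA in Gg pg *.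
  exists A; split => //; have [tA _ _] := pg.
  have [B [k [n [dB AB]]]] := int_parabolic dA tA.
  have sgn (M : 'M[int]_2) : \det M = 1 -> ma ((-1) ^+ n *: M) = ma M /\ c ((-1) ^+ n *: M) = c M.
    by move=> dM; case: (n); rewrite ?expr0 ?scale1r // expr1 scaleN1r /ma slactN // c_opp.
  have [m1 c1] := sgn _ (det_mul1 dB (det_mT k)).
  have cB : cact (mT k) (c B) = c B.
    rewrite cactE ?det_mT // -c1 -AB; apply/cP; rewrite ?det_mul1 //.
    by rewrite mulmxK ?det1_unit.
  have mT_fix e : ma (mT k) (c B, e) = (c B, e).
    have nn (j : nat) : cact (mT j%:Z) (c B) = c B -> ma (mT j%:Z) (c B, e) = (c B, e).
      by move=> hj; rewrite /ma slactTn // -/pt pt_fix // tp_iter.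
    move: cB; case: (intP k) => [_|j|j hj]; first by rewrite mT0 /ma slact1 // perm1.
      exact: nn.
    have TV : mT (- j.+1%:Z) = invmx (mT j.+1).
      by apply: (can_inj (mulKmx (det1_unit (det_mT j.+1)))); rewrite -mTD subrr mT0 mulmxV ?det1_unit ?det_mT.
    rewrite TV /ma slactV ?det_mT //; apply: fixv; apply: nn.
    by rewrite -{1}hj cactM ?det_mT // -mTD addNr mT0 cact1.
  have E : (ma A * ma B)%g = (ma B * ma (mT k))%g.
    by rewrite /ma -!slactM ?det_mT // AB.
  apply: (@perm_inj _ (ma B)); rewrite -permM E permM.
  rewrite (surjective_pairing (ma B (x0, false))) ma_fst //= cx0 //; exact: mT_fix.
have [P [fP PS [f fq]]] := gz.
have GN := arith_monodromy gG cG tf NG Nopp Npar fP fq.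
have rGfix A : \det A = 1 -> rG A -> fx A.
  by move=> dA /GN [B [dB /real_mx_inj -> _]].
pose ee A := (ma A (x0, false)).2.
have eeE A B : \det A = 1 -> \det B = 1 -> c A = c B -> ee A = ee B.
  move=> dA dB /(cP dA dB) h; have dV := det_inv1 dB.
  rewrite /ee -{1}(mulmxKV (det1_unit dB) A) /ma slactM ?det_mul1 // permM -/(ma _).
  by rewrite (rGfix _ (det_mul1 dA dV) h).
have /choice[r rP] : forall x, exists A, \det A = 1 /\ c A = x by move=> x; have [A] := cS x; exists A.
exists [ffun x => ee (r x)] => x; rewrite !ffunE; have [dr cr] := rP x.
  have [dr' cr'] := rP (up x).
  rewrite (eeE (r (up x)) (r x *m mU)) ?det_mul1 ?det_mU //.
    by rewrite /ee /ma slactM ?det_mU // permM slactU // permE.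
  by rewrite cr' -cactE ?det_mU // cr upE.
have [dr' cr'] := rP (sp x).
rewrite (eeE (r (sp x)) (r x *m mS)) ?det_mul1 ?det_mS //; last by rewrite cr' -cactE ?det_mS // cr spE.
rewrite /ee /ma slactM ?det_mS // permM slactS // permE /= -/(ma _) ma_fst //= cx0 // cr.
by rewrite addbA addbb addFb.
Qed.

End Cocycle.
Let dR A : \det A = 1 -> \det (real_mx R A) = 1.
Proof. by move=> dA; rewrite det_real_mx dA. Qed.

Lemma parab_cj A (k : int) : \det A = 1 -> parab k%:~R (real_mx R A *m e1 R) = real_mx R (A *m mT k *m invmx A).
Proof.
move=> dA; have uA := det1_unit (dR dA).
apply: (can_inj (mulmxK uA)).
rewrite -parab_conj ?dR // -real_mxM mulmxKV ?det1_unit // real_mxM; congr (_ *m _).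
by apply: mx2P; rewrite !mxE /=; ring.
Qed.

Let w (x : X) : nat := #|porbit tp x|.

(** The power of [mT 1] given by the width fixes the coset of [A], so its conjugate by [A] lies in
    [G]. *)
Lemma parab_width A (k : int) : \det A = 1 -> G (parab (k * (w (c A))%:Z)%:~R (real_mx R A *m e1 R)).
Proof.
move=> dA.
have h : rG (A *m mT (w (c A)) *m invmx A).
  apply/cP; rewrite ?det_mul1 ?det_mT // -cactE ?det_mT // -tp_iter; exact: iter_porbit.
rewrite /rG -parab_cj // in h.
have nn (n : nat) : G (parab (n%:Z * (w (c A))%:Z)%:~R (real_mx R A *m e1 R)).
  have := PSL2_subgroupX n gG h; rewrite parabX; congr (G (parab _ _)).
  by rewrite intrM mulrzl.
case: (intP k) => [|n|n]; first exact: (nn 0%N).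
  exact: nn.
have [_ _ _ GV] := gG; have := GV _ (nn n.+1).
by rewrite mulNr mulrNz -[invmx _]mulmx1 -(parab0 (real_mx R A *m e1 R)) -(subrr (n.+1%:Z * (w (c A))%:Z)%:~R) -parabM mulKmx ?det1_unit ?det_parab.
Qed.

Lemma width_bound A B : \det A = 1 -> \det B = 1 ->
  (forall g, G g -> hyperbolic g -> 10 < `|\tr g|) ->
  forall D : int, det2 (real_mx R A *m e1 R) (real_mx R B *m e1 R) = D%:~R -> D != 0 ->
  (13 <= w (c A) * w (c B) * `|D| ^ 2)%N.
Proof.
move=> dA dB hG D DE D0.
have w0 x : (0 < w x)%N by apply/card_gt0P; exists x; exact: porbit_id.
have [_ _ GM _] := gG.
set n := (_ * _ * _)%N; have n0 : (0 < n)%N by rewrite /n !muln_gt0 !w0 /= absz_gt0 D0.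
have T (k : int) : G (parab (k * (w (c A))%:Z)%:~R (real_mx R A *m e1 R) *m parab (1 * (w (c B))%:Z)%:~R (real_mx R B *m e1 R)) /\
    \tr (parab (k * (w (c A))%:Z)%:~R (real_mx R A *m e1 R) *m parab (1 * (w (c B))%:Z)%:~R (real_mx R B *m e1 R)) = (2 - k * n%:Z)%:~R.
  split; first by apply: GM; exact: parab_width.
  rewrite tr_parabM DE mul1r rmorphB /= !intrM -!mulrA; congr (_ - _ * _).
  rewrite -!rmorphXn -!rmorphM /=; congr (_%:~R); rewrite /n !PoszM -mulrA; congr (_ * (_ * _)).
  by rewrite -PoszM mulnn -abszX gez0_abs ?sqr_ge0.
rewrite ltnNge; apply/negP => n12.
have big : forall k : int, (2 < `|2 - k * n%:Z|)%R -> (10 < `|2 - k * n%:Z|)%R.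
  move=> k hk; have [Gk Tk] := T k; have := hG _ Gk; rewrite /hyperbolic Tk -intr_norm.
  by rewrite (ltr_int _ 2) (ltr_int _ 10) => /(_ hk).
(* The trace [2 + n] is hyperbolic in any case, so [n >= 9]; then [2 - n] is hyperbolic as well and
   [n - 2 > 10]. *)
by have := big 1; have := big (-1); lia.
Qed.

(** The cusp of a coset is the orbit of [A *m e1], and the matrices that fix [e1] up to sign are, up
    to sign, the translations [mT k]. *)
Lemma porbit_cusp A B : \det A = 1 -> \det B = 1 ->
  (porbit tp (c A) = porbit tp (c B) <-> boundary_orbit G (real_mx R A *m e1 R) (real_mx R B *m e1 R)).
Proof.
move=> dA dB.
have Te1 (k : int) : real_mx R (mT k) *m e1 R = e1 R.
  by apply: cvP; rewrite mulmx2E !mxE /= ?mulr1 ?mulr0 ?addr0.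
split=> [e|[g Gg [z z0 e]]].
  have : c B \in porbit tp (c A) by rewrite e porbit_id.
  case/porbitP => n; rewrite permX tp_iter cactE ?det_mT // => /esym/cP h.
  have {}h : rG (A *m mT n *m invmx B) by apply: h; rewrite ?det_mul1 ?det_mT.
  apply: boundary_orbit_sym => //; exists (real_mx R (A *m mT n *m invmx B)) => //.
  exists 1; rewrite ?oner_neq0 // scale1r mulmxA -real_mxM mulmxKV ?det1_unit //.
  by rewrite real_mxM -mulmxA Te1.
have /PSL2ZP[C dC gC] := sG Gg; rewrite gC in Gg e.
pose M := invmx B *m (C *m A).
have dM : \det M = 1 by rewrite !det_mul1 ?det_inv1.
have cM : c (B *m M) = c A.
  rewrite /M mulKVmx ?det1_unit //; apply/cP; rewrite ?det_mul1 //.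
  by rewrite mulmxK ?det1_unit.
have fv P : \det P = 1 -> farey_vertex (real_mx R P *m e1 R).
  by move=> dP; apply/farey_vertexP; exists (real_mx R P) => //; exact: PSL2Z_real.
have pm : M 1 0 = 0.
  have E : real_mx R M *m e1 R = z *: e1 R.
    rewrite /M !real_mxM -!mulmxA e -scalemxAr; congr (_ *: _).
    by rewrite mulmxA -real_mxM mulVmx ?det1_unit // real_mx1 mul1mx.
  move/matrixP/(_ 1 0): E; rewrite mulmx2E !mxE /= mulr1 !mulr0 addr0 => /eqP.
  by rewrite intr_eq0 => /eqP.
have [m [k [q [l ME]]]] := mx2_ex M; rewrite ME !mxE /= in pm; rewrite pm in ME.
have ml : m * l = 1 by rewrite -dM ME det_mx2 mulr0 subr0.
have key (k' : int) : porbit tp (c B) = porbit tp (cact (mT k') (c B)).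
  apply/eqP; rewrite eq_porbit_mem.
  have nn (n : nat) x : x \in porbit tp (cact (mT n) x).
    by rewrite porbit_sym -tp_iter -permX; exact: mem_porbit.
  case: (intP k') => [|n|n]; [exact: (nn 0%N)|exact: nn|].
  rewrite porbit_sym; have := nn n.+1 (cact (mT (- n.+1%:Z)) (c B)).
  by rewrite cactM ?det_mT // -mTD addNr mT0 cact1.
have [m1|m1] := int_unit ml.
  have l1 : l = 1 by rewrite m1 mul1r in ml.
  by rewrite -cM ME m1 l1 (key k) cactE ?det_mT.
have l1 : l = -1 by rewrite m1 mulN1r in ml; rewrite -ml opprK.
rewrite -cM ME m1 l1 (key (- k)) cactE ?det_mT // -c_opp ?det_mul1 ?det_mT //.
  by rewrite -mulmxN /mT opp_mx2 opprK oppr0.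
by rewrite det_mx2; ring.
Qed.

(** In the basis of [int_parabolic] the element is a nontrivial translation up to sign, whose only
    eigenvectors are the multiples of [e1]. *)
Lemma parabolic_fixed_farey v : parabolic_fixed_point G v ->
  exists A, \det A = 1 /\ same_point v (real_mx R A *m e1 R).
Proof.
move=> [v0 [g [Gg pg [z z0 e]]]].
have /PSL2ZP[M dM gM] := sG Gg; rewrite gM in pg e; have [tM M1 M2] := pg.
have [B [k [n [dB MB]]]] := int_parabolic dM tM; exists B; split => //.
have uB := det1_unit (dR dB).
have k0 : k != 0.
  apply/eqP => k0; rewrite k0 mT0 mulmx1 in MB.
  have ME : M = (-1) ^+ n *: 1%:M.
    by apply: (can_inj (mulmxK (det1_unit dB))); rewrite MB -scalemxAl mul1mx.
  by move: M1 M2; rewrite ME; case: (n); rewrite ?expr0 ?scale1r ?expr1 ?scaleN1r ?real_mxN real_mx1.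
pose u := invmx (real_mx R B) *m v.
have vE : v = real_mx R B *m u by rewrite mulKVmx.
have E : real_mx R (mT k) *m u = ((-1) ^+ n * z) *: u.
  apply: (can_inj (mulKmx uB)); rewrite -scalemxAr -vE mulmxA -real_mxM.
  have -> : B *m mT k = (-1) ^+ n *: (M *m B) by rewrite MB scalerA -signr_addb addbb expr0 scale1r.
  have -> : real_mx R ((-1) ^+ n *: (M *m B)) = (-1) ^+ n *: real_mx R (M *m B).
    by case: (n); rewrite ?expr0 ?scale1r // expr1 !scaleN1r real_mxN.
  by rewrite -scalemxAl real_mxM -mulmxA -vE e scalerA.
clearbody u.
have u1 : u 1 0 = 0.
  have /matrixP/(_ 0 0) E0 := E; have /matrixP/(_ 1 0) E1 := E; move: E0 E1.
  rewrite !mulmx2E !mxE /= mul0r add0r mul1r; move: (_ * z) => r E0 E1.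
  apply/eqP; apply: contraTT k0 => u1; have r1 : r = 1 by apply: (mulIf u1); rewrite -E1 mul1r.
  move: E0; rewrite r1 !mul1r => /eqP; rewrite addrC -subr_eq0 addrK mulf_eq0 (negbTE u1) orbF intr_eq0.
  by move=> ->.
have uE : u = u 0 0 *: e1 R by apply: cvP; rewrite !mxE /= ?mulr1 ?mulr0.
exists (u 0 0); last by rewrite {1}vE {1}uE -scalemxAr.
by apply: contraNneq v0 => z1; rewrite vE uE z1 scale0r mulmx0.
Qed.

Lemma farey_parabolic_fixed A : \det A = 1 -> parabolic_fixed_point G (real_mx R A *m e1 R).
Proof.
move=> dA.
have fv : farey_vertex (real_mx R A *m e1 R).
  by apply/farey_vertexP; exists (real_mx R A) => //; exact: PSL2Z_real.
have v0 := farey_neq0 fv; split => //.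
have h0 : (0 < w (c A))%N by apply/card_gt0P; exists (c A); exact: porbit_id.
have h := parab_width 1 dA; rewrite mul1r in h.
exists (parab (w (c A))%:Z%:~R (real_mx R A *m e1 R)); split => //.
  split; first by rewrite tr_parab ger0_norm.
    by move/(parab_inj_oo v0)/eqP; rewrite intr_eq0; lia.
  move/(congr1 mxtrace); rewrite tr_parab mx2_1 opp_mx2 tr_mx2; lra.
by exists 1; rewrite ?oner_neq0 // parab_fix scale1r.
Qed.

Lemma card_cusps n : has_cusps G n -> #|porbits tp| = n.
Proof.
move=> [s [s1 s2 s3]].
have /choice[A AP] : forall i, exists A, \det A = 1 /\ same_point (s i) (real_mx R A *m e1 R).
  by move=> i; exact: parabolic_fixed_farey.
have sA i : boundary_orbit G (s i) (real_mx R (A i) *m e1 R).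
  have [_ [z z0 e]] := AP i; have [_ [G1 _] _ _] := gG.
  by exists 1%:M => //; exists z => //; rewrite mul1mx.
have bs := boundary_orbit_sym gG; have bt := boundary_orbit_trans gG.
pose f i := porbit tp (c (A i)).
have fi_ : injective f.
  move=> i j; rewrite /f => /porbit_cusp h; apply: s2; apply: bt (sA i) (bt _ _ _ _ (bs _ _ (sA j))).
  by apply: h; [case: (AP i)|case: (AP j)].
rewrite -[RHS]card_ord -(card_imset _ fi_); apply: eq_card => C; apply/imsetP/imsetP.
  move=> [x _ ->]; have [B dB <-] := cS x.
  have [i hi] := s3 _ (farey_parabolic_fixed dB); exists i => //; apply/porbit_cusp => //.
    by case: (AP i).
  exact: bt hi (sA i).
by move=> [i _ ->]; exists (c (A i)).
Qed.

Lemma short_hyperbolic : genus_zero G -> has_cusps G 5 -> exists g, [/\ G g, hyperbolic g & `|\tr g| <= 10].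
Proof.
move=> gz hc; apply: contrapT => no.
have hG g : G g -> hyperbolic g -> 10 < `|\tr g|.
  by move=> Gg hg; rewrite ltNge; apply/negP => h; apply: no; exists g.
have t5 := card_cusps hc.
have X18 : (#|X| <= 18)%N.
  apply: (card_cosets_le (c 1%:M) sp2 sp_free up3 up_free (t := tp)); first by rewrite t5.
  by move=> a as_ ac; exact: cocycle_coboundary.
(* The coset of [A] stands for the edge from [A *m e1] to [A *m e2]: [sp] reverses it and [tp] turns
   it about its first end. The ends of an edge have determinant 1, and the far ends of two edges [d]
   turns apart have determinant [d] up to sign. *)
have SE (A : 'M[int]_2) : \det A = 1 -> sp (c A) = c (A *m mS) /\ real_mx R (A *m mS) *m e1 R = real_mx R A *m e2 R.
  move=> dA; rewrite spE cactE ?det_mS // real_mxM -mulmxA; split => //; congr (_ *m _).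
  by apply: cvP; rewrite mulmx2E !mxE /= ?mulr1 ?mulr0 ?addr0.
have dS A : \det A = 1 -> \det (A *m mS) = 1 by move=> dA; rewrite det_mul1 ?det_mS.
apply: (no_widths sp2 t5 X18) => [x|x d d0].
  have [A dA <-] := cS x; have [-> E] := SE _ dA.
  have := width_bound dA (dS _ dA) hG (D := 1); rewrite muln1; apply => //.
  by rewrite E det2_mul dR // mul1r /det2 !cvE; ring.
have [A dA <-] := cS x; have [-> E] := SE _ dA.
have dAT : \det (A *m mT d) = 1 by rewrite det_mul1 ?det_mT.
rewrite tp_iter cactE ?det_mT //; have [-> E'] := SE _ dAT.
have := width_bound (dS _ dA) (dS _ dAT) hG (D := - d%:Z); rewrite abszN; apply.
  rewrite E E' real_mxM -mulmxA det2_mul dR // mul1r /det2 !mulmx2E !mxE /= mulrNz.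
  by ring.
by rewrite oppr_eq0; lia.
Qed.

End Action.

End Cosets.

(** * From traces to systoles *)

Section Systole.
Variable R : realType.
Implicit Types (G : set 'M[R]_2) (g h : 'M[R]_2).

Lemma ler_arccosh (x y : R) : 1 <= x -> x <= y -> arccosh x <= arccosh y.
Proof.
move=> x1 xy; have x0 : 0 < x by apply: lt_le_trans x1.
rewrite /arccosh ler_ln ?posrE ?ltr_pwDl ?sqrtr_ge0 //; last exact: lt_le_trans xy.
by rewrite lerD // ler_wsqrtr // lerB // lerXn2r ?nnegrE ?(ltW x0) ?(le_trans (ltW x0)) //.
Qed.

Lemma arccosh_ge0 (x : R) : 1 <= x -> 0 <= arccosh x.
Proof. by move=> x1; rewrite ln_ge0 // -[1]addr0 lerD ?sqrtr_ge0. Qed.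

Lemma hyperbolic_half g : hyperbolic g -> 1 <= `|\tr g| / 2.
Proof. by rewrite /hyperbolic => h; rewrite ler_pdivlMr // mul1r ltW. Qed.

Lemma systole_le G g : G g -> hyperbolic g -> systole G <= 2 * arccosh (`|\tr g| / 2).
Proof.
move=> Gg hg; apply: ge_inf; last by exists g.
by exists 0 => _ [h [_ hh] <-]; rewrite mulr_ge0 // arccosh_ge0 // hyperbolic_half.
Qed.

Lemma systole_eq G g : G g -> hyperbolic g ->
  (forall h, G h -> hyperbolic h -> `|\tr g| <= `|\tr h|) -> systole G = 2 * arccosh (`|\tr g| / 2).
Proof.
move=> Gg hg gmin; apply/eqP; rewrite eq_le systole_le //=; apply: lb_le_inf; first by exists (2 * arccosh (`|\tr g| / 2)), g.
move=> _ [h [Gh hh] <-]; rewrite ler_pM2l // ler_arccosh ?hyperbolic_half //.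
by rewrite ler_pM2r ?invr_gt0 //; exact: gmin.
Qed.

Lemma arithmetic_systole_le G : punctured_sphere 5 G -> arithmetic_group G -> systole G <= 2 * arccosh 5.
Proof.
move=> pG aG; have [h [k [dh dk [[gG tf gz hc] fi]]]] := integral_conjugate pG aG.
have [sG _] := fi.
have [X [c [cP cS]]] := coset_type gG fi.
have [g [Gg hg tg]] := short_hyperbolic gG sG fi cP cS tf gz hc.
have [GG _ _ _] := pG.
have /(cjP _ dk) /(cjP _ dh) := Gg; set g' := _ *m h => Gg'.
have tr_g : \tr g' = \tr g.
  by rewrite /g' -{2}(invmxK h) tr_conj2 ?det_inv1 // -{2}(invmxK k) tr_conj2 ?det_inv1.
have hg' : hyperbolic g' by rewrite /hyperbolic tr_g.
apply: le_trans (systole_le Gg' hg') _; rewrite ler_pM2l // ler_arccosh ?hyperbolic_half //.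
rewrite tr_g; lra.
Qed.

End Systole.

(** * Labels of the Farey vertices *)

(** Labels are handled as natural numbers, so that properties of the bipyramid become closed Boolean
    checks over five values. *)
Lemma all_lt5P (P : nat -> nat -> bool) :
  all (fun i => all (P i) (iota 0 5)) (iota 0 5) -> forall i j : 'I_5, P i j.
Proof.
move=> /allP h i j; have /h/allP : (i : nat) \in iota 0 5 by rewrite mem_iota ltn_ord.
by apply; rewrite mem_iota ltn_ord.
Qed.

Definition eqnext (j : nat) : nat := if j == 4 then 2 else j.+1.
Definition eqprev (j : nat) : nat := if j == 2 then 4 else j.-1.
Definition dartn (i j : nat) : bool := (i != j) && ~~ ((i < 2)%N && (j < 2)%N).

(* The third vertex of the face to the left of the edge from i to j, when 2, 3, 4 run counterclockwise around 0. *)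
Definition third (i j : nat) : nat :=
  if i == 0 then eqnext j else if i == 1 then eqprev j
  else if j == 0 then eqprev i else if j == 1 then eqnext i else (j != eqnext i).

Definition third5 (i j : 'I_5) : 'I_5 := inord (third i j).

Lemma third5E (i j : 'I_5) : dartn i j -> third5 i j = third i j :> nat.
Proof.
move=> h; rewrite inordK //; apply/implyP: h; move: i j.
by apply: (all_lt5P (P := fun i j => dartn i j ==> (third i j < 5)%N)).
Qed.

Notation dart := {y : 'I_5 * 'I_5 | dartn y.1 y.2}.

Opaque third5.

Lemma dart_rot (i j : 'I_5) : dartn i j -> dartn j (third5 i j).
Proof.
move=> h; rewrite third5E //; apply/implyP: h; move: i j.
by apply: (all_lt5P (P := fun i j => dartn i j ==> dartn j (third i j))).
Qed.

Lemma dart_opp (i j : 'I_5) : dartn i j -> dartn j i.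
Proof. by rewrite /dartn eq_sym andbC [(_ && (_ < 2)%N)]andbC andbC. Qed.

Lemma third_rot (i j : 'I_5) : dartn i j -> third5 j (third5 i j) = i.
Proof.
move=> h; apply: val_inj; rewrite /= third5E ?dart_rot // third5E //.
apply/eqP; apply/implyP: h; move: i j.
by apply: (all_lt5P (P := fun i j => dartn i j ==> (third j (third i j) == i))).
Qed.

Lemma third_opp (i j : 'I_5) : dartn i j -> third5 i j <> third5 j i.
Proof.
move=> h e; have := third5E h; rewrite e (third5E (dart_opp h)) => /esym/eqP.
apply/negP; apply/implyP: h; move: i j {e}.
by apply: (all_lt5P (P := fun i j => dartn i j ==> (third i j != third j i))).
Qed.

Lemma third_neq (i j : 'I_5) : dartn i j -> uniq [:: i; j; third5 i j].
Proof.
move=> h; rewrite -(map_inj_uniq val_inj) /= third5E //; apply/implyP: h; move: i j.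
by apply: (all_lt5P (P := fun i j => dartn i j ==> uniq [:: i; j; third i j])).
Qed.

Definition dart_s (y : dart) : dart := exist _ ((val y).2, (val y).1) (dart_opp (valP y)).
Definition dart_u (y : dart) : dart :=
  exist _ ((val y).2, third5 (val y).1 (val y).2) (dart_rot (valP y)).

Lemma dart_sK : involutive dart_s.
Proof. by move=> y; apply: val_inj; case: y => -[]. Qed.

Lemma dart_uK y : dart_u (dart_u (dart_u y)) = y.
Proof.
apply: val_inj; case: y => -[i j] /= h; rewrite third_rot //; congr pair.
by have := third_rot (dart_rot h); rewrite (third_rot h).
Qed.

Lemma dart_u_inj : injective dart_u.
Proof. by apply: (can_inj (g := dart_u \o dart_u)) => y; exact: dart_uK. Qed.

Definition ds : {perm dart} := perm (can_inj dart_sK).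
Definition du : {perm dart} := perm dart_u_inj.

Lemma ds2 : (ds * ds = 1)%g.
Proof. by apply/permP => y; rewrite permM perm1 !permE dart_sK. Qed.

Lemma du3 : (du * (du * du) = 1)%g.
Proof. by apply/permP => y; rewrite !permM perm1 !permE dart_uK. Qed.

Definition dart0 : dart := exist _ (@Ordinal 5 0 isT, @Ordinal 5 2 isT) isT.

(** The dart onto which the oriented Farey edge from [A *m e1] to [A *m e2] is folded, when the edge
    from infinity to 0 goes to [dart0]. *)
Definition state (A : 'M[int]_2) : dart := slact ds du A dart0.

Lemma stateM A B : \det A = 1 -> \det B = 1 -> state (A *m B) = slact ds du B (state A).
Proof. by move=> dA dB; rewrite /state slactM ?ds2 ?du3 // permM. Qed.

Lemma stateN A : \det A = 1 -> state (- A) = state A.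
Proof. by move=> dA; rewrite /state slactN ?ds2 ?du3. Qed.

Lemma stateS A : \det A = 1 -> state (A *m mS) = dart_s (state A).
Proof. by move=> dA; rewrite stateM ?det_mS // slactS ?ds2 ?du3 // permE. Qed.

Lemma stateU A : \det A = 1 -> state (A *m mU) = dart_u (state A).
Proof. by move=> dA; rewrite stateM ?det_mU // slactU ?ds2 ?du3 // permE. Qed.

Lemma stateT A : \det A = 1 -> val (state (A *m mT 1)) =
  ((val (state A)).1, third5 (val (state A)).1 (val (state A)).2).
Proof.
move=> dA; rewrite mT1 !mulmxA stateS ?det_mul1 ?det_mU // !stateU ?det_mul1 ?det_mU //.
by case: (state A) => -[i j] h /=; rewrite third_rot.
Qed.

Lemma state_cancel A B C : \det A = 1 -> \det B = 1 -> \det C = 1 ->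
  state (A *m C) = state (B *m C) <-> state A = state B.
Proof. by move=> dA dB dC; rewrite !stateM //; split=> [/perm_inj|->]. Qed.

Lemma state_turn A k : \det A = 1 -> (val (state (A *m mT k))).1 = (val (state A)).1.
Proof.
move=> dA.
have nn (n : nat) B : \det B = 1 -> (val (state (B *m mT n))).1 = (val (state B)).1.
  elim: n B => [|n IH] B dB; first by rewrite mT0 mulmx1.
  have -> : mT n.+1 = mT 1 *m mT n by rewrite -mTD; congr mT; lia.
  by rewrite mulmxA IH ?det_mul1 ?det_mT // stateT.
case: (intP k) => [|n|n]; [exact: (nn 0%N)|exact: nn|].
rewrite -(nn n.+1) ?det_mul1 ?det_mT // -mulmxA -mTD addNr mT0 mulmx1 //.
Qed.

(** The vertices have degree 3 or 4, so fewer than four turns reach every dart with the same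
    origin. *)
Lemma turn_dart (i j k : nat) : (i < 5)%N -> (j < 5)%N -> (k < 5)%N -> dartn i j -> dartn i k ->
  exists2 n, (n < 4)%N & iter n (third i) j = k.
Proof.
move=> i5 j5 k5; move: i j i5 j5 => i j i5 j5.
have := all_lt5P (P := fun i j => all (fun k => dartn i j ==> dartn i k ==> has (fun n => iter n (third i) j == k) (iota 0 4)) (iota 0 5)) isT (Ordinal i5) (Ordinal j5).
move=> /allP/(_ k); rewrite mem_iota k5 => /(_ isT) /implyP h1 /h1 /implyP h2 /h2 /hasP[n].
by rewrite mem_iota => n4 /eqP e; exists n.
Qed.

Lemma iter_third A n : \det A = 1 -> iter n (third (val (state A)).1) (val (state A)).2 = (val (state (A *m mT n))).2 :> nat.
Proof.
move=> dA; elim: n => [|n IH]; first by rewrite mT0 mulmx1.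
rewrite iterS IH; have -> : mT n.+1 = mT n *m mT 1 by rewrite -mTD; congr mT; lia.
rewrite mulmxA stateT ?det_mul1 ?det_mT //= third5E ?state_turn //.
by have := valP (state (A *m mT n)); rewrite state_turn.
Qed.

Lemma state_turnP A B : \det A = 1 -> \det B = 1 -> (val (state A)).1 = (val (state B)).1 ->
  exists n : nat, state (A *m mT n) = state B.
Proof.
move=> dA dB e; have hA := valP (state A); have hB := valP (state B); rewrite -e in hB.
have [n _ nE] := turn_dart (ltn_ord _) (ltn_ord _) (ltn_ord _) hA hB; exists n; apply: val_inj.
rewrite (surjective_pairing (val _)) [RHS]surjective_pairing state_turn // e; congr pair.
by apply: val_inj; rewrite [LHS](esym (iter_third n dA)).
Qed.

Lemma state_surj (y : dart) : exists2 A, \det A = 1 & state A = y.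
Proof.
pose reach i j := exists A, \det A = 1 /\ val (state A) = (i, j).
have r0 : reach (val dart0).1 (val dart0).2.
  by exists 1%:M; rewrite det1 /state slact1 ?ds2 ?du3 // perm1.
have rs i j : reach i j -> reach j i.
  by move=> [A [dA e]]; exists (A *m mS); rewrite det_mul1 ?det_mS // stateS //= e.
have rt (i j k : 'I_5) : reach i j -> dartn i k -> reach i k.
  move=> [A [dA e]] h; have hA := valP (state A); rewrite e /= in hA.
  have [n _ nE] := turn_dart (ltn_ord _) (ltn_ord _) (ltn_ord _) hA h.
  exists (A *m mT n); split; first by rewrite det_mul1 ?det_mT.
  rewrite (surjective_pairing (val _)) state_turn // e; congr pair.
  by apply: val_inj; rewrite /= [LHS](esym (iter_third n dA)) e.
suff [A [dA e]] : reach (val y).1 (val y).2.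
  by exists A => //; apply: val_inj; rewrite e -surjective_pairing.
case: y => -[i j] /= h.
have r1 (k : 'I_5) : (1 < k)%N -> reach k (val dart0).1.
  by move=> k2; apply/rs/(rt _ _ _ r0); rewrite /dartn /= -leqNgt k2 andbT neq_ltn (ltnW k2).
have [i2|i2] := ltnP 1 i; first exact: rt (r1 _ i2) h.
apply: rs; apply: (rt _ (val dart0).1 _ (r1 _ _) (dart_opp h)).
by move: h; rewrite /dartn ltnS i2 /= -leqNgt => /andP[].
Qed.

Section Labels.
Variable R : realType.
Implicit Types (A B C : 'M[int]_2) (u v w : 'cV[R]_2).

Lemma real_mx_det1 A : \det A = 1 -> \det (real_mx R A) = 1.
Proof. by move=> dA; rewrite det_real_mx dA. Qed.

Lemma real_mx_unit A : \det A = 1 -> real_mx R A \in unitmx.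
Proof. by move=> dA; apply: det1_unit; exact: real_mx_det1. Qed.

Lemma det2Nl u v : det2 (- u) v = - det2 u v. Proof. by rewrite /det2 !mxE; ring. Qed.
Lemma det2Nr u v : det2 u (- v) = - det2 u v. Proof. by rewrite /det2 !mxE; ring. Qed.

Definition e3 : 'cV[R]_2 := cv 1 1.

Lemma mT_e1 k : real_mx R (mT k) *m e1 R = e1 R.
Proof. by apply: cvP; rewrite mulmx2E !mxE /=; ring. Qed.
Lemma mT_e2 : real_mx R (mT 1) *m e2 R = e3.
Proof. by apply: cvP; rewrite mulmx2E !mxE /=; ring. Qed.
Lemma mS_e1 : real_mx R mS *m e1 R = e2 R.
Proof. by apply: cvP; rewrite mulmx2E !mxE /=; ring. Qed.
Lemma mS_e2 : real_mx R mS *m e2 R = - e1 R.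
Proof. by apply: cvP; rewrite mulmx2E !mxE /=; ring. Qed.

Lemma mS_e3 : real_mx R mS *m e3 = cv (-1) 1.
Proof. by apply: cvP; rewrite mulmx2E !mxE /=; ring. Qed.

Lemma fix_e1 A : \det A = 1 -> real_mx R A *m e1 R = e1 R -> exists k, A = mT k.
Proof.
have [a [b [c [d ->]]]] := mx2_ex A; rewrite det_mx2 => dA e.
have /matrixP/(_ 0 0) := e; have /matrixP/(_ 1 0) := e; rewrite !mulmx2E !mxE /= !mulr1 !mulr0 !addr0.
move=> /eqP; rewrite intr_eq0 => /eqP c0 /eqP; rewrite (eqr_int R _ 1) => /eqP a1.
by exists b; move: dA; rewrite a1 c0 mulr0 subr0 mul1r => ->.
Qed.

Definition pm u v : Prop := u = v \/ u = - v.

Lemma pm_same u v : pm u v -> same_point u v.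
Proof.
case=> ->; first by exists 1; rewrite ?oner_neq0 // scale1r.
by exists (-1); rewrite ?oppr_eq0 ?oner_neq0 // scaleN1r.
Qed.

Lemma pm_sym u v : pm u v -> pm v u.
Proof. by case=> ->; [left|right; rewrite opprK]. Qed.

Lemma pm_trans u v w : pm u v -> pm v w -> pm u w.
Proof. by case=> -> [->|->]; rewrite ?opprK; [left|right|right|left]. Qed.

Lemma pm_mul g u v : pm u v -> pm (g *m u) (g *m v).
Proof. by case=> ->; [left|right; rewrite mulmxN]. Qed.

Lemma pm_farey u v : farey_vertex u -> farey_vertex v -> same_point u v -> pm u v.
Proof.
move=> fu fv [c c0 e]; apply: farey_parallel => //.
by rewrite e /det2 !mxE; ring.
Qed.

Lemma farey_A1 A : \det A = 1 -> farey_vertex (real_mx R A *m e1 R).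
Proof. by move=> dA; apply: PSL2Z_farey; [exact: PSL2Z_real|exact: farey_e1]. Qed.
Lemma farey_A2 A : \det A = 1 -> farey_vertex (real_mx R A *m e2 R).
Proof. by move=> dA; apply: PSL2Z_farey; [exact: PSL2Z_real|exact: farey_e2]. Qed.
Lemma farey_A3 A : \det A = 1 -> farey_vertex (real_mx R A *m e3).
Proof.
move=> dA; rewrite -mT_e2 mulmxA -real_mxM; apply: farey_A2; by rewrite det_mul1 ?det_mT.
Qed.

Lemma farey_coords v : farey_vertex v -> exists2 A, \det A = 1 & v = real_mx R A *m e1 R.
Proof. by case/farey_vertexP => g /PSL2ZP[A dA ->] ->; exists A. Qed.

(** An edge has determinant 1 or -1; changing the sign of [w] absorbs the difference, so that
    matrices parametrize oriented edges. *)
Lemma farey_edgeP v w : farey_edge v w <->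
  exists A, [/\ \det A = 1, v = real_mx R A *m e1 R & pm w (real_mx R A *m e2 R)].
Proof.
split=> [[fv fw d1]|[A [dA -> pw]]]; last first.
  split; first exact: farey_A1.
    by case: pw => ->; [|apply: farey_vertexN]; exact: farey_A2.
  have E : det2 (real_mx R A *m e1 R) (real_mx R A *m e2 R) = 1.
    by rewrite det2_mul real_mx_det1 // mul1r /det2 !mxE /=; ring.
  rewrite -[_ - _]/(det2 _ _) in E *.
  case: pw => ->; first by rewrite E normr1.
  by rewrite det2Nr normrN E normr1.
have [p [q [_ vp vq]]] := fv; have [r [s [_ wr ws]]] := fw.
have vE : v = cv p%:~R q%:~R by apply: cvP; rewrite !mxE /= ?vp ?vq.
have wE : w = cv r%:~R s%:~R by apply: cvP; rewrite !mxE /= ?wr ?ws.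
have D : p * s - r * q = 1 \/ p * s - r * q = -1.
  move: d1; rewrite vp vq wr ws -!intrM -intrB -intr_norm => /eqP; rewrite (eqr_int R _ 1) => /eqP; lia.
case: D => D.
  exists (mx2 p r q s); rewrite det_mx2; split => //; [|left].
    by rewrite vE; apply: cvP; rewrite mulmx2E !mxE /=; ring.
  by rewrite wE; apply: cvP; rewrite mulmx2E !mxE /=; ring.
exists (mx2 p (- r) q (- s)); rewrite det_mx2; split; [|rewrite vE|rewrite wE; right].
- by rewrite -[RHS]opprK -D; ring.
- by apply: cvP; rewrite mulmx2E !mxE /=; ring.
rewrite -[LHS]opprK; congr (- _); apply: cvP; rewrite mulmx2E !mxE /=; ring.
Qed.

(** The third vertex at the edge of [A] is the sum or the difference of the two columns; passing to
    [A *m mS] turns the second case into the first, at the price of exchanging [u] and [v]. *)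
Lemma farey_triangleP u v w : farey_triangle u v w <->
  exists A, [/\ \det A = 1, pm w (real_mx R A *m e3) &
    (pm u (real_mx R A *m e1 R) /\ pm v (real_mx R A *m e2 R)) \/
    (pm u (real_mx R A *m e2 R) /\ pm v (real_mx R A *m e1 R))].
Proof.
split.
  move=> [/farey_edgeP[A [dA uE vE]] [_ fw e1] [_ _ e2']].
  have uA := real_mx_unit dA.
  have [x [xd wE]] : exists x, x = invmx (real_mx R A) *m w /\ w = real_mx R A *m x.
    by exists (invmx (real_mx R A) *m w); rewrite mulKVmx.
  have [_ _ _ ZV] := PSL2Z_group R.
  have [p [q [_ xp xq]]] : farey_vertex x by rewrite xd; apply: PSL2Z_farey => //; apply: ZV; exact: PSL2Z_real.
  have {}xE : x = cv p%:~R q%:~R by apply: cvP; rewrite !mxE /= ?xp ?xq.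
  have q1 : q = 1 \/ q = -1.
    have : `|det2 u w| = 1 by [].
    rewrite uE wE det2_mul real_mx_det1 // mul1r xE /det2 !mxE /= mul1r mulr0 subr0 -intr_norm.
    by move/eqP; rewrite (eqr_int R _ 1) => /eqP; lia.
  have p1 : p = 1 \/ p = -1.
    have : `|det2 (real_mx R A *m e2 R) w| = 1.
      have : `|det2 v w| = 1 by [].
      by case: vE => ->; rewrite ?det2Nl ?normrN.
    rewrite wE det2_mul real_mx_det1 // mul1r xE /det2 !mxE /= mul0r mulr1 sub0r normrN -intr_norm.
    by move/eqP; rewrite (eqr_int R _ 1) => /eqP; lia.
  have [pq|pq] : p = q \/ p = - q by lia.
    exists A; split => //; last by left; split => //; rewrite uE; left.
    rewrite wE; apply: pm_mul; rewrite xE pq; case: q1 => ->; [left|right]; by apply: cvP; rewrite !mxE.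
  exists (A *m mS); rewrite !real_mxM -!mulmxA mS_e1 mS_e2 det_mul1 ?det_mS //; split => //.
    rewrite wE; apply: pm_mul; rewrite mS_e3 xE pq; case: q1 => ->; [left|right]; apply: cvP;
      by rewrite !mxE /=; ring.
  by right; split => //; rewrite uE mulmxN; right; rewrite opprK.
have edge x y z t : farey_edge z t -> pm x z -> pm y t -> farey_edge x y.
  move=> [fz ft zt] xz yt; split.
  - by case: xz => -> //; exact: farey_vertexN.
  - by case: yt => -> //; exact: farey_vertexN.
  have: `|det2 z t| = 1 by [].
  by rewrite -!/(det2 _ _); case: xz => ->; case: yt => ->; rewrite ?det2Nl ?det2Nr ?opprK ?normrN.
move=> [A [dA pw puv]].
have A12 : farey_edge (real_mx R A *m e1 R) (real_mx R A *m e2 R).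
  by apply/farey_edgeP; exists A; split => //; left.
have A13 : farey_edge (real_mx R A *m e1 R) (real_mx R A *m e3).
  apply/farey_edgeP; exists (A *m mT 1); rewrite det_mul1 ?det_mT // !real_mxM -!mulmxA mT_e1 mT_e2.
  by split => //; left.
have A21 : farey_edge (real_mx R A *m e2 R) (real_mx R A *m e1 R).
  apply/farey_edgeP; exists (A *m mS); rewrite det_mul1 ?det_mS // !real_mxM -!mulmxA mS_e1 mS_e2.
  by split => //; rewrite mulmxN; right; rewrite opprK.
have A23 : farey_edge (real_mx R A *m e2 R) (real_mx R A *m e3).
  apply/farey_edgeP; exists (A *m mU); rewrite det_mul1 ?det_mU //.
  have -> : real_mx R (A *m mU) *m e1 R = real_mx R A *m e2 R.
    by rewrite real_mxM -mulmxA; congr (_ *m _); apply: cvP; rewrite mulmx2E !mxE /=; ring.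
  split => //; right; rewrite real_mxM -mulmxA -mulmxN; congr (_ *m _).
  by rewrite -[LHS]opprK; congr (- _); apply: cvP; rewrite mulmx2E !mxE /=; ring.
by case: puv => -[pu pv]; split;
  [exact: edge A12 _ _|exact: edge A23 _ _|exact: edge A13 _ _|exact: edge A21 _ _|exact: edge A13 _ _|exact: edge A23 _ _].
Qed.

Definition bip_label v : 'I_5 :=
  (val (state (xget 1%:M [set A | \det A = 1 /\ real_mx R A *m e1 R = v]))).1.

(** Two matrices with the same first column differ by some [mT k] on the right, which turns about
    the first vertex and keeps its label. *)
Lemma bip_labelE A : \det A = 1 -> bip_label (real_mx R A *m e1 R) = (val (state A)).1.
Proof.
move=> dA; rewrite /bip_label; case: xgetP => [B _ [dB e]|/(_ A)]; last by case.
have dC : \det (invmx B *m A) = 1 by rewrite det_mul1 ?det_inv1.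
have [k kE] : exists k, invmx B *m A = mT k.
  by apply: fix_e1 => //; rewrite real_mxM -mulmxA -e mulmxA -real_mxM mulVmx ?det1_unit // real_mx1 mul1mx.
by rewrite -(state_turn k dB) -kE mulKVmx ?det1_unit.
Qed.

Lemma bip_labelE2 A : \det A = 1 -> bip_label (real_mx R A *m e2 R) = (val (state A)).2.
Proof.
by move=> dA; rewrite -mS_e1 mulmxA -real_mxM bip_labelE ?det_mul1 ?det_mS // stateS.
Qed.

Lemma bip_labelE3 A : \det A = 1 ->
  bip_label (real_mx R A *m e3) = third5 (val (state A)).1 (val (state A)).2.
Proof.
by move=> dA; rewrite -mT_e2 mulmxA -real_mxM bip_labelE2 ?det_mul1 ?det_mT // stateT.
Qed.

Lemma bip_label_pm v w : farey_vertex v -> pm w v -> bip_label w = bip_label v.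
Proof.
case/farey_coords => A dA -> [->|->] //.
by rewrite -mulNmx -real_mxN !bip_labelE ?det_opp2 // stateN.
Qed.

Definition bip_group : set 'M[R]_2 :=
  [set g | exists A, [/\ \det A = 1, g = real_mx R A & state A = dart0]].

Lemma bip_groupP A B : \det A = 1 -> \det B = 1 ->
  bip_group (real_mx R (A *m invmx B)) <-> state A = state B.
Proof.
move=> dA dB; have dV := det_inv1 dB.
have s1 : state 1%:M = dart0 by rewrite /state slact1 ?ds2 ?du3 // perm1.
have E : state (A *m invmx B) = dart0 <-> state A = state B.
  by rewrite -(state_cancel _ _ dV) // mulmxV ?det1_unit // s1.
split=> [[C [dC /real_mx_inj e h]]|h]; first by apply/E; rewrite e.
by exists (A *m invmx B); rewrite det_mul1 //; split => //; apply/E.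
Qed.

Lemma bip_group_int : bip_group `<=` @PSL2Z R.
Proof. by move=> _ [A [dA -> _]]; exact: PSL2Z_real. Qed.

Lemma bip_group_PSL2 : PSL2_subgroup bip_group.
Proof.
have s1 : state 1%:M = dart0 by rewrite /state slact1 ?ds2 ?du3 // perm1.
have dG : forall g, bip_group g -> \det g = 1 by move=> _ [A [dA -> _]]; exact: real_mx_det1.
split => //.
- split; first by exists 1%:M; rewrite det1 real_mx1.
  by exists (- 1%:M); rewrite det_opp2 det1 real_mxN real_mx1 stateN ?det1.
- move=> _ _ [A [dA -> sA]] [B [dB -> sB]]; exists (A *m B); rewrite det_mul1 // real_mxM; split => //.
  by rewrite stateM // sA.
move=> _ [A [dA -> sA]]; have dV := det_inv1 dA; exists (invmx A); rewrite inv_real_mx //; split => //.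
by rewrite -s1; apply/(state_cancel _ _ dA) => //; rewrite ?det1 // mulVmx ?det1_unit // mul1mx s1.
Qed.

Lemma bip_group_finite_index : finite_index bip_group (@PSL2Z R).
Proof.
split; first exact: bip_group_int.
have [dG _ GM GV] := bip_group_PSL2.
have /choice[r rP] : forall y : dart, exists A, \det A = 1 /\ state A = y.
  by move=> y; have [A] := state_surj y; exists A.
apply: (@sub_finite_set _ _ [set (mulmx (real_mx R (invmx (r y))) @` bip_group) | y in [set: dart]]); last exact/finite_image/finite_finset.
move=> _ [_ /PSL2ZP[A dA ->] <-]; have dV := det_inv1 dA; exists (state (invmx A)) => //.
have [dr sr] := rP (state (invmx A)).
have h : bip_group (real_mx R (r (state (invmx A)) *m invmx (invmx A))) by apply/bip_groupP.
move: h sr dr; set B := r _; rewrite invmxK real_mxM => h _ dB.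
have h' : bip_group (invmx (real_mx R A) *m real_mx R (invmx B)).
  by rewrite -inv_real_mx // -invmx_mul ?real_mx_det1 //; exact: GV.
apply/seteqP; split=> _ [g Gg <-].
  exists (invmx (real_mx R A) *m real_mx R (invmx B) *m g); first exact: GM.
  by rewrite -!mulmxA mulKVmx ?real_mx_unit.
exists (real_mx R B *m real_mx R A *m g); first exact: GM.
by rewrite -!mulmxA -inv_real_mx // mulKmx ?real_mx_unit.
Qed.

Lemma bip_dart A : \det A = 1 -> dartn (bip_label (real_mx R A *m e1 R)) (bip_label (real_mx R A *m e2 R)).
Proof. by move=> dA; rewrite bip_labelE // bip_labelE2 //; exact: (valP (state A)). Qed.

Lemma bip_state_eq A B : \det A = 1 -> \det B = 1 ->
  bip_label (real_mx R A *m e1 R) = bip_label (real_mx R B *m e1 R) ->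
  bip_label (real_mx R A *m e2 R) = bip_label (real_mx R B *m e2 R) -> state A = state B.
Proof.
move=> dA dB; rewrite !bip_labelE // !bip_labelE2 // => h1 h2; apply: val_inj.
by rewrite (surjective_pairing (val (state A))) h1 h2 -surjective_pairing.
Qed.

Lemma adj_dartn (i j : 'I_5) : adj bipyramid i j = dartn i j.
Proof. by rewrite adj_bipyramid. Qed.

Lemma card_lt2 (s : seq 'I_5) : uniq s ->
  #|[pred i in finset (fun x => x \in s) | (i < 2)%N]| = count (fun i : 'I_5 => (i < 2)%N) s.
Proof.
move=> us; rewrite -size_filter; have us' := filter_uniq (fun i : 'I_5 => (i < 2)%N) us.
rewrite -(card_uniqP us'); apply: eq_card => i.
by rewrite mem_filter andbC !inE.
Qed.

Lemma face_third (t : {set 'I_5}) : t \in bipyramid <->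
  exists i j : 'I_5, dartn i j /\ t = finset (fun x => x \in [:: i; j; third5 i j]).
Proof.
split=> [|[i [j [h ->]]]]; last first.
  have u := third_neq h; rewrite inE cardsE (card_uniqP u) /= card_lt2 //= third5E //.
  apply/implyP: h; move: i j {u}.
  by apply: (all_lt5P (P := fun i j => dartn i j ==> ((i < 2) + ((j < 2) + ((third i j < 2) + 0)) == 1)%N)).
rewrite inE => /andP[/eqP c3 /eqP c1].
have tE : t = finset (fun x => x \in enum t) by apply/finset.setP => x; rewrite inE mem_enum.
rewrite {1}tE card_lt2 ?enum_uniq // in c1.
have := enum_uniq (mem t); have : size (enum t) = 3 by rewrite -cardE.
move: c1 tE; case: (enum t) => [|i [|j [|k []]]] //= c1 -> _ u.
pose K (i j k : nat) := (uniq [:: i; j; k]) && ((i < 2) + ((j < 2) + ((k < 2) + 0)) == 1)%N.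
have hK : K i j k by rewrite /K c1 andbT -[[:: _; _; _]]/(map val [:: i; j; k]) (map_inj_uniq val_inj).
pose D (i j k : nat) := dartn i j && (third i j == k).
have : [|| D i j k, D j i k | D i k j].
  have := all_lt5P (P := fun i j => all (fun k => K i j k ==> [|| D i j k, D j i k | D i k j]) (iota 0 5)) isT i j.
  by move=> /allP/(_ k); rewrite mem_iota ltn_ord => /(_ isT)/implyP; apply.
have fin (a b c : 'I_5) : D a b c -> third5 a b = c.
  by move=> /andP[h /eqP e]; apply: val_inj; rewrite /= third5E.
case/or3P => h; have := fin _ _ _ h; move: h => /andP[h _] e.
- by exists i, j; rewrite e.
- by exists j, i; rewrite e; split => //; apply/finset.setP => x; rewrite !inE orbCA.
exists i, k; rewrite e; split => //; apply/finset.setP => x; rewrite !inE; congr (_ || _); exact: orbC.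
Qed.

Lemma bip_farey_iso : farey_quotient_iso bip_group bipyramid bip_label.
Proof.
have move_to A B : \det A = 1 -> \det B = 1 -> state A = state B ->
    exists2 g, bip_group g & forall v, g *m (real_mx R A *m v) = real_mx R B *m v.
  move=> dA dB e; exists (real_mx R (B *m invmx A)); first by apply/bip_groupP.
  by move=> v; rewrite mulmxA -real_mxM mulmxKV ?det1_unit.
have lab g v : bip_group g -> farey_vertex v -> bip_label (g *m v) = bip_label v.
  move=> [B [dB -> sB]] /farey_coords[A dA ->]; rewrite mulmxA -real_mxM !bip_labelE ?det_mul1 //.
  by rewrite stateM // sB.
split.
- split=> [v w fv fw|x].
    split=> [|[g Gg gvw]].
      move: (fv) (fw) => /farey_coords[A dA ->] /farey_coords[B dB ->]; rewrite !bip_labelE // => e.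
      have [n nE] := state_turnP dA dB e.
      have [g Gg gE] := move_to _ _ (det_mul1 dA (det_mT n)) dB nE.
      by exists g => //; apply: pm_same; left; rewrite -gE real_mxM -[_ *m _ *m e1 R]mulmxA mT_e1.
    rewrite -(lab g v) //; apply: bip_label_pm => //; apply: pm_farey => //.
    by apply: PSL2Z_farey => //; exact: bip_group_int.
  have [y yx] : exists y : dart, (val y).1 = x.
    have [j h] : exists j : 'I_5, dartn x j.
      have [x3|x3] := ltnP x 3; first by exists (@Ordinal 5 3 isT); rewrite /dartn andbF andbT neq_ltn x3.
      by exists (@Ordinal 5 0 isT); rewrite /dartn /= andbT -leqNgt ltnW // andbT neq_ltn (leq_trans _ x3) ?orbT.
    by exists (exist _ (x, j) h).
  have [A dA sA] := state_surj y; exists (real_mx R A *m e1 R); first exact: farey_A1.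
  by rewrite bip_labelE // sA.
- move=> x y; rewrite adj_dartn; split=> [h|[v [w [/farey_edgeP[A [dA -> pw]] <- <-]]]]; last first.
    by rewrite (bip_label_pm (farey_A2 dA) pw) bip_dart.
  have [A dA sA] := state_surj (exist _ (x, y) h); exists (real_mx R A *m e1 R), (real_mx R A *m e2 R).
  by rewrite bip_labelE // bip_labelE2 // sA; split => //; apply/farey_edgeP; exists A; split => //; left.
- move=> v w v' w' /farey_edgeP[A [dA -> pw]] /farey_edgeP[B [dB -> pw']] e1' e2'.
  rewrite (bip_label_pm (farey_A2 dA) pw) (bip_label_pm (farey_A2 dB) pw') in e2'.
  have [g Gg gE] := move_to _ _ dA dB (bip_state_eq dA dB e1' e2').
  exists g; split => //; first by apply: pm_same; rewrite gE; left.
  apply: pm_same; apply: pm_trans (pm_mul g pw) _; rewrite gE; exact: pm_sym.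
- move=> t; split=> [/face_third[i [j [h ->]]]|[u [v [w [/farey_triangleP[A [dA pw puv]] ->]]]]].
    have [A dA sA] := state_surj (exist _ (i, j) h).
    exists (real_mx R A *m e1 R), (real_mx R A *m e2 R), (real_mx R A *m e3).
    rewrite bip_labelE // bip_labelE2 // bip_labelE3 // sA; split => //.
    by apply/farey_triangleP; exists A; split => //; [left|left; split; left].
  apply/face_third; rewrite (bip_label_pm (farey_A3 dA) pw).
  exists (val (state A)).1, (val (state A)).2; split; first exact: (valP (state A)).
  rewrite -bip_labelE3 // -bip_labelE // -bip_labelE2 //.
  case: puv => -[pu pv].
    by rewrite (bip_label_pm (farey_A1 dA) pu) (bip_label_pm (farey_A2 dA) pv).
  rewrite (bip_label_pm (farey_A2 dA) pu) (bip_label_pm (farey_A1 dA) pv).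
  by apply/finset.setP => x; rewrite !inE orbCA.
move=> u v w u' v' w' /farey_triangleP[A [dA pw puv]] /farey_triangleP[B [dB pw' puv']] eu ev ew.
rewrite (bip_label_pm (farey_A3 dA) pw) (bip_label_pm (farey_A3 dB) pw') in ew.
have fin x y a b : pm x (real_mx R A *m a) -> pm y (real_mx R B *m a) ->
    forall g, (forall v, g *m (real_mx R A *m v) = real_mx R B *m v) -> same_point (g *m x) y.
  move=> px py g gE; apply: pm_same; apply: pm_trans (pm_mul g px) _; rewrite gE; exact: pm_sym.
(* Triangles with equal labels cannot be matched with opposite orientation: the two faces at an edge
   of the bipyramid have different third vertices. *)
have flip x y x' y' : bip_label x = bip_label x' -> bip_label y = bip_label y' ->
   pm x (real_mx R A *m e1 R) -> pm y (real_mx R A *m e2 R) ->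
   pm x' (real_mx R B *m e2 R) -> pm y' (real_mx R B *m e1 R) -> False.
  move=> ex ey p1 p2 q1 q2; move: ew ex ey.
  rewrite (bip_label_pm (farey_A1 dA) p1) (bip_label_pm (farey_A2 dA) p2).
  rewrite (bip_label_pm (farey_A2 dB) q1) (bip_label_pm (farey_A1 dB) q2).
  rewrite !bip_labelE3 // !bip_labelE // !bip_labelE2 // => e h1 h2; rewrite -h1 -h2 in e.
  by apply: third_opp e; exact: (valP (state A)).
case: puv => -[pu pv]; case: puv' => -[pu' pv'].
- rewrite (bip_label_pm (farey_A1 dA) pu) (bip_label_pm (farey_A1 dB) pu') in eu.
  rewrite (bip_label_pm (farey_A2 dA) pv) (bip_label_pm (farey_A2 dB) pv') in ev.
  have [g Gg gE] := move_to _ _ dA dB (bip_state_eq dA dB eu ev).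
  by exists g; split => //; [exact: fin pu pu' _ gE|exact: fin pv pv' _ gE|exact: fin pw pw' _ gE].
- by have := flip _ _ _ _ eu ev pu pv pu' pv'.
- by have := flip _ _ _ _ ev eu pv pu pv' pu'.
rewrite (bip_label_pm (farey_A2 dA) pu) (bip_label_pm (farey_A2 dB) pu') in eu.
rewrite (bip_label_pm (farey_A1 dA) pv) (bip_label_pm (farey_A1 dB) pv') in ev.
have [g Gg gE] := move_to _ _ dA dB (bip_state_eq dA dB ev eu).
by exists g; split => //; [exact: fin pu pu' _ gE|exact: fin pv pv' _ gE|exact: fin pw pw' _ gE].
Qed.

End Labels.

(** * Reduction of hyperbolic matrices to positive words *)

Section Reduction.
Implicit Types (A B M N : 'M[int]_2).

(** Take a conjugate with the smallest [|a - d|]. Conjugation by an elementary matrix changes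
    [a - d] by twice an off-diagonal entry, so minimality gives [|a - d| <= |c|] unless [c = 0]; the
    multiplied form covers both cases, and likewise for [b]. *)
Lemma reduce_conj M : \det M = 1 -> exists A a b c d, [/\ \det A = 1, M *m A = A *m mx2 a b c d,
  `|c| * `|a - d| <= c ^+ 2 & `|b| * `|a - d| <= b ^+ 2].
Proof.
move=> dM.
pose P n := `[< exists A a b c d, [/\ \det A = 1, M *m A = A *m mx2 a b c d & `|a - d|%N = n] >].
have ex : exists n, P n.
  have [a [b [c [d ME]]]] := mx2_ex M; exists `|a - d|%N; apply/asboolP; exists 1%:M, a, b, c, d.
  by rewrite det1 mulmx1 mul1mx.
have [n /asboolP[A [a [b [c [d [dA MA nE]]]]]] nmin] := ex_minnP ex.
have step C a' b' c' d' : \det C = 1 -> mx2 a b c d *m C = C *m mx2 a' b' c' d' -> `|a - d| <= `|a' - d'|.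
  move=> dC CE; rewrite -!abszE lez_nat nE; apply: nmin; apply/asboolP; exists (A *m C), a', b', c', d'.
  by rewrite det_mul1 // mulmxA MA -mulmxA CE mulmxA.
exists A, a, b, c, d; split => //.
  have h1 : `|a - d| <= `|a - d - c *+ 2|.
    have -> : a - d - c *+ 2 = a - c - (c + d) by ring.
    apply: (step (mx2 1 1 0 1) _ (a + b - c - d) c); first by rewrite det_mx2; ring.
    by rewrite !mul_mx2; congr mx2; ring.
  have h2 : `|a - d| <= `|a - d + c *+ 2|.
    have -> : a - d + c *+ 2 = a + c - (d - c) by ring.
    apply: (step (mx2 1 (-1) 0 1) _ (b + d - a - c) c); first by rewrite det_mx2; ring.
    by rewrite !mul_mx2; congr mx2; ring.
  by rewrite expr2; nia.
have h1 : `|a - d| <= `|a - d + b *+ 2|.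
  have -> : a - d + b *+ 2 = a + b - (d - b) by ring.
  apply: (step (mx2 1 0 1 1) _ b (c + d - a - b)); first by rewrite det_mx2; ring.
  by rewrite !mul_mx2; congr mx2; ring.
have h2 : `|a - d| <= `|a - d - b *+ 2|.
  have -> : a - d - b *+ 2 = a - b - (b + d) by ring.
  apply: (step (mx2 1 0 (-1) 1) _ b (a - b + c - d)); first by rewrite det_mx2; ring.
  by rewrite !mul_mx2; congr mx2; ring.
by rewrite expr2; nia.
Qed.

(** The square of the trace is [(a - d) ^ 2 + 4 + 4 * b * c], and the two bounds together give
    [(a - d) ^ 2 <= - (b * c)]. *)
Lemma reduced_bounds (a b c d : int) : `|c| * `|a - d| <= c ^+ 2 -> `|b| * `|a - d| <= b ^+ 2 ->
  a * d - b * c = 1 -> b * c < 0 -> (a + d) ^+ 2 <= 4 - 3 * (- (b * c)).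
Proof.
move=> hc hb D bc.
have hb' : `|a - d| <= `|b| by nia.
have hc' : `|a - d| <= `|c| by nia.
have h : (a - d) ^+ 2 <= - (b * c).
  by rewrite -(ltr0_norm bc) normrM -real_normK ?num_real // expr2 ler_pM.
have -> : (a + d) ^+ 2 = (a - d) ^+ 2 + 4 * (a * d - b * c) + 4 * (b * c) by ring.
rewrite D; lia.
Qed.

Lemma same_sign (x y : int) : 0 < x * y -> (0 < x /\ 0 < y) \/ (x < 0 /\ y < 0).
Proof. by case: (ltrgt0P x) => [x0|x0|->]; rewrite ?mul0r // ?(pmulr_rgt0 _ x0) ?(nmulr_rgt0 _ x0) => y0; [left|right]. Qed.

(** In a reduced conjugate [b * c < 0] would give a trace of absolute value at most 1, and
    [b * c = 0] one of 2. So [b * c] and [a * d = 1 + b * c] are positive; conjugation by [mS] and a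
    change of sign make all entries positive. *)
Lemma hyperbolic_positive M : \det M = 1 -> 2 < `|\tr M| ->
  exists A (a b c d : int) (s : bool), [/\ \det A = 1, M *m A = (-1) ^+ s *: (A *m mx2 a b c d) &
    [/\ 0 < a, 0 < b, 0 < c & 0 < d]].
Proof.
move=> dM tM; have [A [a [b [c [d [dA MA hc hb]]]]]] := reduce_conj dM.
have ME : M = A *m mx2 a b c d *m invmx A by rewrite -MA mulmxK ?det1_unit.
have D : a * d - b * c = 1 by move: dM; rewrite ME !det_mulmx det_mx2 dA det_inv1 // mulr1 mul1r.
have T : 2 < `|a + d| by move: tM; rewrite ME tr_conj2 // tr_mx2.
have bc : 0 < b * c.
  rewrite ltNge; apply/negP => bc.
  have [bc0|bc0] : b * c = 0 \/ b * c < 0 by lia.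
    by rewrite bc0 subr0 in D; have [] := int_unit D => a1; rewrite a1 in D T; lia.
  have := reduced_bounds hc hb D bc0; rewrite -real_normK ?num_real // expr2.
  by move: `|a + d| T => t; nia.
have [ad|ad] : (0 < a /\ 0 < d) \/ (a < 0 /\ d < 0) by apply: same_sign; lia.
  have [b0|b0] := same_sign bc.
    by exists A, a, b, c, d, false; rewrite expr0 scale1r; case: ad; case: b0.
  exists (A *m mS), d, (- c), (- b), a, false; rewrite det_mul1 ?det_mS // expr0 scale1r mulmxA MA -!mulmxA.
  by split => //; [congr (_ *m _); rewrite !mul_mx2; congr mx2; ring|split; lia].
have [b0|b0] := same_sign bc.
  exists (A *m mS), (- d), c, b, (- a), true; rewrite det_mul1 ?det_mS // expr1 scaleN1r mulmxA MA -!mulmxA -mulmxN.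
  by split => //; [congr (_ *m _); rewrite !mul_mx2 opp_mx2; congr mx2; ring|split; lia].
exists A, (- a), (- b), (- c), (- d), true; rewrite expr1 scaleN1r MA -mulmxN opp_mx2 !opprK; split => //; split; lia.
Qed.

Definition mL : 'M[int]_2 := mx2 1 0 1 1.

Lemma det_mL : \det mL = 1. Proof. by rewrite det_mx2. Qed.

Definition word_mx (w : seq bool) : 'M[int]_2 := foldr (fun b M => (if b then mL else mT 1) *m M) 1%:M w.

Lemma det_word w : \det (word_mx w) = 1.
Proof. by elim: w => [|b w IH] /=; rewrite ?det1 // det_mul1 // ; case: b; rewrite ?det_mL ?det_mT. Qed.

(** Subtractive Euclid on the rows: one row dominates the other, and subtracting splits off an
    elementary factor, unless the matrix is the identity. *)
Lemma nonneg_word (a b c d : int) : 0 <= a -> 0 <= b -> 0 <= c -> 0 <= d -> a * d - b * c = 1 ->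
  exists w, mx2 a b c d = word_mx w.
Proof.
move=> a0 b0 c0 d0 D; have [n] := ubnP `|(a + b + c + d)%R|%N.
elim: n a b c d a0 b0 c0 d0 D => // n IH a b c d a0 b0 c0 d0 D hn.
have rT : c <= a -> d <= b -> exists w, mx2 a b c d = word_mx w.
  move=> ca db; have ad : 0 < c + d by nia.
  have [||||||w wE] := IH (a - c) (b - d) c d; try lia.
  by exists (false :: w); rewrite /= -wE mul_mx2; congr mx2; ring.
have rL : a <= c -> b <= d -> exists w, mx2 a b c d = word_mx w.
  move=> ca db; have ad : 0 < a + b by nia.
  have [||||||w wE] := IH a b (c - a) (d - b); try lia.
  by exists (true :: w); rewrite /= -wE mul_mx2; congr mx2; ring.
have [ac|ac] := leP c a; have [bd|bd] := leP d b; [exact: rT| | |apply: rL; lia].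
  have [ac'|ac'] := eqVneq a c; first by apply: rL; lia.
  have b1 : b = 0 by nia.
  have c1 : c = 0 by nia.
  have a1 : a = 1 by nia.
  have d1 : d = 1 by nia.
  by exists [::]; rewrite a1 b1 c1 d1 /= mx2_1.
by exfalso; nia.
Qed.

(** When both letters occur the trace exceeds the length of the word, so a bound on the trace leaves
    finitely many words. *)
Lemma word_trace w (a b c d : int) : word_mx w = mx2 a b c d ->
  [/\ 0 < a, 0 <= b, 0 <= c & 0 < d] /\
  [\/ [/\ 0 < b, 0 < c & (size w)%:Z < a + d], [/\ b = 0, a = 1, d = 1 & c = size w] |
      [/\ c = 0, a = 1, d = 1 & b = size w]].
Proof.
elim: w a b c d => [|x w IH] a b c d /=.
  by rewrite mx2_1 => /mx2_inj[<- <- <- <-]; split => //; constructor 2.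
have [a' [b' [c' [d' wE]]]] := mx2_ex (word_mx w); have [[h1 h2 h3 h4] h5] := IH _ _ _ _ wE.
rewrite wE; case: x; rewrite mul_mx2 => /mx2_inj[<- <- <- <-];
  rewrite ?mul1r ?mul0r ?add0r ?addr0; split; try by split; lia.
  case: h5 => -[g1 g2 g3]; try move=> g4; [constructor 1|constructor 2|]; try by split; lia.
  have [?|?] : b' = 0 \/ 0 < b' by lia.
    by constructor 2; split; lia.
  by constructor 1; split; lia.
case: h5 => -[g1 g2 g3]; try move=> g4; [constructor 1| |constructor 3]; try by split; lia.
have [?|?] : c' = 0 \/ 0 < c' by lia.
  by constructor 3; split; lia.
by constructor 1; split; lia.
Qed.

Fixpoint words (n : nat) : seq (seq bool) :=
  if n is n'.+1 then [::] :: [seq b :: w | b <- [:: true; false], w <- words n'] else [:: [::]].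

Lemma mem_words n w : (size w <= n)%N -> w \in words n.
Proof.
elim: n w => [|n IH] [|b w] //=; rewrite ltnS => /IH h.
by rewrite in_cons !mem_cat; case: b; rewrite map_f ?orbT.
Qed.

End Reduction.

Definition face3 (q : nat * nat * nat) : bool :=
  let: (i, j, k) := q in uniq [:: i; j; k] && ((i < 2) + ((j < 2) + ((k < 2) + 0)) == 1)%N.

(* The vertex opposite to k across the edge ij: the three equatorial labels add up to 9. *)
Definition opposite (i j k : nat) : nat := if (k < 2)%N then (1 - k)%N else (9 - k - maxn i j)%N.

(** Right multiplication by [mL] or by [mT 1] passes to the Farey triangle across the edge opposite
    to the first or to the second vertex; these are the labels after the crossing. *)
Definition step (q : nat * nat * nat) (b : bool) : nat * nat * nat :=
  let: (i, j, k) := q in if b then (k, j, opposite k j i) else (i, k, opposite i k j).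

Lemma lt5E (i : nat) : (i < 5)%N = (i \in iota 0 5). Proof. by rewrite mem_iota. Qed.

Lemma oppositeP (i j k l : nat) : (i < 5)%N -> (j < 5)%N -> (k < 5)%N -> (l < 5)%N ->
  face3 (i, j, k) -> face3 (i, j, l) -> l != k -> l = opposite i j k.
Proof.
have /allP h : all (fun i => all (fun j => all (fun k => all (fun l => face3 (i, j, k) ==>
  face3 (i, j, l) ==> (l != k) ==> (l == opposite i j k)) (iota 0 5)) (iota 0 5)) (iota 0 5)) (iota 0 5) by vm_compute.
rewrite !lt5E => /h /allP{}h /h /allP{}h /h /allP{}h /h /implyP{}h /h /implyP{}h /h /implyP{}h /h.
by move/eqP.
Qed.

Definition word_nat (w : seq bool) : nat * nat * nat * nat :=
  foldr (fun b m => let: (a, b', c, d) := m in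
    if b then (a, b', a + c, b' + d)%N else (a + c, b' + d, c, d)%N) (1, 0, 0, 1)%N w.

Lemma word_natE w : word_mx w = let: (a, b, c, d) := word_nat w in mx2 a%:Z b%:Z c%:Z d%:Z.
Proof.
elim: w => [|x w IH]; first by rewrite /= mx2_1.
rewrite /= IH; case: (word_nat w) => -[[a b] c] d; case: x; rewrite mul_mx2; congr mx2; lia.
Qed.

(** The length 8 comes from [word_trace], as the trace is at most 9. Every such word is evaluated on
    every face. *)
Lemma no_short_closed_word w (i j k : nat) : (i < 5)%N -> (j < 5)%N -> (k < 5)%N -> face3 (i, j, k) -> (size w <= 8)%N ->
  (let: (a, _, _, d) := word_nat w in 3 <= a + d <= 9)%N -> foldl step (i, j, k) w != (i, j, k).
Proof.
have /allP h : all (fun w => (let: (a, _, _, d) := word_nat w in 3 <= a + d <= 9)%N ==>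
  all (fun i => all (fun j => all (fun k => face3 (i, j, k) ==>
    (foldl step (i, j, k) w != (i, j, k))) (iota 0 5)) (iota 0 5)) (iota 0 5)) (words 8) by vm_compute.
move=> i5 j5 k5 f /mem_words /h /implyP{}h /h; rewrite !lt5E in i5 j5 k5 *.
by move=> /allP/(_ _ i5) /allP/(_ _ j5) /allP/(_ _ k5) /implyP; apply.
Qed.

(** * Groups whose Farey quotient is the bipyramid *)

Section BipyramidLabels.
Variables (R : realType) (G : set 'M[R]_2) (phi : 'cV[R]_2 -> 'I_5).
Hypotheses (gG : PSL2_subgroup G) (sG : G `<=` @PSL2Z R) (iso : farey_quotient_iso G bipyramid phi).
Implicit Types (A B C : 'M[int]_2) (u v w : 'cV[R]_2).

Lemma label_act g v : G g -> farey_vertex v -> phi (g *m v) = phi v.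
Proof.
move=> Gg fv; have [[h _] _ _ _ _] := iso; have fg := PSL2Z_farey (sG Gg) fv.
apply/esym; apply/h => //; exists g => //; exists 1; rewrite ?oner_neq0 // scale1r //.
Qed.

Lemma label_pm v w : farey_vertex v -> pm w v -> phi w = phi v.
Proof.
move=> fv [->//|->]; have [_ [_ G1] _ _] := gG.
by rewrite -(label_act G1 fv) mulNmx mul1mx.
Qed.

Lemma fix_axes A : \det A = 1 -> pm (real_mx R A *m e1 R) (e1 R) -> pm (real_mx R A *m e2 R) (e2 R) ->
  A = 1%:M \/ A = - 1%:M.
Proof.
have [a [b [c [d ->]]]] := mx2_ex A; rewrite det_mx2 => D C1 C2.
have intP (m r : int) : m%:~R = r%:~R :> R -> m = r by apply: intr_inj.
have {}C1 : pm (cv a%:~R c%:~R) (e1 R).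
  by move: C1; congr pm; apply: cvP; rewrite mulmx2E !mxE /=; ring.
have {}C2 : pm (cv b%:~R d%:~R) (e2 R).
  by move: C2; congr pm; apply: cvP; rewrite mulmx2E !mxE /=; ring.
have [a1 c0] : (a = 1 \/ a = -1) /\ c = 0.
  case: C1 => /matrixP C1; have := C1 0 0; have := C1 1 0; rewrite !mxE /= ?oppr0.
    by move=> /(intP _ 0) -> /(intP _ 1) ->; split => //; left.
  by move=> /(intP _ 0) -> /(intP _ (-1)) ->; split => //; right.
have [d1 b0] : (d = 1 \/ d = -1) /\ b = 0.
  case: C2 => /matrixP C2; have := C2 0 0; have := C2 1 0; rewrite !mxE /= ?oppr0.
    by move=> /(intP _ 1) -> /(intP _ 0) ->; split => //; left.
  by move=> /(intP _ (-1)) -> /(intP _ 0) ->; split => //; right.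
have ad : a = d by rewrite b0 mul0r subr0 in D; lia.
by rewrite b0 c0 ad mx2_1 opp_mx2 oppr0; case: d1 => ->; [left|right].
Qed.

Definition tri A : nat * nat * nat :=
  (phi (real_mx R A *m e1 R) : nat, phi (real_mx R A *m e2 R) : nat, phi (real_mx R A *m e3 R) : nat).

Lemma tri_face A : \det A = 1 -> face3 (tri A).
Proof.
move=> dA; have [_ _ _ h _] := iso.
set i := phi (real_mx R A *m e1 R); set j := phi (real_mx R A *m e2 R); set k := phi (real_mx R A *m e3 R).
have /h : exists u v w, farey_triangle u v w /\ finset (fun x => x \in [:: i; j; k]) = finset (fun x => x \in [:: phi u; phi v; phi w]).
  exists (real_mx R A *m e1 R), (real_mx R A *m e2 R), (real_mx R A *m e3 R); split => //.
  by apply/farey_triangleP; exists A; split => //; [left|left; split; left].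
rewrite inE cardsE => /andP[/eqP c3 /eqP c1].
have u : uniq [:: i; j; k] by apply/card_uniqP; rewrite c3.
rewrite /face3 /tri -/i -/j -/k -[[:: _; _; _]]/(map val [:: i; j; k]) (map_inj_uniq val_inj) u /=.
by have /= <- := card_lt2 u; rewrite c1.
Qed.

(** If the labels agreed, some element of [G] would carry one triangle to the other. It fixes both
    ends of the common edge, so it is [1] or [-1], and the two opposite vertices coincide. *)
Lemma label_across u v x y : farey_triangle u v x -> farey_triangle u v y -> det2 x y != 0 -> phi x <> phi y.
Proof.
move=> ux uy xy exy; have [_ _ _ _ h] := iso.
have [g [Gg gu gv gx]] := h _ _ _ _ _ _ ux uy erefl erefl exy.
have [/farey_edgeP[A [dA uE vE]] [_ fx _] _] := ux.
have /PSL2ZP[B dB gB] := sG Gg.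
have uA := real_mx_unit R dA.
have [a [b [c [d CE]]]] := mx2_ex (invmx A *m B *m A).
have BE z : real_mx R B *m (real_mx R A *m z) = real_mx R A *m (real_mx R (mx2 a b c d) *m z).
  by rewrite -CE !mulmxA -!real_mxM !mulmxA mulmxV ?det1_unit // mul1mx.
have D : a * d - b * c = 1 by rewrite -det_mx2 -CE !det_mul1 ?det_inv1.
have cE z : real_mx R A *m z = u \/ real_mx R A *m z = v -> pm (real_mx R (mx2 a b c d) *m z) z.
  move=> zuv; have : pm (g *m (real_mx R A *m z)) (real_mx R A *m z).
    have [fu fv _] : farey_edge u v by case: ux.
    case: zuv => ->; apply: pm_farey => //; by apply: PSL2Z_farey => //; exact: sG.
  rewrite gB BE => /(pm_mul (invmx (real_mx R A))); by rewrite !mulKmx.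
have C1 := cE (e1 R) (or_introl (esym uE)).
have C2 : pm (real_mx R (mx2 a b c d) *m e2 R) (e2 R).
  case: vE => vE; first by apply: cE; right.
  have := cE (- e2 R) (or_intror _); rewrite !mulmxN vE => /(_ erefl).
  by case=> /oppr_inj ->; [left|right].
have gpm z : pm (g *m z) z.
  have -> : z = real_mx R A *m (invmx (real_mx R A) *m z) by rewrite mulKVmx.
  rewrite gB BE; apply: pm_mul; case: (fix_axes _ C1 C2) => [|->|->]; first by rewrite det_mx2.
    by left; rewrite real_mx1 mul1mx.
  by right; rewrite real_mxN real_mx1 mulNmx mul1mx.
have [z z0 e] := gx; move/eqP: xy; apply; move: (gpm x); rewrite e => -[k|k].
  by rewrite -k /det2 !mxE; ring.
by rewrite -[x]opprK -k /det2 !mxE; ring.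
Qed.

Lemma tri_step A (b : bool) : \det A = 1 -> tri (A *m (if b then mL else mT 1)) = step (tri A) b.
Proof.
move=> dA; have dL : \det (A *m mL) = 1 by rewrite det_mul1 ?det_mL.
have dT : \det (A *m mT 1) = 1 by rewrite det_mul1 ?det_mT.
have e3E : e3 R = e1 R + e2 R by apply: cvP; rewrite !mxE /=; ring.
have L1 : real_mx R mL *m e1 R = e3 R by apply: cvP; rewrite mulmx2E !mxE /=; ring.
have L2 : real_mx R mL *m e2 R = e2 R by apply: cvP; rewrite mulmx2E !mxE /=; ring.
have hT := tri_face dT; have hL := tri_face dL; have hA := tri_face dA.
have tr B : \det B = 1 -> farey_triangle (real_mx R B *m e1 R) (real_mx R B *m e2 R) (real_mx R B *m e3 R).
  by move=> dB; apply/farey_triangleP; exists B; split => //; [left|left; split; left].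
have trA := tr _ dA; have trL := tr _ dL; have trT := tr _ dT.
have es x y : farey_edge x y -> @farey_edge R y x.
  by move=> [fx fy xy]; split => //; rewrite distrC.
have sw x y z : farey_triangle x y z -> @farey_triangle R y x z.
  by move=> [xy yz xz]; split => //; exact: es.
have rot x y z : farey_triangle x y z -> @farey_triangle R y z x.
  by move=> [xy yz xz]; split => //; exact: es.
have rotf (i j k : nat) : face3 (i, j, k) -> face3 (i, k, j) /\ face3 (k, j, i).
  rewrite /face3 /= !inE !negb_or !andbT => /andP[/andP[/andP[ij ik] jk] c].
  by split; lia.
have tb B : tri B = (phi (real_mx R B *m e1 R) : nat, phi (real_mx R B *m e2 R) : nat, phi (real_mx R B *m e3 R) : nat) by [].
have D12 (x y : 'cV[R]_2) : det2 x y != 0 -> det2 (real_mx R A *m x) (real_mx R A *m y) != 0.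
  by rewrite det2_mul real_mx_det1 // mul1r.
case: b; rewrite tb [in RHS]tb /step !real_mxM -!mulmxA ?L1 ?L2 ?mT_e1 ?mT_e2; congr (_, _, _).
  rewrite /tri !real_mxM -!mulmxA L1 L2 in hL; have [_ hA'] := rotf _ _ _ hA.
  apply: oppositeP hA' hL _; rewrite ?ltn_ord //; apply/eqP => /val_inj.
  apply: (label_across (u := real_mx R A *m e2 R) (v := real_mx R A *m e3 R)).
  - have := trL; rewrite !real_mxM -!mulmxA L1 L2; exact: sw.
  - exact: rot trA.
  - apply: D12; rewrite (_ : det2 _ _ = - 2); first by rewrite oppr_eq0 pnatr_eq0.
    by rewrite /det2 !mulmx2E !mxE /=; ring.
rewrite /tri !real_mxM -!mulmxA mT_e1 mT_e2 in hT; have [hA' _] := rotf _ _ _ hA.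
apply: oppositeP hA' hT _; rewrite ?ltn_ord //; apply/eqP => /val_inj.
apply: (label_across (u := real_mx R A *m e1 R) (v := real_mx R A *m e3 R)).
- by have := trT; rewrite !real_mxM -!mulmxA mT_e1 mT_e2.
- exact: sw (rot _ _ _ (rot _ _ _ trA)).
- apply: D12; rewrite (_ : det2 _ _ = 2); first by rewrite pnatr_eq0.
  by rewrite /det2 !mulmx2E !mxE /=; ring.
Qed.

Lemma tri_word A (w : seq bool) : \det A = 1 -> tri (A *m word_mx w) = foldl step (tri A) w.
Proof.
elim: w A => [|b w IH] A dA; first by rewrite mulmx1.
rewrite /= mulmxA IH ?tri_step // det_mul1 //; case: b; by rewrite ?det_mL ?det_mT.
Qed.

Lemma triN A : \det A = 1 -> tri (- A) = tri A.
Proof.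
move=> dA; rewrite /tri real_mxN !mulNmx.
by congr (_, _, _); congr nat_of_ord; apply: label_pm; [exact: farey_A1|right|exact: farey_A2|right|exact: farey_A3|right].
Qed.

Lemma tri_act A B : \det A = 1 -> \det B = 1 -> G (real_mx R B) -> tri (B *m A) = tri A.
Proof.
move=> dA dB GB; rewrite /tri !real_mxM -!mulmxA.
by congr (_, _, _); congr nat_of_ord; apply: label_act => //; [exact: farey_A1|exact: farey_A2|exact: farey_A3].
Qed.

Lemma tri_eq A B : \det A = 1 -> \det B = 1 -> (tri A).1 = (tri B).1 -> G (real_mx R (B *m invmx A)).
Proof.
move=> dA dB [/val_inj h1 /val_inj h2].
have [_ _ h _ _] := iso.
have ed C : \det C = 1 -> farey_edge (real_mx R C *m e1 R) (real_mx R C *m e2 R).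
  by move=> dC; apply/farey_edgeP; exists C; split => //; left.
have [g [Gg g1 g2]] := h _ _ _ _ (ed _ dA) (ed _ dB) h1 h2.
have /PSL2ZP[C dC gC] := sG Gg; rewrite gC in Gg g1 g2.
have fc D : \det D = 1 -> farey_vertex (real_mx R C *m (real_mx R D *m e1 R)) /\ farey_vertex (real_mx R C *m (real_mx R D *m e2 R)).
  by move=> dD; split; apply: PSL2Z_farey; [exact: PSL2Z_real|exact: farey_A1|exact: PSL2Z_real|exact: farey_A2].
have [f1 f2] := fc _ dA.
have {}g1 := pm_farey f1 (farey_A1 R dB) g1; have {}g2 := pm_farey f2 (farey_A2 R dB) g2.
pose D := invmx B *m (C *m A).
have CA : C *m A = B *m D by rewrite mulKVmx ?det1_unit.
have dD : \det D = 1 by rewrite !det_mul1 ?det_inv1.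
have pmB z : pm (real_mx R C *m (real_mx R A *m z)) (real_mx R B *m z) -> pm (real_mx R D *m z) z.
  rewrite mulmxA -real_mxM CA real_mxM -mulmxA => /(pm_mul (invmx (real_mx R B))).
  by rewrite !mulKmx ?real_mx_unit.
have [_ [_ GN1] GM _] := gG.
case: (fix_axes dD (pmB _ g1) (pmB _ g2)) => DE; rewrite DE in CA.
  by rewrite mulmx1 in CA; rewrite -CA mulmxK ?det1_unit.
have -> : B = - (C *m A) by rewrite CA mulmxN mulmx1 opprK.
by rewrite mulNmx mulmxK ?det1_unit // real_mxN -[real_mx R C]mul1mx -mulNmx; apply: GM.
Qed.

Lemma systole_bound g : G g -> hyperbolic g -> 10 <= `|\tr g|.
Proof.
move=> Gg; have /PSL2ZP[M dM gM] := sG Gg; rewrite gM in Gg *; rewrite /hyperbolic tr_real_mx -intr_norm.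
rewrite (ltr_int _ 2) (ler_int _ 10) => tM; rewrite leNgt; apply/negP => t10.
have [A [a [b [c [d [s [dA MA [a0 b0 c0 d0]]]]]]]] := hyperbolic_positive dM tM.
have ME : M = (-1) ^+ s *: (A *m mx2 a b c d *m invmx A) by rewrite scalemxAl -MA mulmxK ?det1_unit.
have nT : `|\tr M| = a + d.
  by rewrite ME mxtraceZ tr_conj2 // tr_mx2 normrM normrX normrN1 expr1n mul1r ger0_norm // addr_ge0 // ltW.
have D : a * d - b * c = 1.
  have : \det M = 1 := dM; rewrite ME detZ !det_mulmx det_mx2 dA det_inv1 // mulr1 mul1r.
  by case: (s); rewrite ?expr0 ?expr1 ?sqrrN expr1n mul1r.
have [w wE] := nonneg_word (ltW a0) (ltW b0) (ltW c0) (ltW d0) D.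
have [_ [[_ _ sw]|[b00 _ _ _]|[c00 _ _ _]]] := word_trace (esym wE); [|by rewrite b00 in b0|by rewrite c00 in c0].
have := word_natE w; rewrite -wE; case E : (word_nat w) => [[[a' b'] c'] d'] /mx2_inj[aE bE cE dE].
(* [M] preserves labels, and [M *m A] is [A] followed by the word, up to sign. *)
have closed : foldl step (tri A) w = tri A.
  rewrite -tri_word // -wE -[RHS](tri_act dA dM Gg) MA.
  have dW : \det (A *m mx2 a b c d) = 1 by rewrite det_mul1 // det_mx2.
  by case: (s); rewrite ?expr0 ?scale1r // expr1 scaleN1r triN.
move: closed; apply/eqP; apply: no_short_closed_word; rewrite ?ltn_ord //; first exact: tri_face.
  by rewrite nT in t10; lia.
by rewrite nT in t10 tM; rewrite E; lia.
Qed.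

Lemma systole_witness : exists2 g, G g & `|\tr g| = 10.
Proof.
have [_ h _ _ _] := iso.
have /h[v [w [/farey_edgeP[A [dA vE pw]] v0 w2]]] : adj bipyramid (@Ordinal 5 0 isT) (@Ordinal 5 2 isT) by rewrite adj_bipyramid.
have [k tE] : exists k : 'I_5, tri A = (0, 2, val k)%N.
  exists (phi (real_mx R A *m e3 R)); rewrite /tri -vE v0 (label_pm _ (pm_sym pw)) ?w2 //.
  by case: pw => ->; [|apply: farey_vertexN]; exact: farey_A2.
have fk : face3 (0, 2, val k)%N by rewrite -tE tri_face.
(* Three turns about the vertex labelled 0, of degree 3, and four turns about the one labelled 2, of
   degree 4, close up whatever the third label is. The first times the inverse of the second has
   trace [2 - 3 * 4]. *)
have cl (s : seq bool) : s \in [:: nseq 3 false; nseq 4 true] -> tri (A *m word_mx s) = tri A.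
  move=> hs; rewrite tri_word // tE; move: fk hs; case: k tE => -[|[|[|[|[|k]]]]] //= ? _ _; rewrite !inE => /orP[]/eqP-> //.
have d3 := det_word (nseq 3 false); have d4 := det_word (nseq 4 true).
have G1 := tri_eq dA (det_mul1 dA d3) (congr1 fst (esym (cl _ (mem_head _ _)))).
have G2 := tri_eq (det_mul1 dA d4) dA (congr1 fst (cl _ (mem_last _ _))).
have [_ _ GM _] := gG; have := GM _ _ G1 G2; set g := _ *m _ => Gg; exists g => //.
have gE : g = real_mx R (A *m (word_mx (nseq 3 false) *m invmx (word_mx (nseq 4 true))) *m invmx A).
  by rewrite /g -real_mxM invmx_mul // !mulmxA (mulmxKV (det1_unit dA)).
rewrite gE tr_real_mx tr_conj2 // invmx2 // !word_natE /= mul_mx2 tr_mx2 !mxE /=.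
by rewrite -intr_norm.
Qed.

Lemma label_cusps : finite_index G (@PSL2Z R) -> has_cusps G 5.
Proof.
move=> fi; have [[h1 h2] _ _ _ _] := iso.
have [X [c [cP cS]]] := coset_type gG fi.
have /choice[s sP] : forall i : 'I_5, exists v : 'cV[R]_2, farey_vertex v /\ phi v = i.
  by move=> i; have [v] := h2 i; exists v.
exists s; split=> [i|i j /h1|v /(parabolic_fixed_farey sG)[A [dA pv]]].
- have [/farey_coords[A dA ->] _] := sP i; exact: (farey_parabolic_fixed gG cP cS dA).
- by move=> h; have [fi' <-] := sP i; have [fj <-] := sP j; apply: h.
exists (phi (real_mx R A *m e1 R)); have [fs ps] := sP (phi (real_mx R A *m e1 R)).
have : boundary_orbit G (real_mx R A *m e1 R) (s (phi (real_mx R A *m e1 R))).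
  by apply/h1 => //; exact: farey_A1.
apply: boundary_orbit_trans => //; have [z z0 e] := pv; have [_ [G1 _] _ _] := gG.
by exists 1%:M => //; exists z => //; rewrite mul1mx.
Qed.

(** Distinguish by the trace. Up to sign, powers of a hyperbolic element are conjugate to positive
    matrices, and those of a parabolic one to translations. An elliptic element reduces to
    [b * c = -1] and [a * d = 0]; it carries one end of an edge to the other, against the distinct
    labels of a face. *)
Lemma label_torsion_free : torsion_free G.
Proof.
move=> g k Gg k0; have /PSL2ZP[M dM gM] := sG Gg; rewrite gM in Gg *.
have rpw n B : real_mx R B ^+ n = real_mx R (B ^+ n).
  by elim: n => [|n IH]; rewrite ?expr0 ?real_mx1 // !exprS real_mxM -IH.
rewrite rpw -real_mx1 -real_mxN => Mk.
have {}Mk : M ^+ k = 1%:M \/ M ^+ k = - 1%:M by case: Mk => /real_mx_inj ->; [left|right].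
suff : M = 1%:M \/ M = - 1%:M by case=> ->; [left|right].
have M2k : (M *m M) ^+ k = 1%:M.
  by rewrite -[M *m M]/(M ^+ 2) -exprM mulnC exprM; case: Mk => ->; rewrite ?sqrrN expr1n.
have pw (A N : 'M[int]_2) (s : bool) : \det A = 1 -> M *m A = (-1) ^+ s *: (A *m N) -> (N *m N) ^+ k = 1%:M.
  move=> dA MA; have MMA : M *m M *m A = A *m (N *m N).
    by rewrite -mulmxA MA -scalemxAr (mulmxA M A N) MA -scalemxAl scalerA -signr_addb addbb expr0 scale1r -mulmxA.
  have E n : (M *m M) ^+ n *m A = A *m (N *m N) ^+ n.
    elim: n => [|n IH]; first by rewrite !expr0 mul1mx mulmx1.
    rewrite !exprS; move: MMA IH; move: (M *m M) (N *m N) => P Q PQ IH.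
    by rewrite -[P * _]/(P *m _) -[Q * _]/(Q *m _) -mulmxA IH (mulmxA P A) PQ -mulmxA.
  by apply: (can_inj (mulKmx (det1_unit dA))); rewrite -E M2k mul1mx mulmx1.
have [tM|tM] := ltP 2 `|\tr M|.
  have [A [a [b [c [d [s [dA MA [a0 b0 c0 d0]]]]]]]] := hyperbolic_positive dM tM.
  have pos n : exists a' b' c' d', mx2 a b c d ^+ n.+1 = mx2 a' b' c' d' /\ [/\ 0 < a', 0 < b', 0 < c' & 0 < d'].
    elim: n => [|n [a' [b' [c' [d' [E [a1 b1 c1 d1]]]]]]]; first by exists a, b, c, d; rewrite expr1.
    rewrite exprS E -[_ * _]/(_ *m _) mul_mx2; do 4!eexists; split; first reflexivity.
    by split; nia.
  have := pw _ _ _ dA MA; rewrite -[_ *m _]/(_ ^+ 2) -exprM; have -> : (2 * k = (2 * k).-1.+1)%N by lia.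
  by have [a' [b' [c' [d' [-> [_ b1 _ _]]]]]] := pos (2 * k).-1; rewrite mx2_1 => /mx2_inj[_ b2]; rewrite b2 in b1.
have [t2|t2] := eqVneq `|\tr M| 2.
  have [A [m [s [dA MA]]]] : exists B k (n : bool), \det B = 1 /\ M *m B = (-1) ^+ n *: (B *m mT k).
    by apply: (@int_parabolic R) => //; rewrite tr_real_mx -intr_norm t2.
  have := pw _ _ _ dA MA; rewrite -mTD.
  have -> n : mT (m + m) ^+ n = mT ((m + m) * n%:Z).
    elim: n => [|n IH]; first by rewrite expr0 mulr0 mT0.
    by rewrite exprS IH -[_ * _]/(_ *m _) -mTD; congr mT; lia.
  rewrite mx2_1 => /mx2_inj[_ m0 _ _]; have {}m0 : m = 0 by nia.
  move: MA; rewrite m0 mT0 mulmx1 => MA.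
  have ME : M = (-1) ^+ s *: 1%:M.
    by apply: (can_inj (mulmxK (det1_unit dA))); rewrite MA -scalemxAl mul1mx.
  by rewrite -mx2_1 ME; case: (s); [right; rewrite expr1 scaleN1r|left; rewrite expr0 scale1r].
have [A [a [b [c [d [dA MA hc hb]]]]]] := reduce_conj dM.
have ME : M = A *m mx2 a b c d *m invmx A by rewrite -MA mulmxK ?det1_unit.
have D : a * d - b * c = 1 by move: dM; rewrite ME !det_mulmx det_mx2 dA det_inv1 // mulr1 mul1r.
have T : `|a + d| <= 1 by move: tM t2; rewrite ME tr_conj2 // tr_mx2 => t1 /eqP t2; lia.
have T2 : (a + d) ^+ 2 <= 1 by rewrite -real_normK ?num_real // expr2; move: `|a + d| (normr_ge0 (a + d)) T => t; nia.
have bc : b * c < 0.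
  have : (a + d) ^+ 2 = (a - d) ^+ 2 + 4 * (a * d - b * c) + 4 * (b * c) by ring.
  by have := sqr_ge0 (a - d); rewrite D; lia.
have bc1 : b * c = -1 by have := reduced_bounds hc hb D bc; have := sqr_ge0 (a + d); lia.
have ad0 : a * d = 0 by lia.
have bcu : (b = 1 /\ c = -1) \/ (b = -1 /\ c = 1).
  by have [] := @int_unit b (- c); [lia|left|right]; lia.
have lab x : farey_vertex (real_mx R A *m x) -> phi (real_mx R A *m (real_mx R (mx2 a b c d) *m x)) = phi (real_mx R A *m x).
  by move=> fx; rewrite mulmxA -real_mxM -MA real_mxM -mulmxA label_act.
exfalso; have := tri_face dA; rewrite /tri /face3 /= inE.
suff -> : phi (real_mx R A *m e1 R) = phi (real_mx R A *m e2 R) by rewrite eqxx.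
have [a0|d0] : a = 0 \/ d = 0 by nia.
  rewrite -(lab (e1 R) (farey_A1 R dA)); apply: label_pm; first exact: farey_A2.
  by apply: pm_mul; case: bcu => -[_ ->]; [right|left]; rewrite a0; apply: cvP; rewrite mulmx2E !mxE /=; ring.
apply/esym; rewrite -(lab (e2 R) (farey_A2 R dA)); apply: label_pm; first exact: farey_A1.
by apply: pm_mul; case: bcu => -[-> _]; [left|right]; rewrite d0; apply: cvP; rewrite mulmx2E !mxE /=; ring.
Qed.

End BipyramidLabels.

From mathcomp Require Import measurable_realfun.

(** * Finite area *)

Section Area.
Variable R : realType.
Implicit Types (z w : R * R) (A O U : set (R * R)).

Definition box (q : rat * rat * rat) : set (R * R) :=
  ball (ratr q.1.1 : R) (ratr q.2) `*` ball (ratr q.1.2 : R) (ratr q.2).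

Lemma box_dense z (e : R) : 0 < e -> exists q, box q z /\ box q `<=` ball z e.
Proof.
move=> e0.
have ap (x : R) : exists q : rat, `|ratr q - x| < e / 4.
  have [|q] := @rat_in_itvoo R (x - e / 4) (x + e / 4); first by lra.
  by rewrite in_itv /= => /andP[h1 h2]; exists q; rewrite ltr_norml; lra.
have [q1 h1] := ap z.1; have [q2 h2] := ap z.2.
have [|r] := @rat_in_itvoo R (e / 4) (e / 2); first by lra.
rewrite in_itv /= => /andP[r1 r2]; exists (q1, q2, r); split.
  by split; rewrite /ball /=; [exact: lt_trans h1 r1|exact: lt_trans h2 r1].
have tri (x y q : R) : `|q - x| < e / 4 -> `|q - y| < ratr r -> `|x - y| < e.
  by rewrite !ltr_norml; lra.
by move=> w [k1 k2]; split; rewrite /ball /=; [exact: tri h1 k1|exact: tri h2 k2].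
Qed.

Lemma measurable_box q : measurable (box q : set (measurableTypeR R * measurableTypeR R)).
Proof. by apply: measurableX; apply: open_measurable; exact: ball_open. Qed.

(** Measurability refers to the product structure, so the open set is exhausted by countably many
    rational boxes, enumerated through [unpickle]. *)
Lemma open_measurable2 O : open O -> measurable (O : set (measurableTypeR R * measurableTypeR R)).
Proof.
move=> oO; pose b (n : nat) : set (R * R) :=
  if unpickle n is Some q then (if `[< box q `<=` O >] then box q else set0) else set0.
have -> : O = \bigcup_n b n.
  apply/seteqP; split=> [z Oz|z [n _]]; last first.
    by rewrite /b; case: unpickle => // q; case: asboolP => // h; exact: h.
  have [e /= e0 eO] : exists2 e : R, 0 < e & ball z e `<=` O.
    by move: oO; rewrite openE => /(_ _ Oz) /nbhs_ballP.
  have [q [qz qe]] := box_dense z e0; exists (pickle q); first exact: I.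
  rewrite /b pickleK.
  by case: asboolP => // -[]; exact: subset_trans qe eO.
apply: bigcupT_measurable => n; rewrite /b; case: unpickle => // q.
by case: ifP => // _; exact: measurable_box.
Qed.

Lemma open_upper_half : open (@upper_half R).
Proof.
rewrite openE => z /= z0; apply/nbhs_ballP; exists z.2 => // w [_]; rewrite /ball /= ltr_norml.
by rewrite /upper_half /=; lra.
Qed.

Lemma open_mobius g O : \det g = 1 -> open O -> open [set w | 0 < w.2 /\ O (mobius g w)].
Proof.
move=> dg oO; rewrite openE => w [w0 Ow].
have h1 : nbhs w (@upper_half R) by apply: open_nbhs_nbhs; split => //; exact: open_upper_half.
have h2 : nbhs w (mobius g @^-1` O).
  by apply: mobius_cont => //; apply: open_nbhs_nbhs.
by apply: filterS2 h1 h2 => u.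
Qed.

(* A matrix with lower left entry [c <> 0] maps the strip [|x| < 1, y > 1/2] into a region whose section
   at height [y] has width [O(y ^ 2)]; the area of such a region is finite. *)
Definition spikes (s : seq (R * R)) : set (R * R) :=
  [set z | 0 < z.2 < 3 /\ exists2 p, p \in s & `|p.1 - z.1| < p.2 * z.2 ^+ 2].

Lemma measurable_spikes s : measurable (spikes s : set (measurableTypeR R * measurableTypeR R)).
Proof.
have c1 : continuous (fst : R * R -> R) by move=> z; exact: cvg_fst.
have c2 : continuous (snd : R * R -> R) by move=> z; exact: cvg_snd.
apply: open_measurable2.
have -> : spikes s = [set z | 0 < z.2] `&` [set z | z.2 < 3] `&` \bigcup_(p in [set` s])
   [set z | 0 < p.2 * z.2 ^+ 2 - `|p.1 - z.1| ].
  apply/seteqP; split=> [z [/andP[h1 h2] [p ps h]]|z [[h1 h2] [p ps h]]].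
    by split; [split|exists p => //=; rewrite subr_gt0].
  by split; [apply/andP|exists p => //; move: h; rewrite /= subr_gt0].
apply: openI; first apply: openI.
- exact: open_upper_half.
- by apply: (open_comp (D := [set y : R | y < 3])) => [z _|]; [exact: c2|exact: open_lt].
apply: bigcup_open => p _; apply: (open_comp (f := fun z : R * R => p.2 * z.2 ^+ 2 - `|p.1 - z.1|) (D := [set y : R | 0 < y])) => [z _|]; last exact: open_gt.
apply: cvgB.
  by apply: cvgM; [exact: cvg_cst|rewrite expr2; under eq_fun do rewrite expr2; apply: cvgM; exact: c2].
by apply: cvg_norm; apply: cvgB; [exact: cvg_cst|exact: c1].
Qed.

Lemma spikes_section s (y : R) : 0 < y < 3 -> [set x | spikes s (x, y)] =
  \big[setU/set0]_(i < size s) ball (nth (0, 0) s i).1 ((nth (0, 0) s i).2 * y ^+ 2).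
Proof.
move=> y0; rewrite -(bigcup_mkord _ (fun i => ball (nth (0, 0) s i).1 ((nth (0, 0) s i).2 * y ^+ 2))).
apply/seteqP; split=> [x [_ [p ps h]]|x [i /= si h]].
  by exists (index p s); rewrite /= ?index_mem // nth_index.
by split => //; exists (nth (0, 0) s i) => //; exact: mem_nth.
Qed.

Let T2 : measurableType _ := (measurableTypeR R * measurableTypeR R)%type.
Let f : T2 -> \bar R := fun z => (z.2 ^- 2)%:E.

Lemma measurable_fun_height s : measurable_fun (spikes s : set T2) f.
Proof.
apply/measurable_EFinP.
apply: (@measurable_comp _ _ _ _ _ _ [set y : measurableTypeR R | 0 < y] (fun y : measurableTypeR R => y ^- 2) _ snd).
- by apply: open_measurable; exact: open_gt.
- by move=> _ [z [/andP[]] + _ _ <-].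
- apply: open_continuous_measurable_fun; first exact: open_gt.
  move=> y; rewrite in_setE /= => y0; apply: cvgV; first by rewrite expf_neq0 // gt_eqF.
  exact: exprn_continuous.
by apply: measurable_funTS; exact: measurable_snd.
Qed.

(** Tonelli's theorem reduces the integral to horizontal sections: at height [y] the section has
    length at most [K * y ^ 2], which cancels the density, and only heights below 3 occur. *)
Lemma area_spikes s : (forall p, p \in s -> 0 <= p.2) -> (hyperbolic_area (spikes s) < +oo)%E.
Proof.
move=> s0; have mS := measurable_spikes s; rewrite /hyperbolic_area -/f integral_mkcond.
have f0 z : (0 <= (f \_ (spikes s)) z)%E by apply: erestrict_ge0 => w _; rewrite lee_fin invr_ge0 sqr_ge0.
have mf : measurable_fun [set: T2] (f \_ (spikes s) : T2 -> \bar R).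
  by apply/(@measurable_restrictT _ _ T2 _ (spikes s) f mS); exact: measurable_fun_height.
rewrite fubini_tonelli2 //.
pose K : R := \sum_(i < size s) (nth (0, 0) s i).2 *+ 2.
pose J : set R := `]0, 3[%classic.
have G1 (y : R) : (\int[lebesgue_measure]_x (f \_ (spikes s)) (x, y) <= (cst K%:E \_ J) y)%E.
  have -> : (fun x : R => (f \_ (spikes s)) (x, y)) = (cst (y ^- 2)%:E \_ [set x | spikes s (x, y)]).
    by apply/funext.
  rewrite -integral_mkcond /patch; case: ifPn => y3; last first.
    have -> : [set x | spikes s (x, y)] = set0.
      by apply/seteqP; split=> // x [h _]; move: y3; rewrite notin_setE /J /= in_itv /=.
    by rewrite integral_set0.
  have {}y3 : 0 < y < 3 by move: y3; rewrite in_setE /J /= in_itv.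
  have [y0 _] := andP y3.
  have mb i : measurable (ball (nth (0, 0) s i).1 ((nth (0, 0) s i).2 * y ^+ 2)).
    by apply: open_measurable; exact: ball_open.
  rewrite integral_cst; last by rewrite spikes_section //; apply: bigsetU_measurable => i _; exact: mb.
  have le1 : (lebesgue_measure [set x | spikes s (x, y)] <= (K * y ^+ 2)%:E)%E.
    rewrite spikes_section //; apply: le_trans.
      by apply: (@Boole_inequality _ _ _ lebesgue_measure (fun i => ball (nth (0, 0) s i).1 ((nth (0, 0) s i).2 * y ^+ 2))) => i _; exact: mb.
    rewrite /K mulr_suml -sumEFin; apply: lee_sum => i _.
    rewrite le_eqVlt; apply/orP; left; apply/eqP; rewrite mulrnAl; apply: lebesgue_measure_ball.
    by rewrite mulr_ge0 ?sqr_ge0 // s0 // mem_nth.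
  apply: (@le_trans _ _ ((y ^- 2)%:E * (K * y ^+ 2)%:E)%E).
    by apply: lee_wpmul2l => //; rewrite lee_fin invr_ge0 sqr_ge0.
  by rewrite -EFinM mulrCA mulVf ?mulr1 // expf_neq0 // gt_eqF.
apply: (@le_lt_trans _ _ (\int[lebesgue_measure]_y (cst K%:E \_ J) y)%E).
  apply: ge0_le_integral => //.
  - by move=> y _; apply: integral_ge0 => x _; exact: f0.
  - exact: measurable_fun_fubini_tonelli_G.
  - by apply/(@measurable_restrictT _ _ (measurableTypeR R) _ J (cst K%:E) (measurable_itv _)); exact: measurable_cst.
  - by move=> y _; exact: G1.
have hJ : lebesgue_measure J = 3%:E by rewrite /J lebesgue_measure_itv /= lte_fin ltr0n -EFinB subr0.
rewrite -integral_mkcond integral_cst; last exact: measurable_itv.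
by apply: (@le_lt_trans _ _ (K%:E * 3%:E)%E); [rewrite -hJ|rewrite -EFinM ltry].
Qed.

(** The tip [r 0 0 / r 1 0] is the image of infinity. For [|x| < 1] the number [k] bounds
    [|c x + d|], and [4 * k ^ 2 + c ^ 2] compares the denominator [D] with [y ^ 2]; the final 1
    makes the estimate strict. *)
Definition spike_of (r : 'M[R]_2) : R * R :=
  let k := `|r 1 0| + `|r 1 1| in (r 0 0 / r 1 0, k * (4 * k ^+ 2 + r 1 0 ^+ 2) / `|r 1 0| + 1).

(* With [D = (cx+d)^2 + (cy)^2] the image of [x+iy] is [a/c - (cx+d)/(cD) + i y/D]. *)
Lemma mobius_spike (r : 'M[R]_2) z : \det r = 1 -> 1 <= r 1 0 ^+ 2 -> `|z.1| < 1 -> 1 / 2 < z.2 ->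
  let w := mobius r z in 0 < w.2 < 3 /\ `|(spike_of r).1 - w.1| < (spike_of r).2 * w.2 ^+ 2.
Proof.
case: z => x y dr c1 x1 y1 w; rewrite [fst _]/= [snd _]/= in x1 y1.
have y0 : 0 < y by lra.
rewrite {}/w /spike_of (mobiusE _ dr) //; rewrite det_mx2E in dr; cbn [fst snd].
move: dr c1; move: (r 0 0) (r 0 1) (r 1 0) (r 1 1) => a b c d dr c1.
have c0 : c != 0 by apply: contraTneq c1 => ->; rewrite expr0n /= -ltNge ltr01.
have nc0 : 0 < `|c| by rewrite normr_gt0.
set D := _ + _; set k := `|c| + `|d|.
have k0 : 0 <= k by rewrite addr_ge0.
have y2 : 1 <= 4 * y ^+ 2 by rewrite expr2; nra.
have Dy : y ^+ 2 <= D.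
  by rewrite /D exprMn -[X in X <= _]mul1r; apply: ler_wpDl; rewrite ?sqr_ge0 // ler_wpM2r ?sqr_ge0.
have D0 : 0 < D by apply: lt_le_trans Dy; rewrite exprn_gt0.
have cxd : `|c * x + d| <= k.
  apply: le_trans (ler_normD _ _) _; rewrite lerD2r normrM -[X in _ <= X]mulr1 ler_wpM2l // ltW //.
have Dk : D <= (4 * k ^+ 2 + c ^+ 2) * y ^+ 2.
  rewrite /D exprMn mulrDl lerD2r -real_normK ?num_real //.
  apply: (@le_trans _ _ (k ^+ 2)); first by rewrite ler_sqr ?nnegrE.
  by rewrite mulrAC ler_peMl ?sqr_ge0.
split.
  rewrite divr_gt0 //= ltr_pdivrMr //; apply: (@lt_le_trans _ _ (3 * y ^+ 2)); first by rewrite expr2; nra.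
  by rewrite ler_wpM2l.
have -> : a / c - ((a * x + b) * (c * x + d) + a * c * y ^+ 2) / D = (c * x + d) / (c * D).
  apply/eqP; rewrite -subr_eq0; apply/eqP.
  have -> : a / c - ((a * x + b) * (c * x + d) + a * c * y ^+ 2) / D - (c * x + d) / (c * D) =
     (a * D - c * ((a * x + b) * (c * x + d) + a * c * y ^+ 2) - (c * x + d)) / (c * D).
    by field; rewrite c0 gt_eqF.
  have -> : a * D - c * ((a * x + b) * (c * x + d) + a * c * y ^+ 2) - (c * x + d) = (a * d - b * c - 1) * (c * x + d).
    by rewrite /D; ring.
  by rewrite dr subrr !mul0r.
rewrite normrM normfV normrM (gtr0_norm D0) expr_div_n.
have -> : `|c * x + d| / (`|c| * D) = (`|c * x + d| * D / `|c|) / D ^+ 2 by field; rewrite !gt_eqF.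
rewrite mulrA ltr_pM2r ?invr_gt0 ?exprn_gt0 // ltr_pdivrMr //.
apply: (@lt_le_trans _ _ (k * ((4 * k ^+ 2 + c ^+ 2) * y ^+ 2) + `|c| * y ^+ 2)).
  rewrite ltr_pwDr ?mulr_gt0 ?exprn_gt0 //; apply: le_trans (_ : k * D <= _).
    by rewrite ler_wpM2r // ltW.
  by rewrite ler_wpM2l.
by rewrite le_eqVlt; apply/orP; left; apply/eqP; field; rewrite gt_eqF.
Qed.

End Area.

Section Cofinite.
Variables (R : realType) (G : set 'M[R]_2).
Hypotheses (gG : PSL2_subgroup G) (fi : finite_index G (@PSL2Z R)) (tf : torsion_free G).

Let strip : set (R * R) := [set z | `|z.1| < 1 /\ 1 / 2 < z.2].

Lemma open_strip : open strip.
Proof.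
have c1 : continuous (fst : R * R -> R) by move=> z; exact: cvg_fst.
have c2 : continuous (snd : R * R -> R) by move=> z; exact: cvg_snd.
apply: openI.
  apply: (open_comp (f := fun z : R * R => `|z.1|) (D := [set y : R | y < 1])) => [z _|]; last exact: open_lt.
  by apply: cvg_norm; exact: c1.
by apply: (open_comp (D := [set y : R | 1 / 2 < y])) => [z _|]; [exact: c2|exact: open_gt].
Qed.

(** Coset representatives move every orbit into images of the strip, which contains the modular
    fundamental domain. A representative with lower left entry 0 would fix infinity and give
    unbounded heights, so it is first multiplied by [L], a lower triangular parabolic element of
    [G]. *)
Lemma strip_reps : exists rs : seq 'M[R]_2, (forall r, r \in rs -> \det r = 1 /\ 1 <= r 1 0 ^+ 2) /\
  forall z, 0 < z.2 -> exists g r, [/\ G g, r \in rs & strip (mobius (invmx r) (mobius g z))].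
Proof.
have gZ := PSL2Z_group R; have [Gd _ GM GV] := gG; have [Zd _ ZM ZV] := gZ.
have [s [sZ sP]] := finite_index_reps gG gZ fi.
have int2 : int_cv (e2 R) by apply: farey_int; exact: farey_e2.
have [k k0 Gk] := finite_index_pow gG gZ fi (parab_int 1 int2).
rewrite parabX in Gk; set L := parab _ _ in Gk; have dL : \det L = 1 by exact: det_parab.
pose fixr (r : 'M[R]_2) := if r 1 0 == 0 then L *m r else r.
exists [seq fixr (invmx h) | h <- s]; split=> [r /mapP[h hs ->]|z z0].
  have := ZV _ (sZ _ hs); move: (invmx h) => {h hs} r0 Zr0.
  have dr0 := Zd _ Zr0.
  have sq (x : R) : x \is a Num.int -> x != 0 -> 1 <= x ^+ 2.
    move=> /intrP[m ->]; rewrite intr_eq0 -rmorphXn /= (ler_int _ 1) => m0.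
    by rewrite -real_normK ?num_real // exprn_ege1 //; lia.
  rewrite /fixr; case: eqP => c0; last by split => //; apply: sq; [case: Zr0 => _; apply|apply/eqP].
  rewrite det_mul1 //; split => //.
  have -> : (L *m r0) 1 0 = - (k%:R * r0 0 0) by rewrite mulmx2E !mxE /= c0; ring.
  rewrite sqrrN; have [_ ir] := Zr0; apply: sq; first by apply: rpredM => //; exact: natr_int.
  rewrite mulf_neq0 ?pnatr_eq0 -?lt0n //; apply: contra_eq_neq dr0 => r00.
  by rewrite det_mx2E r00 c0 mul0r mulr0 subr0 eq_sym oner_neq0.
have [g Zg [gx gy]] := PSL2Z_reduce z0; have dg := Zd _ Zg.
have [h hs Gh] := sP _ Zg; have dh := Zd _ (sZ _ hs); have dV := det_inv1 dh.
have st : strip (mobius g z).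
  have := mobius_gt0 z0 dg; move: (mobius g z) gx gy => [x y] /=; rewrite /strip /= => gx gy y0.
  split; first by lra.
  have x2 : x ^+ 2 <= (1 / 2) ^+ 2 by rewrite -real_normK ?num_real // ler_sqr ?nnegrE.
  rewrite ltNge; apply/negP => yle; have : y ^+ 2 <= (1 / 2) ^+ 2 by rewrite ler_sqr ?nnegrE // ltW.
  by move: x2 gy; rewrite !expr2; lra.
have gz0 := mobius_gt0 z0 dg.
have st0 : strip (mobius (invmx (invmx h)) (mobius (invmx h *m g) z)).
  by rewrite invmxK -mobiusM ?det_mul1 // mulmxA mulmxV ?det1_unit // mul1mx.
have [c0|c0] := boolP (invmx h 1 0 == 0).
  exists (L *m (invmx h *m g)), (fixr (invmx h)); split; [exact: GM|exact: map_f|].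
  rewrite /fixr c0 -mobiusM ?det_inv1 ?det_mul1 // ?det_mul1 // invmx_mul //.
  rewrite -mulmxA mulKmx ?det1_unit //; rewrite -mobiusM ?det_mul1 ?det_inv1 // in st0; exact: st0.
exists (invmx h *m g), (fixr (invmx h)); split => //; first exact: map_f.
by rewrite /fixr (negbTE c0).
Qed.

(** From each of countably many small open sets remove the orbits met by earlier ones: what is left
    is measurable and meets every orbit exactly once. It lies in [E], the union of the images of the
    strip, hence in finitely many spikes. *)
Theorem finite_index_cofinite : cofinite G.
Proof.
have [Gd [G1 _] GM GV] := gG.
have [rs [rsP rsE]] := strip_reps.
pose E : set (R * R) := \bigcup_(r in [set` rs]) [set w | 0 < w.2 /\ strip (mobius (invmx r) w)].
have oE : open E.
  apply: bigcup_open => r rr; apply: open_mobius; last exact: open_strip.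
  by have [dr _] := rsP _ rr; exact: det_inv1.
(* Boxes to which only [1] and [-1] return points, so that each contains at most one point of an
   orbit. *)
pose good q := forall g z, G g -> @box R q z -> @box R q (mobius g z) -> 0 < z.2 /\ (g = 1%:M \/ g = - 1%:M).
pose U (n : nat) : set (R * R) := if unpickle n is Some q then (if `[< good q >] then @box R q `&` E else set0) else set0.
have obox q : open (@box R q).
  have -> : @box R q = ball (ratr q.1.1 : R, ratr q.1.2 : R) (ratr q.2) by apply/seteqP; split => w [].
  exact: ball_open.
have oU n : open (U n).
  rewrite /U; case: unpickle => [q|]; last exact: open0.
  by case: ifP => _; [apply: openI => //; exact: obox|exact: open0].
have EH w : E w -> 0 < w.2 by move=> [r _ []].
have UE n w : U n w -> E w.
  by rewrite /U; case: unpickle => // q; case: ifP => // _ [].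
pose T n : set (R * R) := \bigcup_(g in G) [set w | 0 < w.2 /\ U n (mobius g w)].
have oT n : open (T n) by apply: bigcup_open => g Gg; apply: open_mobius => //; exact: Gd.
pose D n : set (R * R) := U n `\` \bigcup_(m in [set m | (m < n)%N]) T m.
exists (\bigcup_n D n); split.
- apply: bigcupT_measurable => n; apply: measurableD; apply: open_measurable2 => //.
  exact: bigcup_open.
- by move=> w [n _ [/UE/EH]].
- move=> z z0; have zg g : G g -> 0 < (mobius g z).2 by move=> Gg; exact: mobius_gt0 z0 (Gd _ Gg).
  pose P n := `[< exists2 g, G g & U n (mobius g z) >].
  have exP : exists n, P n.
    have [g [r [Gg rr st]]] := rsE z z0; have w0 := zg _ Gg.
    have [e e0 He] := free_nbhd gG (finite_index_commensurable gG fi) tf w0.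
    have [q [qw qe]] := box_dense (mobius g z) e0.
    have : U (pickle q) = if `[< good q >] then @box R q `&` E else set0 by rewrite /U pickleK.
    move: (pickle q) => m UE_; exists m; apply/asboolP; exists g => //; rewrite UE_.
    case: asboolP => [_|[]]; first by split => //; exists r.
    by move=> h y Gh hy hhy; apply: He Gh (qe _ hy) (qe _ hhy).
  have [n /asboolP[g Gg Un] nmin] := ex_minnP exP.
  have move_ g' h : G g' -> G h -> mobius (h *m invmx g') (mobius g' z) = mobius h z.
    move=> Gg' Gh; rewrite -mobiusM ?det_mul1 ?det_inv1 ?Gd //.
    by rewrite mulmxKV ?det1_unit ?Gd.
  exists (mobius g z); split.
    split; last by exists g.
    exists n => //; split => // -[m mn [h Gh [_ Uh]]]; have : P m.
      by apply/asboolP; exists (h *m g); [exact: GM|rewrite mobiusM ?Gd].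
    by move=> /nmin; rewrite leqNgt mn.
  move=> w' [[n' _ Dn'] [g' Gg' gw']]; rewrite -{}gw' in Dn' *; have [Un' nT] := Dn'.
  have nn' : (n <= n')%N by apply: nmin; apply/asboolP; exists g'.
  have [lt_nn'|] := ltnP n n'.
    exfalso; apply: nT; exists n => //; exists (g *m invmx g'); first by apply: GM => //; exact: GV.
    by split; [exact: zg|rewrite move_].
  move=> n'n; have nE : n' = n by apply/eqP; rewrite eqn_leq nn' n'n.
  move: Un Un'; rewrite nE /U; case: unpickle => // q; case: asboolP => // gq [bz _] [bz' _].
  have := gq (g *m invmx g') (mobius g' z) (GM _ _ Gg (GV _ Gg')) bz'; rewrite move_ // => /(_ bz)[_ gg'].
  rewrite -(move_ g' g) //; have z'0 := zg _ Gg'.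
  by case: gg' => ->; [exact: mobius1|rewrite mobiusN ?det1 //; exact: mobius1].
pose sp := map (@spike_of R) rs.
have sp0 p : p \in sp -> 0 <= p.2.
  move=> /mapP[r _ ->] /=.
  have k0 : 0 <= `|r 1 0| + `|r 1 1| by exact: addr_ge0.
  apply: addr_ge0 => //; apply: divr_ge0 => //; apply: mulr_ge0 => //.
  by apply: addr_ge0; rewrite ?sqr_ge0 // mulr_ge0 ?sqr_ge0.
apply: le_lt_trans (area_spikes sp0); apply: ge0_subset_integral.
- apply: bigcupT_measurable => n; apply: measurableD; apply: open_measurable2 => //; exact: bigcup_open.
- exact: measurable_spikes.
- exact: measurable_fun_height.
- by move=> w _; rewrite lee_fin invr_ge0 sqr_ge0.
move=> w [n _ [/UE[r rr [w0 [sx sy]]] _]]; have [dr r1] := rsP _ rr.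
have [] := mobius_spike dr r1 sx sy; rewrite (mobiusKV w0 dr) => h1 h2.
by split => //; exists (spike_of r) => //; apply: map_f.
Qed.

End Cofinite.

(** * The quotient as a punctured sphere *)

Section Star.
Variable R : realType.
Implicit Types (z w : R * R) (p : R * R * R) (h : nat -> R).

(* The union of the two Farey triangles along the edge from [e2] = 0 to [e1] = oo, without its outer edges. *)
Definition star z : Prop := [/\ 0 < z.2, `|z.1| < 1 & `|z.1| < z.1 ^+ 2 + z.2 ^+ 2].

Lemma maxp0 (x : R) : 0 <= x -> Num.max x 0 = x. Proof. by move=> x0; apply/max_idPl. Qed.
Lemma maxn0 (x : R) : 0 <= x -> Num.max (- x) 0 = 0. Proof. by move=> x0; apply/max_idPr; rewrite oppr_le0. Qed.

Definition wt1 z : R := (z.1 ^+ 2 + z.2 ^+ 2 - `|z.1|) / z.2.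
Definition wt2 z : R := (1 - `|z.1|) / z.2.
Definition wt3 z : R := Num.max z.1 0 / z.2.
Definition wt4 z : R := Num.max (- z.1) 0 / z.2.

(** The squares are those of the linear forms vanishing at infinity, 0, 1 and -1, the four vertices
    of the star. The last two coefficients come from the positive and the negative part of [z.1], so
    at most one of them is nonzero. *)
Lemma nht_star z v : 0 < z.2 -> nht z v =
  wt1 z * det2 (e1 R) v ^+ 2 + wt2 z * det2 (e2 R) v ^+ 2 + wt3 z * det2 (e3 R) v ^+ 2
  + wt4 z * det2 (cv 1 (-1)) v ^+ 2.
Proof.
case: z => x y /= y0; rewrite /nht /wt1 /wt2 /wt3 /wt4 /det2 !mxE /=.
have yn : y != 0 by rewrite gt_eqF.
have [x0|x0] := leP 0 x; first by rewrite (max_idPr _) ?oppr_le0 // ger0_norm // ; field.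
by rewrite (max_idPl _) ?oppr_ge0 ?ltW // ltr0_norm //; field.
Qed.

(** [invz] and [rotz] are the actions of the inverses of [mS] and [mU], namely [-1 / z] and
    [1 - 1 / z], in real coordinates. *)
Definition invz z : R * R := (- z.1 / (z.1 ^+ 2 + z.2 ^+ 2), z.2 / (z.1 ^+ 2 + z.2 ^+ 2)).
Definition rotz z : R * R := (1 - z.1 / (z.1 ^+ 2 + z.2 ^+ 2), z.2 / (z.1 ^+ 2 + z.2 ^+ 2)).

Lemma star_inv z : star z -> star (invz z).
Proof.
case: z => x y [/= y0 x1 x2]; rewrite /star /invz /=.
have D0 : 0 < x ^+ 2 + y ^+ 2 by apply: le_lt_trans x2.
rewrite normrM normrN normfV (gtr0_norm D0); split; first by rewrite divr_gt0.
  by rewrite ltr_pdivrMr // mul1r.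
have -> : (- x / (x ^+ 2 + y ^+ 2)) ^+ 2 + (y / (x ^+ 2 + y ^+ 2)) ^+ 2 = 1 / (x ^+ 2 + y ^+ 2).
  by field; rewrite gt_eqF.
by rewrite ltr_pM2r // invr_gt0.
Qed.

Lemma wt_inv z : 0 < z.2 -> [/\ wt1 (invz z) = wt2 z, wt2 (invz z) = wt1 z, wt3 (invz z) = wt4 z & wt4 (invz z) = wt3 z].
Proof.
case: z => x y /= y0; rewrite /wt1 /wt2 /wt3 /wt4 /invz /=.
have D0 : 0 < x ^+ 2 + y ^+ 2 by rewrite ltr_wpDl ?sqr_ge0 // exprn_gt0.
rewrite normrM normrN normfV (gtr0_norm D0).
have mx (a b : R) : 0 < b -> Num.max (a / b) 0 = Num.max a 0 / b.
  by move=> b0; rewrite -[X in Num.max _ X](mul0r b^-1) maxr_pMl // ltW // invr_gt0.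
rewrite -[- (- x / _)]mulNr opprK !mx //; split; field; rewrite ?gt_eqF //.
Qed.

Lemma wt_rot z : 0 < z.2 -> 0 <= z.1 -> 0 <= (rotz z).1 ->
  [/\ wt1 (rotz z) = wt2 z, wt2 (rotz z) = wt3 z, wt3 (rotz z) = wt1 z, wt4 (rotz z) = 0 & wt4 z = 0].
Proof.
case: z => x y /= y0 x0; rewrite /wt1 /wt2 /wt3 /wt4 /rotz /= => x1.
have D0 : 0 < x ^+ 2 + y ^+ 2 by rewrite ltr_wpDl ?sqr_ge0 // exprn_gt0.
rewrite !ger0_norm // (maxp0 x0) (maxp0 x1) (maxn0 x0) (maxn0 x1) !mul0r.
by split => //; field; rewrite ?gt_eqF.
Qed.

(* The inverse, up to scaling, of [z |-> (wt1 z, wt2 z, wt3 z - wt4 z)]. *)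
Definition kap (a b t : R) : R * R :=
  (t / (b + `|t|), Num.sqrt (a * b + (a + b) * `|t|) / (b + `|t|)).

Lemma kapP (a b t : R) : 0 < a -> 0 < b -> star (kap a b t) /\ exists2 s, 0 < s &
  [/\ wt1 (kap a b t) = a / s, wt2 (kap a b t) = b / s, wt3 (kap a b t) = Num.max t 0 / s &
     wt4 (kap a b t) = Num.max (- t) 0 / s].
Proof.
move=> a0 b0; rewrite /star /kap /wt1 /wt2 /wt3 /wt4 /=.
have [u [uE t0 t2]] : exists u : R, [/\ `|t| = u, 0 <= u & t ^+ 2 = u ^+ 2].
  by exists `|t|; rewrite real_normK ?num_real.
rewrite uE.
have D0 : 0 < a * b + (a + b) * u by rewrite ltr_pwDl ?mulr_gt0 // mulr_ge0 // addr_ge0 // ltW.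
have [s [sE s0 s2]] : exists s : R, [/\ Num.sqrt (a * b + (a + b) * u) = s, 0 < s & s ^+ 2 = a * b + (a + b) * u].
  by exists (Num.sqrt (a * b + (a + b) * u)); rewrite sqrtr_gt0 sqr_sqrtr // ltW.
rewrite sE.
have e0 : 0 < b + u by rewrite ltr_pwDl.
rewrite normrM normfV uE (gtr0_norm e0).
have E : (t / (b + u)) ^+ 2 + (s / (b + u)) ^+ 2 = (a + u) / (b + u).
  by rewrite !expr_div_n t2 s2; field; rewrite gt_eqF.
split.
  rewrite E divr_gt0 //; split => //; first by rewrite ltr_pdivrMr // mul1r ltrDr.
  by rewrite ltr_pM2r ?invr_gt0 // ltrDr.
have mx (c d : R) : 0 < d -> Num.max (c / d) 0 = Num.max c 0 / d.
  by move=> d0; rewrite -[X in Num.max _ X](mul0r d^-1) maxr_pMl // ltW // invr_gt0.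
exists s => //; rewrite E -[- (t / _)]mulNr !mx //; split; field; rewrite ?gt_eqF //.
Qed.

Lemma kapK z c : 0 < c -> star z -> kap (c * wt1 z) (c * wt2 z) (c * wt3 z - c * wt4 z) = z.
Proof.
case: z => x y c0 [/= y0 x1 x2]; rewrite /kap /wt1 /wt2 /wt3 /wt4 /=.
have yn : y != 0 by rewrite gt_eqF.
have -> : c * (Num.max x 0 / y) - c * (Num.max (- x) 0 / y) = c * x / y.
  have [x0|x0] := leP 0 x; first by rewrite (max_idPr _) ?oppr_le0 // mul0r mulr0 subr0 mulrA.
  by rewrite (max_idPl _) ?oppr_ge0 ?ltW //; field.
rewrite normrM normfV normrM (gtr0_norm c0) (gtr0_norm y0).
have t2 : `|x| ^+ 2 = x ^+ 2 by rewrite real_normK ?num_real.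
move: (`|x|) (normr_ge0 x) x1 x2 t2 => u u0 x1 x2 t2.
have -> : c * ((1 - u) / y) + c * u / y = c / y by field.
have -> : c * ((x ^+ 2 + y ^+ 2 - u) / y) * (c * ((1 - u) / y)) +
  (c * ((x ^+ 2 + y ^+ 2 - u) / y) + c * ((1 - u) / y)) * (c * u / y) = c ^+ 2.
  by rewrite -t2; field.
rewrite sqrtr_sqr gtr0_norm //; congr pair; field; rewrite ?gt_eqF //.
Qed.

(* The bipyramid has apexes [(0, 0, 1)], [(0, 0, -1)] and equator [(1, 0, 0)], [(0, 1, 0)], [(-1, -1, 0)];
   [tent p] expresses [p] in terms of the vertices of the face that the ray through [p] meets. *)
Definition pt h : R * R * R := (h 2 - h 4, h 3 - h 4, h 0 - h 1).

Definition tent p (m : nat) : R :=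
  let t4 := Num.max 0 (Num.max (- p.1.1) (- p.1.2)) in
  match m with 0 => Num.max p.2 0 | 1 => Num.max (- p.2) 0 | 2 => p.1.1 + t4 | 3 => p.1.2 + t4 | _ => t4 end.

Lemma tent_ge0 p m : 0 <= tent p m.
Proof.
case: p => -[x y] z; rewrite /tent /=.
have [h0 [h1 h2]] : let t := Num.max 0 (Num.max (- x) (- y)) in 0 <= t /\ - x <= t /\ - y <= t.
  by rewrite /= !le_max !lexx !orbT.
by case: m => [|[|[|[|m]]]]; rewrite ?le_max ?lexx ?orbT //; lra.
Qed.

Lemma pt_tent p : pt (tent p) = p.
Proof.
case: p => -[x y] z; rewrite /pt /tent /= !addrK; congr (_, _, _).
have [z0|z0] := leP 0 z; first by rewrite (max_idPr _) ?oppr_le0 // subr0.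
by rewrite (max_idPl _) ?oppr_ge0 ?ltW // sub0r opprK.
Qed.

Lemma tent_face p : tent p 0 * tent p 1 = 0 /\ tent p 2 * tent p 3 * tent p 4 = 0.
Proof.
case: p => -[x y] z; rewrite /tent /=; split.
  have [z0|z0] := leP 0 z; first by rewrite (max_idPr _) ?oppr_le0 // mulr0.
  by rewrite mul0r.
by case: (leP (- x) (- y)) => xy; case: leP => h; rewrite ?addr0 ?mulr0 ?addrN ?mulr0 ?mul0r.
Qed.

(** The two product conditions express that the support lies in a face: some apex and some
    equatorial coordinate vanish, which decides every maximum in [tent]. *)
Lemma tent_pt h m : (m < 5)%N -> (forall m, 0 <= h m) -> h 0 * h 1 = 0 -> h 2 * h 3 * h 4 = 0 ->
  tent (pt h) m = h m.
Proof.
move=> m5 h0 h1 h2; have := (h0 0, h0 1, h0 2, h0 3, h0 4) => -[[[[a0 b0] c0] d0] e0].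
have t4 : Num.max 0 (Num.max (- (h 2 - h 4)) (- (h 3 - h 4))) = h 4.
  apply/le_anti/andP; split; first by rewrite !ge_max; apply/and3P; split; lra.
  move/eqP: h2; rewrite !mulf_eq0 => /orP[/orP[]|] /eqP E; rewrite !le_max; apply/or3P.
  - by constructor 2; lra.
  - by constructor 3; lra.
  by constructor 1; lra.
rewrite /tent /pt /= t4; move/eqP: h1; rewrite mulf_eq0 => /orP[]/eqP E;
  case: m m5 => [|[|[|[|[|m]]]]] // _; rewrite ?subrK //.
- by rewrite E sub0r (max_idPr _) // oppr_le0.
- by rewrite E sub0r opprK (max_idPl _).
- by rewrite E subr0 (max_idPl _).
by rewrite E subr0 (max_idPr _) // oppr_le0.
Qed.

Definition scale3 (c : R) p : R * R * R := (c * p.1.1, c * p.1.2, c * p.2).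

Lemma tent_scale c p m : 0 <= c -> tent (scale3 c p) m = c * tent p m.
Proof.
move=> c0; have mx (a b : R) : Num.max (c * a) (c * b) = c * Num.max a b by rewrite maxr_pMr.
have t4 : Num.max 0 (Num.max (- (c * p.1.1)) (- (c * p.1.2))) = c * Num.max 0 (Num.max (- p.1.1) (- p.1.2)).
  by rewrite -!mulrN mx -{1}(mulr0 c) mx.
by case: m => [|[|[|[|m]]]]; rewrite /tent /= ?t4 ?mulrDr // -?mulrN -{1}(mulr0 c) mx.
Qed.

Definition norm3 p : R := Num.sqrt (p.1.1 ^+ 2 + p.1.2 ^+ 2 + p.2 ^+ 2).
Definition unit3 p : R * R * R := scale3 (norm3 p)^-1 p.

End Star.

(** * Weights of a point at the five labels, and the map to the sphere *)

Section Charts.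
Variables (R : realType) (G : set 'M[R]_2) (phi : 'cV[R]_2 -> 'I_5).
Hypotheses (gG : PSL2_subgroup G) (sG : G `<=` @PSL2Z R) (iso : farey_quotient_iso G bipyramid phi).
Implicit Types (A B C : 'M[int]_2) (z w : R * R) (p : R * R * R).

Notation mob A := (mobius (real_mx R A)).

Lemma mob_inv z : 0 < z.2 -> mob mS (invz z) = z.
Proof.
case: z => x y /= y0; have D0 : 0 < x ^+ 2 + y ^+ 2 by rewrite ltr_wpDl ?sqr_ge0 // exprn_gt0.
rewrite mobiusE ?real_mx_det1 ?det_mS //; last by rewrite /= divr_gt0.
by rewrite !real_mxE !mxE /=; congr pair; field; rewrite ?gt_eqF // ?oppr_eq0 ?mulf_neq0 ?gt_eqF.
Qed.

Lemma mob_rot z : 0 < z.2 -> mob mU (rotz z) = z.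
Proof.
case: z => x y /= y0; have D0 : 0 < x ^+ 2 + y ^+ 2 by rewrite ltr_wpDl ?sqr_ge0 // exprn_gt0.
rewrite mobiusE ?real_mx_det1 ?det_mU //; last by rewrite /= divr_gt0.
by rewrite !real_mxE !mxE /=; congr pair; field; rewrite ?gt_eqF // ?oppr_eq0 ?mulf_neq0 ?gt_eqF.
Qed.

(* The coefficients of [nht_star] for the image of [star] under [A], collected by the labels of the four vertices. *)
Definition weight A z (m : nat) : R :=
  let: (i, j, k) := tri phi A in
  wt1 z *+ (i == m) + wt2 z *+ (j == m) + wt3 z *+ (k == m) + wt4 z *+ ((tri phi (A *m mS)).2 == m).

Lemma triS A : \det A = 1 -> tri phi (A *m mS) = ((tri phi A).1.2, (tri phi A).1.1, (tri phi (A *m mS)).2).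
Proof.
move=> dA; rewrite /tri /= !real_mxM -!mulmxA mS_e1 mS_e2; congr (_, nat_of_ord _, _).
by apply: (label_pm gG sG iso (farey_A1 R dA)); right; rewrite mulmxN.
Qed.

Lemma triU A : \det A = 1 -> tri phi (A *m mU) = ((tri phi A).1.2, (tri phi A).2, (tri phi A).1.1).
Proof.
move=> dA; rewrite /tri /= !real_mxM -!mulmxA.
have -> : real_mx R mU *m e1 R = e2 R by apply: cvP; rewrite mulmx2E !mxE /=; ring.
have -> : real_mx R mU *m e2 R = - e3 R by apply: cvP; rewrite mulmx2E !mxE /=; ring.
have -> : real_mx R mU *m e3 R = - e1 R by apply: cvP; rewrite mulmx2E !mxE /=; ring.
congr (_, _, _); congr nat_of_ord; [apply: (label_pm gG sG iso (farey_A3 R dA))|apply: (label_pm gG sG iso (farey_A1 R dA))]; by right; rewrite mulmxN.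
Qed.

Lemma triSS A : \det A = 1 -> tri phi (A *m mS *m mS) = tri phi A.
Proof. by move=> dA; rewrite -mulmxA mSS mulmxN mulmx1 (triN gG sG iso). Qed.

Lemma weightN A z m : \det A = 1 -> weight (- A) z m = weight A z m.
Proof. by move=> dA; rewrite /weight mulNmx !(triN gG sG iso) // det_mul1 ?det_mS. Qed.

Lemma weight_inv A z m : \det A = 1 -> 0 < z.2 -> weight (A *m mS) (invz z) m = weight A z m.
Proof.
move=> dA z0; have [w1 w2 w3 w4] := wt_inv z0.
rewrite /weight triSS // (triS dA); case: (tri phi A) => -[i j] k; rewrite w1 w2 w3 w4.
by rewrite [wt2 z *+ _ + _]addrC -!addrA; congr (_ + (_ + _)); rewrite addrC.
Qed.

Lemma weight_rot A z m : \det A = 1 -> 0 < z.2 -> 0 <= z.1 -> 0 <= (rotz z).1 -> weight (A *m mU) (rotz z) m = weight A z m.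
Proof.
move=> dA z0 x0 x1; have [w1 w2 w3 w4 w5] := wt_rot z0 x0 x1.
rewrite /weight (triU dA); case: (tri phi A) => -[i j] k; rewrite w1 w2 w3 w4 w5 !mul0rn !addr0 /=.
by rewrite [LHS]addrC addrA.
Qed.

Lemma weight_ge0 A z m : star z -> 0 <= weight A z m.
Proof.
case: z => x y [/= y0 x1 x2]; rewrite /weight; case: (tri phi A) => -[i j] k.
rewrite /wt1 /wt2 /wt3 /wt4 /=.
by do 3?[apply: addr_ge0]; apply: mulrn_wge0; apply: divr_ge0; rewrite ?le_max ?lexx ?orbT ?ltW ?subr_gt0.
Qed.

(** Half of [m ^ 2 + n ^ 2 + (m + n) ^ 2]. As linear forms, its six vectors of value 1 are those
    vanishing at [e1], [e2] or [e3], with both signs. *)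
Definition qf (m n : int) : int := m ^+ 2 + m * n + n ^+ 2.

Lemma qf_ge1 m n : ~~ ((m == 0) && (n == 0)) -> 1 <= qf m n.
Proof. by rewrite /qf !expr2; case: (eqVneq m 0) => [->|m0] /=; nia. Qed.

Lemma qf1 m n : qf m n = 1 -> -1 <= n <= 1.
Proof. by rewrite /qf !expr2 => h; apply/andP; nia. Qed.

Lemma qf_basis (a b c d : int) : a * d - b * c = 1 -> qf c d = 1 -> qf a b = 1 ->
  (a, b, c, d) \in [:: (1, 0, 0, 1); (-1, 0, 0, -1); (0, 1, -1, 0); (0, -1, 1, 0);
    (-1, 1, -1, 0); (1, -1, 1, 0); (0, -1, 1, -1); (0, 1, -1, 1);
    (1, 0, -1, 1); (-1, 0, 1, -1); (1, -1, 0, 1); (-1, 1, 0, -1)].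
Proof.
move=> D q1 q2.
have rng (m n : int) : qf m n = 1 -> n \in [:: -1; 0; 1] by move=> /qf1; rewrite !inE; lia.
have qfC m n : qf m n = qf n m by rewrite /qf; ring.
have /allP h : all (fun a => all (fun b => all (fun c => all (fun d => [&& a * d - b * c == 1, qf c d == 1 & qf a b == 1] ==>
  ((a, b, c, d) \in [:: (1, 0, 0, 1); (-1, 0, 0, -1); (0, 1, -1, 0); (0, -1, 1, 0);
    (-1, 1, -1, 0); (1, -1, 1, 0); (0, -1, 1, -1); (0, 1, -1, 1);
    (1, 0, -1, 1); (-1, 0, 1, -1); (1, -1, 0, 1); (-1, 1, 0, -1)])) [:: -1; 0; 1]) [:: -1; 0; 1]) [:: -1; 0; 1]) [:: -1; 0; 1 : int].
  by vm_compute.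
have /h/allP/(_ b (rng _ _ q2))/allP{}h : a \in [:: -1; 0; 1 : int] by apply: (rng b); rewrite qfC.
have /h/allP/(_ d (rng _ _ q1))/implyP : c \in [:: -1; 0; 1 : int] by apply: (rng d); rewrite qfC.
by rewrite D q1 q2 !eqxx; apply.
Qed.

Definition wtsum z : R := wt1 z + wt2 z + wt3 z.

(* Evaluate the form [nht z] on [e1], [e2], [e3] and add up: a primitive vector [u] contributes
   [det2 e1 u ^+ 2 + det2 e2 u ^+ 2 + det2 e3 u ^+ 2 >= 2], with equality for [e1], [e2], [e3] only. *)
Lemma wtsum_mobius z (a b c d : int) : let w := mob (mx2 a b c d) z in
  a * d - b * c = 1 -> 0 < z.2 -> 0 <= z.1 -> 0 < w.2 -> 0 <= w.1 ->
  wtsum z = wt1 w * (qf c d)%:~R + wt2 w * (qf a b)%:~R + wt3 w * (qf (a - c) (b - d))%:~R.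
Proof.
move=> w D z0 x0 w0 wx; have dC : \det (mx2 a b c d) = 1 by rewrite det_mx2.
have w4 t : 0 <= t.1 -> wt4 t = 0 :> R by move=> t0; rewrite /wt4 (maxn0 t0) mul0r.
have E v : nht z v = nht w (real_mx R (mx2 a b c d) *m v) by rewrite nht_mobius ?real_mx_det1.
have F v : wt1 z * det2 (e1 R) v ^+ 2 + wt2 z * det2 (e2 R) v ^+ 2 + wt3 z * det2 (e3 R) v ^+ 2 =
   wt1 w * det2 (e1 R) (real_mx R (mx2 a b c d) *m v) ^+ 2 + wt2 w * det2 (e2 R) (real_mx R (mx2 a b c d) *m v) ^+ 2 +
   wt3 w * det2 (e3 R) (real_mx R (mx2 a b c d) *m v) ^+ 2.
  by have := E v; rewrite !nht_star // !w4 // !mul0r !addr0.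
have := F (e1 R); have := F (e2 R); have := F (e3 R).
rewrite /det2 !mulmx2E !mxE /= /wtsum /qf; move: (wt1 w) (wt2 w) (wt3 w) => w1 w2 w3.
rewrite !(intrD, intrM, rmorphXn, mulrNz) /=; move: (a%:~R : R) (b%:~R : R) (c%:~R : R) (d%:~R : R) => a' b' c' d'.
lra.
Qed.

Lemma star_wt z : star z -> [/\ 0 < wt1 z, 0 < wt2 z, 0 <= wt3 z & 0 <= wt4 z].
Proof.
by move=> [z0 x1 x2]; rewrite /wt1 /wt2 /wt3 /wt4 !divr_gt0 ?subr_gt0 // !divr_ge0 ?le_max ?lexx ?orbT ?ltW.
Qed.

Lemma wtsum_le z (a b c d : int) : let w := mob (mx2 a b c d) z in
  a * d - b * c = 1 -> star z -> 0 <= z.1 -> star w -> 0 <= w.1 -> wtsum w <= wtsum z ?= iff [&& qf c d == 1, qf a b == 1 & (wt3 w == 0) || (qf (a - c) (b - d) == 1)].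
Proof.
move=> w D sz x0 sw wx; have [z0 _ _] := sz; have [w0 _ _] := sw.
have [w1 w2 w3 _] := star_wt sw.
rewrite (wtsum_mobius D z0 x0 w0 wx) -/w.
have q1 : 1 <= qf c d by apply: qf_ge1; apply/negP => /andP[/eqP e1 /eqP e2']; rewrite e1 e2' !mulr0 subr0 in D.
have q2 : 1 <= qf a b by apply: qf_ge1; apply/negP => /andP[/eqP e1 /eqP e2']; rewrite e1 e2' !mul0r subr0 in D.
have q3 : 1 <= qf (a - c) (b - d) by apply: qf_ge1; apply/negP; lia.
have key (t : R) (q : int) : 0 <= t -> 1 <= q -> t <= t * q%:~R ?= iff ((t == 0) || (q == 1)).
  move=> t0 q1'; split; first by rewrite ler_peMr // (ler_int _ 1).
  rewrite -{1}[t]mulr1 -subr_eq0 -mulrBr mulf_eq0 subr_eq0; congr (_ || _).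
  by rewrite eq_sym (eqr_int R _ 1).
rewrite andbA /wtsum; have k1 := key _ _ (ltW w1) q1; have k2 := key _ _ (ltW w2) q2; have k3 := key _ _ w3 q3.
rewrite gt_eqF //= in k1; rewrite gt_eqF //= in k2.
exact: leifD (leifD k1 k2) k3.
Qed.

(** [wtsum_le] applies in both directions between [z] and its image, so equality holds and both rows
    have [qf] equal to 1. The star inequalities and the sign of the real part of the image leave, of
    the twelve matrices in [qf_basis], only the identity, the inverse of [mS] and the two rotations,
    up to sign. *)
Lemma star_overlap z (a b c d : int) : let w := mob (mx2 a b c d) z in
  a * d - b * c = 1 -> star z -> 0 <= z.1 -> star w -> 0 <= w.1 ->
  exists2 M : 'M[int]_2, mx2 a b c d = M \/ mx2 a b c d = - M &
    [\/ M = 1%:M, M = mx2 0 1 (-1) 0, M = mx2 (-1) 1 (-1) 0 | M = mU].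
Proof.
move=> w D sz x0 sw wx; have [z0 x1 x2] := sz; have [w0 _ _] := sw.
have dC : \det (mx2 a b c d) = 1 by rewrite det_mx2.
have L1 := wtsum_le D sz x0 sw wx.
have zE : mob (mx2 d (- b) (- c) a) w = z.
  have -> : mx2 d (- b) (- c) a = invmx (mx2 a b c d) by rewrite invmx2 // !mxE.
  by rewrite -inv_real_mx // mobiusK ?real_mx_det1.
have L2 : wtsum z <= wtsum w.
  have := @wtsum_le w d (- b) (- c) a; rewrite zE => -[] //.
  by rewrite mulrNN -D; ring.
have : wtsum w == wtsum z by rewrite eq_le L2 L1.
rewrite L1 => /and3P[/eqP q1 /eqP q2 _].
have num : 0 <= (a%:~R * z.1 + b%:~R) * (c%:~R * z.1 + d%:~R) + a%:~R * c%:~R * z.2 ^+ 2.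
  move: wx w0; rewrite /w mobiusE ?real_mx_det1 // !real_mxE !mxE /=; move: (_ ^+ 2 + _ ^+ 2) => N h1 h2.
  by move: h2 h1; rewrite (pmulr_rgt0 _ z0) => N0; rewrite pmulr_lge0.
rewrite ger0_norm // in x1 x2.
have L := qf_basis D q1 q2; move: num; clear -L z0 x0 x1 x2.
rewrite !inE in L; move: L; repeat case/orP; move=> /eqP[-> -> -> ->] num.
- by exists 1%:M; [left; rewrite mx2_1|constructor 1].
- by exists 1%:M; [right; rewrite mx2_1 opp_mx2 oppr0|constructor 1].
- by exists (mx2 0 1 (-1) 0); [left|constructor 2].
- by exists (mx2 0 1 (-1) 0); [right; rewrite opp_mx2 oppr0 opprK|constructor 2].
- by exists (mx2 (-1) 1 (-1) 0); [left|constructor 3].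
- by exists (mx2 (-1) 1 (-1) 0); [right; rewrite opp_mx2 oppr0 !opprK|constructor 3].
- by exists mU; [left|constructor 4].
- by exists mU; [right; rewrite opp_mx2 oppr0 !opprK|constructor 4].
all: exfalso; rewrite expr2 in x2; rewrite expr2 in num; move: z.1 z.2 x0 x1 x2 num => x y x0 x1 x2; lra.
Qed.

Lemma mobN A z : \det A = 1 -> 0 < z.2 -> mob (- A) z = mob A z.
Proof. by move=> dA z0; rewrite real_mxN mobiusN // real_mx_det1. Qed.

Lemma mobM A B z : \det A = 1 -> \det B = 1 -> 0 < z.2 -> mob (A *m B) z = mob A (mob B z).
Proof. by move=> dA dB z0; rewrite real_mxM mobiusM // real_mx_det1. Qed.

Lemma mob_gt0 A z : \det A = 1 -> 0 < z.2 -> 0 < (mob A z).2.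
Proof. by move=> dA z0; rewrite mobius_gt0 // real_mx_det1. Qed.

Lemma mob_injl A z w : \det A = 1 -> 0 < z.2 -> 0 < w.2 -> mob A z = mob A w -> z = w.
Proof.
move=> dA z0 w0 /(congr1 (mobius (invmx (real_mx R A)))).
by rewrite !mobiusK ?real_mx_det1.
Qed.

Lemma star_pos A z : \det A = 1 -> star z -> exists B w,
  [/\ \det B = 1, star w, 0 <= w.1, mob B w = mob A z & forall m, weight B w m = weight A z m].
Proof.
move=> dA sz; have [z0 _ _] := sz; have [x0|x0] := leP 0 z.1; first by exists A, z.
have sI := star_inv sz; have [i0 _ _] := sI.
exists (A *m mS), (invz z); split => //; first by rewrite det_mul1 ?det_mS.
- rewrite /invz /= mulr_ge0 ?oppr_ge0 ?(ltW x0) // invr_ge0 addr_ge0 ?sqr_ge0 //.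
- by rewrite mobM ?det_mS // mob_inv.
by move=> m; exact: weight_inv.
Qed.

(** By [star_pos] both points may be taken with nonnegative real part. Then [star_overlap] leaves
    the identity, [mS] and the rotations, under which weights and labels are permuted together. *)
Lemma weight_eq A B z w m : \det A = 1 -> \det B = 1 -> star z -> star w -> mob A z = mob B w ->
  weight A z m = weight B w m.
Proof.
move=> dA0 dB0 sz0 sw0 e0; have [A' [z' [dA sz x0 zE <-]]] := star_pos dA0 sz0.
have [B' [w' [dB sw wx wE <-]]] := star_pos dB0 sw0.
have {e0 zE wE} e : mob A' z' = mob B' w' by rewrite zE wE.
move: A' B' z' w' dA dB sz sw x0 wx e => {dA0 dB0 sz0 sw0} {A B z w} A B z w dA dB sz sw x0 wx e.
have [z0 _ _] := sz; have [w0 _ _] := sw.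
have [a [b [c [d CE]]]] := mx2_ex (invmx B *m A).
have AE : A = B *m mx2 a b c d by rewrite -CE mulKVmx ?det1_unit.
have D : a * d - b * c = 1 by rewrite -det_mx2 -CE det_mul1 ?det_inv1.
have wE : mob (mx2 a b c d) z = w.
  apply: (mob_injl dB) => //; first by rewrite mob_gt0 ?det_mx2.
  by rewrite -mobM ?det_mx2 // -AE.
have := @star_overlap z a b c d; rewrite wE => /(_ D sz x0 sw wx)[M CM]; rewrite AE; case=> ME.
- have wz : w = z.
    rewrite -wE; case: CM => ->; rewrite ME ?mobN ?det1 // real_mx1 mobius1 //.
  by case: CM => ->; rewrite ME ?mulmxN mulmx1 ?weightN // wz.
- have dM : \det M = 1 by rewrite ME det_mx2.
  have MS : M *m mS = 1%:M by rewrite ME mul_mx2 mx2_1; congr mx2; ring.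
  have wz : w = invz z.
    have i0 : 0 < (invz z).2 by have [] := star_inv sz.
    rewrite -wE -{1}(mob_inv z0); case: CM => ->; rewrite ?mobN ?mob_gt0 ?det_mS // -mobM ?det_mS // MS real_mx1 mobius1 //.
  have -> : weight B w m = weight (B *m M *m mS) (invz z) m by rewrite -mulmxA MS mulmx1 wz.
  by rewrite weight_inv ?det_mul1 //; case: CM => ->; rewrite ?mulmxN ?weightN ?det_mul1.
- have dM : \det M = 1 by rewrite ME det_mx2.
  have MU : M *m mU = 1%:M by rewrite ME mul_mx2 mx2_1; congr mx2; ring.
  have i0 : 0 < (rotz z).2 by rewrite divr_gt0 // ltr_wpDl ?sqr_ge0 // exprn_gt0.
  have wz : w = rotz z.
    rewrite -wE -{1}(mob_rot z0); case: CM => ->; rewrite ?mobN ?mob_gt0 ?det_mU // -mobM ?det_mU // MU real_mx1 mobius1 //.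
  have -> : weight B w m = weight (B *m M *m mU) (rotz z) m by rewrite -mulmxA MU mulmx1 wz.
  by rewrite weight_rot ?det_mul1 -?wz //; case: CM => ->; rewrite ?mulmxN ?weightN ?det_mul1.
have dM : \det M = 1 by rewrite ME det_mU.
have i0 : 0 < (rotz w).2 by rewrite divr_gt0 // ltr_wpDl ?sqr_ge0 // exprn_gt0.
have zw : z = rotz w.
  apply: (mob_injl dM) => //; rewrite [RHS](_ : _ = w); last by rewrite ME mob_rot.
  by rewrite -wE; case: CM => ->; rewrite ?mobN.
have -> : weight (B *m mx2 a b c d) z m = weight (B *m mU) z m.
  by case: CM => ->; rewrite ME ?mulmxN ?weightN ?det_mul1 ?det_mU.
by rewrite zw weight_rot // -zw.
Qed.

Lemma star_cover z : 0 < z.2 -> exists A, \det A = 1 /\ star (mobius (invmx (real_mx R A)) z).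
Proof.
move=> z0; have [g /PSL2ZP[B dB ->] [h1 h2]] := PSL2Z_reduce z0.
exists (invmx B); rewrite det_inv1 // -inv_real_mx // invmxK; split => //.
by split; [exact: mob_gt0|lra|lra].
Qed.

(** A face of the bipyramid has one apex and two equatorial labels, so it misses an apex and an
    equatorial vertex, whose weights vanish. *)
Lemma weight_face A z : \det A = 1 -> star z ->
  weight A z 0 * weight A z 1 = 0 /\ weight A z 2 * weight A z 3 * weight A z 4 = 0.
Proof.
move=> dA0 sz0; have [B [w [dB sw wx _ E]]] := star_pos dA0 sz0; rewrite -!E.
have := tri_face iso dB; rewrite /weight; case: (tri phi B) => -[i j] k /=.
rewrite /wt4 (maxn0 wx) mul0r !mul0rn !addr0 !inE.
have ev (t : R) (b : bool) : b = false -> t *+ b = 0 by move=> ->.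
move=> f; have fz (n : nat) : i != n -> j != n -> k != n -> wt1 w *+ (i == n) + wt2 w *+ (j == n) + wt3 w *+ (k == n) = 0.
  by move=> /negPf-> /negPf-> /negPf->; rewrite !mulr0n !addr0.
split.
  have [h|h] : (i != 0 /\ j != 0 /\ k != 0) \/ (i != 1 /\ j != 1 /\ k != 1) by lia.
    by rewrite fz ?mul0r; case: h => ? [].
  by rewrite (fz 1) ?mulr0; case: h => ? [].
have [h|[h|h]] : (i != 2 /\ j != 2 /\ k != 2) \/ (i != 3 /\ j != 3 /\ k != 3) \/ (i != 4 /\ j != 4 /\ k != 4) by lia.
- by rewrite fz ?mul0r; case: h => ? [].
- by rewrite (fz 3) ?mulr0 ?mul0r; case: h => ? [].
by rewrite (fz 4) ?mulr0; case: h => ? [].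
Qed.

(** The two triangles at an edge have different third labels by [label_across]; so the four vertices
    of the star carry distinct labels and their coefficients can be read off separately. *)
Lemma tri_quad A : \det A = 1 -> exists i j k l, [/\ tri phi A = (i, j, k), (tri phi (A *m mS)).2 = l,
  uniq [:: i; j; k; l], all (gtn 5) [:: i; j; k; l] &
  (((i < 2) + ((j < 2) + ((k < 2) + 0)) == 1) && ((i < 2) + ((j < 2) + ((l < 2) + 0)) == 1))%N].
Proof.
move=> dA; have dS : \det (A *m mS) = 1 by rewrite det_mul1 ?det_mS.
have := tri_face iso dS; rewrite triS //; have := tri_face iso dA.
case E : (tri phi A) => [[i j] k]; set l := (tri phi (A *m mS)).2 => f1 f2.
exists i, j, k, l; split => //.
  have kl : k != l.
    have tr B : \det B = 1 -> farey_triangle (real_mx R B *m e1 R) (real_mx R B *m e2 R) (real_mx R B *m e3 R).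
      by move=> dB; apply/farey_triangleP; exists B; split => //; [left|left; split; left].
    have sw : farey_triangle (real_mx R A *m e1 R) (real_mx R A *m e2 R) (real_mx R (A *m mS) *m e3 R).
      have [e12 e23 e13] := tr _ dS; have [e12' _ _] := tr _ dA.
      move: e12 e23 e13; rewrite !real_mxM -!mulmxA mS_e1 mS_e2 => e12 [f2' f3' e23] e13; split => //.
      split => //; first exact: farey_A1.
      by move: e23; rewrite -!/(det2 _ _) mulmxN det2Nl normrN.
    have [<- <-] : phi (real_mx R A *m e3 R) = k :> nat /\ phi (real_mx R (A *m mS) *m e3 R) = l :> nat.
      by split => //; move: E; rewrite /tri => -[].
    apply/eqP => /val_inj; apply: (label_across sG iso (tr _ dA) sw).
    rewrite real_mxM -mulmxA mS_e3 det2_mul (real_mx_det1 R dA) (_ : det2 _ _ = 2) ?mul1r ?pnatr_eq0 //.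
    by rewrite /det2 !mxE /=; ring.
  by move: f1 f2 kl; rewrite /face3 /= !inE; lia.
  by rewrite /= /l /tri; move: E; rewrite /tri => -[<- <- <-]; rewrite !ltn_ord.
by move: f1 f2; rewrite /face3 /= !inE; lia.
Qed.

Lemma weight_at A z i j k l : uniq [:: i; j; k; l] -> tri phi A = (i, j, k) -> (tri phi (A *m mS)).2 = l ->
  [/\ weight A z i = wt1 z, weight A z j = wt2 z, weight A z k = wt3 z & weight A z l = wt4 z] /\
  forall m, m \notin [:: i; j; k; l] -> weight A z m = 0.
Proof.
move=> + e1 e2'; rewrite /weight e1 e2' /= !inE !negb_or => /and4P[/and3P[ij ik il] /andP[jk jl] kl _].
have ev (b : bool) (t : R) : ~~ b -> t *+ b = 0 by move=> /negPf->.
have ji : j != i by rewrite eq_sym. have ki : k != i by rewrite eq_sym. have li : l != i by rewrite eq_sym.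
have kj : k != j by rewrite eq_sym. have lj : l != j by rewrite eq_sym. have lk : l != k by rewrite eq_sym.
split=> [|m]; first by rewrite !(negPf ij, negPf ik, negPf il, negPf jk, negPf jl, negPf kl, negPf ji, negPf ki, negPf li, negPf kj, negPf lj, negPf lk) !eqxx !mulr0n !addr0 !add0r !mulr1n.
by rewrite !inE !negb_or ![m == _]eq_sym => /and4P[h1 h2 h3 h4]; rewrite !ev // !addr0.
Qed.

(** Local inverse of [sphere_map] on the star of [A]: read off the coordinates at the ends of the
    edge and the signed difference at the two third vertices, then return to the half plane by
    [kap]. *)
Definition chart A p : R * R :=
  let: (i, j, k) := tri phi A in
  mob A (kap (tent p i) (tent p j) (tent p k - tent p (tri phi (A *m mS)).2)).

(** A ray with positive coordinates at both ends of an edge meets one of the two faces at that edge;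
    checked by running through the labels. *)
Lemma quad_support (t : nat -> R) (i j k l : nat) : uniq [:: i; j; k; l] -> all (gtn 5) [:: i; j; k; l] ->
  (((i < 2) + ((j < 2) + ((k < 2) + 0)) == 1) && ((i < 2) + ((j < 2) + ((l < 2) + 0)) == 1))%N ->
  0 < t i -> 0 < t j -> t 0 * t 1 = 0 -> t 2 * t 3 * t 4 = 0 ->
  (forall m, (m < 5)%N -> m \notin [:: i; j; k; l] -> t m = 0) /\ t k * t l = 0.
Proof.
move=> u i5 f ti tj h1 h2.
have ni : t i != 0 by rewrite gt_eqF. have nj : t j != 0 by rewrite gt_eqF.
have {}h1 : (t 0 == 0) || (t 1 == 0) by rewrite -mulf_eq0 h1.
have {}h2 : [|| t 2 == 0, t 3 == 0 | t 4 == 0] by rewrite orbA -!mulf_eq0 h2.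
case: i => [|[|[|[|[|i]]]]] in u i5 f ni ti *; rewrite ?andbF // in i5;
case: j => [|[|[|[|[|j]]]]] in u i5 f nj tj *; rewrite ?andbF // in i5;
case: k => [|[|[|[|[|k]]]]] in u i5 f *; rewrite ?andbF // in i5;
case: l => [|[|[|[|[|l]]]]] in u i5 f *; rewrite ?andbF // in i5; clear i5;
rewrite ?(negPf ni) ?(negPf nj) /= ?orbF in h1; rewrite ?(negPf ni) ?(negPf nj) /= ?orbF in h2;
(split; [by case=> [|[|[|[|[|m]]]]] // _ _; apply/eqP|apply/eqP; rewrite mulf_eq0; first [done|by rewrite orbC]]).
Qed.

Lemma chartP A p : \det A = 1 -> 0 < tent p (tri phi A).1.1 -> 0 < tent p (tri phi A).1.2 ->
  exists z s, [/\ star z, chart A p = mob A z, 0 < s & forall m, (m < 5)%N -> weight A z m = tent p m / s].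
Proof.
move=> dA; have [i [j [k [l [e1 e2' u u5 f]]]]] := tri_quad dA; rewrite e1 /= => ti tj.
have [h1 h2] := tent_face p.
have [supp kl] := quad_support u u5 f ti tj h1 h2.
rewrite /chart e1 e2'; set t := tent p k - tent p l.
have [mk ml] : Num.max t 0 = tent p k /\ Num.max (- t) 0 = tent p l.
  have k0 := tent_ge0 p k; have l0 := tent_ge0 p l.
  move/eqP: kl; rewrite /t mulf_eq0 => /orP[]/eqP->.
    by rewrite sub0r opprK (maxp0 l0) (maxn0 l0).
  by rewrite subr0 (maxp0 k0) (maxn0 k0).
have [sz [s s0 [w1 w2 w3 w4]]] := kapP t ti tj.
exists (kap (tent p i) (tent p j) t), s; split => // m m5.
have [[a1 a2 a3 a4] a0] := weight_at (kap (tent p i) (tent p j) t) u e1 e2'.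
have [|mn] := boolP (m \in [:: i; j; k; l]); last by rewrite a0 // supp // mul0r.
by rewrite !inE => /or4P[]/eqP->; rewrite ?a1 ?a2 ?a3 ?a4 ?w1 ?w2 ?w3 ?w4 ?mk ?ml.
Qed.

Lemma chartK A z c p : \det A = 1 -> star z -> 0 < c -> (forall m, (m < 5)%N -> tent p m = c * weight A z m) ->
  chart A p = mob A z.
Proof.
move=> dA sz c0 E; have [i [j [k [l [e1 e2' u u5 f]]]]] := tri_quad dA; rewrite /chart e1 e2'.
have [[a1 a2 a3 a4] _] := weight_at z u e1 e2'.
have /and5P[i5 j5 k5 l5 _] := u5.
by rewrite !E // a1 a2 a3 a4 kapK.
Qed.

Lemma norm3_ge0 p : 0 <= norm3 p. Proof. exact: sqrtr_ge0. Qed.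

Lemma norm3_gt0 p m : tent p m != 0 -> 0 < norm3 p.
Proof.
apply: contraTT; rewrite -leNgt negbK; case: p => -[x y] z N0.
have {N0} S0 : x ^+ 2 + y ^+ 2 + z ^+ 2 <= 0.
  by rewrite leNgt -sqrtr_gt0 -leNgt; exact: N0.
have [x0 [y0 z0]] : x = 0 /\ y = 0 /\ z = 0.
  have := (sqr_ge0 x, sqr_ge0 y, sqr_ge0 z) => -[[a b] c].
  by do !split; apply/eqP; rewrite -sqrf_eq0 eq_le; apply/andP; split => //; lra.
by rewrite x0 y0 z0; case: m => [|[|[|[|m]]]]; rewrite /tent /= ?oppr0 ?maxxx ?addr0 ?maxxx.
Qed.

Lemma sphere_norm p : sphere2 p <-> norm3 p = 1.
Proof.
rewrite /sphere2 /norm3 /=; split=> [->|h]; first exact: sqrtr1.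
have p0 : 0 <= p.1.1 ^+ 2 + p.1.2 ^+ 2 + p.2 ^+ 2 by rewrite !addr_ge0 ?sqr_ge0.
by rewrite -(sqr_sqrtr p0) h expr1n.
Qed.

Lemma norm_scale c p : 0 <= c -> norm3 (scale3 c p) = c * norm3 p.
Proof.
move=> c0; rewrite /norm3 /scale3 /= !exprMn -!mulrDr sqrtrM ?sqr_ge0 // sqrtr_sqr ger0_norm //.
Qed.

Lemma unit_scale c p : 0 < c -> unit3 (scale3 c p) = unit3 p.
Proof.
move=> c0; rewrite /unit3 norm_scale ?(ltW c0) // invfM /scale3 /=.
have E (x : R) : c^-1 * (norm3 p)^-1 * (c * x) = (norm3 p)^-1 * x by rewrite mulrACA mulVf ?gt_eqF // mul1r.
by rewrite !E.
Qed.

Lemma unit_id p : norm3 p = 1 -> unit3 p = p.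
Proof. by move=> n1; rewrite /unit3 n1 invr1 /scale3 !mul1r; case: p {n1} => -[]. Qed.

Lemma unit_norm p : 0 < norm3 p -> norm3 (unit3 p) = 1.
Proof. by move=> p0; rewrite /unit3 norm_scale ?invr_ge0 ?(ltW p0) // mulVf ?gt_eqF. Qed.

Lemma pt_eq (h h' : nat -> R) : (forall m, (m < 5)%N -> h m = h' m) -> pt h = pt h'.
Proof. by move=> E; rewrite /pt !E. Qed.

Lemma pt_scale c (h : nat -> R) : pt (fun m => c * h m) = scale3 c (pt h).
Proof. by rewrite /pt /scale3 /= !mulrBr. Qed.

Definition delta (n m : nat) : R := (m == n)%:R.
Definition puncture (n : nat) : R * R * R := unit3 (pt (delta n)).

Lemma tent_delta n m : (m < 5)%N -> tent (pt (delta n)) m = delta n m.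
Proof.
move=> m5; apply: (tent_pt m5); first by move=> k; exact: ler0n.
all: by rewrite /delta; case: n => [|[|[|[|[|n]]]]]; rewrite /= ?mulr0 ?mul0r ?mulr0.
Qed.

Lemma puncture_norm n : (n < 5)%N -> 0 < norm3 (pt (delta n)).
Proof. by move=> n5; apply: (@norm3_gt0 _ n); rewrite tent_delta // /delta eqxx oner_neq0. Qed.

(** A unit vector with a single positive coordinate is a puncture. *)
Lemma two_labels p : norm3 p = 1 -> (forall n, (n < 5)%N -> p <> puncture n) ->
  exists i j, [/\ (i < 5)%N, (j < 5)%N, i != j, 0 < tent p i & 0 < tent p j].
Proof.
move=> n1 np; apply: contrapT => no.
have [i [i5 ti]] : exists i, (i < 5)%N /\ 0 < tent p i.
  apply: contrapT => no'; have : norm3 p = 0.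
    rewrite -(pt_tent p) (@pt_eq _ (fun=> 0)); first by rewrite /norm3 /pt /= !subrr !expr0n /= !addr0 sqrtr0.
    move=> m m5; apply/eqP; rewrite eq_le tent_ge0 andbT leNgt; apply/negP => tm; apply: no'; by exists m.
  by rewrite n1; move/eqP; rewrite oner_eq0.
apply: (np i i5); rewrite -(unit_id n1) -{1}(pt_tent p) /puncture -(unit_scale (pt (delta i)) ti) -pt_scale; congr unit3.
apply: pt_eq => m m5; rewrite /delta; have [->|mi] := eqVneq m i; first by rewrite mulr1.
rewrite mulr0; apply/eqP; rewrite eq_le tent_ge0 andbT leNgt; apply/negP => tm; apply: no.
by exists i, m; split => //; rewrite eq_sym.
Qed.

(** The choice of [A] is immaterial: by [weight_eq] all images of [star] that contain [z] give the
    same weights. *)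
Definition sphere_map z : R * R * R :=
  let A := xget 1%:M [set A | \det A = 1 /\ star (mobius (invmx (real_mx R A)) z)] in
  unit3 (pt (weight A (mobius (invmx (real_mx R A)) z))).

Lemma sphere_mapE A z : \det A = 1 -> star z -> sphere_map (mob A z) = unit3 (pt (weight A z)).
Proof.
move=> dA sz; have [z0 _ _] := sz; have w0 := mob_gt0 dA z0.
rewrite /sphere_map; case: xgetP => [B _ [dB sB]|h]; last first.
  by have [B /h] := star_cover w0.
congr unit3; apply: pt_eq => m _; apply: weight_eq => //.
by rewrite mobiusKV ?real_mx_det1.
Qed.

Lemma tent_weight A z m : \det A = 1 -> star z -> (m < 5)%N -> tent (pt (weight A z)) m = weight A z m.
Proof.
move=> dA sz m5; have [h1 h2] := weight_face dA sz.
by apply: tent_pt => // n; exact: weight_ge0.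
Qed.

Lemma tri_weights A z : \det A = 1 -> star z -> let i := (tri phi A).1.1 in let j := (tri phi A).1.2 in
  [/\ (i < 5)%N, (j < 5)%N, i != j, 0 < weight A z i & 0 < weight A z j].
Proof.
move=> dA sz; have [i [j [k [l [e1 e2' u u5 f]]]]] := tri_quad dA; rewrite e1.
have [[a1 a2 _ _] _] := weight_at z u e1 e2'; have [w1 w2 _ _] := star_wt sz.
have /and5P[i5 j5 _ _ _] := u5; rewrite /= a1 a2; split => //.
by move: u => /andP[]; rewrite !inE !negb_or => /and3P[].
Qed.

Lemma weight_norm A z : \det A = 1 -> star z -> 0 < norm3 (pt (weight A z)).
Proof.
move=> dA sz; have [i5 _ _ wi _] := tri_weights dA sz.
by apply: (@norm3_gt0 _ (tri phi A).1.1); rewrite tent_weight // gt_eqF.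
Qed.

Lemma tent_map A z m : \det A = 1 -> star z -> (m < 5)%N ->
  tent (sphere_map (mob A z)) m = (norm3 (pt (weight A z)))^-1 * weight A z m.
Proof.
move=> dA sz m5; rewrite sphere_mapE // /unit3 tent_scale ?tent_weight // invr_ge0 ltW // weight_norm //.
Qed.

Lemma chart_map A z : \det A = 1 -> star z -> chart A (sphere_map (mob A z)) = mob A z.
Proof.
move=> dA sz; apply: (chartK (c := (norm3 (pt (weight A z)))^-1)) => //; first by rewrite invr_gt0 weight_norm.
by move=> m; exact: tent_map.
Qed.

Lemma map_chart A p : \det A = 1 -> norm3 p = 1 -> 0 < tent p (tri phi A).1.1 -> 0 < tent p (tri phi A).1.2 ->
  0 < (chart A p).2 /\ sphere_map (chart A p) = p.
Proof.
move=> dA n1 ti tj; have [z [s [sz -> s0 E]]] := chartP dA ti tj; have [z0 _ _] := sz.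
split; first exact: mob_gt0.
have pE : p = unit3 (scale3 s^-1 (pt (tent p))) by rewrite unit_scale ?invr_gt0 // pt_tent unit_id.
rewrite sphere_mapE // [RHS]pE -pt_scale; congr unit3.
by apply: pt_eq => m m5; rewrite E // mulrC.
Qed.

Lemma dart_edge (i j : nat) : (i < 5)%N -> (j < 5)%N -> dartn i j -> exists2 A, \det A = 1 & (tri phi A).1 = (i, j).
Proof.
move=> i5 j5 ij; have [_ h _ _ _] := iso.
have /h[v [w [/farey_edgeP[A [dA vE pw]] vi wj]]] : adj bipyramid (Ordinal i5) (Ordinal j5) by rewrite adj_dartn.
exists A => //; rewrite /tri /= -vE vi; congr pair.
have fw : farey_vertex w by case: pw => ->; [|apply: farey_vertexN]; exact: farey_A2.
by rewrite (label_pm gG sG iso fw (pm_sym pw)) wj.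
Qed.

Lemma map_act g z : G g -> 0 < z.2 -> sphere_map (mobius g z) = sphere_map z.
Proof.
move=> Gg z0; have /PSL2ZP[B dB gB] := sG Gg; rewrite gB in Gg *.
have [A [dA sA]] := star_cover z0; set w := mobius _ z in sA.
have zE : z = mob A w by rewrite /w mobiusKV ?real_mx_det1.
have [w0 _ _] := sA; rewrite zE -(mobM dB dA w0) !sphere_mapE ?det_mul1 //; congr unit3; apply: pt_eq => m _.
have dS : \det (A *m mS) = 1 by rewrite det_mul1 ?det_mS.
by rewrite /weight -[B *m A *m mS]mulmxA (tri_act sG iso dA dB Gg) (tri_act sG iso dS dB Gg).
Qed.

Lemma star_rot z : star z -> 0 < z.1 -> star (rotz z) /\ 0 < (rotz z).1.
Proof.
case: z => x y [/= y0 + +] x0; rewrite /rotz /star (gtr0_norm x0) /= => x1 x2.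
have D0 : 0 < x ^+ 2 + y ^+ 2 by apply: lt_trans x2.
have E0 : 0 < 1 - x / (x ^+ 2 + y ^+ 2) by rewrite subr_gt0 ltr_pdivrMr // mul1r.
rewrite (gtr0_norm E0); split => //; split; first by rewrite divr_gt0.
  by rewrite ltrBlDr ltrDl divr_gt0.
rewrite -subr_gt0 (_ : _ - _ = (1 - x) / (x ^+ 2 + y ^+ 2)); last by field; rewrite gt_eqF.
by rewrite divr_gt0 // subr_gt0.
Qed.

(** After [star_pos] the labels of positive weight are among the vertices of a single triangle;
    rotating it by [mU], or reversing an edge by [mS], brings the two labels to the front. *)
Lemma switch_edge B w (i j : nat) : \det B = 1 -> star w -> i != j -> 0 < weight B w i -> 0 < weight B w j ->
  exists C v, [/\ \det C = 1, star v, mob C v = mob B w & (tri phi C).1 = (i, j)].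
Proof.
move=> dB0 sw0 ij wi wj; have [C [v [dC sv v0 <- E]]] := star_pos dB0 sw0.
rewrite -!E in wi wj; move: C v dC sv v0 {E} wi wj => {dB0 sw0} {B w} B w dB sw x0 wi wj.
have [a [b [c [l [e1 e2' u _ _]]]]] := tri_quad dB.
have [[_ _ wc wl] w0] := weight_at w u e1 e2'.
have wl0 : weight B w l = 0 by rewrite wl /wt4 (maxn0 x0) mul0r.
have lab n : 0 < weight B w n -> [\/ n = a, n = b | n = c /\ 0 < w.1].
  move=> wn; have [|/w0 h] := boolP (n \in [:: a; b; c; l]); last by rewrite h ltxx in wn.
  rewrite !inE => /or4P[]/eqP nE; [by constructor 1|by constructor 2|constructor 3|by rewrite nE wl0 ltxx in wn].
  split => //; rewrite lt0r x0 andbT; apply/eqP => x00.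
  by move: wn; rewrite nE wc /wt3 x00 maxxx mul0r ltxx.
have sw_ C v : \det C = 1 -> star v -> mob C v = mob B w -> (tri phi C).1 = (j, i) ->
    exists C v, [/\ \det C = 1, star v, mob C v = mob B w & (tri phi C).1 = (i, j)].
  move=> dC sv e t; have [v0 _ _] := sv; exists (C *m mS), (invz v); split.
  - by rewrite det_mul1 ?det_mS.
  - exact: star_inv.
  - have [i0 _ _] := star_inv sv; by rewrite mobM ?det_mS // mob_inv.
  by rewrite triS // t.
have rot C v : \det C = 1 -> star v -> mob C v = mob B w -> 0 < v.1 ->
    [/\ \det (C *m mU) = 1, star (rotz v), mob (C *m mU) (rotz v) = mob B w & 0 < (rotz v).1].
  move=> dC sv e v1; have [v0 _ _] := sv; have [sr r1] := star_rot sv v1; have [r0 _ _] := sr.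
  by rewrite det_mul1 ?det_mU // mobM ?det_mU // mob_rot.
have key : 0 < w.1 -> exists C v, [/\ \det C = 1, star v, mob C v = mob B w & (tri phi C).1 = (b, c)] /\
   exists C v, [/\ \det C = 1, star v, mob C v = mob B w & (tri phi C).1 = (c, a)].
  move=> w1; have [dU sU eU U1] := rot _ _ dB sw erefl w1; have [dUU sUU eUU _] := rot _ _ dU sU eU U1.
  exists (B *m mU), (rotz w); split; first by split => //; rewrite triU // e1.
  exists (B *m mU *m mU), (rotz (rotz w)); split => //.
  by rewrite triU // triU // e1.
case: (lab _ wi) (lab _ wj) => [iE|iE|[iE w1]] [jE|jE|[jE w1']]; try by rewrite iE jE eqxx in ij.
- by exists B, w; split => //; rewrite e1 iE jE.
- have [_ [_ [_ [C [v [dC sv e t]]]]]] := key w1'; apply: (sw_ C v) => //; by rewrite t iE jE.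
- by apply: (sw_ B w) => //; rewrite e1 iE jE.
- have [C [v [[dC sv e t] _]]] := key w1'; by exists C, v; rewrite iE jE.
- have [_ [_ [_ [C [v [dC sv e t]]]]]] := key w1; by exists C, v; rewrite iE jE.
have [C [v [[dC sv e t] _]]] := key w1; apply: (sw_ C v) => //; by rewrite t iE jE.
Qed.

(** Equal images have the same positive labels, so both points lie in stars of edges with the same
    two labels. By [tri_eq] an element of [G] matches these edges, and [chart_map] recovers a point
    from its image and its edge. *)
Lemma map_orbit z w : 0 < z.2 -> 0 < w.2 -> sphere_map z = sphere_map w -> same_orbit G z w.
Proof.
move=> z0 w0 e.
have [A [dA sA]] := star_cover z0; set z1 := mobius _ z in sA.
have zE : z = mob A z1 by rewrite /z1 mobiusKV ?real_mx_det1.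
have [B [dB sB]] := star_cover w0; set w1 := mobius _ w in sB.
have wE : w = mob B w1 by rewrite /w1 mobiusKV ?real_mx_det1.
have [i5 j5 ij wi wj] := tri_weights dA sA.
have N1 := weight_norm dA sA; have N2 := weight_norm dB sB.
have pos n : (n < 5)%N -> 0 < weight A z1 n -> 0 < weight B w1 n.
  move=> n5 wn; have := tent_map dA sA n5; rewrite -zE e wE tent_map // => E.
  by rewrite -(@pmulr_rgt0 _ (norm3 (pt (weight B w1)))^-1) ?invr_gt0 // E mulr_gt0 ?invr_gt0.
have [C [v [dC sv CE t]]] := switch_edge dB sB ij (pos _ i5 wi) (pos _ j5 wj).
have Gg := tri_eq gG sG iso dA dC (esym (etrans t (esym (surjective_pairing _)))).
exists (real_mx R (C *m invmx A)) => //; have [z10 _ _] := sA.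
have gz : mob (C *m invmx A) z = mob C z1.
  by rewrite {1}zE -mobM ?det_mul1 ?det_inv1 // mulmxKV ?det1_unit.
rewrite gz -(chart_map dC sA) -gz map_act // e wE -CE; exact: chart_map.
Qed.

End Charts.

(** * Continuity of the map and of its local inverses *)

Section GenusZero.
Variables (R : realType) (G : set 'M[R]_2) (phi : 'cV[R]_2 -> 'I_5).
Hypotheses (gG : PSL2_subgroup G) (sG : G `<=` @PSL2Z R) (iso : farey_quotient_iso G bipyramid phi).
Implicit Types (A B C : 'M[int]_2) (z w : R * R) (p : R * R * R).

Notation mob A := (mobius (real_mx R A)).

Lemma abs_cont (T : topologicalType) (f : T -> R) (x : T) :
  {for x, continuous f} -> {for x, continuous (fun y => `|f y|)}.
Proof. by move=> fc; apply: (@continuous_comp _ _ _ f (fun t : R => `|t|)) => //; exact: norm_continuous. Qed.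

Lemma max_cont (T : topologicalType) (f g : T -> R) (x : T) :
  {for x, continuous f} -> {for x, continuous g} -> {for x, continuous (fun y => Num.max (f y) (g y))}.
Proof. by move=> fc gc; exact: (continuous_max fc gc). Qed.

Lemma star_near z : star z -> \forall w \near z, star w.
Proof.
move=> [z0 x1 x2].
have c1 : {for z, continuous (fun w : R * R => w.1)} by exact: cvg_fst.
have c2 : {for z, continuous (fun w : R * R => w.2)} by exact: cvg_snd.
have ca := abs_cont c1.
have cs : {for z, continuous (fun w : R * R => w.1 ^+ 2 + w.2 ^+ 2 - `|w.1|)}.
  by apply: cvgB => //; apply: cvgD; rewrite expr2; apply: cvgM.
have h0 : \forall w \near z, 0 < w.2 by exact: (cvgr_gt _ c2).
have h1 : \forall w \near z, `|w.1| < 1 by exact: (cvgr_lt _ ca).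
have h2 : \forall w \near z, 0 < w.1 ^+ 2 + w.2 ^+ 2 - `|w.1| by apply: (cvgr_gt _ cs); rewrite subr_gt0.
near=> w; split; [by near: w|by near: w|rewrite -subr_gt0; by near: w].
Unshelve. all: by end_near.
Qed.

Lemma weight_cont A z m : 0 < z.2 -> {for z, continuous (fun w => weight phi A w m)}.
Proof.
move=> z0; have yn := lt0r_neq0 z0.
have c1 : {for z, continuous (fun w : R * R => w.1)} by exact: cvg_fst.
have c2 : {for z, continuous (fun w : R * R => w.2)} by exact: cvg_snd.
have ci : {for z, continuous (fun w : R * R => w.2^-1)} by apply: cvgV.
have ca := abs_cont c1.
have cn : {for z, continuous (fun w : R * R => - w.1)} by apply: cvgN.
have k (c : R) : {for z, continuous (fun _ : R * R => c)} by exact: cvg_cst.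
have b (f : R * R -> R) (e : bool) : {for z, continuous f} -> {for z, continuous (fun w => f w *+ e)}.
  by case: e => // _; rewrite (_ : (fun w => _) = (fun=> 0)).
have w1 : {for z, continuous (@wt1 R)}.
  by apply: cvgM => //; apply: cvgB => //; apply: cvgD; rewrite expr2; apply: cvgM.
have w2 : {for z, continuous (@wt2 R)} by apply: cvgM => //; exact: (cvgB (k 1) ca).
have w3 : {for z, continuous (@wt3 R)} by apply: cvgM => //; apply: max_cont.
have w4 : {for z, continuous (@wt4 R)} by apply: cvgM => //; exact: (max_cont cn (k 0)).
rewrite /weight; case: (tri phi A) => -[i j] l; set q := (tri phi _).2.
by apply: cvgD; [apply: cvgD; [apply: cvgD|]|]; apply: b.
Qed.

Lemma norm3_cont p : {for p, continuous (@norm3 R)}.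
Proof.
have c1 : {for p, continuous (fun q : R * R * R => q.1.1)}.
  by apply: (@continuous_comp _ _ _ fst fst); exact: cvg_fst.
have c2 : {for p, continuous (fun q : R * R * R => q.1.2)}.
  by apply: (@continuous_comp _ _ _ fst snd); [exact: cvg_fst|exact: cvg_snd].
have c3 : {for p, continuous (fun q : R * R * R => q.2)} by exact: cvg_snd.
apply: (@continuous_comp _ _ _ (fun q : R * R * R => q.1.1 ^+ 2 + q.1.2 ^+ 2 + q.2 ^+ 2) Num.sqrt).
  by apply: cvgD; [apply: cvgD|]; rewrite expr2; apply: cvgM.
exact: sqrt_continuous.
Qed.

Lemma unit3_cont p : 0 < norm3 p -> {for p, continuous (@unit3 R)}.
Proof.
move=> p0; have cn : {for p, continuous (fun q => (norm3 q)^-1)} by apply: cvgV; [exact: lt0r_neq0|exact: norm3_cont].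
have c1 : {for p, continuous (fun q : R * R * R => q.1.1)}.
  by apply: (@continuous_comp _ _ _ fst fst); exact: cvg_fst.
have c2 : {for p, continuous (fun q : R * R * R => q.1.2)}.
  by apply: (@continuous_comp _ _ _ fst snd); [exact: cvg_fst|exact: cvg_snd].
have c3 : {for p, continuous (fun q : R * R * R => q.2)} by exact: cvg_snd.
by apply: (@pair_cont _ _ _ (fun q => ((norm3 q)^-1 * q.1.1, (norm3 q)^-1 * q.1.2)) (fun q => (norm3 q)^-1 * q.2));
  [apply: (@pair_cont _ _ _ (fun q => (norm3 q)^-1 * q.1.1) (fun q => (norm3 q)^-1 * q.1.2))|]; apply: cvgM.
Qed.

Lemma pt_cont A z : 0 < z.2 -> {for z, continuous (fun w => pt (weight phi A w))}.
Proof.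
move=> z0; have c m := @weight_cont A z m z0.
apply: (@pair_cont _ _ _ (fun w => (weight phi A w 2 - weight phi A w 4, weight phi A w 3 - weight phi A w 4))
  (fun w => weight phi A w 0 - weight phi A w 1)); last exact: (cvgB (c 0%N) (c 1%N)).
by apply: (@pair_cont _ _ _ (fun w => weight phi A w 2 - weight phi A w 4)
  (fun w => weight phi A w 3 - weight phi A w 4)); [exact: (cvgB (c 2%N) (c 4%N))|exact: (cvgB (c 3%N) (c 4%N))].
Qed.

(** A star that contains [z] also contains the nearby points, so one matrix [A] serves for all of
    them. *)
Lemma map_cont z : 0 < z.2 -> {for z, continuous (sphere_map phi)}.
Proof.
move=> z0; have [A [dA sA]] := star_cover z0; set z1 := mobius _ z in sA.
have dI : \det (invmx (real_mx R A)) = 1 by rewrite det_inv1 ?real_mx_det1.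
have [z10 _ _] := sA.
have cm : {for z, continuous (mobius (invmx (real_mx R A)))} by exact: mobius_cont.
have hs : \forall w \near z, star (mobius (invmx (real_mx R A)) w) by exact: (cm _ (star_near sA)).
have c2 : {for z, continuous (fun w : R * R => w.2)} by exact: cvg_snd.
have h0 : \forall w \near z, 0 < w.2 by exact: (cvgr_gt _ c2).
pose F w := unit3 (pt (weight phi A (mobius (invmx (real_mx R A)) w))).
have FE : \forall w \near z, F w = sphere_map phi w.
  near=> w; have w0 : 0 < w.2 by near: w.
  have sw : star (mobius (invmx (real_mx R A)) w) by near: w.
  by rewrite /F -(sphere_mapE gG sG iso dA sw) mobiusKV ?real_mx_det1.
rewrite /prop_for /continuous_at -(nbhs_singleton FE).
apply: cvg_trans; first by apply: near_eq_cvg; exact: FE.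
have cF : {for z, continuous F}; last exact: cF.
apply: (@continuous_comp _ _ _ (mobius (invmx (real_mx R A))) (fun w => unit3 (pt (weight phi A w)))) => //.
apply: (@continuous_comp _ _ _ (fun w => pt (weight phi A w)) (@unit3 R)); first exact: pt_cont.
by apply: unit3_cont; exact: (weight_norm gG sG iso).
Unshelve. all: by end_near.
Qed.

Lemma tent_cont p m : {for p, continuous (fun q => tent q m)}.
Proof.
have c1 : {for p, continuous (fun q : R * R * R => q.1.1)}.
  by apply: (@continuous_comp _ _ _ fst fst); exact: cvg_fst.
have c2 : {for p, continuous (fun q : R * R * R => q.1.2)}.
  by apply: (@continuous_comp _ _ _ fst snd); [exact: cvg_fst|exact: cvg_snd].
have c3 : {for p, continuous (fun q : R * R * R => q.2)} by exact: cvg_snd.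
have k0 : {for p, continuous (fun _ : R * R * R => 0 : R)} by exact: cvg_cst.
have c4 : {for p, continuous (fun q : R * R * R => Num.max 0 (Num.max (- q.1.1) (- q.1.2)))}.
  by apply: max_cont => //; apply: max_cont; apply: cvgN.
case: m => [|[|[|[|m]]]]; rewrite /tent /=.
- exact: max_cont.
- by apply: max_cont => //; apply: cvgN.
- exact: cvgD.
- exact: cvgD.
exact: c4.
Qed.

Lemma chart_cont A p : \det A = 1 -> 0 < tent p (tri phi A).1.1 -> 0 < tent p (tri phi A).1.2 ->
  {for p, continuous (chart phi A)}.
Proof.
move=> dA; rewrite /chart; set l := (tri phi (A *m mS)).2; case: (tri phi A) => -[i j] k /= ti tj.
have [a [aE ca]] : exists a : R * R * R -> R, a = (fun q => tent q i) /\ {for p, continuous a}.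
  by eexists; split; first reflexivity; exact: tent_cont.
have [b [bE cb]] : exists b : R * R * R -> R, b = (fun q => tent q j) /\ {for p, continuous b}.
  by eexists; split; first reflexivity; exact: tent_cont.
have [t [tE ct]] : exists t : R * R * R -> R, t = (fun q => tent q k - tent q l) /\ {for p, continuous t}.
  by eexists; split; first reflexivity; apply: cvgB; exact: tent_cont.
have -> : (fun q => mob A (kap (tent q i) (tent q j) (tent q k - tent q l))) = (fun q => mob A (kap (a q) (b q) (t q))).
  by rewrite aE bE tE.
have a0 : 0 < a p by rewrite aE. have b0 : 0 < b p by rewrite bE.
clear aE bE tE ti tj.
have cu := abs_cont ct.
have d0 : b p + `|t p| != 0 by rewrite gt_eqF // ltr_pwDl.
have cd : {for p, continuous (fun q => (b q + `|t q|)^-1)} by apply: cvgV => //; apply: cvgD.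
apply: (@continuous_comp _ _ _ (fun q => kap (a q) (b q) (t q)) (mobius (real_mx R A))); last first.
  by apply: mobius_cont; [have [[]] := kapP (t p) a0 b0|exact: real_mx_det1].
apply: (@pair_cont _ _ _ (fun q => t q / (b q + `|t q|))
  (fun q => Num.sqrt (a q * b q + (a q + b q) * `|t q|) / (b q + `|t q|))); apply: cvgM => //.
apply: (@continuous_comp _ _ _ (fun q => a q * b q + (a q + b q) * `|t q|) Num.sqrt); last exact: sqrt_continuous.
by apply: cvgD; apply: cvgM => //; apply: cvgD.
Qed.

Lemma map_not_puncture z n : 0 < z.2 -> (n < 5)%N -> sphere_map phi z <> puncture R n.
Proof.
move=> z0 n5; have [A [dA sA]] := star_cover z0; set z1 := mobius _ z in sA.
have -> : z = mob A z1 by rewrite /z1 mobiusKV ?real_mx_det1.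
have [i5 j5 ij wi wj] := tri_weights gG sG iso dA sA.
have N := weight_norm gG sG iso dA sA.
move=> e; have pos m : (m < 5)%N -> 0 < weight phi A z1 m -> m = n.
  move=> m5 wm; apply: contrapT => /eqP mn.
  have := tent_map gG sG iso dA sA m5; rewrite e /puncture /unit3 tent_scale ?invr_ge0 ?norm3_ge0 // tent_delta // /delta (negPf mn) mulr0.
  by move/esym/eqP; rewrite mulf_eq0 invr_eq0 !gt_eqF.
by move: ij; rewrite (pos _ i5 wi) (pos _ j5 wj) eqxx.
Qed.

Lemma map_sphere z : 0 < z.2 -> norm3 (sphere_map phi z) = 1.
Proof.
move=> z0; have [A [dA sA]] := star_cover z0; set z1 := mobius _ z in sA.
have -> : z = mob A z1 by rewrite /z1 mobiusKV ?real_mx_det1.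
by rewrite (sphere_mapE gG sG iso) // unit_norm // (weight_norm gG sG iso).
Qed.

Lemma chart_exists p : norm3 p = 1 -> (forall n, (n < 5)%N -> p <> puncture R n) ->
  exists2 A, \det A = 1 & 0 < tent p (tri phi A).1.1 /\ 0 < tent p (tri phi A).1.2.
Proof.
move=> n1 np; have [i [j [i5 j5 ij ti tj]]] := two_labels n1 np.
have [t01 _] := tent_face p.
have d : dartn i j.
  rewrite /dartn ij; apply/negP => /andP[i2 j2].
  move/eqP: t01; rewrite mulf_eq0; have [[iE jE]|[iE jE]] : (i = 0%N /\ j = 1%N) \/ (i = 1%N /\ j = 0%N) by lia.
    by rewrite -jE -iE !gt_eqF.
  by rewrite -iE -jE !gt_eqF.
by have [A dA tA] := dart_edge gG sG iso i5 j5 d; exists A => //; rewrite tA.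
Qed.

Lemma bipyramid_genus_zero : genus_zero G.
Proof.
pose P := [set puncture R n | n in [set n : nat | (n < 5)%N]].
have PE p : P p <-> exists2 n, (n < 5)%N & p = puncture R n.
  by split=> [[n n5 <-]|[n n5 ->]]; exists n.
have XE p : (@sphere2 R `\` P) p <-> norm3 p = 1 /\ forall n, (n < 5)%N -> p <> puncture R n.
  split=> [[/sphere_norm n1 nP]|[n1 np]]; split => //.
  - by move=> n n5 e; apply: nP; apply/PE; exists n.
  - exact/sphere_norm.
  by move=> /PE[n n5 e]; exact: (np n).
have fX z : 0 < z.2 -> (@sphere2 R `\` P) (sphere_map phi z).
  by move=> z0; apply/XE; split; [exact: map_sphere|move=> n; exact: map_not_puncture].
exists P; split.
- by apply: finite_image; exact: finite_II.
- by move=> p /PE[n n5 ->]; apply/sphere_norm; rewrite unit_norm // puncture_norm.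
exists (sphere_map phi); split.
- apply/seteqP; split=> [p [z z0 <-]|p /XE[n1 np]]; first exact: fX.
  have [A dA [ti tj]] := chart_exists n1 np.
  by have [c0 cE] := map_chart gG sG iso dA n1 ti tj; exists (chart phi A p).
- move=> z w z0 w0; split=> [|[g Gg <-]]; first exact: (map_orbit gG sG iso).
  by rewrite (map_act gG sG iso).
- by apply: continuous_in_subspaceT => z; rewrite in_setE => z0; exact: map_cont.
move=> U oU; pose I := sphere_map phi @` (@upper_half R `&` U).
(* The union of all open sets whose trace on the punctured sphere lies in the image. That it covers
   the image follows from the continuity of [chart], a local section of the map. *)
exists (\bigcup_(V in [set V : set (R * R * R) | open V /\ (@sphere2 R `\` P) `&` V `<=` I]) V).
  by apply: bigcup_open => V [].
apply/seteqP; split; last by move=> p [pX [V [_ VI] Vp]]; apply: VI.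
move=> p [z [z0 Uz] <-]; split; first exact: fX.
have [A [dA sA]] := star_cover z0; set z1 := mobius _ z in sA.
have zE : z = mob A z1 by rewrite /z1 mobiusKV ?real_mx_det1.
have [i5 j5 ij wi wj] := tri_weights gG sG iso dA sA.
have N := weight_norm gG sG iso dA sA.
set q := sphere_map phi z.
have ti : 0 < tent q (tri phi A).1.1 by rewrite /q zE (tent_map gG sG iso) // mulr_gt0 ?invr_gt0.
have tj : 0 < tent q (tri phi A).1.2 by rewrite /q zE (tent_map gG sG iso) // mulr_gt0 ?invr_gt0.
have cq : chart phi A q = z by rewrite /q zE (chart_map gG sG iso).
have hi : \forall p \near q, 0 < tent p (tri phi A).1.1 by exact: (cvgr_gt _ (tent_cont (p := q) (m := _))).
have hj : \forall p \near q, 0 < tent p (tri phi A).1.2 by exact: (cvgr_gt _ (tent_cont (p := q) (m := _))).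
have hU : \forall p \near q, U (chart phi A p).
  by apply: (chart_cont dA ti tj); rewrite cq; exact: open_nbhs_nbhs.
have : nbhs q [set p | [/\ 0 < tent p (tri phi A).1.1, 0 < tent p (tri phi A).1.2 & U (chart phi A p)]].
  by near=> r; split; near: r.
rewrite nbhsE => -[V [oV Vq] VV]; exists V => //; split => // r [/XE[n1 _] /VV[pi pj pU]].
have [c0 cE] := map_chart gG sG iso dA n1 pi pj; by exists (chart phi A r).
Unshelve. all: by end_near.
Qed.

End GenusZero.

Theorem mainTheorem3 (R : realType) :
  (forall Gamma : set 'M[R]_2,
     punctured_sphere 5 Gamma -> arithmetic_group Gamma ->
     systole Gamma <= 2 * arccosh 5) /\
  (exists Gamma : set 'M[R]_2, corresponds_to Gamma bipyramid) /\
  (forall Gamma : set 'M[R]_2, corresponds_to Gamma bipyramid ->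
     [/\ punctured_sphere 5 Gamma, arithmetic_group Gamma &
         systole Gamma = 2 * arccosh 5]).
Proof.
split; first by move=> G; exact: arithmetic_systole_le.
split=> [|G [gG fi tf gz [phi iso]]].
  have gG := bip_group_PSL2 R; have sG := @bip_group_int R; have iso := bip_farey_iso R.
  exists (@bip_group R); split => //.
  - exact: bip_group_finite_index.
  - exact: (label_torsion_free gG sG iso).
  - exact: (bipyramid_genus_zero gG sG iso).
  by exists (@bip_label R).
have [sG _] := fi; split; last 1 first.
- have [g Gg tg] := systole_witness gG sG iso.
  have hg : hyperbolic g by rewrite /hyperbolic tg ltr_nat.
  rewrite (systole_eq Gg hg) tg; first by congr (2 * arccosh _); lra.
  by move=> h; exact: (systole_bound gG sG iso).
- split => //; first exact: integral_discrete.
    exact: finite_index_cofinite.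
  by split => //; exact: (label_cusps gG sG iso).
exact: finite_index_arithmetic.
Qed.
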